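(* Let $K,f,\Gamma_w,\tilde\Gamma_w,\overline\Gamma_w,U,\phi$ be as in the context. Fix $\theta\in\mathbb R$. Assume: (1) $0\notin P_\phi$, i.e. $r_m:=\min_{p\in P_\phi}|p|>0$. (2) There are constants $c<1$ and $\tilde C$ such that for all positive integers $n$ and $m=1,\dots,n_\phi$, $\sum_{p\in P_\phi\cap(D(0,n)\setminus D(0,n-1))}|b_{p,m}|\le\tilde C\,n^c$. (3) There are entire functions $\psi_z$, $z\in\overline\Gamma_w$, $w\in W$, such that $\phi_z(\gamma)=\tilde\phi'_z(\gamma)+\psi_z(\gamma)$ for all $\gamma\in O_{\epsilon,z}$, all $z\in\overline\Gamma_w$ and all $w\in W$. (4) $\cos(\theta-\theta_\gamma)>0$ and $\gamma\in U_{\theta,\alpha_\theta(w)}$ for all $w\in W$, where $\alpha_\theta(w)=\frac1{r_m}\sup_{z\in\overline\Gamma_w,\ p\in P_\phi}|z|\cos(\theta+\theta_z-\theta_p)$. (5) There exist $\alpha'_\theta:W\to\mathbb R$, finitely many constants $C_i$ and non-negative integers $m_i$, and for each $w\in W$ an open subset $V_{w,\theta}\subset\mathbb C$ containing the closed half line $\overline{\mathbb R_+^\theta}$, such that for all $w\in W$ and $z\in\overline\Gamma_w$: $\mathcal L_\theta^{-1}(\psi_z)\in\mathcal O(V_{w,\theta})$ and $|\mathcal L_\theta^{-1}(\psi_z)(\xi)|\le e^{\alpha'_\theta(w)|\xi|}\sum_iC_i|\xi|^{m_i}$ for all $\xi\in V_{w,\theta}$. Then for all $w\in W$ and $\xi\in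 V_{w,\theta}$ $$B_w(\xi)=-\sum_{p\in P_\phi}\sum_{m=1}^{n_\phi}\frac{b_{p,m}}{p^m}\sum_{l=0}^{m-1}\binom ml(-1)^l\sum_{l'=0}^{l}\binom l{l'}\left(\int_{\overline\Gamma_w}K(w,z)e^{\frac{z\xi}p}\left(\frac zp\right)^{m-l+l'}dz\right)\frac{\xi^{m-l+l'-1}}{(m-l+l'-1)!}+\int_{\overline\Gamma_w}K(w,z)\,\mathcal L_\theta^{-1}(\psi_z)(\xi)\,dz .$$
   Context: Setting. For a meromorphic function $h$ on $\mathbb C$, $P_h$ denotes its set of poles and $h_\gamma(z)=h(\gamma z)$. $D(0,R)$ is the open disc of radius $R$ about $0$; $\mathcal O(V)$ denotes holomorphic functions on $V$. $W\subset\mathbb C$ is open and connected; $K$ is a meromorphic function on $W\times\mathbb C$ such that for every $w\in W$ the set $\{w\}\times\mathbb C$ is not contained in its pole divisor; $K_w(z)=K(w,z)$. $(\Gamma_w)_{w\in W}$ is a continuous family of curves in $\mathbb C$ (possibly non-compact, possibly with fixed boundary) with $\Gamma_w\subset\mathbb C\setminus P_{K_w}$. $U\subset\mathbb C$ is a non-empty connected open set with $0\in\bar U\setminus U$. $f$ is meromorphic on $\mathbb C$ with $\Gamma_w\subset\mathbb C\setminus(P_{K_w}\cup P_{f_\gamma})$ and such that $g_\gamma(w)=\int_{\Gamma_w}K(w,z)f_\gamma(z)\,dz$ exists for all $(w,\gamma)\in W\times U$ and is holomorphic in $w$. The integrals $h_m(w)=\int_{\Gamma_w}K(w,z)z^m\,dz$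 ($m\in\mathbb Z$) are assumed to exist and be holomorphic on $W$. The pole order $k_0\in\mathbb Z_{\ge0}$ of $K_w$ at $0$ is independent of $w$. $n_0\in\mathbb Z_{\ge0}$ is the pole order of $f$ at $0$ and $f(z)=\sum_{m\ge-n_0}a_mz^m$ is its Laurent series at $0$. Contour and decay assumptions. $\Gamma_w$ can be continuously deformed (relative to its boundary, if non-empty) inside $\mathbb C\setminus\big((P_{K_w}\cup P_{f_\gamma})\setminus\{0\}\big)$ to a contour $\tilde\Gamma_w$ consisting of $d$ (finitely many) smooth arc segments (split at $0$ if passing through $0$), along which the following three conditions (E) hold with positive constants $b,c_0,\delta_1,\delta_2$, $\delta:=\delta_1-\delta_2>0$, and $c_w\in\mathbb R_+$, $\tilde c_\gamma\in[c_0,\infty)$: (i) $|\cos\Theta(z)|\ge b$, where $\Theta(z)$ is the angle between the line through $0$ and $z$ and the tangent line to the segment at $z$; (ii) $|K(w,z)|\le c_we^{-\delta_1|z|}|z|^{-k_0}$ for $z\neq0$; (iii) $|f_\gamma(z)|\le\tilde c_\gamma e^{\delta_2|z|}|\gamma z|^{-n_0}$ for $z\neq0$; for all $w\in W,\gamma\in U$. Moreover there is a continuous deformation of $\tilde\Gamma_w$ inside $\mathbb C\setminus P_{K_w}$ to a contour $\overline\Gamma_w\subset\mathbb C\setminus(P_{K_w}\cup\{0\})$ for all $w\in W$, and $r(w)\in\mathbb R_+$, such that conditions (E) hold along $\overline\Gamma_w\cap(\mathbb C\setminus D(0,r(w)))$. Borel and Laplace transforms. $g^+_\gamma(w)=\sum_{m=k_0}^\infty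 a_mh_m(w)\gamma^m$ (formal series), $\mathcal B$ is the formal Borel transform, linear over $\mathcal O(W)$ with $\mathcal B(\gamma^m)=\xi^{m-1}/(m-1)!$, and $B_w(\xi)=\mathcal B(g^+_\gamma(w))(\xi)$ (extended holomorphically to $V_{w,\theta}$). $\mathbb R_+^\theta=e^{i\theta}\mathbb R_+$, $\mathcal L_\theta(\psi)(\gamma)=\int_{\mathbb R_+^\theta}e^{-\xi/\gamma}\psi(\xi)\,d\xi$, and $\mathcal L_\theta^{-1}(\psi_z)$ denotes the function of $\xi$ whose transform $\mathcal L_\theta$ is $\gamma\mapsto\psi_z(\gamma)$. $\theta_\gamma=\operatorname{Arg}\gamma$, $\theta_z=\operatorname{Arg}z$, $\theta_p=\operatorname{Arg}p$. $U_{\theta,\alpha}=\{\gamma\in U:\cos(\theta-\theta_\gamma)>|\gamma|\alpha\}$. Principal parts. $\phi(z)=f(z)-\sum_{m=-n_0}^{k_0-1}a_mz^m$ and $\phi_z(\gamma)=\phi(\gamma z)$. The pole orders of $\phi$ are assumed bounded by an integer $n_\phi$, and the principal part at $p\in P_\phi$ is written $\tilde\phi_{z,p}(\gamma)=\sum_{m=1}^{n_\phi}\frac{b_{p,m}}{(\gamma z-p)^m}$. For $p\ne0$, $$\tilde\phi'_{z,p}(\gamma)=-\sum_{m=1}^{n_\phi}\frac{b_{p,m}}{p^m}\sum_{l=0}^{m-1}\binom ml(-1)^l\sum_{l'=0}^l\binom l{l'}\left(\frac zp\right)^{m-l+l'}\frac1{(\frac1\gamma-\frac zp)^{m-l+l'}},$$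 so that $\tilde\phi_{z,p}(\gamma)=\sum_{m}\frac{b_{p,m}}{p^m}(-1)^m+\tilde\phi'_{z,p}(\gamma)$. $\tilde\phi'_z(\gamma)=\sum_{p\in P_\phi}\tilde\phi'_{z,p}(\gamma)$, summed with the points of $P_\phi$ ordered by increasing distance to $0$; under (1) and (2) it converges uniformly on $O_{\epsilon,z}=\{\gamma\in\mathbb C:|\frac1\gamma-\frac zp|>\epsilon\ \forall p\in P_\phi\}$ for every $\epsilon>0$.
   Formalization: Added: V_{w,θ} is connected; at points of V_{w,θ} off the closed half line the integrals of K e^{zξ/p}(z/p)^k over the final contour converge absolutely; deformations of non-compact contours sweep arcs at infinity contributing nothing to the integrals of K z^m, m ≥ k_0. *)

(* Defs.v *)
(* Stdlib reals, with Coquelicot for complex numbers, limits, derivatives and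
   (improper) integrals. *)
From Stdlib Require Import Reals ZArith List.
From Coquelicot Require Import Coquelicot.
Open Scope R_scope.

Definition Csum {T : Type} (l : list T) (F : T -> C) : C :=
  fold_right (fun x s => Cplus (F x) s) (RtoC 0) l.

Definition Rsum {T : Type} (l : list T) (F : T -> R) : R :=
  fold_right (fun x s => F x + s) 0 l.

Definition Cexp (z : C) : C :=
  (exp (Re z) * cos (Im z), exp (Re z) * sin (Im z)).

(* Principal argument, in ]-PI, PI]; the value at 0 is irrelevant. *)
Definition Carg (z : C) : R :=
  if Rle_dec 0 (Im z) then acos (Re z / Cmod z) else - acos (Re z / Cmod z).

Definition CpowZ (z : C) (m : Z) : C :=
  match m with
  | Z0 => RtoC 1
  | Zpos q => Cpow z (Pos.to_nat q)
  | Zneg q => Cinv (Cpow z (Pos.to_nat q))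
  end.

Definition disc (z0 : C) (r : R) (z : C) : Prop := Cmod (z - z0) < r.

Definition Copen (D : C -> Prop) : Prop := open (T := C_UniformSpace) D.

Definition Cconnected (D : C -> Prop) : Prop :=
  forall X Y : C -> Prop, Copen X -> Copen Y ->
    (forall z, D z -> X z \/ Y z) ->
    (forall z, ~ (D z /\ X z /\ Y z)) ->
    (forall z, D z -> X z) \/ (forall z, D z -> Y z).

Definition holomorphic_on (D : C -> Prop) (f : C -> C) : Prop :=
  forall z, D z -> ex_derive (K := C_AbsRing) (V := C_NormedModule) f z.

Definition entire (f : C -> C) : Prop := holomorphic_on (fun _ => True) f.

(* n = 0 means that f has a removable singularity, or none, at z0. *)
Definition pole_order (f : C -> C) (z0 : C) (n : nat) : Prop :=
  exists (r : R) (g : C -> C),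
    0 < r /\ holomorphic_on (disc z0 r) g /\
    ((0 < n)%nat -> g z0 <> RtoC 0) /\
    (forall z, disc z0 r z -> z <> z0 -> f z = (g z / Cpow (z - z0) n)%C).

Definition is_pole (f : C -> C) (z0 : C) : Prop :=
  exists n : nat, (0 < n)%nat /\ pole_order f z0 n.

(* A meromorphic function is represented by a total function, which is
   holomorphic off its poles and has arbitrary values at its poles. *)
Definition meromorphic (f : C -> C) : Prop :=
  forall z0, is_pole f z0 \/
    (exists r, 0 < r /\ holomorphic_on (disc z0 r) f).

Definition bidisc (w0 z0 : C) (r : R) (w z : C) : Prop :=
  disc w0 r w /\ disc z0 r z.

Definition holomorphic2_on (D : C -> C -> Prop) (F : C -> C -> C) : Prop :=
  forall w z, D w z ->
    ex_filterdiff (K := C_AbsRing)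
      (U := prod_NormedModule C_AbsRing C_NormedModule C_NormedModule)
      (V := C_NormedModule)
      (fun x => F (fst x) (snd x)) (locally (w, z)).

Definition regular2 (F : C -> C -> C) (w z : C) : Prop :=
  exists r, 0 < r /\ holomorphic2_on (bidisc w z r) F.

(* F is a meromorphic function on W x C whose pole divisor contains no slice
   {w} x C.  A point is off the pole divisor iff it satisfies regular2.  At a
   point (w, z) of the divisor the value of F is the one given by the slice F w
   if z is not a pole of that slice (such as (0, 0) for w / z), and arbitrary
   otherwise. *)
Definition meromorphic2 (W : C -> Prop) (F : C -> C -> C) : Prop :=
  (forall w0 z0, W w0 ->
     exists (r : R) (G H : C -> C -> C),
       0 < r /\
       holomorphic2_on (bidisc w0 z0 r) G /\
       holomorphic2_on (bidisc w0 z0 r) H /\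
       (exists w z, bidisc w0 z0 r w z /\ H w z <> RtoC 0) /\
       (forall w z, bidisc w0 z0 r w z -> W w -> H w z <> RtoC 0 ->
          F w z = (G w z / H w z)%C)) /\
  (forall w, W w -> exists z, regular2 F w z) /\
  (forall w, W w -> meromorphic (F w)).

(* Curves are parametrized by the interval [A, B] intersected with R: finite
   endpoints are the boundary of the curve, infinite ones are the ends of a
   non-compact curve, along which |z| tends to infinity. *)
Definition param (A B : Rbar) (t : R) : Prop := Rbar_le A t /\ Rbar_le t B.

Definition inner (A B : Rbar) (t : R) : Prop := Rbar_lt A t /\ Rbar_lt t B.

Definition trace (A B : Rbar) (c : R -> C) (z : C) : Prop :=
  exists t, param A B t /\ c t = z.

Definition velocity (c : R -> C) (t : R) : C :=
  (Derive (fun s => fst (c s)) t, Derive (fun s => snd (c s)) t).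

(* Piecewise C^1 curves; bs contains the points where the arcs are joined. *)
Record contour (A B : Rbar) (bs : list R) (c : R -> C) : Prop := {
  contour_dom : Rbar_lt A B;
  contour_continuous : forall t, param A B t ->
    filterlim c (within (param A B) (locally t)) (locally (c t));
  contour_C1 : forall t, inner A B t -> ~ In t bs ->
    ex_derive (K := R_AbsRing) (V := C_R_NormedModule) c t /\
    filterlim (velocity c) (locally t) (locally (velocity c t));
  contour_left : forall t : R, Rbar_lt A t -> Rbar_le t B ->
    exists v : C, filterlim (velocity c) (at_left t) (locally v);
  contour_right : forall t : R, Rbar_le A t -> Rbar_lt t B ->
    exists v : C, filterlim (velocity c) (at_right t) (locally v);
  contour_start : A = m_infty -> is_lim (fun t => Cmod (c t)) m_infty p_infty;
  contour_end : B = p_infty -> is_lim (fun t => Cmod (c t)) p_infty p_infty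
}.

Definition endpoint (A : Rbar) : (R -> Prop) -> Prop :=
  match A with
  | Finite a => at_point a
  | _ => Rbar_locally A
  end.

Definition is_cint (A B : Rbar) (c : R -> C) (F : C -> C) (l : C) : Prop :=
  is_RInt_gen (V := C_R_NormedModule)
    (fun t => (F (c t) * velocity c t)%C) (endpoint A) (endpoint B) l.

Definition cint_abs_converges (A B : Rbar) (c : R -> C) (F : C -> C) : Prop :=
  ex_RInt_gen (V := R_NormedModule)
    (fun t => Cmod (F (c t)) * Cmod (velocity c t)) (endpoint A) (endpoint B).

Definition closed_curve (A B : Rbar) (c : R -> C) : Prop :=
  match A, B with
  | Finite a, Finite b => c a = c b
  | _, _ => False
  end.

Definition boundary_param (A B : Rbar) (t : R) : Prop :=
  A = Finite t \/ B = Finite t.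

(* Either every curve of the family is closed, or the boundary points (if any)
   do not depend on w. *)
Definition continuous_family (W : C -> Prop) (A B : Rbar)
    (Gam : C -> R -> C) : Prop :=
  (forall w t, W w -> param A B t ->
     filterlim (fun x : C * R => Gam (fst x) (snd x))
       (within (fun x : C * R => W (fst x) /\ param A B (snd x))
          (locally (T := prod_UniformSpace C_UniformSpace R_UniformSpace)
             (w, t)))
       (locally (Gam w t))) /\
  ((forall w, W w -> closed_curve A B (Gam w)) \/
   (forall w w' t, W w -> W w' -> boundary_param A B t ->
      Gam w t = Gam w' t)).

(* Homotopy inside S from c0 to c1, relative to the boundary, or through closed
   curves when c0 is closed (its boundary being empty). *)
Definition deformation (S : C -> Prop) (A B : Rbar) (c0 c1 : R -> C)
    (H : R -> R -> C) : Prop :=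
  (forall s t, 0 <= s <= 1 -> param A B t ->
     filterlim (fun x : R * R => H (fst x) (snd x))
       (within (fun x : R * R => 0 <= fst x <= 1 /\ param A B (snd x))
          (locally (T := prod_UniformSpace R_UniformSpace R_UniformSpace)
             (s, t)))
       (locally (H s t))) /\
  (forall t, param A B t -> H 0 t = c0 t /\ H 1 t = c1 t) /\
  (forall s t, 0 <= s <= 1 -> param A B t -> S (H s t)) /\
  (closed_curve A B c0 -> forall s, 0 <= s <= 1 -> closed_curve A B (H s)) /\
  (~ closed_curve A B c0 -> forall s t, 0 <= s <= 1 -> boundary_param A B t ->
     H s t = c0 t).

(* The paths swept by the points c0 t under the homotopy H contribute nothing
   to the integral of F as t tends to an end at infinity.  This is trivial when
   the homotopy is stationary near the ends, and void for compact curves.  It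
   cannot be dropped: exp(-z^4) decays along both [0,+oo[ and i[0,+oo[, but the
   rotation of one into the other changes its integral. *)
Definition no_flux_at_infinity (A B : Rbar) (H : R -> R -> C) (F : C -> C)
    : Prop :=
  forall E : Rbar, (E = A \/ E = B) -> ~ is_finite E ->
  forall eps, 0 < eps ->
    Rbar_locally E (fun t =>
      (exists bs, contour 0 1 bs (fun s => H s t)) /\
      exists l, is_cint 0 1 (fun s => H s t) F l /\ Cmod l < eps).

Definition deformable (S : C -> Prop) (A B : Rbar) (c0 c1 : R -> C)
    (integrands : (C -> C) -> Prop) : Prop :=
  exists H, deformation S A B c0 c1 H /\
    forall F, integrands F -> no_flux_at_infinity A B H F.

(* Cosine of the angle between the vectors z and v; for the lines that they
   span, only its absolute value makes sense. *)
Definition cos_angle (z v : C) : R :=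
  (Re z * Re v + Im z * Im v) / (Cmod z * Cmod v).

(* The angle and growth conditions along the part of the curve c lying in D;
   v <> 0 says that the arc has a tangent line at t. *)
Definition conditions_E (b delta1 delta2 : R) (k0 n0 : nat)
    (cw : R) (ctilde : C -> R) (Kw f : C -> C) (U D : C -> Prop)
    (A B : Rbar) (bs : list R) (c : R -> C) : Prop :=
  (forall t, inner A B t -> ~ In t bs -> D (c t) -> c t <> RtoC 0 ->
     velocity c t <> RtoC 0 /\ b <= Rabs (cos_angle (c t) (velocity c t))) /\
  (forall z, trace A B c z -> D z -> z <> RtoC 0 ->
     Cmod (Kw z) <= cw * exp (- delta1 * Cmod z) * / (Cmod z) ^ k0) /\
  (forall z gam, trace A B c z -> D z -> z <> RtoC 0 -> U gam ->
     Cmod (f (gam * z)%C)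
       <= ctilde gam * exp (delta2 * Cmod z) * / (Cmod (gam * z)) ^ n0).

Definition is_laurent_at0 (f : C -> C) (n0 : nat) (a : Z -> C) : Prop :=
  exists r, 0 < r /\ forall z, 0 < Cmod z < r ->
    is_pseries (K := C_AbsRing) (V := C_NormedModule)
      (fun j => a (Z.of_nat j - Z.of_nat n0)%Z) z (Cpow z n0 * f z)%C.

(* f minus the part of its Laurent series of degrees -n0, ..., k0 - 1; not
   meaningful at z = 0. *)
Definition laurent_tail (f : C -> C) (a : Z -> C) (n0 k0 : nat) (z : C) : C :=
  (f z - Csum (seq 0 (n0 + k0)) (fun j =>
     let m := (Z.of_nat j - Z.of_nat n0)%Z in a m * CpowZ z m))%C.

Definition is_principal_part (phi : C -> C) (p : C) (nphi : nat)
    (bp : nat -> C) : Prop :=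
  exists (r : R) (g : C -> C), 0 < r /\ holomorphic_on (disc p r) g /\
    forall z, disc p r z -> z <> p ->
      phi z = (g z + Csum (seq 1 nphi) (fun m => bp m / Cpow (z - p) m))%C.

Definition enumerates {T : Type} (P : T -> Prop) (l : list T) : Prop :=
  NoDup l /\ forall x, In x l <-> P x.

(* Sum over a discrete subset of C, ordered by increasing distance to 0. *)
Definition is_sum_by_modulus (P : C -> Prop) (F : C -> C) (S : C) : Prop :=
  forall eps, 0 < eps -> exists R0, forall R1, R0 < R1 ->
    exists l, enumerates (fun p => P p /\ Cmod p < R1) l /\
      Cmod (Csum l F - S) < eps.

(* sum_{m=1}^{n} b_m / p^m sum_{l=0}^{m-1} binom(m,l) (-1)^l
     sum_{l'=0}^{l} binom(l,l') X_{m-l+l'} *)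
Definition principal_sum (n : nat) (bp : nat -> C) (p : C) (X : nat -> C) : C :=
  Csum (seq 1 n) (fun m =>
    bp m / Cpow p m *
    Csum (seq 0 m) (fun l =>
      RtoC (Binomial.C m l) * Cpow (RtoC (-1)) l *
      Csum (seq 0 (S l)) (fun l' =>
        RtoC (Binomial.C l l') * X (m - l + l')%nat)))%C.

Definition tilde_phi' (n : nat) (b : C -> nat -> C) (p z gam : C) : C :=
  (- principal_sum n (b p) p (fun k =>
       Cpow (z / p) k * / Cpow (/ gam - z / p) k))%C.

(* gam = 0, where 1/gam is infinite, is left out. *)
Definition O_region (P : C -> Prop) (eps : R) (z gam : C) : Prop :=
  gam <> RtoC 0 /\ forall p, P p -> eps < Cmod (/ gam - z / p).

Definition r_min (P : C -> Prop) : Rbar :=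
  Glb_Rbar (fun x => exists p, P p /\ x = Cmod p).

(* (1/r_min) sup |z| cos(theta + Arg z - Arg p); by the conventions of Rbar, it
   is 0 if P is empty. *)
Definition alpha (theta : R) (Gam P : C -> Prop) : Rbar :=
  Rbar_mult (Rbar_inv (r_min P))
    (Lub_Rbar (fun x => exists z p, Gam z /\ P p /\
       x = Cmod z * cos (theta + Carg z - Carg p))).

Definition U_sector (U : C -> Prop) (theta : R) (al : Rbar) (gam : C) : Prop :=
  U gam /\ Rbar_lt (Rbar_mult al (Cmod gam)) (cos (theta - Carg gam)).

Definition closed_ray (theta : R) (xi : C) : Prop :=
  exists t, 0 <= t /\ xi = (t * Cexp (Ci * theta))%C.

Definition is_laplace (theta : R) (chi : C -> C) (gam v : C) : Prop :=
  is_RInt_gen (V := C_R_NormedModule)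
    (fun t : R => let xi := (t * Cexp (Ci * theta))%C in
       (Cexp (- (xi / gam)) * chi xi * Cexp (Ci * theta))%C)
    (at_point 0) (Rbar_locally p_infty) v.

(* chi has Laplace transform psi, on the region where the transform of a function
   bounded by a polynomial times exp(al |xi|) converges absolutely. *)
Definition is_inverse_laplace (theta al : R) (psi chi : C -> C) : Prop :=
  forall gam, gam <> RtoC 0 -> Cmod gam * al < cos (theta - Carg gam) ->
    is_laplace theta chi gam (psi gam).

(* Formal series in gamma with coefficients functions of w. *)
Definition g_plus (k0 : nat) (a : Z -> C) (h : Z -> C -> C) (m : nat) (w : C)
    : C :=
  if Nat.leb k0 m then (a (Z.of_nat m) * h (Z.of_nat m) w)%C else RtoC 0.

(* Coefficient of xi^n; gamma^0 is sent to 0, as 1/(-1)! = 0. *)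
Definition formal_borel (u : nat -> C -> C) (n : nat) (w : C) : C :=
  (u (S n) w / RtoC (INR (fact n)))%C.

Definition is_analytic_extension (s : nat -> C) (V : C -> Prop) (B : C -> C)
    : Prop :=
  holomorphic_on V B /\
  exists r, 0 < r /\ forall xi, Cmod xi < r ->
    V xi /\ is_pseries (K := C_AbsRing) (V := C_NormedModule) s xi (B xi).

(* Main.v *)
Require Import Defs.
From Stdlib Require Import Reals ZArith List Permutation Lra Lia ClassicalChoice ClassicalEpsilon.
From Coquelicot Require Import Coquelicot.
Open Scope R_scope.

(* psi_z(gamma) - phi(gamma z) is a function T(gamma z) of gamma z alone: T(u) sums the principal
   sums with (x/(1-x))^k, x = u/p, as k-th entry.  So psi_z(gamma) = Psi(gamma z) near 0 for one
   entire function Psi = sum C_n u^n, and C_{n+1} = lambda_n + alpha_{n+1}, where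
   phi = sum alpha_n u^n and T = sum lambda_n u^{n+1}.
   Watson's lemma along the ray, and the identity theorem on V_w, turn this into
   L^{-1}(psi_z)(xi) = z X(z xi) with X(y) = sum C_{n+1} y^n/n!.  On an unbounded contour the bound
   (5) and Cauchy's estimates force X = 0, otherwise the series may be integrated termwise; either
   way the last integral of the formula is sum C_{n+1} H_{n+1} xi^n/n!, H_m = int K(w,z) z^m dz
   over the contour avoiding 0.  The sum over the poles is holomorphic on V_w, because each of its
   integrals has a second order expansion in xi with constants O(1/|p|), and near 0 it equals
   sum lambda_n H_{n+1} xi^n/n!.  The difference has the coefficients alpha_{n+1} H_{n+1}/n! of
   the Borel transform, as h_m = H_m for m >= k_0 by homotopy invariance, K(w,z) z^m having no pole
   at 0. *)

(** The right-hand side of the formula is taken as the definition of [Bw], so that only its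
    holomorphy on [V w] and its germ at 0 have to be established. The sum over the poles and the
    contour integral are then interchanged only for |xi| <= rm delta1 / 10, where expanding e^(z
    xi/p) costs at most half of the decay of K, uniformly in p. Elsewhere in [V w] the integrals
    converge for reasons that depend on p: on the ray because [H4] makes the supremum in [alpha]
    finite, off the ray by [Hconv]. This pointwise convergence becomes locally uniform because
    e^(s|z/p|) is bounded by exponentials in four directions, that is, by the kernels at four
    neighbouring points of [V w]. The curves of a homotopy are merely continuous, and the middle
    contour may run through 0, where K may have a pole. Integrals along such curves are therefore
    replaced by integrals along inscribed polygons, of a function made holomorphic at 0. *)

Notation CR := C_R_NormedModule.

(** * Moduli, neighbourhoods and derivatives *)

Lemma CR_norm (x : C) : norm (K := R_AbsRing) (V := CR) x = Cmod x.
Proof. symmetry; apply Cmod_norm. Qed.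

Lemma CR_scal (x : R) (y : C) : scal (V := CR) x y = (x * y)%C.
Proof.
  destruct y; unfold scal; simpl; unfold prod_scal, Cmult, scal; simpl; unfold mult; simpl.
  f_equal; ring.
Qed.

Lemma Cmod_minus_sym (x y : C) : Cmod (x - y) = Cmod (y - x).
Proof. rewrite <- Cmod_opp; f_equal; ring. Qed.

Lemma Cmod_triangle_minus (x y : C) : Cmod x - Cmod y <= Cmod (x - y).
Proof.
  generalize (Cmod_triangle (x - y) y); replace (x - y + y)%C with x by ring; lra.
Qed.

Lemma Cmod_minus_le (x y : C) : Cmod (x - y) <= Cmod x + Cmod y.
Proof. generalize (Cmod_triangle x (- y)); rewrite Cmod_opp; intro H; exact H. Qed.

Lemma Cminus_diag (x : C) : (x - x = 0)%C.
Proof. ring. Qed.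

Lemma Cmod_minus_diag (x : C) : Cmod (x - x) = 0.
Proof. rewrite Cminus_diag; apply Cmod_0. Qed.

Lemma Cminus_eq_0 (x y : C) : Cmod (x - y) = 0 -> x = y.
Proof.
  intro H; apply Cmod_eq_0 in H; replace x with (x - y + y)%C by ring; rewrite H; ring.
Qed.

Lemma Cmod_small_0 (x : C) : (forall eps, 0 < eps -> Cmod x <= eps) -> x = 0%C.
Proof.
  intro H; apply Cmod_eq_0; apply Rle_antisym; [|apply Cmod_ge_0].
  apply le_epsilon; intros e He; rewrite Rplus_0_l; auto.
Qed.

Lemma locally_Cmod (z : C) (P : C -> Prop) :
  locally (T := C_UniformSpace) z P <->
  exists d, 0 < d /\ forall y, Cmod (y - z) < d -> P y.
Proof.
  split.
  - intros [d H]; exists d; split; [apply cond_pos|]; intros y Hy.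
    apply H; apply C_NormedModule_mixin_compat1; exact Hy.
  - intros [d [Hd H]].
    assert (S2 : 0 < sqrt 2) by (apply sqrt_lt_R0; lra).
    assert (Hd' : 0 < d / sqrt 2) by (apply Rdiv_lt_0_compat; lra).
    exists (mkposreal _ Hd'); intros y Hy; apply H.
    apply C_NormedModule_mixin_compat2 in Hy; simpl in Hy.
    replace d with (sqrt 2 * (d / sqrt 2)) by (field; lra); exact Hy.
Qed.

Lemma locally_Cmod_alg (z : C) (P : C -> Prop) :
  locally (T := AbsRing_UniformSpace C_AbsRing) z P <->
  exists d, 0 < d /\ forall y, Cmod (y - z) < d -> P y.
Proof. rewrite <- locally_Cmod; symmetry; apply locally_C. Qed.

Lemma filterlim_Cmod {T : Type} (F : (T -> Prop) -> Prop) {FF : Filter F} (f : T -> C) (l : C) :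
  filterlim f F (locally (T := C_UniformSpace) l) <->
  forall eps, 0 < eps -> F (fun x => Cmod (f x - l) < eps).
Proof.
  split; intro H.
  - intros eps He; apply (H (fun y => Cmod (y - l) < eps)).
    apply locally_Cmod; exists eps; auto.
  - intros P HP; apply locally_Cmod in HP; destruct HP as [d [Hd HP]].
    unfold filtermap; generalize (H d Hd); apply filter_imp; auto.
Qed.

(** C carries several structures here: product of two lines, real normed space, normed field. The
    epsilon forms [ccont], [cderiv] and [pderiv] use [Cmod] alone and are tied to these structures
    once and for all by equivalences. *)
Definition ccont (c : R -> C) (t : R) : Prop :=
  forall eps, 0 < eps -> exists d, 0 < d /\
    forall s, Rabs (s - t) < d -> Cmod (c s - c t) < eps.

Lemma continuous_ccont (c : R -> C) (t : R) :
  continuous (U := CR) c t <-> ccont c t.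
Proof.
  unfold continuous; etransitivity; [apply (filterlim_Cmod (locally t))|].
  split; intros H eps He; destruct (H eps He) as [d Hd].
  - exists d; split; [apply cond_pos|]; exact Hd.
  - destruct Hd as [Hd0 Hd]; exists (mkposreal d Hd0); exact Hd.
Qed.

Definition cderiv (f : C -> C) (z l : C) : Prop :=
  forall eps, 0 < eps -> exists d, 0 < d /\
    forall y, Cmod (y - z) < d -> Cmod (f y - f z - l * (y - z)) <= eps * Cmod (y - z).

Lemma is_derive_cderiv (f : C -> C) (z l : C) :
  is_derive (K := C_AbsRing) (V := C_NormedModule) f z l <-> cderiv f z l.
Proof.
  split.
  - intros [_ H] eps He.
    specialize (H z (fun P HP => HP) (mkposreal eps He)).
    apply locally_Cmod_alg in H; destruct H as [d [Hd H]]; exists d; split; auto.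
    intros y Hy; specialize (H y Hy); simpl in H.
    change (Cmod (f y - f z - (y - z) * l) <= eps * Cmod (y - z)) in H.
    replace (l * (y - z))%C with ((y - z) * l)%C by ring; exact H.
  - intro H; split; [apply is_linear_scal_l|].
    intros x Hx eps.
    assert (x = z) as ->.
    { symmetry; apply (is_filter_lim_locally_unique (K := C_AbsRing) (V := AbsRing_NormedModule C_AbsRing)); exact Hx. }
    apply locally_Cmod_alg; destruct (H eps (cond_pos eps)) as [d [Hd H']].
    exists d; split; auto; intros y Hy; specialize (H' y Hy).
    change (Cmod (f y - f z - (y - z) * l) <= eps * Cmod (y - z)).
    replace ((y - z) * l)%C with (l * (y - z))%C by ring; exact H'.
Qed.

Definition pderiv (c : R -> C) (t : R) (v : C) : Prop :=
  forall eps, 0 < eps -> exists d, 0 < d /\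
    forall s, Rabs (s - t) < d -> Cmod (c s - c t - (s - t)%R * v) <= eps * Rabs (s - t).

Lemma is_derive_pderiv (c : R -> C) (t : R) (v : C) :
  is_derive (K := R_AbsRing) (V := CR) c t v <-> pderiv c t v.
Proof.
  split.
  - intros [_ H] eps He.
    specialize (H t (fun P HP => HP) (mkposreal eps He)).
    destruct H as [d H]; exists d; split; [apply cond_pos|].
    intros y Hy; specialize (H y Hy).
    change (norm (V := CR) (minus (minus (c y) (c t)) (scal (V := CR) (y - t) v))
      <= eps * Rabs (y - t)) in H.
    rewrite CR_norm, CR_scal in H; exact H.
  - intro H; split; [apply is_linear_scal_l|].
    intros x Hx eps.
    assert (x = t) as ->.
    { symmetry; apply (is_filter_lim_locally_unique (K := R_AbsRing) (V := R_NormedModule)); exact Hx. }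
    destruct (H eps (cond_pos eps)) as [d [Hd H']].
    exists (mkposreal d Hd); intros y Hy; specialize (H' y Hy).
    change (norm (V := CR) (minus (minus (c y) (c t)) (scal (V := CR) (y - t) v))
      <= eps * Rabs (y - t)).
    rewrite CR_norm, CR_scal; exact H'.
Qed.

Lemma cderiv_continuous (f : C -> C) (z l : C) : cderiv f z l ->
  forall eps, 0 < eps -> exists d, 0 < d /\ forall y, Cmod (y - z) < d -> Cmod (f y - f z) < eps.
Proof.
  intros H eps He; destruct (H 1 Rlt_0_1) as [d [Hd H']].
  set (M := 1 + Cmod l + 1).
  assert (HM : 0 < M) by (unfold M; generalize (Cmod_ge_0 l); lra).
  exists (Rmin d (eps / M)); split.
  { apply Rmin_glb_lt; auto; apply Rdiv_lt_0_compat; auto. }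
  intros y Hy.
  assert (Hy1 : Cmod (y - z) < d) by (eapply Rlt_le_trans; [apply Hy|apply Rmin_l]).
  assert (Hy2 : Cmod (y - z) < eps / M) by (eapply Rlt_le_trans; [apply Hy|apply Rmin_r]).
  specialize (H' y Hy1).
  replace (f y - f z)%C with ((f y - f z - l * (y - z)) + l * (y - z))%C by ring.
  eapply Rle_lt_trans; [apply Cmod_triangle|]; rewrite Cmod_mult.
  apply Rle_lt_trans with (M * Cmod (y - z)).
  - unfold M; generalize (Cmod_ge_0 (y - z)); nra.
  - replace eps with (M * (eps / M)) by (field; lra); apply Rmult_lt_compat_l; auto.
Qed.

Lemma pderiv_ccont (c : R -> C) (t : R) (v : C) : pderiv c t v -> ccont c t.
Proof.
  intro H; apply continuous_ccont, ex_derive_continuous; exists v; apply is_derive_pderiv, H.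
Qed.

Lemma cderiv_local (f g : C -> C) (z l : C) (d0 : R) : 0 < d0 ->
  (forall y, Cmod (y - z) < d0 -> f y = g y) -> cderiv f z l -> cderiv g z l.
Proof.
  intros Hd0 E H eps He; destruct (H eps He) as [d [Hd D]].
  exists (Rmin d d0); split; [apply Rmin_glb_lt; auto|]; intros y Hy.
  rewrite <- !E; [| rewrite Cmod_minus_diag; auto | eapply Rlt_le_trans; [apply Hy|apply Rmin_r]].
  apply D; eapply Rlt_le_trans; [apply Hy|apply Rmin_l].
Qed.

Lemma cderiv_const (k z : C) : cderiv (fun _ => k) z 0.
Proof.
  intros eps He; exists 1; split; [lra|]; intros y _.
  replace (k - k - 0 * (y - z))%C with (RtoC 0) by ring; rewrite Cmod_0.
  apply Rmult_le_pos; [lra|apply Cmod_ge_0].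
Qed.

Lemma cderiv_id (z : C) : cderiv (fun y => y) z 1.
Proof.
  intros eps He; exists 1; split; [lra|]; intros y _.
  replace (y - z - 1 * (y - z))%C with (RtoC 0) by ring; rewrite Cmod_0.
  apply Rmult_le_pos; [lra|apply Cmod_ge_0].
Qed.

Lemma cderiv_plus (f g : C -> C) (z l m : C) :
  cderiv f z l -> cderiv g z m -> cderiv (fun y => f y + g y)%C z (l + m).
Proof.
  intros H H' eps He.
  destruct (H (eps / 2)) as [d [Hd D]]; [lra|]; destruct (H' (eps / 2)) as [d' [Hd' D']]; [lra|].
  exists (Rmin d d'); split; [apply Rmin_glb_lt; auto|]; intros y Hy.
  specialize (D y (Rlt_le_trans _ _ _ Hy (Rmin_l _ _))).
  specialize (D' y (Rlt_le_trans _ _ _ Hy (Rmin_r _ _))).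
  replace (f y + g y - (f z + g z) - (l + m) * (y - z))%C with
    ((f y - f z - l * (y - z)) + (g y - g z - m * (y - z)))%C by ring.
  eapply Rle_trans; [apply Cmod_triangle|]; lra.
Qed.

Lemma cderiv_mult (f g : C -> C) (z l m : C) :
  cderiv f z l -> cderiv g z m -> cderiv (fun y => f y * g y)%C z (l * g z + f z * m).
Proof.
  intros H H' eps He.
  set (A := Cmod (g z) + 1); set (L := Cmod l + 1); set (F := Cmod (f z) + 1).
  assert (HA : 0 < A) by (unfold A; generalize (Cmod_ge_0 (g z)); lra).
  assert (HL : 0 < L) by (unfold L; generalize (Cmod_ge_0 l); lra).
  assert (HF : 0 < F) by (unfold F; generalize (Cmod_ge_0 (f z)); lra).
  destruct (H (eps / (3 * A))) as [d1 [Hd1 D1]]; [apply Rdiv_lt_0_compat; lra|].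
  destruct (H' (eps / (3 * F))) as [d2 [Hd2 D2]]; [apply Rdiv_lt_0_compat; lra|].
  destruct (cderiv_continuous g z m H' (Rmin 1 (eps / (3 * L)))) as [d3 [Hd3 D3]].
  { apply Rmin_glb_lt; [lra|apply Rdiv_lt_0_compat; lra]. }
  exists (Rmin d1 (Rmin d2 d3)); split; [repeat apply Rmin_glb_lt; auto|]; intros y Hy.
  assert (Y1 : Cmod (y - z) < d1) by (eapply Rlt_le_trans; [apply Hy|apply Rmin_l]).
  assert (Y : Cmod (y - z) < Rmin d2 d3) by (eapply Rlt_le_trans; [apply Hy|apply Rmin_r]).
  assert (Y2 : Cmod (y - z) < d2) by (eapply Rlt_le_trans; [apply Y|apply Rmin_l]).
  assert (Y3 : Cmod (y - z) < d3) by (eapply Rlt_le_trans; [apply Y|apply Rmin_r]).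
  specialize (D1 y Y1); specialize (D2 y Y2); specialize (D3 y Y3).
  generalize (Rmin_l 1 (eps / (3 * L))) (Rmin_r 1 (eps / (3 * L))); intros M1 M2.
  assert (G : Cmod (g y) <= A).
  { unfold A; generalize (Cmod_triangle_minus (g y) (g z)); lra. }
  replace (f y * g y - f z * g z - (l * g z + f z * m) * (y - z))%C with
    (((f y - f z - l * (y - z)) * g y + (l * (y - z)) * (g y - g z))
     + f z * (g y - g z - m * (y - z)))%C by ring.
  set (h := Cmod (y - z)) in *.
  assert (Hh : 0 <= h) by apply Cmod_ge_0.
  assert (B1 : Cmod ((f y - f z - l * (y - z)) * g y) <= eps / 3 * h).
  { rewrite Cmod_mult; replace (eps / 3 * h) with ((eps / (3 * A) * h) * A) by (field; lra).
    apply Rmult_le_compat; auto using Cmod_ge_0. }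
  assert (B2 : Cmod (l * (y - z) * (g y - g z)) <= eps / 3 * h).
  { rewrite !Cmod_mult; fold h; replace (eps / 3 * h) with ((L * h) * (eps / (3 * L))) by (field; lra).
    apply Rmult_le_compat; auto using Cmod_ge_0; [| |lra].
    - apply Rmult_le_pos; auto using Cmod_ge_0.
    - apply Rmult_le_compat_r; auto; unfold L; lra. }
  assert (B3 : Cmod (f z * (g y - g z - m * (y - z))) <= eps / 3 * h).
  { rewrite Cmod_mult; replace (eps / 3 * h) with (F * (eps / (3 * F) * h)) by (field; lra).
    apply Rmult_le_compat; auto using Cmod_ge_0; unfold F; lra. }
  eapply Rle_trans; [apply Cmod_triangle|].
  eapply Rle_trans; [apply Rplus_le_compat_r, Cmod_triangle|]; lra.
Qed.

Lemma cderiv_inv (z : C) : z <> 0%C -> cderiv (fun y => / y)%C z (- / (z * z))%C.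
Proof.
  intros Hz eps He.
  assert (Z : 0 < Cmod z) by (apply Cmod_gt_0; auto).
  set (r := Cmod z) in *.
  exists (Rmin (r / 2) (eps * (r * r * r / 2))); split.
  { apply Rmin_glb_lt; [lra|]; apply Rmult_lt_0_compat; auto; repeat apply Rmult_lt_0_compat; lra. }
  intros y Hy.
  assert (Y1 : Cmod (y - z) < r / 2) by (eapply Rlt_le_trans; [apply Hy|apply Rmin_l]).
  assert (Y2 : Cmod (y - z) < eps * (r * r * r / 2)) by (eapply Rlt_le_trans; [apply Hy|apply Rmin_r]).
  assert (Yr : r / 2 <= Cmod y).
  { generalize (Cmod_triangle_minus z y); rewrite Cmod_minus_sym; fold r; lra. }
  assert (Hy0 : y <> 0%C) by (apply Cmod_gt_0; lra).
  replace (/ y - / z - - / (z * z) * (y - z))%C with ((y - z) * (y - z) * / (y * (z * z)))%C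
    by (field; auto).
  rewrite !Cmod_mult, Cmod_inv, !Cmod_mult; [|repeat apply Cmult_neq_0; auto].
  fold r; set (h := Cmod (y - z)) in *.
  assert (Hh : 0 <= h) by apply Cmod_ge_0.
  assert (P : 0 < r * r * r / 2) by (repeat apply Rmult_lt_0_compat; lra).
  assert (Q : / (Cmod y * (r * r)) <= / (r * r * r / 2)).
  { apply Rinv_le_contravar; auto; nra. }
  apply Rle_trans with (h * h * / (r * r * r / 2)).
  - apply Rmult_le_compat_l; auto; nra.
  - replace (eps * h) with (eps * (r * r * r / 2) * h * / (r * r * r / 2)) by (field; lra).
    apply Rmult_le_compat_r; [left; apply Rinv_0_lt_compat; auto|].
    apply Rmult_le_compat_r; lra.
Qed.

Lemma cderiv_pderiv (f : C -> C) (c : R -> C) (t : R) (l v : C) :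
  cderiv f (c t) l -> pderiv c t v -> pderiv (fun s => f (c s)) t (l * v)%C.
Proof.
  intros Hf Hc eps He.
  set (L := Cmod l + 1); set (N := Cmod v + 1).
  assert (HL : 0 < L) by (unfold L; generalize (Cmod_ge_0 l); lra).
  assert (HN : 0 < N) by (unfold N; generalize (Cmod_ge_0 v); lra).
  destruct (Hf (eps / (2 * N))) as [d1 [Hd1 D1]]; [apply Rdiv_lt_0_compat; lra|].
  destruct (Hc (Rmin 1 (eps / (2 * L)))) as [d2 [Hd2 D2]].
  { apply Rmin_glb_lt; [lra|apply Rdiv_lt_0_compat; lra]. }
  destruct (pderiv_ccont c t v Hc d1 Hd1) as [d3 [Hd3 D3]].
  exists (Rmin d2 d3); split; [apply Rmin_glb_lt; auto|]; intros s Hs.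
  assert (S2 : Rabs (s - t) < d2) by (eapply Rlt_le_trans; [apply Hs|apply Rmin_l]).
  assert (S3 : Rabs (s - t) < d3) by (eapply Rlt_le_trans; [apply Hs|apply Rmin_r]).
  specialize (D2 s S2); specialize (D1 _ (D3 s S3)).
  generalize (Rmin_l 1 (eps / (2 * L))) (Rmin_r 1 (eps / (2 * L))); intros M1 M2.
  set (h := Rabs (s - t)) in *.
  assert (Hh : 0 <= h) by apply Rabs_pos.
  assert (E : Cmod (c s - c t) <= N * h).
  { replace (c s - c t)%C with ((c s - c t - (s - t)%R * v) + (s - t)%R * v)%C by ring.
    eapply Rle_trans; [apply Cmod_triangle|]; rewrite Cmod_mult, Cmod_R; fold h.
    unfold N; nra. }
  replace (f (c s) - f (c t) - (s - t)%R * (l * v))%C with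
    ((f (c s) - f (c t) - l * (c s - c t)) + l * (c s - c t - (s - t)%R * v))%C by ring.
  eapply Rle_trans; [apply Cmod_triangle|]; rewrite Cmod_mult.
  assert (B1 : Cmod (f (c s) - f (c t) - l * (c s - c t)) <= eps / 2 * h).
  { eapply Rle_trans; [apply D1|]; replace (eps / 2 * h) with (eps / (2 * N) * (N * h)) by (field; lra).
    apply Rmult_le_compat_l; auto; left; apply Rdiv_lt_0_compat; lra. }
  assert (B2 : Cmod l * Cmod (c s - c t - (s - t)%R * v) <= eps / 2 * h).
  { replace (eps / 2 * h) with (L * (eps / (2 * L) * h)) by (field; lra).
    apply Rmult_le_compat; auto using Cmod_ge_0; [unfold L; lra|].
    eapply Rle_trans; [apply D2|]; apply Rmult_le_compat_r; auto. }
  lra.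
Qed.

Lemma holomorphic_on_cderiv (D : C -> Prop) (f : C -> C) :
  holomorphic_on D f <-> forall z, D z -> exists l, cderiv f z l.
Proof.
  split; intros H z Hz; destruct (H z Hz) as [l Hl]; exists l; apply is_derive_cderiv; exact Hl.
Qed.

Lemma cderiv_scal (k : C) (f : C -> C) (z l : C) :
  cderiv f z l -> cderiv (fun y => k * f y)%C z (k * l).
Proof.
  intro H; replace (k * l)%C with (0 * f z + k * l)%C by ring.
  apply (cderiv_mult (fun _ => k) f); [apply cderiv_const|exact H].
Qed.

Lemma cderiv_ext (f g : C -> C) (z l : C) : (forall y, f y = g y) -> cderiv f z l -> cderiv g z l.
Proof. intros E; apply (cderiv_local f g z l 1); [lra|intros; apply E]. Qed.

Lemma cderiv_minus (f g : C -> C) (z l m : C) :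
  cderiv f z l -> cderiv g z m -> cderiv (fun y => f y - g y)%C z (l - m).
Proof.
  intros Hf Hg; replace (l - m)%C with (l + (-(1)) * m)%C by ring.
  apply (cderiv_ext (fun y => f y + (-(1)) * g y)%C); [intro; ring|].
  apply cderiv_plus; [exact Hf|apply cderiv_scal; exact Hg].
Qed.

(** * Riemann integrals of complex functions of a real variable *)

Notation CRInt := (is_RInt (V := CR)).

Lemma is_RInt_uniq {V : NormedModule R_AbsRing} (f : R -> V) (a b : R) (l l' : V) :
  is_RInt f a b l -> is_RInt f a b l' -> l = l'.
Proof. intros H H'; exact (filterlim_locally_unique (F := Riemann_fine a b) _ _ _ H H'). Qed.

Lemma is_RInt_val {V : NormedModule R_AbsRing} (f : R -> V) (a b : R) (l l' : V) :
  is_RInt f a b l -> l = l' -> is_RInt f a b l'.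
Proof. intros H <-; exact H. Qed.

Lemma CRInt_val (f : R -> C) (a b : R) (l l' : C) : CRInt f a b l -> l = l' -> CRInt f a b l'.
Proof. intros H <-; exact H. Qed.

Lemma CRInt_ext (f g : R -> C) (a b : R) (l : C) :
  (forall t, f t = g t) -> CRInt f a b l -> CRInt g a b l.
Proof. intros E; apply (is_RInt_ext (V := CR)); intros; apply E. Qed.

(** In the real normed space [CR] a complex factor is not a scalar, so that linearity is checked on
    real and imaginary parts. *)
Lemma CRInt_mult_l (k : C) (f : R -> C) (a b : R) (l : C) :
  CRInt f a b l -> CRInt (fun t => k * f t)%C a b (k * l)%C.
Proof.
  intro H; destruct k as [k1 k2], l as [l1 l2].
  assert (H1 : is_RInt (fun t => fst (f t)) a b l1).
  { apply (is_RInt_fct_extend_fst (U := R_NormedModule) (V := R_NormedModule) f a b (l1, l2)), H. }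
  assert (H2 : is_RInt (fun t => snd (f t)) a b l2).
  { apply (is_RInt_fct_extend_snd (U := R_NormedModule) (V := R_NormedModule) f a b (l1, l2)), H. }
  apply (is_RInt_fct_extend_pair (U := R_NormedModule) (V := R_NormedModule)); simpl.
  - apply (is_RInt_minus (V := R_NormedModule) (fun t => k1 * fst (f t)) (fun t => k2 * snd (f t)));
      apply (is_RInt_scal (V := R_NormedModule)); assumption.
  - apply (is_RInt_plus (V := R_NormedModule) (fun t => k1 * snd (f t)) (fun t => k2 * fst (f t)));
      apply (is_RInt_scal (V := R_NormedModule)); assumption.
Qed.

Lemma CRInt_plus (f g : R -> C) (a b : R) (l m : C) :
  CRInt f a b l -> CRInt g a b m -> CRInt (fun t => f t + g t)%C a b (l + m)%C.
Proof. intros; apply (is_RInt_plus (V := CR)); assumption. Qed.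

Lemma CRInt_minus (f g : R -> C) (a b : R) (l m : C) :
  CRInt f a b l -> CRInt g a b m -> CRInt (fun t => f t - g t)%C a b (l - m)%C.
Proof. intros; apply (is_RInt_minus (V := CR)); assumption. Qed.

Lemma CRInt_const (k : C) (a b : R) : CRInt (fun _ => k) a b ((b - a)%R * k)%C.
Proof.
  rewrite <- (CR_scal (b - a) k); apply (is_RInt_const (V := CR)).
Qed.

Lemma CRInt_norm_le (f : R -> C) (g : R -> R) (a b : R) (l : C) (m : R) : a <= b ->
  (forall t, a <= t <= b -> Cmod (f t) <= g t) ->
  CRInt f a b l -> is_RInt g a b m -> Cmod l <= m.
Proof.
  intros Hab H Hf Hg; rewrite <- CR_norm.
  apply (norm_RInt_le (V := CR) f g a b l m Hab); auto.
  intros t Ht; rewrite CR_norm; auto.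
Qed.

Lemma CRInt_bound (f : R -> C) (a b M : R) (l : C) : a <= b ->
  (forall t, a <= t <= b -> Cmod (f t) <= M) -> CRInt f a b l -> Cmod l <= M * (b - a).
Proof.
  intros Hab H Hf; apply (CRInt_norm_le f (fun _ => M) a b); auto.
  apply (is_RInt_val _ _ _ _ _ (is_RInt_const (V := R_NormedModule) a b M)).
  unfold scal; simpl; unfold mult; simpl; ring.
Qed.

(** Induction on the list of break points, splitting the interval at each. Without break points,
    replacing the endpoint values by the one-sided limits makes the function continuous and does not
    affect integrability. *)
Lemma ex_RInt_piecewise {V : CompleteNormedModule R_AbsRing} (f : R -> V) (bs : list R) (a b : R) :
  a <= b ->
  (forall t, a < t < b -> ~ In t bs -> continuous f t) ->
  (forall t, a <= t < b -> exists v : V, filterlim f (at_right t) (locally v)) ->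
  (forall t, a < t <= b -> exists v : V, filterlim f (at_left t) (locally v)) ->
  ex_RInt f a b.
Proof.
  revert a b; induction bs as [|x bs IH]; intros a b Hab Hc Hr Hl.
  - destruct Hab as [Hab|<-]; [|apply ex_RInt_point].
    destruct (Hr a) as [u Hu]; [lra|]; destruct (Hl b) as [v Hv]; [lra|].
    (* [g] is constant outside ]a, b[, so that it is continuous at a and b in the two-sided
       sense. *)
    set (g := fun t => if Rle_dec t a then u else if Rle_dec b t then v else f t).
    apply (ex_RInt_ext g).
    { rewrite Rmin_left, Rmax_right by lra; intros t Ht; unfold g.
      destruct (Rle_dec t a); [lra|]; destruct (Rle_dec b t); [lra|reflexivity]. }
    apply ex_RInt_continuous; rewrite Rmin_left, Rmax_right by lra; intros t Ht.
    destruct (Req_dec t a) as [->|Na]; [|destruct (Req_dec t b) as [->|Nb]].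
    + apply filterlim_locally; intro eps.
      apply filterlim_locally with (eps := eps) in Hu; destruct Hu as [d Hd].
      assert (Hm : 0 < Rmin d (b - a)) by (apply Rmin_glb_lt; [apply cond_pos|lra]).
      exists (mkposreal _ Hm); intros y Hy; unfold g.
      change (Rabs (y - a) < Rmin d (b - a)) in Hy.
      destruct (Rle_dec a a); [|lra].
      destruct (Rle_dec y a); [apply ball_center|].
      generalize (Rmin_l d (b - a)) (Rmin_r d (b - a)); intros M1 M2.
      rewrite Rabs_pos_eq in Hy by lra.
      destruct (Rle_dec b y); [lra|].
      apply Hd; [|lra]; change (Rabs (y - a) < d); rewrite Rabs_pos_eq; lra.
    + apply filterlim_locally; intro eps.
      apply filterlim_locally with (eps := eps) in Hv; destruct Hv as [d Hd].
      assert (Hm : 0 < Rmin d (b - a)) by (apply Rmin_glb_lt; [apply cond_pos|lra]).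
      exists (mkposreal _ Hm); intros y Hy; unfold g.
      change (Rabs (y - b) < Rmin d (b - a)) in Hy.
      destruct (Rle_dec b a); [lra|]; destruct (Rle_dec b b); [|lra].
      generalize (Rmin_l d (b - a)) (Rmin_r d (b - a)); intros M1 M2.
      destruct (Rle_dec y a); [rewrite Rabs_left1 in Hy by lra; lra|].
      destruct (Rle_dec b y); [apply ball_center|].
      apply Hd; [|lra]; change (Rabs (y - b) < d); lra.
    + apply (continuous_ext_loc g f t).
      * assert (Hm : 0 < Rmin (t - a) (b - t)) by (apply Rmin_glb_lt; lra).
        exists (mkposreal _ Hm); intros y Hy; unfold g.
        change (Rabs (y - t) < Rmin (t - a) (b - t)) in Hy.
        generalize (Rmin_l (t - a) (b - t)) (Rmin_r (t - a) (b - t)); intros M1 M2.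
        apply Rabs_def2 in Hy.
        destruct (Rle_dec y a); [lra|]; destruct (Rle_dec b y); [lra|reflexivity].
      * apply Hc; [lra|auto].
  - destruct (Rlt_dec a x) as [H1|H1]; [destruct (Rlt_dec x b) as [H2|H2]|].
    + apply ex_RInt_Chasles with x; apply IH; try lra.
      * intros t Ht Nt; apply Hc; [lra|]; intros [E|E]; [lra|auto].
      * intros t Ht; apply Hr; lra.
      * intros t Ht; apply Hl; lra.
      * intros t Ht Nt; apply Hc; [lra|]; intros [E|E]; [lra|auto].
      * intros t Ht; apply Hr; lra.
      * intros t Ht; apply Hl; lra.
    + apply IH; auto; intros t Ht Nt; apply Hc; auto; intros [E|E]; [lra|auto].
    + apply IH; auto; intros t Ht Nt; apply Hc; auto; intros [E|E]; [lra|auto].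
Qed.

Lemma ex_RInt_sub {V : CompleteNormedModule R_AbsRing} (f : R -> V) (a b c d : R) :
  a <= c -> c <= d -> d <= b -> ex_RInt f a b -> ex_RInt f c d.
Proof.
  intros H1 H2 H3 H; apply (ex_RInt_Chasles_1 f c d b); [lra|].
  apply (ex_RInt_Chasles_2 f a c b); [lra|exact H].
Qed.

(** Continuity relative to the interval: a contour is continuous only within its parameter domain,
    and nothing is known beyond a finite endpoint. *)
Definition ccont_on (a b : R) (c : R -> C) : Prop :=
  forall t, a <= t <= b -> forall eps, 0 < eps -> exists d, 0 < d /\
    forall s, a <= s <= b -> Rabs (s - t) < d -> Cmod (c s - c t) < eps.

Lemma ccont_on_sub (a b a' b' : R) (c : R -> C) : a <= a' -> b' <= b ->
  ccont_on a b c -> ccont_on a' b' c.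
Proof.
  intros Ha Hb H t Ht eps He; destruct (H t ltac:(lra) eps He) as [d [Hd D]].
  exists d; split; auto; intros s Hs; apply D; lra.
Qed.

(** Nothing is assumed about f at the endpoints and break points except integrability, which bounds
    f by some M. Between two break points the classical theorem applies on [a + e, b - e]; each end
    contributes at most M e, and G is continuous up to a and b. *)
Lemma RInt_FTC_piecewise (G f : R -> C) (bs : list R) (a b : R) (l : C) :
  a <= b ->
  ccont_on a b G ->
  (forall t, a < t < b -> ~ In t bs -> pderiv G t (f t) /\ ccont f t) ->
  CRInt f a b l -> l = (G b - G a)%C.
Proof.
  revert a b l; induction bs as [|x bs IH]; intros a b l Hab HG Hd Hl.
  - destruct Hab as [Hab|<-].
    2: { rewrite Cminus_diag; eapply is_RInt_uniq; [apply Hl|apply (is_RInt_point (V := CR))]. }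
    apply Cminus_eq_0; rewrite (Cmod_small_0 (l - (G b - G a))); [apply Cmod_0|]; intros eps He.
    destruct (ex_RInt_ub (V := CR) f a b) as [M HM]; [exists l; exact Hl|].
    rewrite Rmin_left, Rmax_right in HM by lra.
    assert (HM' : forall t, a <= t <= b -> Cmod (f t) <= M).
    { intros t Ht; rewrite <- CR_norm; apply HM; auto. }
    assert (M0 : 0 <= M) by (eapply Rle_trans; [apply (Cmod_ge_0 (f a))|apply HM'; lra]).
    destruct (HG a ltac:(lra)) with (eps := eps / 4) as [d1 [Hd1 D1]]; [lra|].
    destruct (HG b ltac:(lra)) with (eps := eps / 4) as [d2 [Hd2 D2]]; [lra|].
    set (q := eps / (4 * (M + 1))).
    assert (Hq : 0 < q) by (apply Rdiv_lt_0_compat; lra).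
    assert (Mq : M * q <= eps / 4).
    { unfold q; replace (eps / 4) with ((M + 1) * (eps / (4 * (M + 1)))) by (field; lra).
      apply Rmult_le_compat_r; [left; exact Hq|lra]. }
    (* [e] is below both moduli of continuity of G, below [q], which makes M e at most eps/4, and
       below half the length. *)
    set (e := Rmin (Rmin d1 d2) (Rmin q ((b - a) / 2)) / 2).
    assert (P : 0 < Rmin (Rmin d1 d2) (Rmin q ((b - a) / 2))) by (repeat apply Rmin_glb_lt; lra).
    assert (E0 : 0 < e) by (unfold e; lra).
    assert (E : e < d1 /\ e < d2 /\ e < q /\ e < (b - a) / 2).
    { unfold e; generalize (Rmin_l (Rmin d1 d2) (Rmin q ((b - a) / 2)))
       (Rmin_r (Rmin d1 d2) (Rmin q ((b - a) / 2))) (Rmin_l d1 d2) (Rmin_r d1 d2)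
       (Rmin_l q ((b - a) / 2)) (Rmin_r q ((b - a) / 2)); lra. }
    destruct E as [E1 [E2 [E3 E4]]].
    assert (I2 : CRInt f (a + e) (b - e) (G (b - e)%R - G (a + e)%R)%C).
    { apply (is_RInt_derive (V := C_R_CompleteNormedModule) G f);
        rewrite Rmin_left, Rmax_right by lra; intros t Ht.
      - apply is_derive_pderiv, Hd; [lra|auto].
      - apply continuous_ccont, Hd; [lra|auto]. }
    destruct (ex_RInt_sub (V := C_R_CompleteNormedModule) f a b a (a + e)) as [u Hu]; try lra.
    { exists l; exact Hl. }
    destruct (ex_RInt_sub (V := C_R_CompleteNormedModule) f a b (b - e) b) as [v Hv]; try lra.
    { exists l; exact Hl. }
    assert (L : l = (u + (G (b - e)%R - G (a + e)%R) + v)%C).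
    { eapply is_RInt_uniq; [apply Hl|].
      apply (is_RInt_Chasles (V := CR)) with (b - e); [|exact Hv].
      apply (is_RInt_Chasles (V := CR)) with (a + e); [exact Hu|exact I2]. }
    assert (U : Cmod u <= eps / 4).
    { eapply Rle_trans; [apply (CRInt_bound f a (a + e) M u)|]; [lra| |exact Hu|].
      - intros t Ht; apply HM'; lra.
      - eapply Rle_trans; [|apply Mq]; apply Rmult_le_compat_l; lra. }
    assert (U' : Cmod v <= eps / 4).
    { eapply Rle_trans; [apply (CRInt_bound f (b - e) b M v)|]; [lra| |exact Hv|].
      - intros t Ht; apply HM'; lra.
      - eapply Rle_trans; [|apply Mq]; apply Rmult_le_compat_l; lra. }
    rewrite L.
    replace (u + (G (b - e)%R - G (a + e)%R) + v - (G b - G a))%C with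
      ((u + v) + ((G (b - e)%R - G b) - (G (a + e)%R - G a)))%C by ring.
    assert (X1 : Cmod (G (a + e) - G a) < eps / 4).
    { apply D1; [lra|]; replace (a + e - a) with e by ring; rewrite Rabs_pos_eq; lra. }
    assert (X2 : Cmod (G (b - e) - G b) < eps / 4).
    { apply D2; [lra|]; replace (b - e - b) with (- e) by ring; rewrite Rabs_Ropp, Rabs_pos_eq; lra. }
    eapply Rle_trans; [apply Cmod_triangle|].
    eapply Rle_trans; [apply Rplus_le_compat; [apply Cmod_triangle|apply Cmod_minus_le]|]; lra.
  - destruct (Rlt_dec a x) as [H1|H1]; [destruct (Rlt_dec x b) as [H2|H2]|].
    + destruct (ex_RInt_sub (V := C_R_CompleteNormedModule) f a b a x) as [u Hu]; try lra.
      { exists l; exact Hl. }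
      destruct (ex_RInt_sub (V := C_R_CompleteNormedModule) f a b x b) as [v Hv]; try lra.
      { exists l; exact Hl. }
      assert (L : l = (u + v)%C).
      { eapply is_RInt_uniq; [apply Hl|]; apply (is_RInt_Chasles (V := CR)) with x; [exact Hu|exact Hv]. }
      rewrite L, (IH a x u), (IH x b v); try lra; try assumption; [ring| | | |].
      * apply (ccont_on_sub a b); [lra|lra|exact HG].
      * intros t Ht Nt; apply Hd; [lra|]; intros [E|E]; [lra|auto].
      * apply (ccont_on_sub a b); [lra|lra|exact HG].
      * intros t Ht Nt; apply Hd; [lra|]; intros [E|E]; [lra|auto].
    + apply IH; auto; intros t Ht Nt; apply Hd; auto; intros [E|E]; [lra|auto].
    + apply IH; auto; intros t Ht Nt; apply Hd; auto; intros [E|E]; [lra|auto].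
Qed.

Lemma ccont_mult (f g : R -> C) (t : R) : ccont f t -> ccont g t -> ccont (fun s => f s * g s)%C t.
Proof.
  intros Hf Hg eps He.
  set (A := Cmod (f t) + 1); set (B := Cmod (g t) + 1).
  assert (HA : 0 < A) by (unfold A; generalize (Cmod_ge_0 (f t)); lra).
  assert (HB : 0 < B) by (unfold B; generalize (Cmod_ge_0 (g t)); lra).
  destruct (Hf (eps / (2 * B))) as [d1 [Hd1 D1]]; [apply Rdiv_lt_0_compat; lra|].
  destruct (Hg (Rmin 1 (eps / (2 * A)))) as [d2 [Hd2 D2]].
  { apply Rmin_glb_lt; [lra|apply Rdiv_lt_0_compat; lra]. }
  exists (Rmin d1 d2); split; [apply Rmin_glb_lt; auto|]; intros s Hs.
  specialize (D1 s (Rlt_le_trans _ _ _ Hs (Rmin_l _ _))).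
  specialize (D2 s (Rlt_le_trans _ _ _ Hs (Rmin_r _ _))).
  generalize (Rmin_l 1 (eps / (2 * A))) (Rmin_r 1 (eps / (2 * A))); intros M1 M2.
  assert (G : Cmod (g s) <= B).
  { unfold B; generalize (Cmod_triangle_minus (g s) (g t)); lra. }
  replace (f s * g s - f t * g t)%C with ((f s - f t) * g s + f t * (g s - g t))%C by ring.
  eapply Rle_lt_trans; [apply Cmod_triangle|]; rewrite !Cmod_mult.
  assert (B1 : Cmod (f s - f t) * Cmod (g s) <= Cmod (f s - f t) * B).
  { apply Rmult_le_compat_l; auto using Cmod_ge_0. }
  assert (B1' : Cmod (f s - f t) * B < eps / (2 * B) * B) by (apply Rmult_lt_compat_r; auto).
  replace (eps / (2 * B) * B) with (eps / 2) in B1' by (field; lra).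
  assert (B2 : Cmod (f t) * Cmod (g s - g t) <= A * (eps / (2 * A))).
  { apply Rmult_le_compat; auto using Cmod_ge_0; [unfold A|]; lra. }
  replace (A * (eps / (2 * A))) with (eps / 2) in B2 by (field; lra).
  lra.
Qed.

Lemma ccont_const (k : C) (t : R) : ccont (fun _ => k) t.
Proof. intros eps He; exists 1; split; [lra|]; intros; rewrite Cmod_minus_diag; auto. Qed.

Lemma ccont_comp (f : C -> C) (c : R -> C) (t : R) :
  (forall eps, 0 < eps -> exists d, 0 < d /\ forall y, Cmod (y - c t) < d -> Cmod (f y - f (c t)) < eps) ->
  ccont c t -> ccont (fun s => f (c s)) t.
Proof.
  intros Hf Hc eps He; destruct (Hf eps He) as [d [Hd D]]; destruct (Hc d Hd) as [d' [Hd' D']].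
  exists d'; split; auto.
Qed.

Lemma ccont_ex_CRInt (f : R -> C) (a b : R) : a <= b ->
  (forall t, a <= t <= b -> ccont f t) -> exists l : C, CRInt f a b l.
Proof.
  intros Hab H; apply (ex_RInt_continuous (V := C_R_CompleteNormedModule)).
  rewrite Rmin_left, Rmax_right by lra; intros t Ht; apply continuous_ccont, H, Ht.
Qed.

(** * Goursat's lemma and homotopy invariance *)

Definition seg (z z' : C) (t : R) : C := (z + t * (z' - z))%C.

Definition sgint (F : C -> C) (z z' : C) : C :=
  RInt (V := C_R_CompleteNormedModule) (fun t => F (seg z z' t) * (z' - z))%C 0 1.

Definition holo_at (F : C -> C) (z : C) : Prop := exists l, cderiv F z l.

Lemma seg_pderiv (z z' : C) (t : R) : pderiv (seg z z') t (z' - z).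
Proof.
  intros eps He; exists 1; split; [lra|]; intros s _; unfold seg.
  replace (z + s * (z' - z) - (z + t * (z' - z)) - (s - t)%R * (z' - z))%C with (RtoC 0)
    by (rewrite RtoC_minus; ring).
  rewrite Cmod_0; apply Rmult_le_pos; [lra|apply Rabs_pos].
Qed.

Lemma seg_ball (z z' w : C) (r t : R) : 0 <= t <= 1 ->
  Cmod (z - w) <= r -> Cmod (z' - w) <= r -> Cmod (seg z z' t - w) <= r.
Proof.
  intros Ht H H'; unfold seg.
  replace (z + t * (z' - z) - w)%C with ((1 - t)%R * (z - w) + t * (z' - w))%C
    by (rewrite RtoC_minus; ring).
  eapply Rle_trans; [apply Cmod_triangle|]; rewrite !Cmod_mult, !Cmod_R, !Rabs_pos_eq by lra; nra.
Qed.

Lemma holo_at_continuous (F : C -> C) (z : C) : holo_at F z ->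
  forall eps, 0 < eps -> exists d, 0 < d /\ forall y, Cmod (y - z) < d -> Cmod (F y - F z) < eps.
Proof. intros [l H]; apply cderiv_continuous with l; exact H. Qed.

Lemma sgint_correct (F : C -> C) (z z' : C) :
  (forall t, 0 <= t <= 1 -> holo_at F (seg z z' t)) ->
  CRInt (fun t => F (seg z z' t) * (z' - z))%C 0 1 (sgint F z z').
Proof.
  intro H; apply (RInt_correct (V := C_R_CompleteNormedModule)).
  apply ccont_ex_CRInt; [lra|]; intros t Ht.
  apply ccont_mult; [|apply ccont_const]; apply ccont_comp; [apply holo_at_continuous; auto|].
  apply pderiv_ccont with (z' - z)%C; apply seg_pderiv.
Qed.

Lemma sgint_val (F : C -> C) (z z' l : C) :
  CRInt (fun t => F (seg z z' t) * (z' - z))%C 0 1 l -> sgint F z z' = l.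
Proof. intro H; apply (is_RInt_unique (V := C_R_CompleteNormedModule)); exact H. Qed.

Lemma sgint_diag (F : C -> C) (z : C) : sgint F z z = 0%C.
Proof.
  apply sgint_val, (CRInt_ext (fun _ => RtoC 0)).
  - intros t; rewrite Cminus_diag; ring.
  - eapply CRInt_val; [apply CRInt_const|]; ring.
Qed.

Lemma CRInt_comp_lin (f : R -> C) (u v a b : R) (l : C) :
  CRInt f (u * a + v) (u * b + v) l -> CRInt (fun y => u * f (u * y + v)%R)%C a b l.
Proof.
  intro H; apply (is_RInt_ext (V := CR) (fun y => scal u (f (u * y + v)))).
  - intros; apply CR_scal.
  - apply (is_RInt_comp_lin (V := CR)); exact H.
Qed.

Lemma sgint_split (F : C -> C) (z z' : C) :
  (forall t, 0 <= t <= 1 -> holo_at F (seg z z' t)) ->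
  sgint F z z' = (sgint F z ((z + z') / 2) + sgint F ((z + z') / 2) z')%C.
Proof.
  intro H; assert (I := sgint_correct F z z' H).
  destruct (ex_RInt_sub (V := C_R_CompleteNormedModule) _ 0 1 0 (1 / 2)
    ltac:(lra) ltac:(lra) ltac:(lra) (ex_intro _ _ I)) as [u Hu].
  destruct (ex_RInt_sub (V := C_R_CompleteNormedModule) _ 0 1 (1 / 2) 1
    ltac:(lra) ltac:(lra) ltac:(lra) (ex_intro _ _ I)) as [v Hv].
  assert (E : sgint F z z' = (u + v)%C).
  { eapply is_RInt_uniq; [apply I|]; apply (is_RInt_Chasles (V := CR)) with (1 / 2); [exact Hu|exact Hv]. }
  rewrite E; f_equal; symmetry; apply sgint_val.
  - replace 0 with (1 / 2 * 0 + 0) in Hu at 1 by ring.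
    replace (1 / 2) with (1 / 2 * 1 + 0) in Hu at 2 by ring.
    apply CRInt_comp_lin in Hu.
    eapply CRInt_ext; [|exact Hu]; intros t; unfold seg; cbv beta.
    replace (z + ((1 / 2 * t + 0)%R) * (z' - z))%C with (z + t * ((z + z') / 2 - z))%C
      by (rewrite RtoC_plus, !RtoC_mult, RtoC_div by lra; field).
    rewrite RtoC_div by lra; field.
  - replace (1 / 2) with (1 / 2 * 0 + 1 / 2) in Hv at 1 by field.
    replace 1 with (1 / 2 * 1 + 1 / 2) in Hv at 3 by field.
    apply CRInt_comp_lin in Hv.
    eapply CRInt_ext; [|exact Hv]; intros t; unfold seg; cbv beta.
    replace (z + ((1 / 2 * t + 1 / 2)%R) * (z' - z))%C with ((z + z') / 2 + t * (z' - (z + z') / 2))%C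
      by (rewrite RtoC_plus, !RtoC_mult, RtoC_div by lra; field).
    rewrite RtoC_div by lra; field.
Qed.

Lemma sgint_rev (F : C -> C) (z z' : C) :
  (forall t, 0 <= t <= 1 -> holo_at F (seg z z' t)) -> sgint F z' z = (- sgint F z z')%C.
Proof.
  intro H; assert (I := sgint_correct F z z' H).
  apply sgint_val.
  apply (is_RInt_swap (V := CR)) in I.
  replace 1 with ((-1) * 0 + 1) in I at 1 by ring.
  replace 0 with ((-1) * 1 + 1) in I at 2 by ring.
  apply CRInt_comp_lin in I.
  eapply CRInt_ext; [|exact I]; intros t; unfold seg; cbv beta.
  replace (z + ((-1 * t + 1)%R) * (z' - z))%C with (z' + t * (z - z'))%C
    by (rewrite RtoC_plus, !RtoC_mult; ring).
  replace (RtoC (-1)) with (- (1))%C by (rewrite <- RtoC_opp; reflexivity); ring.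
Qed.

Lemma sgint_bound (F : C -> C) (z z' : C) (M : R) :
  (forall t, 0 <= t <= 1 -> holo_at F (seg z z' t)) ->
  (forall t, 0 <= t <= 1 -> Cmod (F (seg z z' t)) <= M) ->
  Cmod (sgint F z z') <= M * Cmod (z' - z).
Proof.
  intros H HM; replace (M * Cmod (z' - z)) with (M * Cmod (z' - z) * (1 - 0)) by ring.
  eapply CRInt_bound; [lra| |apply sgint_correct; exact H]; intros t Ht; cbv beta.
  rewrite Cmod_mult; apply Rmult_le_compat_r; [apply Cmod_ge_0|auto].
Qed.

Lemma sgint_FTC (F G : C -> C) (z z' : C) :
  (forall t, 0 <= t <= 1 -> cderiv G (seg z z' t) (F (seg z z' t))) ->
  (forall t, 0 <= t <= 1 -> holo_at F (seg z z' t)) ->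
  sgint F z z' = (G z' - G z)%C.
Proof.
  intros HG H.
  assert (E : seg z z' 1 = z') by (unfold seg; ring).
  assert (E0 : seg z z' 0 = z) by (unfold seg; ring).
  rewrite <- E at 2; rewrite <- E0 at 3.
  assert (P : forall t, 0 <= t <= 1 ->
    pderiv (fun t => G (seg z z' t)) t (F (seg z z' t) * (z' - z))%C).
  { intros t Ht; apply (cderiv_pderiv G (seg z z')); [auto|apply seg_pderiv]. }
  apply (RInt_FTC_piecewise (fun t => G (seg z z' t)) (fun t => F (seg z z' t) * (z' - z))%C nil 0 1);
    [lra| | |apply sgint_correct; exact H].
  - intros t Ht eps He; destruct (pderiv_ccont _ _ _ (P t Ht) eps He) as [d [Hd D]].
    exists d; split; auto.
  - intros t Ht _; split; [apply P; lra|].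
    apply ccont_mult; [|apply ccont_const]; apply ccont_comp; [apply holo_at_continuous, H; lra|].
    apply pderiv_ccont with (z' - z)%C; apply seg_pderiv.
Qed.

Lemma sgint_minus (F G : C -> C) (z z' : C) :
  (forall t, 0 <= t <= 1 -> holo_at F (seg z z' t)) ->
  (forall t, 0 <= t <= 1 -> holo_at G (seg z z' t)) ->
  sgint (fun y => F y - G y)%C z z' = (sgint F z z' - sgint G z z')%C.
Proof.
  intros HF HG; apply sgint_val.
  eapply CRInt_ext; [|apply (CRInt_minus _ _ _ _ _ _ (sgint_correct F z z' HF) (sgint_correct G z z' HG))].
  intros t; simpl; ring.
Qed.

Lemma Cseq_complete (u : nat -> C) :
  (forall eps, 0 < eps -> exists N, forall n m, (N <= n)%nat -> (N <= m)%nat -> Cmod (u n - u m) < eps) ->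
  exists l, forall eps, 0 < eps -> exists N, forall n, (N <= n)%nat -> Cmod (u n - l) < eps.
Proof.
  intro H.
  assert (H1 : ex_lim_seq_cauchy (fun n => fst (u n))).
  { intros eps; destruct (H eps (cond_pos eps)) as [N HN]; exists N; intros n m Hn Hm.
    eapply Rle_lt_trans; [|apply (HN n m Hn Hm)].
    apply (re_le_Cmod (u n - u m)%C). }
  assert (H2 : ex_lim_seq_cauchy (fun n => snd (u n))).
  { intros eps; destruct (H eps (cond_pos eps)) as [N HN]; exists N; intros n m Hn Hm.
    eapply Rle_lt_trans; [|apply (HN n m Hn Hm)].
    eapply Rle_trans; [|apply Rmax_Cmod]; apply Rmax_r. }
  apply ex_lim_seq_cauchy_corr in H1; apply ex_lim_seq_cauchy_corr in H2.
  destruct H1 as [l1 H1], H2 as [l2 H2]; exists (l1, l2); intros eps He.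
  apply is_lim_seq_spec in H1; apply is_lim_seq_spec in H2.
  assert (He' : 0 < eps / 2) by lra.
  destruct (H1 (mkposreal _ He')) as [N1 N1']; destruct (H2 (mkposreal _ He')) as [N2 N2'].
  exists (max N1 N2); intros n Hn.
  specialize (N1' n ltac:(lia)); specialize (N2' n ltac:(lia)); simpl in N1', N2'.
  eapply Rle_lt_trans; [apply Cmod_2Rmax|]; unfold Cminus, Cplus, Copp; simpl.
  assert (S : sqrt 2 <= 2).
  { generalize (sqrt_sqrt 2 ltac:(lra)) (sqrt_pos 2); nra. }
  assert (M : Rmax (Rabs (fst (u n) + - l1)) (Rabs (snd (u n) + - l2)) < eps / 2)
    by (apply Rmax_lub_lt; auto).
  assert (M0 : 0 <= Rmax (Rabs (fst (u n) + - l1)) (Rabs (snd (u n) + - l2)))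
    by (eapply Rle_trans; [apply Rabs_pos|apply Rmax_l]).
  generalize (sqrt_pos 2); nra.
Qed.

Definition triint (F : C -> C) (a b c : C) : C :=
  (sgint F a b + sgint F b c + sgint F c a)%C.

(** Bisection for Goursat's lemma: among the four triangles cut out by the midpoints, one that
    carries at least a quarter of the integral is kept. The inner triangle is the default; when the
    other three fail the test, it must pass it. *)
Definition tri_next (F : C -> C) (T : C * C * C) : C * C * C :=
  let '(a, b, c) := T in
  let x := ((a + b) / 2)%C in let y := ((b + c) / 2)%C in let z := ((c + a) / 2)%C in
  let I := Cmod (triint F a b c) / 4 in
  if Rle_dec I (Cmod (triint F a x z)) then (a, x, z)
  else if Rle_dec I (Cmod (triint F x b y)) then (x, b, y)
  else if Rle_dec I (Cmod (triint F z y c)) then (z, y, c)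
  else (x, y, z).

Definition tri_ok (z0 : C) (r d : R) (T : C * C * C) : Prop :=
  let '(a, b, c) := T in
  Cmod (a - z0) <= r /\ Cmod (b - z0) <= r /\ Cmod (c - z0) <= r /\
  Cmod (b - a) <= d /\ Cmod (c - b) <= d /\ Cmod (a - c) <= d.

Definition tri_fst (T : C * C * C) : C := fst (fst T).
Definition tri_int (F : C -> C) (T : C * C * C) : C :=
  let '(a, b, c) := T in triint F a b c.

Lemma Cmod_half (x : C) : Cmod (x / 2) = Cmod x / 2.
Proof.
  rewrite Cmod_div, Cmod_R, Rabs_pos_eq; [reflexivity|lra|].
  intro E; apply RtoC_inj in E; lra.
Qed.

Lemma tri_next_ok (F : C -> C) (z0 : C) (r d : R) (T : C * C * C) :
  (forall z, Cmod (z - z0) <= r -> holo_at F z) -> tri_ok z0 r d T ->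
  tri_ok z0 r (d / 2) (tri_next F T) /\
  Cmod (tri_int F T) / 4 <= Cmod (tri_int F (tri_next F T)) /\
  Cmod (tri_fst (tri_next F T) - tri_fst T) <= d / 2.
Proof.
  destruct T as [[a b] c]; intros HF [Ha [Hb [Hc [Hab [Hbc Hca]]]]].
  assert (HS : forall p q, Cmod (p - z0) <= r -> Cmod (q - z0) <= r ->
    forall t, 0 <= t <= 1 -> holo_at F (seg p q t)).
  { intros; apply HF, seg_ball; auto. }
  assert (Hm : forall p q, Cmod (p - z0) <= r -> Cmod (q - z0) <= r -> Cmod ((p + q) / 2 - z0) <= r).
  { intros p q Hp Hq; replace ((p + q) / 2 - z0)%C with (((p - z0) + (q - z0)) / 2)%C by field.
    rewrite Cmod_half; generalize (Cmod_triangle (p - z0) (q - z0)); lra. }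
  set (x := ((a + b) / 2)%C); set (y := ((b + c) / 2)%C); set (z := ((c + a) / 2)%C).
  assert (Hx : Cmod (x - z0) <= r) by (apply Hm; auto).
  assert (Hy : Cmod (y - z0) <= r) by (apply Hm; auto).
  assert (Hz : Cmod (z - z0) <= r) by (apply Hm; auto).
  (* The sides of the inner triangle are run through once in each direction and cancel. *)
  assert (E : triint F a b c =
    (triint F a x z + triint F x b y + triint F z y c + triint F x y z)%C).
  { unfold triint.
    rewrite (sgint_split F a b), (sgint_split F b c), (sgint_split F c a) by auto.
    fold x y z.
    rewrite (sgint_rev F x z), (sgint_rev F x y), (sgint_rev F z y) by auto.
    ring. }
  assert (D : forall p q s : C, (p - q = s / 2)%C -> Cmod s <= d -> Cmod (p - q) <= d / 2).
  { intros p q s -> Hs; rewrite Cmod_half; lra. }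
  assert (N : forall p q, Cmod (p - q) <= d -> Cmod (q - p) <= d).
  { intros p q H; rewrite Cmod_minus_sym; exact H. }
  assert (d0 : 0 <= d) by (eapply Rle_trans; [apply Cmod_ge_0|apply Hab]).
  assert (DD : tri_ok z0 r (d / 2) (a, x, z) /\ tri_ok z0 r (d / 2) (x, b, y) /\
    tri_ok z0 r (d / 2) (z, y, c) /\ tri_ok z0 r (d / 2) (x, y, z)).
  { assert (K : forall p q u v, (q - p = v - u)%C -> Cmod (v - u) <= d / 2 -> Cmod (q - p) <= d / 2)
      by (intros p q u v -> Huv; exact Huv).
    assert (E1 : Cmod (x - a) <= d / 2) by (apply (D _ _ (b - a)%C); [unfold x; field|auto]).
    assert (E2 : Cmod (y - b) <= d / 2) by (apply (D _ _ (c - b)%C); [unfold y; field|auto]).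
    assert (E3 : Cmod (z - c) <= d / 2) by (apply (D _ _ (a - c)%C); [unfold z; field|auto]).
    assert (E1' : Cmod (b - x) <= d / 2) by (apply (K _ _ a x); [unfold x; field|auto]).
    assert (E2' : Cmod (c - y) <= d / 2) by (apply (K _ _ b y); [unfold y; field|auto]).
    assert (E3' : Cmod (a - z) <= d / 2) by (apply (K _ _ c z); [unfold z; field|auto]).
    assert (F1 : Cmod (y - z) <= d / 2) by (apply (K _ _ a x); [unfold x, y, z; field|auto]).
    assert (F2 : Cmod (z - x) <= d / 2) by (apply (K _ _ b y); [unfold x, y, z; field|auto]).
    assert (F3 : Cmod (x - y) <= d / 2) by (apply (K _ _ c z); [unfold x, y, z; field|auto]).
    unfold tri_ok; repeat split; auto; rewrite Cmod_minus_sym; auto. }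
  assert (Dx : Cmod (x - a) <= d / 2) by (apply (D _ _ (b - a)%C); [unfold x; field|auto]).
  assert (Dz : Cmod (z - a) <= d / 2) by (apply (D _ _ (c - a)%C); [unfold z; field|auto]).
  destruct DD as [D1 [D2 [D3 D4]]].
  unfold tri_next; fold x y z; cbv zeta.
  match goal with |- context [Rle_dec ?u ?v] => destruct (Rle_dec u v) as [L1|L1] end.
  { split; [exact D1|split; [exact L1|]]; unfold tri_fst; cbn [fst snd]; rewrite Cmod_minus_diag; lra. }
  match goal with |- context [Rle_dec ?u ?v] => destruct (Rle_dec u v) as [L2|L2] end.
  { split; [exact D2|split; [exact L2|]]; unfold tri_fst; cbn [fst snd]; lra. }
  match goal with |- context [Rle_dec ?u ?v] => destruct (Rle_dec u v) as [L3|L3] end.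
  { split; [exact D3|split; [exact L3|]]; unfold tri_fst; cbn [fst snd]; lra. }
  split; [exact D4|split; [|unfold tri_fst; cbn [fst snd]; lra]].
  unfold tri_int; rewrite E at 1.
  set (I := Cmod (triint F a b c)) in *.
  assert (I <= Cmod (triint F a x z) + Cmod (triint F x b y) + Cmod (triint F z y c) + Cmod (triint F x y z)).
  { unfold I; rewrite E.
    eapply Rle_trans; [apply Cmod_triangle|]; apply Rplus_le_compat_r.
    eapply Rle_trans; [apply Cmod_triangle|]; apply Rplus_le_compat_r; apply Cmod_triangle. }
  rewrite <- E; fold I; lra.
Qed.

(** Bisected triangles shrink to a point [zs] like 2^-n, while their integrals lose at most a factor
    4 each time. Near [zs] the function F differs from the affine function [L] by o(|y - zs|), and
    [L] has the primitive [G], so that its integral over any triangle vanishes. *)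
Lemma goursat (F : C -> C) (z0 : C) (r : R) (a b c : C) :
  (forall z, Cmod (z - z0) <= r -> holo_at F z) ->
  Cmod (a - z0) <= r -> Cmod (b - z0) <= r -> Cmod (c - z0) <= r ->
  triint F a b c = 0%C.
Proof.
  intros HF Ha Hb Hc.
  set (d := Cmod (b - a) + Cmod (c - b) + Cmod (a - c)).
  set (T := fun n => Nat.iter n (tri_next F) (a, b, c)).
  generalize (Cmod_ge_0 (b - a)) (Cmod_ge_0 (c - b)) (Cmod_ge_0 (a - c)); intros P1 P2 P3.
  assert (d0 : 0 <= d) by (unfold d; lra).
  assert (p2 : forall n, 0 < 2 ^ n) by (intro; apply pow_lt; lra).
  assert (HT : forall n, tri_ok z0 r (d / 2 ^ n) (T n) /\
     Cmod (triint F a b c) / 4 ^ n <= Cmod (tri_int F (T n))).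
  { induction n as [|n [IH1 IH2]].
    - split; [|simpl; lra]; unfold T; simpl; unfold d; repeat split; auto; lra.
    - destruct (tri_next_ok F z0 r _ _ HF IH1) as [K1 [K2 _]]; split.
      + replace (d / 2 ^ S n) with (d / 2 ^ n / 2); [exact K1|].
        simpl; field; generalize (p2 n); lra.
      + change (T (S n)) with (tri_next F (T n)); eapply Rle_trans; [|apply K2].
        replace (Cmod (triint F a b c) / 4 ^ S n) with (Cmod (triint F a b c) / 4 ^ n / 4); [lra|].
        simpl; field; apply pow_nonzero; lra. }
  set (u := fun n => tri_fst (T n)).
  assert (Hu : forall n k, Cmod (u (n + k)%nat - u n) <= d / 2 ^ n - d / 2 ^ (n + k)).
  { intros n k; induction k as [|k IH].
    - rewrite Nat.add_0_r, Cmod_minus_diag; lra.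
    - rewrite Nat.add_succ_r.
      destruct (tri_next_ok F z0 r _ _ HF (proj1 (HT (n + k)%nat))) as [_ [_ K]].
      change (Cmod (u (S (n + k)) - u (n + k)%nat) <= d / 2 ^ (n + k) / 2) in K.
      replace (u (S (n + k)) - u n)%C with ((u (S (n + k)) - u (n + k)%nat) + (u (n + k)%nat - u n))%C by ring.
      eapply Rle_trans; [apply Cmod_triangle|].
      replace (d / 2 ^ S (n + k)) with (d / 2 ^ (n + k) / 2)
        by (simpl; field; generalize (p2 (n + k)%nat); lra).
      lra. }
  assert (G2 : forall eps, 0 < eps -> exists N, forall n, (N <= n)%nat -> d / 2 ^ n < eps).
  { intros eps He.
    destruct (pow_lt_1_zero (/ 2) ltac:(rewrite Rabs_pos_eq; lra) (eps / (d + 1))) as [N HN].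
    { apply Rdiv_lt_0_compat; lra. }
    exists N; intros n Hn; specialize (HN n Hn).
    rewrite Rabs_pos_eq in HN by (apply pow_le; lra); rewrite pow_inv in HN.
    unfold Rdiv; apply Rle_lt_trans with ((d + 1) * / 2 ^ n).
    - apply Rmult_le_compat_r; [left; apply Rinv_0_lt_compat; auto|lra].
    - replace eps with ((d + 1) * (eps / (d + 1))) by (field; lra); apply Rmult_lt_compat_l; lra. }
  destruct (Cseq_complete u) as [zs Hzs].
  { intros eps He; destruct (G2 (eps / 2)) as [N HN]; [lra|]; exists N; intros n m Hn Hm.
    assert (X : forall k, (N <= k)%nat -> Cmod (u k - u N) < eps / 2).
    { intros k Hk; replace k with (N + (k - N))%nat by lia; eapply Rle_lt_trans; [apply Hu|].
      specialize (HN N (le_n N)).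
      assert (0 <= d / 2 ^ (N + (k - N))) by (apply Rmult_le_pos; [lra|left; apply Rinv_0_lt_compat; auto]).
      lra. }
    replace (u n - u m)%C with ((u n - u N) - (u m - u N))%C by ring.
    eapply Rle_lt_trans; [apply Cmod_minus_le|]; generalize (X n Hn) (X m Hm); lra. }
  assert (Hd : forall n, Cmod (u n - zs) <= d / 2 ^ n).
  { intro n; apply le_epsilon; intros e He; destruct (Hzs e He) as [N HN].
    specialize (HN (n + N)%nat ltac:(lia)); specialize (Hu n N).
    replace (u n - zs)%C with ((u (n + N)%nat - zs) - (u (n + N)%nat - u n))%C by ring.
    eapply Rle_trans; [apply Cmod_minus_le|].
    assert (0 <= d / 2 ^ (n + N)) by (apply Rmult_le_pos; [lra|left; apply Rinv_0_lt_compat; auto]).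
    lra. }
  assert (Hzr : Cmod (zs - z0) <= r).
  { apply le_epsilon; intros e He; destruct (Hzs e He) as [N HN]; specialize (HN N (le_n N)).
    destruct (HT N) as [K _]; unfold u in HN; destruct (T N) as [[a' b'] c'], K as [K _].
    unfold tri_fst in HN; simpl in HN.
    replace (zs - z0)%C with ((a' - z0) - (a' - zs))%C by ring.
    eapply Rle_trans; [apply Cmod_minus_le|]; lra. }
  destruct (HF zs Hzr) as [l Hl].
  set (L := fun y => (F zs + l * (y - zs))%C).
  set (G := fun y => (F zs * y + l * (y * y / 2 - zs * y))%C).
  assert (HL : forall y, cderiv L y l).
  { intros y eps He; exists 1; split; [lra|]; intros y' _; unfold L.
    replace (F zs + l * (y' - zs) - (F zs + l * (y - zs)) - l * (y' - y))%C with (RtoC 0) by ring.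
    rewrite Cmod_0; apply Rmult_le_pos; [lra|apply Cmod_ge_0]. }
  assert (HG : forall y, cderiv G y (L y)).
  { intros y eps He; exists (eps / (Cmod l + 1)).
    assert (0 < Cmod l + 1) by (generalize (Cmod_ge_0 l); lra).
    split; [apply Rdiv_lt_0_compat; lra|]; intros y' Hy'; unfold G, L.
    replace (F zs * y' + l * (y' * y' / 2 - zs * y') - (F zs * y + l * (y * y / 2 - zs * y))
      - (F zs + l * (y - zs)) * (y' - y))%C with (l * (y' - y) * (y' - y) / 2)%C by field.
    rewrite Cmod_half, !Cmod_mult.
    generalize (Cmod_ge_0 l) (Cmod_ge_0 (y' - y)); intros L0 Y0.
    apply Rlt_le in Hy'; apply Rmult_le_compat_l with (r := Cmod l + 1) in Hy'; [|lra].
    replace ((Cmod l + 1) * (eps / (Cmod l + 1))) with eps in Hy' by (field; lra); nra. }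
  assert (TL : forall p q s, triint L p q s = 0%C).
  { intros; unfold triint; rewrite !(sgint_FTC L G); try ring; intros; try apply HG; eexists; apply HL. }
  apply Cmod_small_0; intros eps He.
  (* Three sides of length at most [dn], all within 2 dn of [zs], give the bound 6 eta dn^2 = 6 eta
     d^2 / 4^N. The summand 1 keeps the denominator positive when d = 0. *)
  set (eta := eps / (6 * (d * d + 1))).
  assert (Heta : 0 < eta) by (apply Rdiv_lt_0_compat; nra).
  destruct (Hl eta Heta) as [del [Hdel D]].
  destruct (G2 (del / 2)) as [N HN]; [lra|]; specialize (HN N (le_n N)).
  destruct (HT N) as [OK I]; specialize (Hd N); unfold u in Hd.
  destruct (T N) as [[p q] s]; destruct OK as [Kp [Kq [Ks [Kpq [Kqs Ksp]]]]].
  unfold tri_fst in Hd; simpl in Hd, I.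
  set (dn := d / 2 ^ N) in *.
  assert (dn0 : 0 <= dn) by (eapply Rle_trans; [apply Cmod_ge_0|apply Hd]).
  assert (near : forall x, Cmod (x - p) <= dn -> Cmod (x - zs) <= 2 * dn).
  { intros x Hx; replace (x - zs)%C with ((x - p) + (p - zs))%C by ring.
    eapply Rle_trans; [apply Cmod_triangle|]; lra. }
  assert (Np : Cmod (p - zs) <= 2 * dn) by lra.
  assert (Nq : Cmod (q - zs) <= 2 * dn) by (apply near; auto).
  assert (Ns : Cmod (s - zs) <= 2 * dn) by (apply near; rewrite Cmod_minus_sym; auto).
  assert (HFs : forall x y, Cmod (x - z0) <= r -> Cmod (y - z0) <= r ->
    forall t, 0 <= t <= 1 -> holo_at F (seg x y t)).
  { intros; apply HF, seg_ball; auto. }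
  assert (HLs : forall x y t, 0 <= t <= 1 -> holo_at L (seg x y t)).
  { intros x y t _; eexists; apply HL. }
  assert (B : forall x y, Cmod (x - z0) <= r -> Cmod (y - z0) <= r ->
    Cmod (x - zs) <= 2 * dn -> Cmod (y - zs) <= 2 * dn -> Cmod (y - x) <= dn ->
    Cmod (sgint F x y - sgint L x y) <= eta * (2 * dn) * dn).
  { intros x y X1 Y1 X2 Y2 XY; rewrite <- sgint_minus by auto.
    eapply Rle_trans; [apply (sgint_bound _ x y (eta * (2 * dn)))|].
    - intros t Ht; destruct (HFs x y X1 Y1 t Ht) as [m Hm]; eexists.
      apply cderiv_minus; [exact Hm|apply HL].
    - intros t Ht.
      assert (Q : Cmod (seg x y t - zs) <= 2 * dn) by (apply seg_ball; auto).
      eapply Rle_trans; [|apply Rmult_le_compat_l; [lra|apply Q]].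
      replace (F (seg x y t) - L (seg x y t))%C with
        (F (seg x y t) - F zs - l * (seg x y t - zs))%C by (unfold L; ring).
      apply D; unfold dn in *; lra.
    - apply Rmult_le_compat_l; [nra|exact XY]. }
  assert (B3 : Cmod (triint F p q s) <= 6 * eta * (dn * dn)).
  { replace (triint F p q s) with
      ((sgint F p q - sgint L p q) + (sgint F q s - sgint L q s) + (sgint F s p - sgint L s p))%C.
    - eapply Rle_trans; [apply Cmod_triangle|].
      eapply Rle_trans; [apply Rplus_le_compat_r, Cmod_triangle|].
      generalize (B p q Kp Kq Np Nq Kpq) (B q s Kq Ks Nq Ns Kqs) (B s p Ks Kp Ns Np Ksp); lra.
    - transitivity (triint F p q s - triint L p q s)%C; [unfold triint; ring|rewrite TL; ring]. }
  assert (p4 : 0 < 4 ^ N) by (apply pow_lt; lra).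
  assert (E4 : 4 ^ N = 2 ^ N * 2 ^ N) by (rewrite <- Rpow_mult_distr; f_equal; lra).
  assert (Fin : Cmod (triint F a b c) <= 6 * eta * (d * d)).
  { apply Rmult_le_reg_r with (/ 4 ^ N); [apply Rinv_0_lt_compat; auto|].
    replace (6 * eta * (d * d) * / 4 ^ N) with (6 * eta * (dn * dn)); [unfold Rdiv in I; lra|].
    unfold dn; rewrite E4; field; generalize (p2 N); lra. }
  eapply Rle_trans; [apply Fin|].
  replace (6 * eta * (d * d)) with (eps * ((d * d) / (d * d + 1))) by (unfold eta; field; nra).
  rewrite <- (Rmult_1_r eps) at 2; apply Rmult_le_compat_l; [lra|].
  apply Rle_div_l; nra.
Qed.

Lemma sgint_triangle (F : C -> C) (z0 : C) (r : R) (a b c : C) :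
  (forall z, Cmod (z - z0) < r -> holo_at F z) ->
  Cmod (a - z0) < r -> Cmod (b - z0) < r -> Cmod (c - z0) < r ->
  sgint F a c = (sgint F a b + sgint F b c)%C.
Proof.
  intros HF Ha Hb Hc.
  set (r' := Rmax (Cmod (a - z0)) (Rmax (Cmod (b - z0)) (Cmod (c - z0)))).
  assert (Hr' : r' < r) by (unfold r'; repeat apply Rmax_lub_lt; auto).
  assert (A' : Cmod (a - z0) <= r') by apply Rmax_l.
  assert (B' : Cmod (b - z0) <= r') by (eapply Rle_trans; [apply Rmax_l|apply Rmax_r]).
  assert (C' : Cmod (c - z0) <= r') by (eapply Rle_trans; [apply Rmax_r|apply Rmax_r]).
  assert (HF' : forall z, Cmod (z - z0) <= r' -> holo_at F z) by (intros; apply HF; lra).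
  assert (G := goursat F z0 r' a b c HF' A' B' C').
  rewrite (sgint_rev F c a).
  2: intros t Ht; apply HF', seg_ball; auto.
  unfold triint in G.
  replace (- sgint F c a)%C with
    (sgint F a b + sgint F b c - (sgint F a b + sgint F b c + sgint F c a))%C by ring.
  rewrite G; ring.
Qed.

Lemma sgint_primitive (F : C -> C) (z0 : C) (r : R) (p : C) :
  (forall z, Cmod (z - z0) < r -> holo_at F z) -> Cmod (p - z0) < r ->
  cderiv (sgint F z0) p (F p).
Proof.
  intros HF Hp eps He.
  assert (Hr : 0 < r) by (eapply Rle_lt_trans; [apply Cmod_ge_0|apply Hp]).
  destruct (holo_at_continuous F p (HF p Hp) eps He) as [d [Hd D]].
  exists (Rmin d (r - Cmod (p - z0))); split; [apply Rmin_glb_lt; lra|]; intros y Hy.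
  assert (Y1 : Cmod (y - p) < d) by (eapply Rlt_le_trans; [apply Hy|apply Rmin_l]).
  assert (Y2 : Cmod (y - p) < r - Cmod (p - z0)) by (eapply Rlt_le_trans; [apply Hy|apply Rmin_r]).
  assert (Hy0 : Cmod (y - z0) < r).
  { replace (y - z0)%C with ((y - p) + (p - z0))%C by ring.
    eapply Rle_lt_trans; [apply Cmod_triangle|]; lra. }
  rewrite (sgint_triangle F z0 r z0 p y HF) by (auto; rewrite Cmod_minus_diag; auto).
  assert (S : forall t, 0 <= t <= 1 -> holo_at F (seg p y t)).
  { intros t Ht; apply HF; eapply Rle_lt_trans.
    - apply (seg_ball p y z0 (Rmax (Cmod (p - z0)) (Cmod (y - z0))) t Ht); [apply Rmax_l|apply Rmax_r].
    - apply Rmax_lub_lt; auto. }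
  assert (K : sgint (fun _ => F p) p y = (F p * (y - p))%C).
  { rewrite (sgint_FTC _ (fun z => F p * z)%C); [ring| |].
    - intros t _; assert (K := cderiv_scal (F p) (fun z => z) (seg p y t) 1 (cderiv_id _)).
      rewrite Cmult_1_r in K; exact K.
    - intros; eexists; apply cderiv_const. }
  replace (sgint F z0 p + sgint F p y - sgint F z0 p - F p * (y - p))%C with
    (sgint F p y - sgint (fun _ => F p) p y)%C by (rewrite K; ring).
  rewrite <- sgint_minus; [|auto|intros; eexists; apply cderiv_const].
  apply sgint_bound.
  - intros t Ht; destruct (S t Ht) as [l Hl]; eexists.
    apply cderiv_minus; [exact Hl|apply cderiv_const].
  - intros t Ht; left; apply D; eapply Rle_lt_trans; [|apply Y1].
    apply seg_ball; [auto| |lra]; rewrite Cmod_minus_diag; apply Cmod_ge_0.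
Qed.

(** The first n terms, so that the empty sum is included and remainders after n terms carry the
    exponent n. *)
Fixpoint csum (n : nat) (u : nat -> C) : C :=
  match n with O => RtoC 0 | S n => (csum n u + u n)%C end.

Lemma csum_ext (n : nat) (u v : nat -> C) : (forall j, (j < n)%nat -> u j = v j) -> csum n u = csum n v.
Proof.
  induction n as [|n IH]; intro H; [reflexivity|]; simpl.
  rewrite IH by (intros; apply H; lia); rewrite H by lia; reflexivity.
Qed.

Lemma csum_plus (n : nat) (u v : nat -> C) :
  csum n (fun j => u j + v j)%C = (csum n u + csum n v)%C.
Proof. induction n as [|n IH]; simpl; [ring|]; rewrite IH; ring. Qed.

Definition node (a b : R) (n j : nat) : R := a + (b - a) * INR j / INR n.

(** The integral along an inscribed polygon makes sense for curves that are only continuous, such as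
    the intermediate curves of a homotopy, which have no velocity. *)
Definition polysum (F : C -> C) (c : R -> C) (a b : R) (n : nat) : C :=
  csum n (fun j => sgint F (c (node a b n j)) (c (node a b n (S j)))).

Lemma node_0 (a b : R) (n : nat) : node a b n 0 = a.
Proof. unfold node; simpl; unfold Rdiv; ring. Qed.

Lemma node_n (a b : R) (n : nat) : (0 < n)%nat -> node a b n n = b.
Proof. intro H; unfold node; apply lt_0_INR in H; field; lra. Qed.

Lemma node_step (a b : R) (n j : nat) : (0 < n)%nat -> node a b n (S j) = node a b n j + (b - a) / INR n.
Proof. intro H; unfold node; rewrite S_INR; apply lt_0_INR in H; field; lra. Qed.

Lemma node_bounds (a b : R) (n j : nat) : (0 < n)%nat -> a <= b -> (j <= n)%nat -> a <= node a b n j <= b.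
Proof.
  intros Hn Hab Hj; unfold node; apply le_INR in Hj; apply lt_0_INR in Hn.
  assert (0 <= INR j / INR n <= 1).
  { generalize (pos_INR j); intro; split; [apply Rdiv_le_0_compat; lra|].
    apply Rle_div_l; lra. }
  replace ((b - a) * INR j / INR n) with ((b - a) * (INR j / INR n)) by (unfold Rdiv; ring); nra.
Qed.

Definition rect_cont (a b : R) (H : R -> R -> C) : Prop :=
  forall s t, 0 <= s <= 1 -> a <= t <= b -> forall eps, 0 < eps -> exists d, 0 < d /\
    forall s' t', 0 <= s' <= 1 -> a <= t' <= b -> Rabs (s' - s) < d -> Rabs (t' - t) < d ->
      Cmod (H s' t' - H s t) < eps.

Lemma INR_large (x : R) : exists N : nat, (0 < N)%nat /\ forall n, (N <= n)%nat -> x < INR n.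
Proof.
  destruct (INR_unbounded x) as [N HN]; exists (S N); split; [lia|]; intros n Hn.
  assert (K : (N <= n)%nat) by lia; apply le_INR in K; lra.
Qed.

(* A Lebesgue number argument: the cells of a fine grid are mapped into discs
   on which F is holomorphic. *)
Lemma grid_discs (F : C -> C) (a b : R) (H : R -> R -> C) : a <= b -> rect_cont a b H ->
  (forall s t, 0 <= s <= 1 -> a <= t <= b -> exists r, 0 < r /\
     forall z, Cmod (z - H s t) < r -> holo_at F z) ->
  exists N, (0 < N)%nat /\ forall n, (N <= n)%nat -> forall i j, (i < n)%nat -> (j < n)%nat ->
    exists z0 r, (forall z, Cmod (z - z0) < r -> holo_at F z) /\
      forall s t, node 0 1 n i <= s <= node 0 1 n (S i) -> node a b n j <= t <= node a b n (S j) ->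
        Cmod (H s t - z0) < r.
Proof.
  intros Hab Hc HF.
  assert (D : forall u v, exists d : posreal, 0 <= u <= 1 -> a <= v <= b ->
    exists r, (forall z, Cmod (z - H u v) < r -> holo_at F z) /\
      forall s t, 0 <= s <= 1 -> a <= t <= b -> Rabs (s - u) < 2 * d -> Rabs (t - v) < 2 * d ->
        Cmod (H s t - H u v) < r).
  { intros u v; destruct (classic (0 <= u <= 1 /\ a <= v <= b)) as [[Hu Hv]|N].
    - destruct (HF u v Hu Hv) as [r [Hr Hz]].
      destruct (Hc u v Hu Hv r Hr) as [d [Hd D]].
      assert (Hd2 : 0 < d / 2) by lra; exists (mkposreal _ Hd2); intros _ _; exists r; split; auto.
      simpl; intros s t Hs Ht H1 H2; apply D; auto; lra.
    - exists (mkposreal 1 Rlt_0_1); intros Hu Hv; exfalso; auto. }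
  destruct (ClassicalChoice.choice (fun (p : R * R) (d : posreal) => 0 <= fst p <= 1 -> a <= snd p <= b ->
    exists r, (forall z, Cmod (z - H (fst p) (snd p)) < r -> holo_at F z) /\
      forall s t, 0 <= s <= 1 -> a <= t <= b -> Rabs (s - fst p) < 2 * d -> Rabs (t - snd p) < 2 * d ->
        Cmod (H s t - H (fst p) (snd p)) < r)) as [delta Hdelta].
  { intros [u v]; apply D. }
  destruct (compactness_value_2d 0 1 a b (fun u v => delta (u, v))) as [d Hd].
  destruct (INR_large (1 / d)) as [N1 [_ HN1]]; destruct (INR_large ((b - a) / d)) as [N2 [_ HN2]].
  exists (max 1 (max N1 N2)); split; [lia|]; intros n Hn i j Hi Hj.
  assert (Hn0 : (0 < n)%nat) by lia; assert (In0 := lt_0_INR n Hn0).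
  specialize (HN1 n ltac:(lia)); specialize (HN2 n ltac:(lia)).
  assert (M1 : (1 - 0) / INR n < d).
  { apply Rlt_div_l; [lra|]; apply Rlt_div_l in HN1; [lra|apply cond_pos]. }
  assert (M2 : (b - a) / INR n < d).
  { apply Rlt_div_l; [lra|]; apply Rlt_div_l in HN2; [lra|apply cond_pos]. }
  assert (Bi := node_bounds 0 1 n i Hn0 Rle_0_1 ltac:(lia)).
  assert (Bi' := node_bounds 0 1 n (S i) Hn0 Rle_0_1 ltac:(lia)).
  assert (Bj := node_bounds a b n j Hn0 Hab ltac:(lia)).
  assert (Bj' := node_bounds a b n (S j) Hn0 Hab ltac:(lia)).
  (* The lower corner of the cell is within [delta (u, v)] of (u, v), and the sides of the cell are
     shorter than [d], hence than [delta (u, v)]. This accounts for the factor 2 in the choice of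
     [delta]. *)
  destruct (NNPP _ (Hd (node 0 1 n i) (node a b n j) Bi Bj)) as [u [v [Hu [Hv [U [V Dd]]]]]].
  destruct (Hdelta (u, v) Hu Hv) as [r [Hr K]]; simpl in Hr, K.
  exists (H u v), r; split; [exact Hr|]; intros s t Hs Ht.
  rewrite node_step in Hs, Ht by auto.
  rewrite node_step in Bi', Bj' by auto.
  apply Rabs_def2 in U; apply Rabs_def2 in V.
  apply K; [lra|lra|apply Rabs_def1; lra|apply Rabs_def1; lra].
Qed.

(** The image of a grid cell lies in a disc on which F is holomorphic, so that by Goursat the two
    ways around the cell give the same integral. Adding up the cells cancels all inner chords. The
    transverse polygons at t = a and t = b stay in the identity: how they are disposed of depends on
    the kind of endpoint. *)
Lemma polysum_homotopy (F : C -> C) (a b : R) (H : R -> R -> C) : a <= b -> rect_cont a b H ->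
  (forall s t, 0 <= s <= 1 -> a <= t <= b -> exists r, 0 < r /\
     forall z, Cmod (z - H s t) < r -> holo_at F z) ->
  exists N, forall n, (N <= n)%nat ->
    (polysum F (H 0) a b n + polysum F (fun s => H s b) 0 1 n =
     polysum F (fun s => H s a) 0 1 n + polysum F (H 1) a b n)%C.
Proof.
  intros Hab Hc HF; destruct (grid_discs F a b H Hab Hc HF) as [N [HN0 HN]].
  exists N; intros n Hn; specialize (HN n Hn).
  assert (Hn0 : (0 < n)%nat) by lia.
  set (x := node 0 1 n); set (y := node a b n).
  set (h := fun i j => sgint F (H (x i) (y j)) (H (x i) (y (S j)))).
  set (v := fun i j => sgint F (H (x i) (y j)) (H (x (S i)) (y j))).
  assert (cell : forall i j, (i < n)%nat -> (j < n)%nat ->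
    (h i j + v i (S j) = v i j + h (S i) j)%C).
  { intros i j Hi Hj; destruct (HN i j Hi Hj) as [z0 [r [Hr K]]].
    assert (X : x i <= x (S i)).
    { unfold x; rewrite node_step by auto.
      assert (0 <= (1 - 0) / INR n) by (apply Rdiv_le_0_compat; [lra|apply lt_0_INR; auto]); lra. }
    assert (Y : y j <= y (S j)).
    { unfold y; rewrite node_step by auto.
      assert (0 <= (b - a) / INR n) by (apply Rdiv_le_0_compat; [lra|apply lt_0_INR; auto]); lra. }
    unfold x, y in X, Y.
    unfold h, v; rewrite <- !(sgint_triangle F z0 r); auto; apply K; unfold x, y; lra. }
  assert (row : forall i, (i < n)%nat -> forall k, (k <= n)%nat ->
    (csum k (h i) + v i k = v i O + csum k (h (S i)))%C).
  { intros i Hi; induction k as [|k IH]; intro Hk; simpl; [ring|].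
    specialize (IH ltac:(lia)); specialize (cell i k Hi ltac:(lia)).
    replace (csum k (h i) + h i k + v i (S k))%C with (csum k (h i) + (h i k + v i (S k)))%C by ring.
    rewrite cell.
    replace (csum k (h i) + (v i k + h (S i) k))%C with (csum k (h i) + v i k + h (S i) k)%C by ring.
    rewrite IH; ring. }
  assert (all : forall k, (k <= n)%nat ->
    (csum n (h O) + csum k (fun i => v i n) = csum k (fun i => v i O) + csum n (h k))%C).
  { induction k as [|k IH]; intro Hk; simpl; [ring|].
    specialize (IH ltac:(lia)); specialize (row k ltac:(lia) n (le_n n)).
    replace (csum n (h O) + (csum k (fun i => v i n) + v k n))%C with
      (csum n (h O) + csum k (fun i => v i n) + v k n)%C by ring.
    rewrite IH.
    replace (csum k (fun i => v i O) + csum n (h k) + v k n)%C with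
      (csum k (fun i => v i O) + (csum n (h k) + v k n))%C by ring.
    rewrite row; ring. }
  specialize (all n (le_n n)); unfold h, v, x, y in all.
  rewrite !node_0, !node_n in all by auto; exact all.
Qed.

(** On a short arc, contained in a disc where F is holomorphic, arc and chord both yield the
    increment of the primitive [sgint F z0]. The polygons therefore give the integral exactly from
    some n on, not only in the limit. *)
Lemma polysum_contour (F : C -> C) (c v : R -> C) (bs : list R) (a b : R) (l : C) : a <= b ->
  ccont_on a b c ->
  (forall t, a <= t <= b -> exists r, 0 < r /\ forall z, Cmod (z - c t) < r -> holo_at F z) ->
  (forall t, a < t < b -> ~ In t bs -> pderiv c t (v t) /\ ccont v t) ->
  CRInt (fun t => F (c t) * v t)%C a b l ->
  exists N, forall n, (N <= n)%nat -> polysum F c a b n = l.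
Proof.
  intros Hab Hc HF Hd Hl.
  (* The grid argument is applied to the homotopy that stays constantly at c. *)
  destruct (grid_discs F a b (fun _ => c) Hab) as [N [HN0 HN]].
  { intros s t _ Ht eps He; destruct (Hc t Ht eps He) as [d [Hdd D]]; exists d; split; auto. }
  { intros; auto. }
  exists N; intros n Hn; specialize (HN n Hn).
  assert (Hn0 : (0 < n)%nat) by lia.
  set (y := node a b n).
  assert (Hy : forall j, y j <= y (S j)).
  { intro j; unfold y; rewrite node_step by auto.
    assert (0 <= (b - a) / INR n) by (apply Rdiv_le_0_compat; [lra|apply lt_0_INR; auto]); lra. }
  assert (By : forall j, (j <= n)%nat -> a <= y j <= b) by (intros; apply node_bounds; auto).
  assert (I : forall k, (k <= n)%nat ->
    CRInt (fun t => F (c t) * v t)%C a (y k) (csum k (fun j => sgint F (c (y j)) (c (y (S j)))))).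
  { induction k as [|k IH]; intro Hk; simpl.
    - unfold y; rewrite node_0; apply (is_RInt_point (V := CR)).
    - specialize (IH ltac:(lia)).
      apply (is_RInt_Chasles (V := CR)) with (y k); [exact IH|].
      generalize (By k ltac:(lia)) (By (S k) Hk) (Hy k); intros B1 B2 B3.
      destruct (ex_RInt_sub (V := C_R_CompleteNormedModule) (fun t => F (c t) * v t)%C a b (y k) (y (S k)))
        as [u Hu]; try lra; [exists l; exact Hl|].
      replace (sgint F (c (y k)) (c (y (S k)))) with u; [exact Hu|].
      destruct (HN O k Hn0 ltac:(lia)) as [z0 [r [Hr K]]].
      assert (K' : forall t, y k <= t <= y (S k) -> Cmod (c t - z0) < r).
      { intros t Ht; apply (K 0); [rewrite node_0, node_step, node_0 by auto|exact Ht].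
        assert (0 <= (1 - 0) / INR n) by (apply Rdiv_le_0_compat; [lra|apply lt_0_INR; auto]); lra. }
      assert (Hz0 : Cmod (z0 - z0) < r).
      { rewrite Cmod_minus_diag; eapply Rle_lt_trans; [apply Cmod_ge_0|apply (K' (y k)); lra]. }
      assert (E : (sgint F z0 (c (y (S k))) - sgint F z0 (c (y k)))%C = sgint F (c (y k)) (c (y (S k)))).
      { rewrite (sgint_triangle F z0 r z0 (c (y k)) (c (y (S k)))); [ring|auto|auto| |]; apply K'; lra. }
      etransitivity; [|exact E].
      apply (RInt_FTC_piecewise (fun t => sgint F z0 (c t)) (fun t => F (c t) * v t)%C bs
        (y k) (y (S k)) u B3); [| |exact Hu].
      + intros t Ht eps He.
        destruct (cderiv_continuous _ _ _ (sgint_primitive F z0 r (c t) Hr (K' t Ht)) eps He)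
          as [d [Hdd D]].
        destruct (Hc t ltac:(lra) d Hdd) as [d' [Hd' D']].
        exists d'; split; auto; intros s Hs Hst; apply D, D'; [lra|auto].
      + intros t Ht Nt; destruct (Hd t ltac:(lra) Nt) as [Hp Hv]; split.
        * apply (cderiv_pderiv (sgint F z0) c); [|exact Hp].
          apply (sgint_primitive F z0 r); [auto|apply K'; lra].
        * apply ccont_mult; [|exact Hv]; apply ccont_comp; [|apply pderiv_ccont with (v t); exact Hp].
          apply holo_at_continuous, Hr, K'; lra. }
  specialize (I n (le_n n)); unfold y in I; rewrite node_n in I by auto.
  eapply is_RInt_uniq; [exact I|exact Hl].
Qed.

Lemma polysum_const (F : C -> C) (c : R -> C) (z : C) (a b : R) (n : nat) : (0 < n)%nat -> a <= b ->
  (forall t, a <= t <= b -> c t = z) -> polysum F c a b n = 0%C.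
Proof.
  intros Hn Hab H; unfold polysum; rewrite (csum_ext _ _ (fun _ => RtoC 0)).
  - induction n; [reflexivity|]; clear; induction (S n); simpl; [reflexivity|rewrite IHn0; ring].
  - intros j Hj; rewrite !H by (apply node_bounds; auto; lia); apply sgint_diag.
Qed.

Lemma polysum_ext (F : C -> C) (c c' : R -> C) (a b : R) (n : nat) : (0 < n)%nat -> a <= b ->
  (forall t, a <= t <= b -> c t = c' t) -> polysum F c a b n = polysum F c' a b n.
Proof.
  intros Hn Hab H; apply csum_ext; intros j Hj.
  rewrite !H by (apply node_bounds; auto; lia); reflexivity.
Qed.

(** * Cauchy's formula and power series *)

Definition cis (t : R) : C := (cos t, sin t).

Lemma Cmod_cis (t : R) : Cmod (cis t) = 1.
Proof.
  unfold Cmod, cis; simpl; rewrite !Rmult_1_r.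
  generalize (sin2_cos2 t); unfold Rsqr; intro H.
  replace (cos t * cos t + sin t * sin t) with 1 by lra; apply sqrt_1.
Qed.

Lemma pderiv_pair (f g : R -> R) (t df dg : R) :
  is_derive f t df -> is_derive g t dg -> pderiv (fun s => (f s, g s)) t (df, dg).
Proof.
  intros [_ Hf] [_ Hg] eps He; assert (He2 : 0 < eps / 2) by lra.
  destruct (Hf t (fun P HP => HP) (mkposreal _ He2)) as [d1 D1].
  destruct (Hg t (fun P HP => HP) (mkposreal _ He2)) as [d2 D2].
  exists (Rmin d1 d2); split; [apply Rmin_glb_lt; apply cond_pos|]; intros s Hs.
  specialize (D1 s (Rlt_le_trans _ _ _ Hs (Rmin_l _ _))).
  specialize (D2 s (Rlt_le_trans _ _ _ Hs (Rmin_r _ _))).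
  change (Rabs (f s - f t - (s - t) * df) <= eps / 2 * Rabs (s - t)) in D1.
  change (Rabs (g s - g t - (s - t) * dg) <= eps / 2 * Rabs (s - t)) in D2.
  replace ((f s, g s) - (f t, g t) - (s - t)%R * (df, dg))%C with
    (RtoC (f s - f t - (s - t) * df) + Ci * RtoC (g s - g t - (s - t) * dg))%C
    by (unfold Ci, Cminus, Cplus, Copp, Cmult, RtoC; simpl; f_equal; ring).
  eapply Rle_trans; [apply Cmod_triangle|]; rewrite Cmod_mult, Cmod_Ci, !Cmod_R; lra.
Qed.

Lemma cis_pderiv (t : R) : pderiv cis t (Ci * cis t)%C.
Proof.
  replace (Ci * cis t)%C with (- sin t, cos t) by (unfold Ci, cis, Cmult; simpl; f_equal; ring).
  apply pderiv_pair; [apply is_derive_cos|apply is_derive_sin].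
Qed.

Lemma cis_ccont (t : R) : ccont cis t.
Proof. apply pderiv_ccont with (Ci * cis t)%C, cis_pderiv. Qed.

Lemma cis_neq_0 (t : R) : cis t <> 0%C.
Proof. apply Cmod_gt_0; rewrite Cmod_cis; lra. Qed.

Lemma cis_2PI : cis (2 * PI) = cis 0.
Proof. unfold cis; rewrite cos_2PI, sin_2PI, cos_0, sin_0; reflexivity. Qed.

Lemma holo_at_plus F G z : holo_at F z -> holo_at G z -> holo_at (fun y => F y + G y)%C z.
Proof. intros [l Hl] [m Hm]; eexists; apply cderiv_plus; eauto. Qed.

Lemma holo_at_minus F G z : holo_at F z -> holo_at G z -> holo_at (fun y => F y - G y)%C z.
Proof. intros [l Hl] [m Hm]; eexists; apply cderiv_minus; eauto. Qed.

Lemma holo_at_mult F G z : holo_at F z -> holo_at G z -> holo_at (fun y => F y * G y)%C z.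
Proof. intros [l Hl] [m Hm]; eexists; apply cderiv_mult; eauto. Qed.

Lemma holo_at_const (k z : C) : holo_at (fun _ => k) z.
Proof. eexists; apply cderiv_const. Qed.

Lemma holo_at_id (z : C) : holo_at (fun y => y) z.
Proof. eexists; apply cderiv_id. Qed.

Lemma holo_at_pow (n : nat) (z : C) : holo_at (fun y => Cpow y n) z.
Proof.
  induction n as [|n IH]; [apply (holo_at_const 1)|].
  apply (holo_at_mult (fun y => y) (fun y => Cpow y n)); [apply holo_at_id|exact IH].
Qed.

Lemma cderiv_inv_sub (p z : C) : z <> p -> holo_at (fun y => / (y - p))%C z.
Proof.
  intro H; assert (Hz : (z - p)%C <> 0%C).
  { intro E; apply H; apply Cminus_eq_0; rewrite E; apply Cmod_0. }
  exists (- / ((z - p) * (z - p)))%C; intros eps He.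
  destruct (cderiv_inv _ Hz eps He) as [d [Hd D]]; exists d; split; auto.
  intros y Hy; specialize (D (y - p)%C).
  replace (y - p - (z - p))%C with (y - z)%C in D by ring; auto.
Qed.

Lemma holo_at_local (f g : C -> C) (z : C) (d0 : R) : 0 < d0 ->
  (forall y, Cmod (y - z) < d0 -> f y = g y) -> holo_at f z -> holo_at g z.
Proof. intros Hd E [l Hl]; exists l; eapply cderiv_local; eauto. Qed.

Lemma CRInt_csum (N : nat) (u : nat -> R -> C) (l : nat -> C) (a b : R) :
  (forall j, (j < N)%nat -> CRInt (u j) a b (l j)) ->
  CRInt (fun t => csum N (fun j => u j t)) a b (csum N l).
Proof.
  induction N as [|N IH]; intro H; simpl.
  - eapply CRInt_val; [apply CRInt_const|ring].
  - apply CRInt_plus; [apply IH; auto|apply H; auto].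
Qed.

(** The factor r cis t / (r cis t - h) dt is dy / (i (y - z)) on the circle. A homotopy in the
    complement of z carries this circle to the circle of radius e about z, so that the integral
    equals the mean of f over small circles, times 2 PI; then e tends to 0. *)
Lemma cauchy_formula (f : C -> C) (z0 h : C) (r R0 : R) (l : C) : r < R0 -> Cmod h < r ->
  (forall z, Cmod (z - z0) < R0 -> holo_at f z) ->
  CRInt (fun t => f (z0 + r * cis t) * (r * cis t / (r * cis t - h)))%C 0 (2 * PI) l ->
  l = (2 * PI * f (z0 + h))%C.
Proof.
  intros HrR Hh Hf Hl.
  assert (P := PI_RGT_0).
  assert (h0 := Cmod_ge_0 h).
  set (z := (z0 + h)%C).
  set (F := fun y => (f y * / (y - z))%C).
  assert (zR : Cmod (z - z0) < R0).
  { unfold z; replace (z0 + h - z0)%C with h by ring; lra. }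
  assert (circ : forall e, 0 < e < r - Cmod h ->
    CRInt (fun t => f (z + e * cis t)%C) 0 (2 * PI) l).
  { intros e He.
    set (rho := fun s => ((1 - s) * r + s * e)%R).
    set (H := fun s t : R => (z0 + s * h + rho s * cis t)%C).
    assert (Hrho : forall s, 0 <= s <= 1 -> 0 < rho s) by (intros s Hs; unfold rho; nra).
    (* The moving circle has radius rho s and the centre at distance (1 - s) |h| from z, which is
       smaller because |h| < r and e > 0. *)
    assert (Far : forall s t, 0 <= s <= 1 -> 0 < Cmod (H s t - z)).
    { intros s t Hs.
      replace (H s t - z)%C with (rho s * cis t - (1 - s)%R * h)%C
        by (unfold H, z; rewrite RtoC_minus; ring).
      eapply Rlt_le_trans; [|apply Cmod_triangle_minus].
      rewrite !Cmod_mult, !Cmod_R, Cmod_cis, !Rabs_pos_eq by (try lra; left; auto).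
      unfold rho; nra. }
    assert (Near : forall s t, 0 <= s <= 1 -> Cmod (H s t - z0) < R0).
    { intros s t Hs.
      replace (H s t - z0)%C with (s * h + rho s * cis t)%C by (unfold H; ring).
      eapply Rle_lt_trans; [apply Cmod_triangle|].
      rewrite !Cmod_mult, !Cmod_R, Cmod_cis, !Rabs_pos_eq by (try lra; left; auto).
      unfold rho; nra. }
    assert (HF : forall s t, 0 <= s <= 1 -> 0 <= t <= 2 * PI -> exists r, 0 < r /\
      forall y, Cmod (y - H s t) < r -> holo_at F y).
    { intros s t Hs _; specialize (Far s t Hs); specialize (Near s t Hs).
      exists (Rmin (Cmod (H s t - z)) (R0 - Cmod (H s t - z0))); split; [apply Rmin_glb_lt; lra|].
      intros y Hy.
      assert (Y1 : Cmod (y - H s t) < Cmod (H s t - z)) by (eapply Rlt_le_trans; [apply Hy|apply Rmin_l]).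
      assert (Y2 : Cmod (y - H s t) < R0 - Cmod (H s t - z0)) by (eapply Rlt_le_trans; [apply Hy|apply Rmin_r]).
      apply holo_at_mult.
      - apply Hf; replace (y - z0)%C with ((y - H s t) + (H s t - z0))%C by ring.
        eapply Rle_lt_trans; [apply Cmod_triangle|]; lra.
      - apply cderiv_inv_sub; intros ->; rewrite Cmod_minus_sym in Y1; lra. }
    assert (HC : rect_cont 0 (2 * PI) H).
    { intros s t Hs Ht eps Heps.
      set (M := Cmod h + r + 1); assert (HM : 0 < M) by (unfold M; lra).
      destruct (cis_ccont t (eps / (3 * M))) as [d [Hd D]]; [apply Rdiv_lt_0_compat; lra|].
      exists (Rmin d (eps / (3 * M))); split; [apply Rmin_glb_lt; auto; apply Rdiv_lt_0_compat; lra|].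
      intros s' t' Hs' Ht' D1 D2.
      assert (X1 : Rabs (s' - s) < eps / (3 * M)) by (eapply Rlt_le_trans; [apply D1|apply Rmin_r]).
      assert (X2 : Cmod (cis t' - cis t) < eps / (3 * M)).
      { apply D; eapply Rlt_le_trans; [apply D2|apply Rmin_l]. }
      replace (H s' t' - H s t)%C with
        ((s' - s)%R * (h + (e - r)%R * cis t') + rho s * (cis t' - cis t))%C
        by (unfold H, rho; rewrite !RtoC_minus, !RtoC_plus, !RtoC_mult, !RtoC_minus; ring).
      eapply Rle_lt_trans; [apply Cmod_triangle|]; rewrite !Cmod_mult, !Cmod_R.
      rewrite (Rabs_pos_eq (rho s)) by (left; auto).
      assert (B1 : Cmod (h + (e - r)%R * cis t') <= M).
      { eapply Rle_trans; [apply Cmod_triangle|]; rewrite Cmod_mult, Cmod_R, Cmod_cis.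
        rewrite Rabs_left1 by lra; unfold M; lra. }
      assert (B2 : rho s <= M) by (unfold rho, M; nra).
      assert (B3 : Rabs (s' - s) * Cmod (h + (e - r)%R * cis t') <= eps / (3 * M) * M).
      { apply Rmult_le_compat; auto using Rabs_pos, Cmod_ge_0; lra. }
      assert (B4 : rho s * Cmod (cis t' - cis t) <= M * (eps / (3 * M))).
      { apply Rmult_le_compat; auto using Cmod_ge_0; [left; auto|lra]. }
      replace (eps / (3 * M) * M) with (eps / 3) in B3 by (field; lra).
      replace (M * (eps / (3 * M))) with (eps / 3) in B4 by (field; lra).
      lra. }
    assert (Hpd : forall s t, pderiv (H s) t (rho s * (Ci * cis t))%C).
    { intros s t; apply (cderiv_pderiv (fun y => z0 + s * h + rho s * y)%C cis t (rho s)); [|apply cis_pderiv].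
      assert (K := cderiv_plus (fun _ => z0 + s * h)%C (fun y => rho s * y)%C (cis t) _ _
        (cderiv_const _ _) (cderiv_scal (rho s) (fun y => y) _ _ (cderiv_id _))).
      replace (0 + rho s * 1)%C with (RtoC (rho s)) in K by ring; exact K. }
    assert (Hv : forall s t, ccont (fun t => rho s * (Ci * cis t))%C t).
    { intros s t; apply (ccont_mult (fun _ => RtoC (rho s))); [apply ccont_const|].
      apply (ccont_mult (fun _ => Ci)); [apply ccont_const|apply cis_ccont]. }
    assert (Hint : forall s, 0 <= s <= 1 ->
      exists l : C, CRInt (fun t => F (H s t) * (rho s * (Ci * cis t)))%C 0 (2 * PI) l).
    { intros s Hs; apply ccont_ex_CRInt; [lra|]; intros t Ht.
      apply ccont_mult; [|apply Hv]; apply ccont_comp; [|eapply pderiv_ccont, Hpd].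
      apply holo_at_continuous; destruct (HF s t Hs Ht) as [q [Hq K]]; apply K.
      rewrite Cmod_minus_diag; exact Hq. }
    assert (Hpoly : forall s (l : C), 0 <= s <= 1 ->
      CRInt (fun t => F (H s t) * (rho s * (Ci * cis t)))%C 0 (2 * PI) l ->
      exists N, forall n, (N <= n)%nat -> polysum F (H s) 0 (2 * PI) n = l).
    { intros s k Hs Hk; apply (polysum_contour F (H s) (fun t => rho s * (Ci * cis t))%C nil); auto; [lra|].
      - intros t _ eps Heps; destruct (pderiv_ccont _ _ _ (Hpd s t) eps Heps) as [d [Hd D]].
        exists d; split; auto. }
    destruct (Hint 0) as [l0 Hl0]; [lra|]; destruct (Hint 1) as [l1 Hl1]; [lra|].
    destruct (Hpoly 0 l0 ltac:(lra) Hl0) as [N0 E0].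
    destruct (Hpoly 1 l1 ltac:(lra) Hl1) as [N1 E1].
    destruct (polysum_homotopy F 0 (2 * PI) H ltac:(lra) HC HF) as [N2 E2].
    set (n := S (max N0 (max N1 N2))).
    specialize (E0 n ltac:(lia)); specialize (E1 n ltac:(lia)); specialize (E2 n ltac:(lia)).
    (* Periodicity of [cis] makes the transverse polygons at both ends equal. *)
    assert (per : polysum F (fun s => H s (2 * PI)) 0 1 n = polysum F (fun s => H s 0) 0 1 n).
    { apply polysum_ext; [lia|lra|]; intros s _; unfold H; rewrite cis_2PI; reflexivity. }
    rewrite E0, E1, per in E2.
    assert (El : l1 = l0).
    { replace l1 with (polysum F (fun s => H s 0) 0 1 n + l1 - polysum F (fun s => H s 0) 0 1 n)%C by ring.
      rewrite <- E2; ring. }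
    assert (E : l0 = (Ci * l)%C).
    { eapply is_RInt_uniq; [apply Hl0|].
      eapply CRInt_ext; [|apply (CRInt_mult_l Ci _ _ _ _ Hl)]; intro t; cbv beta.
      specialize (Far 0 t ltac:(lra)); apply Cmod_gt_0 in Far; revert Far.
      unfold F, H, rho, z; replace ((1 - 0) * r + 0 * e) with r by ring; intro Far.
      replace (z0 + 0 * h + r * cis t - (z0 + h))%C with (r * cis t - h)%C in * by ring.
      replace (z0 + 0 * h + r * cis t)%C with (z0 + r * cis t)%C by ring.
      field; exact Far. }
    apply (CRInt_mult_l (- Ci)) in Hl1.
    eapply CRInt_val; [eapply CRInt_ext; [|apply Hl1]|].
    - intro t; cbv beta.
      specialize (Far 1 t ltac:(lra)); apply Cmod_gt_0 in Far; revert Far.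
      unfold F, H, rho, z; replace ((1 - 1) * r + 1 * e) with e by ring; intro Far.
      replace (z0 + 1 * h + e * cis t - (z0 + h))%C with (e * cis t)%C in * by ring.
      replace (z0 + 1 * h + e * cis t)%C with (z0 + h + e * cis t)%C by ring.
      transitivity (- (Ci * Ci) * (f (z0 + h + e * cis t)%C * (/ (e * cis t) * (e * cis t))))%C; [ring|].
      rewrite Cinv_l by exact Far.
      replace (Ci * Ci)%C with (- (1))%C by (unfold Ci, Cmult, Copp; simpl; apply injective_projections; simpl; ring).
      ring.
    - rewrite El, E; replace (- Ci * (Ci * l))%C with (- (Ci * Ci) * l)%C by ring.
      replace (Ci * Ci)%C with (- (1))%C by (unfold Ci, Cmult, Copp; simpl; apply injective_projections; simpl; ring).
      ring. }
  apply Cminus_eq_0; rewrite (Cmod_small_0 (l - 2 * PI * f z)); [apply Cmod_0|]; intros eps He.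
  destruct (holo_at_continuous f z (Hf z zR) (eps / (2 * PI))) as [d [Hd D]]; [apply Rdiv_lt_0_compat; lra|].
  set (e := Rmin d (r - Cmod h) / 2).
  assert (Hm : 0 < Rmin d (r - Cmod h)) by (apply Rmin_glb_lt; lra).
  generalize (Rmin_l d (r - Cmod h)) (Rmin_r d (r - Cmod h)); intros M1 M2.
  assert (I := circ e ltac:(unfold e; lra)).
  assert (J := CRInt_minus _ _ _ _ _ _ I (CRInt_const (f z) 0 (2 * PI))).
  replace (l - 2 * PI * f z)%C with (l - (2 * PI - 0)%R * f z)%C
    by (rewrite RtoC_minus, RtoC_mult; ring).
  replace eps with (eps / (2 * PI) * (2 * PI - 0)) by (field; lra).
  apply (CRInt_bound _ 0 (2 * PI) _ _ ltac:(lra)) with (2 := J).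
  intros t _; left; apply D; replace (z + e * cis t - z)%C with (e * cis t)%C by ring.
  rewrite Cmod_mult, Cmod_cis, Cmod_R, Rabs_pos_eq; unfold e; lra.
Qed.

Lemma geom_identity (x : C) (N : nat) : x <> 1%C ->
  (/ (1 - x) = csum N (fun j => Cpow x j) + Cpow x N / (1 - x))%C.
Proof.
  intro H; assert (H' : (1 - x)%C <> 0%C).
  { intro E; apply H; symmetry; apply Cminus_eq_0; rewrite E; apply Cmod_0. }
  induction N as [|N IH]; simpl; [field; auto|]; rewrite IH at 1; field; auto.
Qed.

Lemma csum_mult_l (N : nat) (k : C) (u : nat -> C) : csum N (fun j => k * u j)%C = (k * csum N u)%C.
Proof. induction N as [|N IH]; simpl; [ring|rewrite IH; ring]. Qed.

(** The Cauchy kernel is expanded as a finite geometric sum with its exact remainder, so that no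
    limit has to be exchanged with the integral. The bound M is quantified after the coefficients: a
    bound obtained elsewhere, uniform in a parameter, can then be fed into the Cauchy estimates. *)
Lemma taylor (f : C -> C) (z0 : C) (r R0 : R) : 0 < r < R0 ->
  (forall z, Cmod (z - z0) < R0 -> holo_at f z) ->
  exists A : nat -> C,
    (exists M, forall t, 0 <= t <= 2 * PI -> Cmod (f (z0 + r * cis t)%C) <= M) /\
    forall M, (forall t, 0 <= t <= 2 * PI -> Cmod (f (z0 + r * cis t)%C) <= M) ->
      (forall n, Cmod (A n) <= M / r ^ n) /\
      (forall h N, Cmod h < r ->
        Cmod (f (z0 + h)%C - csum N (fun j => A j * Cpow h j)%C) <=
          M * (Cmod h / r) ^ N * (r / (r - Cmod h))).
Proof.
  intros [Hr HrR] Hf; assert (P := PI_RGT_0).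
  assert (Hz : forall t, (r * cis t)%C <> 0%C).
  { intro t; apply Cmod_gt_0; rewrite Cmod_mult, Cmod_R, Cmod_cis, Rabs_pos_eq; lra. }
  assert (Mz : forall t, Cmod (r * cis t) = r).
  { intro t; rewrite Cmod_mult, Cmod_R, Cmod_cis, Rabs_pos_eq; lra. }
  assert (pz : forall t, ccont (fun t => r * cis t)%C t).
  { intro t; apply (ccont_mult (fun _ => RtoC r)); [apply ccont_const|apply cis_ccont]. }
  assert (Cf : forall t, ccont (fun t => f (z0 + r * cis t)%C) t).
  { intro t; apply (ccont_comp (fun y => f (z0 + y)%C) (fun t => r * cis t)%C); [|apply pz].
    intros eps He; destruct (holo_at_continuous f (z0 + r * cis t)%C) with (eps := eps) as [d [Hd D]]; auto.
    - apply Hf; replace (z0 + r * cis t - z0)%C with (r * cis t)%C by ring; rewrite Mz; auto.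
    - exists d; split; auto; intros y Hy; apply D.
      replace (z0 + y - (z0 + r * cis t))%C with (y - r * cis t)%C by ring; exact Hy. }
  assert (Ci : forall n t, ccont (fun t => Cpow (/ (r * cis t)) n) t).
  { intros n t; apply (ccont_comp (fun y => Cpow (/ y) n) (fun t => r * cis t)%C); [|apply pz].
    apply holo_at_continuous; induction n as [|n IH]; [apply (holo_at_const 1)|].
    apply (holo_at_mult (fun y => / y)%C (fun y => Cpow (/ y) n)); [|exact IH].
    eexists; apply cderiv_inv, Hz. }
  destruct (ClassicalChoice.choice (fun n (l : C) =>
    CRInt (fun t => f (z0 + r * cis t)%C * Cpow (/ (r * cis t)) n)%C 0 (2 * PI) l)) as [L HL].
  { intro n; apply ccont_ex_CRInt; [lra|]; intros t _; apply ccont_mult; auto. }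
  set (k := (/ (2 * PI))%C).
  assert (Hk : Cmod k = / (2 * PI)).
  { unfold k; rewrite <- RtoC_mult, <- RtoC_inv, Cmod_R, Rabs_pos_eq; try reflexivity; [|lra].
    left; apply Rinv_0_lt_compat; lra. }
  assert (k2 : (k * (2 * PI) = 1)%C).
  { unfold k; apply Cinv_l; rewrite <- RtoC_mult; intro E; apply RtoC_inj in E; lra. }
  exists (fun n => k * L n)%C; split.
  { destruct (ex_RInt_ub (V := CR) (fun t => f (z0 + r * cis t)%C) 0 (2 * PI)) as [M HM].
    { apply (ex_RInt_continuous (V := C_R_CompleteNormedModule)); intros; apply continuous_ccont, Cf. }
    exists M; intros t Ht; rewrite <- CR_norm; apply HM.
    rewrite Rmin_left, Rmax_right by lra; exact Ht. }
  intros M HM; split.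
  - intro n; rewrite Cmod_mult, Hk.
    assert (B : Cmod (L n) <= M / r ^ n * (2 * PI - 0)).
    { eapply CRInt_bound; [|intros t Ht|apply (HL n)]; [lra|]; cbv beta.
      rewrite Cmod_mult, Cmod_pow, Cmod_inv, Mz by auto; rewrite pow_inv.
      apply Rmult_le_compat_r; [left; apply Rinv_0_lt_compat, pow_lt; auto|auto]. }
    apply Rmult_le_compat_l with (r := / (2 * PI)) in B; [|left; apply Rinv_0_lt_compat; lra].
    replace (M / r ^ n) with (/ (2 * PI) * (M / r ^ n * (2 * PI - 0))); [exact B|].
    field; split; [apply pow_nonzero|]; lra.
  - intros h N Hh; assert (h0 := Cmod_ge_0 h).
    assert (Hd : forall t, (r * cis t - h)%C <> 0%C).
    { intro t; apply Cmod_gt_0; eapply Rlt_le_trans; [|apply Cmod_triangle_minus]; rewrite Mz; lra. }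
    assert (HI : exists l : C, CRInt (fun t => f (z0 + r * cis t) * (r * cis t / (r * cis t - h)))%C 0 (2 * PI) l).
    { apply ccont_ex_CRInt; [lra|]; intros t _.
      apply ccont_mult; [auto|]; apply ccont_mult; [auto|].
      apply (ccont_comp (fun y => / (y - h))%C (fun t => r * cis t)%C); [|auto].
      apply (holo_at_continuous (fun y => / (y - h))%C), cderiv_inv_sub; intro E; apply (Hd t); rewrite E; ring. }
    destruct HI as [l Hl].
    assert (El := cauchy_formula f z0 h r R0 l HrR Hh Hf Hl).
    assert (S : CRInt (fun t => csum N (fun j => Cpow h j * (f (z0 + r * cis t)%C * Cpow (/ (r * cis t)) j)))%C
       0 (2 * PI) (csum N (fun j => Cpow h j * L j)%C)).
    { apply CRInt_csum; intros j _; apply CRInt_mult_l, HL. }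
    assert (D := CRInt_minus _ _ _ _ _ _ Hl S).
    assert (E : (f (z0 + h) - csum N (fun j => k * L j * Cpow h j))%C =
      (k * (l - csum N (fun j => Cpow h j * L j)))%C).
    { rewrite El; transitivity (k * (2 * PI) * f (z0 + h) - k * csum N (fun j => Cpow h j * L j))%C; [|ring].
      rewrite k2, <- csum_mult_l, Cmult_1_l; apply (f_equal (Cminus (f (z0 + h)%C))), csum_ext; intros; ring. }
    rewrite E, Cmod_mult, Hk.
    set (X := M * (Cmod h / r) ^ N * (r / (r - Cmod h))).
    assert (B : Cmod (l - csum N (fun j => Cpow h j * L j))%C <= X * (2 * PI - 0)).
    { eapply CRInt_bound; [| |exact D]; [lra|]; intros t Ht; cbv beta.
      assert (K : (r * cis t / (r * cis t - h))%C = (/ (1 - h * / (r * cis t)))%C).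
      { generalize (r * cis t)%C (Hz t) (Hd t); intros q Hq Hqh; field; auto. }
      assert (Q : (h * / (r * cis t))%C <> 1%C).
      { intro E'; apply (Hd t); replace h with (h * / (r * cis t) * (r * cis t))%C.
        - rewrite E'; ring.
        - rewrite <- Cmult_assoc, Cinv_l by auto; ring. }
      assert (G := geom_identity _ N Q).
      replace (f (z0 + r * cis t) * (r * cis t / (r * cis t - h)) -
        csum N (fun j => Cpow h j * (f (z0 + r * cis t) * Cpow (/ (r * cis t)) j)))%C with
        (f (z0 + r * cis t) * (Cpow (h * / (r * cis t)) N * (r * cis t / (r * cis t - h))))%C.
      2: { rewrite (csum_ext N _ (fun j => f (z0 + r * cis t) * Cpow (h * / (r * cis t)) j)%C)
             by (intros; rewrite Cpow_mult_l; ring).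
           rewrite csum_mult_l, K.
           set (x := (h * / (r * cis t))%C) in *.
           change (csum N (Cpow x)) with (csum N (fun j => Cpow x j)).
           revert G; unfold Cdiv; generalize (csum N (fun j => Cpow x j)) (Cpow x N) (/ (1 - x))%C.
           intros u v w G; replace u with (u + v * w - v * w)%C by ring; rewrite <- G; ring. }
      rewrite !Cmod_mult, Cmod_pow, Cmod_div, Cmod_mult, Cmod_inv, Mz by auto.
      unfold X; rewrite Rmult_assoc; apply Rmult_le_compat; auto using Cmod_ge_0.
      - apply Rmult_le_pos; [apply pow_le, Rdiv_le_0_compat; lra|].
        apply Rdiv_le_0_compat; [lra|]; apply Cmod_gt_0; auto.
      - apply Rmult_le_compat_l; [apply pow_le, Rdiv_le_0_compat; lra|].
        apply Rmult_le_compat_l; [lra|]; apply Rinv_le_contravar; [lra|].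
        eapply Rle_trans; [|apply Cmod_triangle_minus]; rewrite Mz; lra. }
    apply Rmult_le_compat_l with (r := / (2 * PI)) in B; [|left; apply Rinv_0_lt_compat; lra].
    replace X with (/ (2 * PI) * (X * (2 * PI - 0))); [exact B|field; lra].
Qed.

Lemma Cminus_0_r (x : C) : (x - 0 = x)%C.
Proof. ring. Qed.

(** * Limits of sequences and power series *)

Definition clim (u : nat -> C) (v : C) : Prop :=
  forall eps, 0 < eps -> exists N, forall n, (N <= n)%nat -> Cmod (u n - v) < eps.

Lemma clim_unique (u : nat -> C) (v w : C) : clim u v -> clim u w -> v = w.
Proof.
  intros H H'; apply Cminus_eq_0; rewrite (Cmod_small_0 (v - w)); [apply Cmod_0|]; intros eps He.
  destruct (H (eps / 2)) as [N HN]; [lra|]; destruct (H' (eps / 2)) as [N' HN']; [lra|].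
  specialize (HN (max N N') ltac:(lia)); specialize (HN' (max N N') ltac:(lia)).
  replace (v - w)%C with ((u (max N N') - w) - (u (max N N') - v))%C by ring.
  eapply Rle_trans; [apply Cmod_minus_le|]; lra.
Qed.

Lemma clim_bound (u : nat -> C) (v w : C) (M : R) (N : nat) : clim u v ->
  (forall n, (N <= n)%nat -> Cmod (u n - w) <= M) -> Cmod (v - w) <= M.
Proof.
  intros H HM; apply le_epsilon; intros eps He; destruct (H eps He) as [N' HN].
  specialize (HN (max N N') ltac:(lia)); specialize (HM (max N N') ltac:(lia)).
  replace (v - w)%C with ((u (max N N') - w) - (u (max N N') - v))%C by ring.
  eapply Rle_trans; [apply Cmod_minus_le|]; lra.
Qed.

Lemma clim_ext (u u' : nat -> C) (v : C) : (forall n, u n = u' n) -> clim u v -> clim u' v.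
Proof. intros E H eps He; destruct (H eps He) as [N HN]; exists N; intros; rewrite <- E; auto. Qed.

Lemma clim_plus (u u' : nat -> C) (v v' : C) : clim u v -> clim u' v' ->
  clim (fun n => u n + u' n)%C (v + v').
Proof.
  intros H H' eps He.
  destruct (H (eps / 2)) as [N HN]; [lra|]; destruct (H' (eps / 2)) as [N' HN']; [lra|].
  exists (max N N'); intros n Hn; specialize (HN n ltac:(lia)); specialize (HN' n ltac:(lia)).
  replace (u n + u' n - (v + v'))%C with ((u n - v) + (u' n - v'))%C by ring.
  eapply Rle_lt_trans; [apply Cmod_triangle|]; lra.
Qed.

Lemma clim_mult_l (k : C) (u : nat -> C) (v : C) : clim u v -> clim (fun n => k * u n)%C (k * v).
Proof.
  intros H eps He; assert (K : 0 < Cmod k + 1) by (generalize (Cmod_ge_0 k); lra).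
  destruct (H (eps / (Cmod k + 1))) as [N HN]; [apply Rdiv_lt_0_compat; lra|].
  exists N; intros n Hn; specialize (HN n Hn).
  replace (k * u n - k * v)%C with (k * (u n - v))%C by ring; rewrite Cmod_mult.
  apply Rle_lt_trans with ((Cmod k + 1) * Cmod (u n - v)).
  - apply Rmult_le_compat_r; [apply Cmod_ge_0|lra].
  - replace eps with ((Cmod k + 1) * (eps / (Cmod k + 1))) by (field; lra).
    apply Rmult_lt_compat_l; auto.
Qed.

Lemma clim_minus (u u' : nat -> C) (v v' : C) : clim u v -> clim u' v' ->
  clim (fun n => u n - u' n)%C (v - v').
Proof.
  intros H H'; apply (clim_ext (fun n => u n + (-(1)) * u' n)%C); [intro; ring|].
  replace (v - v')%C with (v + (-(1)) * v')%C by ring.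
  apply clim_plus; [exact H|apply clim_mult_l; exact H'].
Qed.

Lemma pow_small (q : R) : 0 <= q < 1 -> forall M eps, 0 < eps ->
  exists N, forall n, (N <= n)%nat -> M * q ^ n < eps.
Proof.
  intros Hq M eps He.
  destruct (pow_lt_1_zero q ltac:(rewrite Rabs_pos_eq; lra) (eps / (Rabs M + 1))) as [N HN].
  { apply Rdiv_lt_0_compat; [lra|generalize (Rabs_pos M); lra]. }
  exists N; intros n Hn; specialize (HN n Hn).
  assert (Q : 0 <= q ^ n) by (apply pow_le; lra).
  rewrite Rabs_pos_eq in HN by auto.
  assert (K := Rle_abs M); assert (K' := Rabs_pos M).
  apply Rle_lt_trans with ((Rabs M + 1) * q ^ n); [nra|].
  replace eps with ((Rabs M + 1) * (eps / (Rabs M + 1))) by (field; lra).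
  apply Rmult_lt_compat_l; lra.
Qed.

Lemma csum_geom_bound (u : nat -> C) (M q : R) : 0 <= M -> 0 <= q < 1 ->
  (forall n, Cmod (u n) <= M * q ^ n) ->
  forall n k, Cmod (csum (n + k) u - csum n u) <= M * q ^ n / (1 - q).
Proof.
  intros HM Hq Hu n k.
  assert (K : Cmod (csum (n + k) u - csum n u) <= M * q ^ n * (1 - q ^ k) / (1 - q)).
  { induction k as [|k IH].
    - rewrite Nat.add_0_r, Cmod_minus_diag; simpl; right; field; lra.
    - rewrite Nat.add_succ_r; simpl.
      replace (csum (n + k) u + u (n + k)%nat - csum n u)%C with
        ((csum (n + k) u - csum n u) + u (n + k)%nat)%C by ring.
      eapply Rle_trans; [apply Cmod_triangle|].
      eapply Rle_trans; [apply Rplus_le_compat; [apply IH|apply Hu]|].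
      rewrite pow_add; right; field; lra. }
  eapply Rle_trans; [apply K|].
  assert (0 <= q ^ k) by (apply pow_le; lra); assert (0 <= q ^ n) by (apply pow_le; lra).
  assert (0 <= M * q ^ n) by (apply Rmult_le_pos; auto).
  unfold Rdiv; apply Rmult_le_compat_r; [left; apply Rinv_0_lt_compat; lra|nra].
Qed.

Lemma csum_geom_limit (u : nat -> C) (M q : R) : 0 <= M -> 0 <= q < 1 ->
  (forall n, Cmod (u n) <= M * q ^ n) ->
  exists v, clim (fun n => csum n u) v /\
    forall n, Cmod (v - csum n u) <= M * q ^ n / (1 - q).
Proof.
  intros HM Hq Hu.
  assert (B := csum_geom_bound u M q HM Hq Hu).
  destruct (Cseq_complete (fun n => csum n u)) as [v Hv].
  { intros eps He; destruct (pow_small q Hq (M / (1 - q)) (eps / 2)) as [N HN]; [lra|].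
    exists N; intros n m Hn Hm; specialize (HN N (le_n N)).
    assert (K := B N (n - N)%nat); assert (K' := B N (m - N)%nat).
    replace (N + (n - N))%nat with n in K by lia; replace (N + (m - N))%nat with m in K' by lia.
    replace (M / (1 - q) * q ^ N) with (M * q ^ N / (1 - q)) in HN by (field; lra).
    replace (csum n u - csum m u)%C with ((csum n u - csum N u) - (csum m u - csum N u))%C by ring.
    eapply Rle_lt_trans; [apply Cmod_minus_le|]; lra. }
  exists v; split; [exact Hv|]; intro n; apply (clim_bound _ _ _ _ n Hv).
  intros m Hm; replace m with (n + (m - n))%nat by lia; apply B.
Qed.

Definition pser (A : nat -> C) (z v : C) : Prop := clim (fun n => csum n (fun j => A j * Cpow z j)%C) v.

(** Such an estimate plays the part of a radius of convergence: it yields convergence for |z| < r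
    together with explicit geometric remainders. *)
Definition pbound (A : nat -> C) (M r : R) : Prop := forall n, Cmod (A n) <= M / r ^ n.

Lemma pbound_term (A : nat -> C) (M r : R) (z : C) (n : nat) : 0 < r -> pbound A M r ->
  Cmod (A n * Cpow z n) <= M * (Cmod z / r) ^ n.
Proof.
  intros Hr H; rewrite Cmod_mult, Cmod_pow; unfold Rdiv; rewrite Rpow_mult_distr, pow_inv.
  eapply Rle_trans; [apply Rmult_le_compat_r; [apply pow_le, Cmod_ge_0|apply H]|].
  right; unfold Rdiv; ring.
Qed.

Lemma pbound_nonneg (A : nat -> C) (M r : R) : pbound A M r -> 0 <= M.
Proof.
  intro H; specialize (H O); simpl in H.
  eapply Rle_trans; [apply Cmod_ge_0|]; rewrite Rdiv_1_r in H; exact H.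
Qed.

Lemma div_lt_1 (x r : R) : 0 <= x < r -> 0 <= x / r < 1.
Proof.
  intros H; split; [apply Rdiv_le_0_compat; lra|apply Rlt_div_l; lra].
Qed.

Lemma pser_exists (A : nat -> C) (M r : R) (z : C) : 0 < r -> pbound A M r -> Cmod z < r ->
  exists v, pser A z v.
Proof.
  intros Hr H Hz; assert (z0 := Cmod_ge_0 z).
  destruct (csum_geom_limit (fun j => A j * Cpow z j)%C M (Cmod z / r)) as [v [Hv _]].
  - eapply pbound_nonneg; eauto.
  - apply div_lt_1; lra.
  - intro; apply pbound_term; auto.
  - exists v; exact Hv.
Qed.

Lemma pser_remainder (A : nat -> C) (M r : R) (z v : C) (N : nat) : 0 < r -> pbound A M r ->
  Cmod z < r -> pser A z v ->
  Cmod (v - csum N (fun j => A j * Cpow z j)%C) <= M * (Cmod z / r) ^ N / (1 - Cmod z / r).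
Proof.
  intros Hr H Hz Hv; assert (z0 := Cmod_ge_0 z).
  destruct (csum_geom_limit (fun j => A j * Cpow z j)%C M (Cmod z / r)) as [v' [Hv' B]].
  - eapply pbound_nonneg; eauto.
  - apply div_lt_1; lra.
  - intro; apply pbound_term; auto.
  - rewrite (clim_unique _ _ _ Hv Hv'); apply B.
Qed.

(** The terms of a convergent series are bounded: late terms are differences of two partial sums
    within 1 of the limit, whence the constant 2, and finitely many terms precede them. *)
Lemma pser_pbound (A : nat -> C) (z v : C) : z <> 0%C -> pser A z v ->
  exists M, pbound A M (Cmod z).
Proof.
  intros Hz Hv; destruct (Hv 1 Rlt_0_1) as [N HN].
  assert (Z : 0 < Cmod z) by (apply Cmod_gt_0; auto).
  assert (B : exists M0, forall n, (n < N)%nat -> Cmod (A n * Cpow z n) <= M0).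
  { clear HN; induction N as [|N [M0 IH]]; [exists 0; intros; lia|].
    exists (Rmax M0 (Cmod (A N * Cpow z N))); intros n Hn.
    destruct (Nat.eq_dec n N) as [->|]; [apply Rmax_r|].
    eapply Rle_trans; [apply IH; lia|apply Rmax_l]. }
  destruct B as [M0 B]; exists (Rmax M0 2); intro n.
  assert (T : Cmod (A n * Cpow z n) <= Rmax M0 2).
  { destruct (le_lt_dec N n) as [L|L].
    - assert (K := HN n L); assert (K' := HN (S n) ltac:(lia)); simpl in K'.
      set (s := csum n (fun j => A j * Cpow z j)%C) in *.
      replace (A n * Cpow z n)%C with ((s + A n * Cpow z n - v) - (s - v))%C by ring.
      eapply Rle_trans; [apply Cmod_minus_le|]; generalize (Rmax_r M0 2); lra.
    - eapply Rle_trans; [apply B; auto|apply Rmax_l]. }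
  rewrite Cmod_mult, Cmod_pow in T.
  apply Rle_div_r; [apply pow_lt; auto|exact T].
Qed.

Lemma pser_is_pseries (A : nat -> C) (z v : C) :
  pser A z v <-> is_pseries (K := C_AbsRing) (V := C_NormedModule) A z v.
Proof.
  assert (E : forall n, sum_n (G := C_AbelianMonoid) (fun k => scal (V := C_NormedModule) (pow_n (K := C_Ring) z k) (A k)) n
    = csum (S n) (fun j => A j * Cpow z j)%C).
  { assert (P : forall k, pow_n (K := C_Ring) z k = Cpow z k).
    { induction k as [|k IH]; [reflexivity|]; simpl; rewrite IH; reflexivity. }
    induction n as [|n IH].
    - rewrite sum_O, P; simpl; unfold scal; simpl; unfold mult; simpl; ring.
    - rewrite sum_Sn, IH, P; simpl; unfold scal, plus; simpl; unfold mult; simpl; ring. }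
  unfold is_pseries, is_series, pser, clim; split.
  - intros H; apply (filterlim_Cmod eventually); intros eps He; destruct (H eps He) as [N HN].
    exists N; intros n Hn.
    change (Cmod (sum_n (G := C_AbelianMonoid) (fun k => scal (V := C_NormedModule) (pow_n (K := C_Ring) z k) (A k)) n - v) < eps).
    rewrite E; apply HN; lia.
  - intros H eps He; apply (filterlim_Cmod eventually) with (eps := eps) in H; auto.
    destruct H as [N HN]; exists (S N); intros n Hn; destruct n as [|n]; [lia|].
    specialize (HN n ltac:(lia)).
    change (Cmod (sum_n (G := C_AbelianMonoid) (fun k => scal (V := C_NormedModule) (pow_n (K := C_Ring) z k) (A k)) n - v) < eps) in HN.
    rewrite E in HN; exact HN.
Qed.

Lemma pow_diff_bound (z h : C) (d : R) (n : nat) : 0 < d -> Cmod h <= d ->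
  Cmod (Cpow (z + h) n - Cpow z n) <= Cmod h / d * (Cmod z + d) ^ n.
Proof.
  intros Hd Hh; assert (h0 := Cmod_ge_0 h); assert (z0 := Cmod_ge_0 z).
  assert (H0 : 0 <= Cmod h / d) by (apply Rdiv_le_0_compat; lra).
  induction n as [|n IH]; [simpl; rewrite Cmod_minus_diag; lra|].
  replace (Cpow (z + h) (S n) - Cpow z (S n))%C with
    (z * (Cpow (z + h) n - Cpow z n) + h * Cpow (z + h) n)%C by (simpl; ring).
  eapply Rle_trans; [apply Cmod_triangle|]; rewrite !Cmod_mult, Cmod_pow.
  set (P := (Cmod z + d) ^ n) in *.
  assert (B : Cmod (z + h) ^ n <= P).
  { apply pow_incr; split; [apply Cmod_ge_0|]; eapply Rle_trans; [apply Cmod_triangle|]; lra. }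
  assert (B1 : Cmod z * Cmod (Cpow (z + h) n - Cpow z n) <= Cmod z * (Cmod h / d * P))
    by (apply Rmult_le_compat_l; auto).
  assert (B2 : Cmod h * Cmod (z + h) ^ n <= Cmod h * P) by (apply Rmult_le_compat_l; auto).
  simpl; fold P; replace (Cmod h / d * ((Cmod z + d) * P)) with
    (Cmod z * (Cmod h / d * P) + Cmod h * P) by (field; lra); lra.
Qed.

(** For |h| <= d a term of degree j >= 2 in the binomial expansion in h is at most (|h|/d)^2 times
    the term with h replaced by d. The remaining factor (|z| + d)^n is summable against the
    coefficients of a power series. *)
Lemma pow_diff2_bound (z h : C) (d : R) (n : nat) : 0 < d -> Cmod h <= d ->
  Cmod (Cpow (z + h) n - Cpow z n - h * (INR n * Cpow z (n - 1))) <=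
    (Cmod h / d) ^ 2 * (Cmod z + d) ^ n.
Proof.
  intros Hd Hh; assert (h0 := Cmod_ge_0 h); assert (z0 := Cmod_ge_0 z).
  assert (H0 : 0 <= Cmod h / d) by (apply Rdiv_le_0_compat; lra).
  induction n as [|n IH].
  { simpl; replace (1 - 1 - h * (0 * 1))%C with (RtoC 0) by ring; rewrite Cmod_0; nra. }
  assert (E : (INR n * (z * Cpow z (n - 1)) = INR n * Cpow z n)%C).
  { destruct n as [|n]; [simpl; ring|]; rewrite <- Cpow_S; do 2 f_equal; lia. }
  replace (Cpow (z + h) (S n) - Cpow z (S n) - h * (INR (S n) * Cpow z (S n - 1)))%C with
    (z * (Cpow (z + h) n - Cpow z n - h * (INR n * Cpow z (n - 1))) + h * (Cpow (z + h) n - Cpow z n))%C.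
  2: { rewrite S_INR, RtoC_plus; replace (S n - 1)%nat with n by lia; simpl.
       transitivity (z * Cpow (z + h) n - z * Cpow z n - h * (INR n * (z * Cpow z (n - 1)))
         + h * (Cpow (z + h) n - Cpow z n))%C; [ring|]; rewrite E; ring. }
  eapply Rle_trans; [apply Cmod_triangle|]; rewrite !Cmod_mult.
  assert (B := pow_diff_bound z h d n Hd Hh).
  set (P := (Cmod z + d) ^ n) in *.
  assert (B1 : Cmod z * Cmod (Cpow (z + h) n - Cpow z n - h * (INR n * Cpow z (n - 1))) <=
    Cmod z * ((Cmod h / d) ^ 2 * P)) by (apply Rmult_le_compat_l; auto).
  assert (B2 : Cmod h * Cmod (Cpow (z + h) n - Cpow z n) <= Cmod h * (Cmod h / d * P))
    by (apply Rmult_le_compat_l; auto).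
  change ((Cmod z + d) ^ S n) with ((Cmod z + d) * P).
  replace ((Cmod h / d) ^ 2 * ((Cmod z + d) * P)) with
    (Cmod z * ((Cmod h / d) ^ 2 * P) + Cmod h * (Cmod h / d * P)) by (field; lra); lra.
Qed.

(** Quadratic remainders with explicit constants can be added up over infinitely many terms, which
    mere differentiability does not allow. Power series and the sum over the poles are both
    differentiated through this criterion. *)
Lemma cderiv_second_order (f : C -> C) (z l : C) (M d : R) : 0 < d ->
  (forall h, Cmod h <= d -> Cmod (f (z + h)%C - f z - h * l) <= M * Cmod h ^ 2) -> cderiv f z l.
Proof.
  intros Hd H eps He; assert (K : 0 < Rabs M + 1) by (generalize (Rabs_pos M); lra).
  exists (Rmin d (eps / (Rabs M + 1))); split; [apply Rmin_glb_lt; auto; apply Rdiv_lt_0_compat; lra|].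
  intros y Hy.
  assert (Y1 : Cmod (y - z) < d) by (eapply Rlt_le_trans; [apply Hy|apply Rmin_l]).
  assert (Y2 : Cmod (y - z) < eps / (Rabs M + 1)) by (eapply Rlt_le_trans; [apply Hy|apply Rmin_r]).
  specialize (H (y - z)%C ltac:(lra)).
  replace (z + (y - z))%C with y in H by ring.
  replace (l * (y - z))%C with ((y - z) * l)%C by ring.
  eapply Rle_trans; [apply H|]; assert (h0 := Cmod_ge_0 (y - z)).
  apply Rmult_lt_compat_l with (r := Rabs M + 1) in Y2; auto.
  replace ((Rabs M + 1) * (eps / (Rabs M + 1))) with eps in Y2 by (field; lra).
  generalize (Rle_abs M); intro; simpl; nra.
Qed.

Lemma csum_minus (n : nat) (u v : nat -> C) :
  csum n (fun j => u j - v j)%C = (csum n u - csum n v)%C.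
Proof. induction n as [|n IH]; simpl; [ring|]; rewrite IH; ring. Qed.

Lemma pser_holo (A : nat -> C) (M r : R) (f : C -> C) (z : C) : 0 < r -> pbound A M r ->
  (forall y, Cmod y < r -> pser A y (f y)) -> Cmod z < r -> holo_at f z.
Proof.
  intros Hr HA Hf Hz; assert (z0 := Cmod_ge_0 z).
  set (d := (r - Cmod z) / 2); assert (Hd : 0 < d) by (unfold d; lra).
  set (q := (Cmod z + d) / r).
  assert (Hq : 0 <= q < 1) by (apply div_lt_1; unfold d; lra).
  assert (M0 := pbound_nonneg _ _ _ HA).
  assert (T : forall n, Cmod (A n) * (Cmod z + d) ^ n <= M * q ^ n).
  { intro n; unfold q, Rdiv; rewrite Rpow_mult_distr, pow_inv.
    eapply Rle_trans; [apply Rmult_le_compat_r; [apply pow_le; lra|apply HA]|].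
    right; unfold Rdiv; ring. }
  assert (D : forall n, Cmod (INR n * Cpow z (n - 1)) <= (Cmod z + d) ^ n / d).
  { induction n as [|n IH]; [simpl; rewrite Cmult_0_l, Cmod_0; apply Rdiv_le_0_compat; lra|].
    assert (E : (INR (S n) * Cpow z (S n - 1) = z * (INR n * Cpow z (n - 1)) + Cpow z n)%C).
    { replace (S n - 1)%nat with n by lia; rewrite S_INR, RtoC_plus.
      destruct n as [|n]; [simpl; ring|]; replace (S n - 1)%nat with n by lia; simpl; ring. }
    rewrite E; eapply Rle_trans; [apply Cmod_triangle|]; rewrite Cmod_mult, Cmod_pow.
    assert (B : Cmod z ^ n <= (Cmod z + d) ^ n) by (apply pow_incr; lra).
    apply Rmult_le_compat_l with (r := Cmod z) in IH; auto.
    simpl; replace ((Cmod z + d) * (Cmod z + d) ^ n / d) with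
      (Cmod z * ((Cmod z + d) ^ n / d) + (Cmod z + d) ^ n) by (field; lra); lra. }
  destruct (csum_geom_limit (fun n => A n * (INR n * Cpow z (n - 1)))%C (M / d) q) as [l [Hl _]]; auto.
  { apply Rdiv_le_0_compat; lra. }
  { intro n; rewrite Cmod_mult.
    eapply Rle_trans; [apply Rmult_le_compat_l; [apply Cmod_ge_0|apply D]|].
    replace (Cmod (A n) * ((Cmod z + d) ^ n / d)) with ((Cmod (A n) * (Cmod z + d) ^ n) / d) by (field; lra).
    replace (M / d * q ^ n) with (M * q ^ n / d) by (field; lra).
    apply Rmult_le_compat_r; [left; apply Rinv_0_lt_compat; auto|auto]. }
  exists l; apply (cderiv_second_order f z l (M / (1 - q) / d ^ 2) d Hd); intros h Hh.
  assert (h0 := Cmod_ge_0 h).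
  assert (Hzh : Cmod (z + h) < r).
  { eapply Rle_lt_trans; [apply Cmod_triangle|]; unfold d in Hh; lra. }
  assert (L := clim_minus _ _ _ _ (clim_minus _ _ _ _ (Hf _ Hzh) (Hf _ Hz)) (clim_mult_l h _ _ Hl)).
  rewrite <- (Cminus_0_r (f (z + h)%C - f z - h * l)).
  apply (clim_bound _ _ _ _ O L); intros n _; rewrite Cminus_0_r.
  rewrite <- csum_mult_l, <- !csum_minus.
  assert (G := csum_geom_bound (fun j => (A j * Cpow (z + h) j - A j * Cpow z j - h * (A j * (INR j * Cpow z (j - 1)))))%C
    (M * (Cmod h / d) ^ 2) q).
  specialize (G ltac:(apply Rmult_le_pos; [auto|apply pow_le, Rdiv_le_0_compat; lra]) Hq).
  assert (B : forall j, Cmod (A j * Cpow (z + h) j - A j * Cpow z j - h * (A j * (INR j * Cpow z (j - 1)))) <=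
    M * (Cmod h / d) ^ 2 * q ^ j).
  { intro j; replace (A j * Cpow (z + h) j - A j * Cpow z j - h * (A j * (INR j * Cpow z (j - 1))))%C with
      (A j * (Cpow (z + h) j - Cpow z j - h * (INR j * Cpow z (j - 1))))%C by ring.
    rewrite Cmod_mult.
    eapply Rle_trans; [apply Rmult_le_compat_l; [apply Cmod_ge_0|apply pow_diff2_bound; [exact Hd|exact Hh]]|].
    replace (Cmod (A j) * ((Cmod h / d) ^ 2 * (Cmod z + d) ^ j)) with
      ((Cmod h / d) ^ 2 * (Cmod (A j) * (Cmod z + d) ^ j)) by ring.
    replace (M * (Cmod h / d) ^ 2 * q ^ j) with ((Cmod h / d) ^ 2 * (M * q ^ j)) by ring.
    apply Rmult_le_compat_l; [apply pow_le, Rdiv_le_0_compat; lra|auto]. }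
  specialize (G B O n); simpl in G; rewrite Cminus_0_r in G.
  eapply Rle_trans; [apply G|]; right; simpl; field; lra.
Qed.

(** Uniqueness of asymptotic expansions along the positive axis: when e j = 0 for j < n, the bound
    for N = n + 1 reads |e n| s^n <= M s^(n+1), and s tends to 0. Only finite sums occur, as an
    asymptotic expansion provides no more. *)
Lemma coeff_zero (e : nat -> C) :
  (forall N, exists M d, 0 < d /\ forall s, 0 < s < d ->
     Cmod (csum N (fun j => e j * Cpow (RtoC s) j)%C) <= M * s ^ N) -> forall n, e n = 0%C.
Proof.
  intros H n; induction n as [n IH] using (well_founded_induction Wf_nat.lt_wf).
  destruct (H (S n)) as [M [d [Hd B]]].
  apply Cmod_small_0; intros eps He.
  assert (K : 0 < Rabs M + 1) by (generalize (Rabs_pos M); lra).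
  set (s := Rmin d (eps / (Rabs M + 1)) / 2).
  assert (P : 0 < Rmin d (eps / (Rabs M + 1))) by (apply Rmin_glb_lt; auto; apply Rdiv_lt_0_compat; lra).
  assert (Hs : 0 < s < d) by (unfold s; generalize (Rmin_l d (eps / (Rabs M + 1))); lra).
  assert (Hs' : s < eps / (Rabs M + 1)) by (unfold s; generalize (Rmin_r d (eps / (Rabs M + 1))); lra).
  specialize (B s Hs); simpl in B.
  rewrite (csum_ext n _ (fun j => 0 * 0)%C) in B by (intros j Hj; rewrite IH by auto; ring).
  rewrite csum_mult_l, Cmult_0_l, Cplus_0_l, Cmod_mult, Cmod_pow, Cmod_R, Rabs_pos_eq in B by lra.
  assert (Pn : 0 < s ^ n) by (apply pow_lt; lra).
  apply Rmult_le_reg_r with (s ^ n); auto.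
  eapply Rle_trans; [apply B|].
  replace (M * (s * s ^ n)) with (M * s * s ^ n) by ring.
  apply Rmult_le_compat_r; [lra|].
  apply Rmult_lt_compat_l with (r := Rabs M + 1) in Hs'; auto.
  replace ((Rabs M + 1) * (eps / (Rabs M + 1))) with eps in Hs' by (field; lra).
  generalize (Rle_abs M); nra.
Qed.

(** Both remainders after N terms are O(s^N) on half of the interval, which is what [coeff_zero]
    asks of the difference. Comparing on positive reals leaves out the point 0, where a germ may be
    unknown. *)
Lemma pser_unique (A B : nat -> C) (d : R) : 0 < d ->
  (forall s, 0 < s < d -> exists v, pser A (RtoC s) v /\ pser B (RtoC s) v) ->
  forall n, A n = B n.
Proof.
  intros Hd H n; apply Cminus_eq_0; rewrite (coeff_zero (fun n => A n - B n)%C); [apply Cmod_0|].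
  intro N; set (r := d / 2).
  assert (Hr : 0 < r < d) by (unfold r; lra).
  assert (Nr : RtoC r <> 0%C) by (intro E; apply RtoC_inj in E; lra).
  assert (Mr : Cmod r = r) by (rewrite Cmod_R, Rabs_pos_eq; lra).
  destruct (H r Hr) as [v [HA HB]].
  destruct (pser_pbound A r v Nr HA) as [M1 P1]; destruct (pser_pbound B r v Nr HB) as [M2 P2].
  rewrite Mr in P1, P2.
  exists ((M1 + M2) * 2 / r ^ N), (r / 2); split; [lra|]; intros s Hs.
  destruct (H s ltac:(lra)) as [w [WA WB]].
  assert (Ms : Cmod s = s) by (rewrite Cmod_R, Rabs_pos_eq; lra).
  assert (R1 := pser_remainder A M1 r s w N ltac:(lra) P1 ltac:(rewrite Ms; lra) WA).
  assert (R2 := pser_remainder B M2 r s w N ltac:(lra) P2 ltac:(rewrite Ms; lra) WB).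
  rewrite Ms in R1, R2.
  set (a := csum N (fun j => A j * Cpow s j)%C) in *.
  set (b := csum N (fun j => B j * Cpow s j)%C) in *.
  replace (csum N (fun j => (A j - B j) * Cpow s j)%C) with ((w - b) - (w - a))%C.
  2: { rewrite (csum_ext N _ (fun j => A j * Cpow s j - B j * Cpow s j)%C) by (intros; ring).
       rewrite csum_minus; fold a b; ring. }
  eapply Rle_trans; [apply Cmod_minus_le|].
  assert (N1 := pbound_nonneg _ _ _ P1); assert (N2 := pbound_nonneg _ _ _ P2).
  assert (Q : forall M, 0 <= M -> M * (s / r) ^ N / (1 - s / r) <= M * 2 / r ^ N * s ^ N).
  { intros M HM; unfold Rdiv at 2; rewrite Rpow_mult_distr, pow_inv.
    assert (Q0 : / (1 - s / r) <= 2).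
    { replace 2 with (/ (1 / 2)) by field; apply Rinv_le_contravar; [lra|].
      assert (s / r <= 1 / 2) by (apply Rle_div_l; lra); lra. }
    unfold Rdiv; replace (M * 2 * / r ^ N * s ^ N) with (M * (s ^ N * / r ^ N) * 2) by ring.
    apply Rmult_le_compat_l; auto.
    apply Rmult_le_pos; [auto|apply Rmult_le_pos; [apply pow_le; lra|left; apply Rinv_0_lt_compat, pow_lt; lra]]. }
  generalize (Q M1 N1) (Q M2 N2).
  replace ((M1 + M2) * 2 / r ^ N * s ^ N) with (M1 * 2 / r ^ N * s ^ N + M2 * 2 / r ^ N * s ^ N)
    by (field; apply pow_nonzero; lra); lra.
Qed.

Lemma pser_eq (A B : nat -> C) (z v : C) : (forall n, A n = B n) -> pser A z v -> pser B z v.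
Proof. intro E; apply clim_ext; intro n; apply csum_ext; intros; rewrite E; reflexivity. Qed.

Lemma taylor_pser (f : C -> C) (z0 : C) (R0 : R) : 0 < R0 ->
  (forall z, Cmod (z - z0) < R0 -> holo_at f z) ->
  exists (A : nat -> C) (M r : R), 0 < r /\ pbound A M r /\ forall h, Cmod h < r -> pser A h (f (z0 + h)%C).
Proof.
  intros HR Hf; destruct (taylor f z0 (R0 / 2) R0 ltac:(lra) Hf) as [A [[M HM] T]].
  destruct (T M HM) as [T1 T2]; exists A, M, (R0 / 2); split; [lra|split; [exact T1|]].
  intros h Hh eps He; assert (h0 := Cmod_ge_0 h).
  destruct (pow_small (Cmod h / (R0 / 2)) ltac:(apply div_lt_1; lra)
    (M * ((R0 / 2) / (R0 / 2 - Cmod h))) eps He) as [N HN].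
  exists N; intros n Hn; rewrite Cmod_minus_sym.
  eapply Rle_lt_trans; [apply T2; auto|].
  eapply Rle_lt_trans; [|apply (HN n Hn)]; right; ring.
Qed.

Lemma isolated_zeros (f : C -> C) (z0 : C) (R0 : R) : 0 < R0 ->
  (forall z, Cmod (z - z0) < R0 -> holo_at f z) ->
  (exists d, 0 < d /\ forall h, Cmod h < d -> f (z0 + h)%C = 0%C) \/
  (exists d, 0 < d /\ forall h, 0 < Cmod h < d -> f (z0 + h)%C <> 0%C).
Proof.
  intros HR Hf; destruct (taylor_pser f z0 R0 HR Hf) as [A [M [r [Hr [PB PS]]]]].
  destruct (classic (exists n, A n <> 0%C)) as [E|E].
  - assert (E' : exists n, A n <> 0%C /\ forall j, (j < n)%nat -> A j = 0%C).
    { destruct E as [n Hn]; revert Hn.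
      induction n as [n IH] using (well_founded_induction Wf_nat.lt_wf); intro Hn.
      destruct (classic (exists j, (j < n)%nat /\ A j <> 0%C)) as [[j [Hj Nj]]|N].
      - apply (IH j Hj Nj).
      - exists n; split; auto; intros j Hj; apply NNPP; intro Nj; apply N; exists j; auto. }
    clear E; destruct E' as [n [Hn H0]]; right.
    apply Cmod_gt_0 in Hn; assert (M0 := pbound_nonneg _ _ _ PB).
    assert (Pr : forall n, 0 < r ^ n) by (intro; apply pow_lt; auto).
    (* For |h| < r/2 the remainder after the first nonzero term is at most 2 M (|h|/r)^(n+1), which
       stays below |A n| |h|^n for |h| < d. *)
    set (d := Rmin (r / 2) (Cmod (A n) * r ^ S n / (2 * (M + 1)))).
    assert (Hd : 0 < d).
    { apply Rmin_glb_lt; [lra|]; apply Rdiv_lt_0_compat; [apply Rmult_lt_0_compat; auto|lra]. }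
    exists d; split; auto; intros h [Hh0 Hhd] Z.
    assert (H1 : Cmod h < r / 2) by (eapply Rlt_le_trans; [apply Hhd|apply Rmin_l]).
    assert (H2 : Cmod h < Cmod (A n) * r ^ S n / (2 * (M + 1))) by (eapply Rlt_le_trans; [apply Hhd|apply Rmin_r]).
    assert (K := pser_remainder A M r h _ (S n) Hr PB ltac:(lra) (PS h ltac:(lra))).
    rewrite Z in K; simpl in K.
    rewrite (csum_ext n _ (fun j => 0 * 0)%C) in K by (intros j Hj; rewrite H0 by auto; ring).
    rewrite csum_mult_l, Cmult_0_l, Cplus_0_l in K.
    replace (0 - A n * Cpow h n)%C with (- (A n * Cpow h n))%C in K by ring.
    rewrite Cmod_opp, Cmod_mult, Cmod_pow in K.
    assert (Q0 : / (1 - Cmod h / r) <= 2).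
    { replace 2 with (/ (1 / 2)) by field; apply Rinv_le_contravar; [lra|].
      assert (Cmod h / r <= 1 / 2) by (apply Rle_div_l; lra); lra. }
    assert (K2 : Cmod (A n) * Cmod h ^ n <= M * (Cmod h / r * (Cmod h / r) ^ n) * 2).
    { eapply Rle_trans; [apply K|]; apply Rmult_le_compat_l; auto.
      apply Rmult_le_pos; auto; apply (pow_le (Cmod h / r) (S n)); apply Rdiv_le_0_compat; lra. }
    assert (Ph : 0 < Cmod h ^ n) by (apply pow_lt; auto).
    assert (K3 : Cmod (A n) * r ^ S n <= 2 * M * Cmod h).
    { apply Rmult_le_reg_r with (Cmod h ^ n * / r ^ S n).
      - apply Rmult_lt_0_compat; auto; apply Rinv_0_lt_compat; auto.
      - replace (Cmod (A n) * r ^ S n * (Cmod h ^ n * / r ^ S n)) with (Cmod (A n) * Cmod h ^ n)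
          by (field; generalize (Pr (S n)); lra).
        eapply Rle_trans; [apply K2|]; unfold Rdiv; rewrite Rpow_mult_distr, pow_inv; right.
        simpl; field; split; [apply pow_nonzero|]; lra. }
    apply Rlt_div_r in H2; [|lra]; nra.
  - left; exists r; split; auto; intros h Hh.
    assert (Z : forall n, A n = 0%C) by (intro n; apply NNPP; intro N; apply E; exists n; exact N).
    apply (clim_unique _ _ _ (PS h Hh)); intros eps He; exists O; intros n _.
    rewrite (csum_ext n _ (fun j => 0 * 0)%C) by (intros j Hj; rewrite Z; ring).
    rewrite csum_mult_l, Cmult_0_l, Cmod_minus_diag; exact He.
Qed.

Lemma Copen_disc (D : C -> Prop) : Copen D <->
  forall z, D z -> exists d, 0 < d /\ forall y, Cmod (y - z) < d -> D y.
Proof. split; intros H z Hz; apply locally_Cmod, H, Hz. Qed.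

Lemma identity_theorem (D : C -> Prop) (f g : C -> C) (z0 : C) (d0 : R) :
  Copen D -> Cconnected D -> (forall z, D z -> holo_at f z) -> (forall z, D z -> holo_at g z) ->
  D z0 -> 0 < d0 -> (forall z, Cmod (z - z0) < d0 -> f z = g z) -> forall z, D z -> f z = g z.
Proof.
  intros HO HC Hf Hg Hz0 Hd0 E; rewrite Copen_disc in HO.
  (* Connectedness is applied to [X] and its complement [Y] in D. [Y] is open because the zeros of f
     - g are isolated near a point where f - g does not vanish identically. *)
  set (X := fun z => exists d, 0 < d /\ forall y, Cmod (y - z) < d -> f y = g y).
  set (Y := fun z => D z /\ ~ X z).
  destruct (HC X Y) as [K|K].
  - apply Copen_disc; intros z [d [Hd H]]; exists (d / 2); split; [lra|]; intros y Hy.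
    exists (d / 2); split; [lra|]; intros x Hx; apply H.
    replace (x - z)%C with ((x - y) + (y - z))%C by ring.
    eapply Rle_lt_trans; [apply Cmod_triangle|]; lra.
  - apply Copen_disc; intros z [Dz NX]; destruct (HO z Dz) as [d [Hd HD]].
    destruct (isolated_zeros (fun y => f y - g y)%C z d Hd) as [[e [He Z]]|[e [He Z]]].
    + intros y Hy; apply holo_at_minus; auto.
    + exfalso; apply NX; exists e; split; auto; intros y Hy; apply Cminus_eq_0.
      specialize (Z (y - z)%C Hy); replace (z + (y - z))%C with y in Z by ring.
      rewrite Z; apply Cmod_0.
    + exists (Rmin d e); split; [apply Rmin_glb_lt; auto|]; intros y Hy.
      assert (Hyd : Cmod (y - z) < d) by (eapply Rlt_le_trans; [apply Hy|apply Rmin_l]).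
      split; [auto|]; intros [e' [He' H']].
      destruct (classic (y = z)) as [->|N]; [apply NX; exists e'; auto|].
      apply (Z (y - z)%C).
      * split; [|eapply Rlt_le_trans; [apply Hy|apply Rmin_r]].
        apply Cmod_gt_0; intro E'; apply N, Cminus_eq_0; rewrite E'; apply Cmod_0.
      * replace (z + (y - z))%C with y by ring; rewrite H'; [ring|rewrite Cmod_minus_diag; auto].
  - intros z Dz; destruct (classic (X z)); [left; auto|right; split; auto].
  - intros z [_ [H [_ H']]]; auto.
  - intros z Dz; destruct (K z Dz) as [d [Hd H]]; apply H; rewrite Cmod_minus_diag; auto.
  - exfalso; apply (K z0 Hz0); exists d0; auto.
Qed.

(** * Integrals along contours *)

Ltac psplit := repeat match goal with |- _ /\ _ => split end.

(** Finite and infinite ends are brought to one form. At a finite end the only admissible parameter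
    not above a1 = A is A itself, so that the condition is [at_point]; at an infinite end it means
    far enough out. *)
Lemma endpoint_left_iff (A B : Rbar) (P : R -> Prop) : Rbar_lt A B ->
  endpoint A P <-> exists a1, param A B a1 /\ forall a, param A B a -> a <= a1 -> P a.
Proof.
  intro H; destruct A as [a0| |]; [| destruct B; contradiction|].
  - split.
    + intro K; exists a0; split.
      { split; [simpl; lra|apply Rbar_lt_le; exact H]. }
      intros a [Ha _] La; simpl in Ha; replace a with a0 by lra; exact K.
    + intros [a1 [[K1 K2] K]]; apply K; [split; [simpl; lra|apply Rbar_lt_le; exact H]|exact K1].
  - split.
    + intros [M K]; destruct B as [b0| |]; [| |contradiction].
      * exists (Rmin b0 (M - 1)); split; [split; [exact I|simpl; apply Rmin_l]|].
        intros a _ La; apply K; generalize (Rmin_r b0 (M - 1)); lra.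
      * exists (M - 1); split; [split; exact I|]; intros a _ La; apply K; lra.
    + intros [a1 [[_ K1] K]]; exists a1; intros a Ha; apply K; [|lra].
      split; [exact I|]; eapply Rbar_le_trans; [|exact K1]; simpl; lra.
Qed.

Lemma endpoint_right_iff (A B : Rbar) (P : R -> Prop) : Rbar_lt A B ->
  endpoint B P <-> exists b1, param A B b1 /\ forall b, param A B b -> b1 <= b -> P b.
Proof.
  intro H; destruct B as [b0| |]; [| |destruct A; contradiction].
  - split.
    + intro K; exists b0; split.
      { split; [apply Rbar_lt_le; exact H|simpl; lra]. }
      intros b [_ Hb] Lb; simpl in Hb; replace b with b0 by lra; exact K.
    + intros [b1 [[K1 K2] K]]; apply K; [split; [apply Rbar_lt_le; exact H|simpl; lra]|exact K2].
  - split.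
    + intros [M K]; destruct A as [a0| |]; [|contradiction|].
      * exists (Rmax a0 (M + 1)); split; [split; [simpl; apply Rmax_l|exact I]|].
        intros b _ Lb; apply K; generalize (Rmax_r a0 (M + 1)); lra.
      * exists (M + 1); split; [split; exact I|]; intros b _ Lb; apply K; lra.
    + intros [b1 [[K1 _] K]]; exists b1; intros b Hb; apply K; [|lra].
      split; [|exact I]; eapply Rbar_le_trans; [exact K1|]; simpl; lra.
Qed.

Lemma param_between (A B : Rbar) (a b t : R) : param A B a -> param A B b -> a <= t <= b -> param A B t.
Proof.
  intros [Ha _] [_ Hb] Ht; split; [eapply Rbar_le_trans; [exact Ha|]|eapply Rbar_le_trans; [|exact Hb]];
    simpl; lra.
Qed.

Lemma param_min (A B : Rbar) (a b : R) : param A B a -> param A B b -> param A B (Rmin a b).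
Proof. intros; unfold Rmin; destruct (Rle_dec a b); auto. Qed.

Lemma param_max (A B : Rbar) (a b : R) : param A B a -> param A B b -> param A B (Rmax a b).
Proof. intros; unfold Rmax; destruct (Rle_dec a b); auto. Qed.

Lemma is_RInt_gen_iff {V : NormedModule R_AbsRing} (A B : Rbar) (f : R -> V) (l : V) : Rbar_lt A B ->
  is_RInt_gen f (endpoint A) (endpoint B) l <->
  forall P, locally l P -> exists a1 b1, param A B a1 /\ param A B b1 /\ a1 <= b1 /\
    forall a b, param A B a -> param A B b -> a <= a1 -> b1 <= b -> exists y, is_RInt f a b y /\ P y.
Proof.
  intro H; split.
  - intros K P HP; specialize (K P HP); destruct K as [Q S HQ HS K].
    apply (endpoint_left_iff A B Q H) in HQ; apply (endpoint_right_iff A B S H) in HS.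
    destruct HQ as [a1 [Ha1 KQ]], HS as [b1 [Hb1 KS]].
    exists (Rmin a1 b1), (Rmax a1 b1); psplit; try apply param_min; try apply param_max; auto.
    + eapply Rle_trans; [apply Rmin_l|apply Rmax_l].
    + intros a b Ha Hb La Lb; apply (K a b).
      * apply KQ; auto; eapply Rle_trans; [exact La|apply Rmin_l].
      * apply KS; auto; eapply Rle_trans; [apply Rmax_r|exact Lb].
  - intros K P HP; destruct (K P HP) as [a1 [b1 [Ha1 [Hb1 [_ K']]]]].
    apply (Filter_prod _ _ _ (fun a => param A B a /\ a <= a1) (fun b => param A B b /\ b1 <= b)).
    + apply (endpoint_left_iff A B _ H); exists a1; split; auto.
    + apply (endpoint_right_iff A B _ H); exists b1; split; auto.
    + intros a b [Ha La] [Hb Lb]; apply K'; auto.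
Qed.

Definition arc_integrand (c : R -> C) (F : C -> C) (t : R) : C := (F (c t) * velocity c t)%C.

Lemma is_cint_iff (A B : Rbar) (c : R -> C) (F : C -> C) (l : C) : Rbar_lt A B ->
  is_cint A B c F l <->
  forall eps, 0 < eps -> exists a1 b1, param A B a1 /\ param A B b1 /\ a1 <= b1 /\
    forall a b, param A B a -> param A B b -> a <= a1 -> b1 <= b ->
      exists y : C, CRInt (arc_integrand c F) a b y /\ Cmod (y - l) < eps.
Proof.
  intro H; etransitivity; [apply (is_RInt_gen_iff (V := CR)); exact H|]; split.
  - intros K eps He; apply (K (fun y => Cmod (y - l) < eps)).
    apply locally_Cmod; exists eps; auto.
  - intros K P HP; apply locally_Cmod in HP; destruct HP as [d [Hd HP]].
    destruct (K d Hd) as [a1 [b1 [H1 [H2 [H3 H4]]]]]; exists a1, b1; psplit; auto.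
    intros a b Ha Hb La Lb; destruct (H4 a b Ha Hb La Lb) as [y [Y1 Y2]]; exists y; split; auto.
Qed.

Definition cont_at (F : C -> C) (z : C) : Prop :=
  forall eps, 0 < eps -> exists d, 0 < d /\ forall y, Cmod (y - z) < d -> Cmod (F y - F z) < eps.

Lemma pderiv_fst (c : R -> C) (t : R) (v : C) : pderiv c t v -> is_derive (fun s => fst (c s)) t (fst v).
Proof.
  intro H; split; [apply is_linear_scal_l|]; intros x Hx.
  assert (x = t) as ->.
  { symmetry; apply (is_filter_lim_locally_unique (K := R_AbsRing) (V := R_NormedModule)); exact Hx. }
  intro eps; destruct (H eps (cond_pos eps)) as [d [Hd D]]; exists (mkposreal d Hd); intros s Hs.
  specialize (D s Hs).
  change (Rabs (fst (c s) - fst (c t) - (s - t) * fst v) <= eps * Rabs (s - t)).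
  eapply Rle_trans; [|apply D]; eapply Rle_trans; [|apply re_le_Cmod]; right; simpl; f_equal; ring.
Qed.

Lemma pderiv_snd (c : R -> C) (t : R) (v : C) : pderiv c t v -> is_derive (fun s => snd (c s)) t (snd v).
Proof.
  intro H; split; [apply is_linear_scal_l|]; intros x Hx.
  assert (x = t) as ->.
  { symmetry; apply (is_filter_lim_locally_unique (K := R_AbsRing) (V := R_NormedModule)); exact Hx. }
  intro eps; destruct (H eps (cond_pos eps)) as [d [Hd D]]; exists (mkposreal d Hd); intros s Hs.
  specialize (D s Hs).
  change (Rabs (snd (c s) - snd (c t) - (s - t) * snd v) <= eps * Rabs (s - t)).
  eapply Rle_trans; [|apply D]; eapply Rle_trans; [|apply Rmax_Cmod].
  eapply Rle_trans; [|apply Rmax_r]; right; simpl; f_equal; ring.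
Qed.

Lemma contour_pderiv (A B : Rbar) (bs : list R) (c : R -> C) (t : R) : contour A B bs c ->
  inner A B t -> ~ In t bs -> pderiv c t (velocity c t) /\ ccont (velocity c) t.
Proof.
  intros H Ht Nt; destruct (contour_C1 _ _ _ _ H t Ht Nt) as [[v Hv] Hc].
  apply is_derive_pderiv in Hv.
  assert (E : velocity c t = v).
  { unfold velocity.
    assert (E1 : Derive (fun s => fst (c s)) t = fst v) by apply is_derive_unique, pderiv_fst, Hv.
    assert (E2 : Derive (fun s => snd (c s)) t = snd v) by apply is_derive_unique, pderiv_snd, Hv.
    rewrite E1, E2; destruct v; reflexivity. }
  rewrite E; split; [exact Hv|].
  apply continuous_ccont; exact Hc.
Qed.

Lemma inner_between (A B : Rbar) (a b t : R) : param A B a -> param A B b -> a < t < b -> inner A B t.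
Proof.
  intros [Ha _] [_ Hb] Ht; split.
  - eapply Rbar_le_lt_trans; [exact Ha|]; simpl; lra.
  - eapply Rbar_lt_le_trans; [|exact Hb]; simpl; lra.
Qed.

Lemma contour_ccont_on (A B : Rbar) (bs : list R) (c : R -> C) (a b : R) : contour A B bs c ->
  param A B a -> param A B b -> ccont_on a b c.
Proof.
  intros H Ha Hb t Ht eps He.
  assert (K := contour_continuous _ _ _ _ H t (param_between _ _ _ _ _ Ha Hb Ht)).
  assert (K' := proj1 (filterlim_Cmod (within (param A B) (locally t)) c (c t)) K eps He).
  destruct K' as [d D]; exists d; split; [apply cond_pos|]; intros s Hs Hst.
  apply D; [exact Hst|apply (param_between _ _ a b); auto].
Qed.

Lemma filterlim_Cmult {T : Type} (F : (T -> Prop) -> Prop) {FF : Filter F} (f g : T -> C) (l m : C) :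
  filterlim f F (locally (T := C_UniformSpace) l) -> filterlim g F (locally (T := C_UniformSpace) m) ->
  filterlim (fun x => f x * g x)%C F (locally (T := C_UniformSpace) (l * m)%C).
Proof.
  intros Hf Hg; apply (filterlim_Cmod F); intros eps He.
  set (X := Cmod l + 1); set (Y := Cmod m + 1).
  assert (HX : 0 < X) by (unfold X; generalize (Cmod_ge_0 l); lra).
  assert (HY : 0 < Y) by (unfold Y; generalize (Cmod_ge_0 m); lra).
  assert (H1 := proj1 (filterlim_Cmod F f l) Hf (eps / (2 * Y)) ltac:(apply Rdiv_lt_0_compat; lra)).
  assert (H2 := proj1 (filterlim_Cmod F g m) Hg (Rmin 1 (eps / (2 * X)))
    ltac:(apply Rmin_glb_lt; [lra|apply Rdiv_lt_0_compat; lra])).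
  generalize (filter_and _ _ H1 H2); apply filter_imp; intros x [D1 D2].
  generalize (Rmin_l 1 (eps / (2 * X))) (Rmin_r 1 (eps / (2 * X))); intros M1 M2.
  assert (G : Cmod (g x) <= Y) by (unfold Y; generalize (Cmod_triangle_minus (g x) m); lra).
  replace (f x * g x - l * m)%C with ((f x - l) * g x + l * (g x - m))%C by ring.
  eapply Rle_lt_trans; [apply Cmod_triangle|]; rewrite !Cmod_mult.
  assert (B1 : Cmod (f x - l) * Cmod (g x) <= Cmod (f x - l) * Y) by (apply Rmult_le_compat_l; auto using Cmod_ge_0).
  assert (B1' : Cmod (f x - l) * Y < eps / (2 * Y) * Y) by (apply Rmult_lt_compat_r; auto).
  replace (eps / (2 * Y) * Y) with (eps / 2) in B1' by (field; lra).
  assert (B2 : Cmod l * Cmod (g x - m) <= X * (eps / (2 * X))).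
  { apply Rmult_le_compat; auto using Cmod_ge_0; [unfold X|]; lra. }
  replace (X * (eps / (2 * X))) with (eps / 2) in B2 by (field; lra); lra.
Qed.

Lemma filterlim_Cmod_R {T : Type} (F : (T -> Prop) -> Prop) {FF : Filter F} (f : T -> C) (l : C) :
  filterlim f F (locally (T := C_UniformSpace) l) -> filterlim (fun x => Cmod (f x)) F (locally (Cmod l)).
Proof.
  intro Hf; apply filterlim_locally; intro eps.
  generalize (proj1 (filterlim_Cmod F f l) Hf eps (cond_pos eps)); apply filter_imp; intros x Hx.
  change (Rabs (Cmod (f x) - Cmod l) < eps).
  generalize (Cmod_triangle_minus (f x) l) (Cmod_triangle_minus l (f x)); rewrite (Cmod_minus_sym l); intros.
  apply Rabs_def1; lra.
Qed.

Lemma cont_at_filterlim (F : C -> C) (z : C) : cont_at F z ->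
  filterlim F (locally (T := C_UniformSpace) z) (locally (T := C_UniformSpace) (F z)).
Proof.
  intro H; apply (filterlim_Cmod (locally z)); intros eps He; destruct (H eps He) as [d [Hd D]].
  apply locally_Cmod; exists d; auto.
Qed.

(** At break points and endpoints only one-sided limits of the velocity are given, and c is
    continuous only within the parameter domain; the neighbourhoods are cut down so as to stay
    inside [a, b]. *)
Lemma arc_integrand_left_right (A B : Rbar) (bs : list R) (c : R -> C) (F : C -> C) : contour A B bs c ->
  (forall z, trace A B c z -> cont_at F z) ->
  forall a b, param A B a -> param A B b ->
  (forall t, a < t < b -> ~ In t bs -> filterlim (arc_integrand c F) (locally t) (locally (T := C_UniformSpace) (arc_integrand c F t))) /\
  (forall t, a <= t < b -> exists v : C, filterlim (arc_integrand c F) (at_right t) (locally v)) /\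
  (forall t, a < t <= b -> exists v : C, filterlim (arc_integrand c F) (at_left t) (locally v)).
Proof.
  intros H HF a b Ha Hb; split; [|split].
  - intros t Ht Nt; destruct (contour_pderiv _ _ _ _ t H (inner_between _ _ _ _ _ Ha Hb Ht) Nt) as [H1 H2].
    apply (filterlim_Cmult (locally t)); [|apply continuous_ccont; exact H2].
    eapply filterlim_comp; [apply continuous_ccont; eapply pderiv_ccont, H1|].
    apply cont_at_filterlim, HF; exists t; split; auto; apply (param_between A B a b); auto; lra.
  - intros t Ht.
    assert (Pt : param A B t) by (apply (param_between A B a b); auto; lra).
    destruct (contour_right _ _ _ _ H t) as [v Hv].
    { apply Pt. }
    { destruct Hb as [_ Hb]; eapply Rbar_lt_le_trans; [|exact Hb]; simpl; lra. }
    exists (F (c t) * v)%C; apply (filterlim_Cmult (at_right t)); [|exact Hv].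
    apply filterlim_comp with (locally (T := C_UniformSpace) (c t)).
    2: { apply cont_at_filterlim, HF; exists t; auto. }
    intros P HP; assert (K := contour_continuous _ _ _ _ H t Pt P HP).
    destruct K as [d D]; assert (Hd : 0 < Rmin d (b - t)) by (apply Rmin_glb_lt; [apply cond_pos|lra]).
    exists (mkposreal _ Hd); intros s Hs Ls; change (Rabs (s - t) < Rmin d (b - t)) in Hs.
    apply D; [eapply Rlt_le_trans; [exact Hs|apply Rmin_l]|].
    apply (param_between A B a b); auto.
    assert (Rabs (s - t) < b - t) by (eapply Rlt_le_trans; [exact Hs|apply Rmin_r]).
    rewrite Rabs_pos_eq in * by lra; lra.
  - intros t Ht.
    assert (Pt : param A B t) by (apply (param_between A B a b); auto; lra).
    destruct (contour_left _ _ _ _ H t) as [v Hv].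
    { destruct Ha as [Ha _]; eapply Rbar_le_lt_trans; [exact Ha|]; simpl; lra. }
    { apply Pt. }
    exists (F (c t) * v)%C; apply (filterlim_Cmult (at_left t)); [|exact Hv].
    apply filterlim_comp with (locally (T := C_UniformSpace) (c t)).
    2: { apply cont_at_filterlim, HF; exists t; auto. }
    intros P HP; assert (K := contour_continuous _ _ _ _ H t Pt P HP).
    destruct K as [d D]; assert (Hd : 0 < Rmin d (t - a)) by (apply Rmin_glb_lt; [apply cond_pos|lra]).
    exists (mkposreal _ Hd); intros s Hs Ls; change (Rabs (s - t) < Rmin d (t - a)) in Hs.
    apply D; [eapply Rlt_le_trans; [exact Hs|apply Rmin_l]|].
    apply (param_between A B a b); auto.
    assert (Rabs (s - t) < t - a) by (eapply Rlt_le_trans; [exact Hs|apply Rmin_r]).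
    rewrite Rabs_left in * by lra; lra.
Qed.

Lemma arc_integrand_ex (A B : Rbar) (bs : list R) (c : R -> C) (F : C -> C) (a b : R) : contour A B bs c ->
  (forall z, trace A B c z -> cont_at F z) -> param A B a -> param A B b -> a <= b ->
  exists l : C, CRInt (arc_integrand c F) a b l.
Proof.
  intros H HF Ha Hb Hab.
  destruct (arc_integrand_left_right A B bs c F H HF a b Ha Hb) as [H1 [H2 H3]].
  exact (ex_RInt_piecewise (V := C_R_CompleteNormedModule) _ bs a b Hab H1 H2 H3).
Qed.

Definition abs_integrand (c : R -> C) (F : C -> C) (t : R) : R := Cmod (F (c t)) * Cmod (velocity c t).

Lemma abs_integrand_ex (A B : Rbar) (bs : list R) (c : R -> C) (F : C -> C) (a b : R) : contour A B bs c ->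
  (forall z, trace A B c z -> cont_at F z) -> param A B a -> param A B b -> a <= b ->
  ex_RInt (abs_integrand c F) a b.
Proof.
  intros H HF Ha Hb Hab.
  destruct (arc_integrand_left_right A B bs c F H HF a b Ha Hb) as [H1 [H2 H3]].
  apply (ex_RInt_ext (V := R_NormedModule) (fun t => Cmod (arc_integrand c F t))).
  { intros t _; unfold arc_integrand, abs_integrand; apply Cmod_mult. }
  apply (ex_RInt_piecewise (V := R_CompleteNormedModule) _ bs a b Hab).
  - intros t Ht Nt; apply (filterlim_Cmod_R (locally t)); auto.
  - intros t Ht; destruct (H2 t Ht) as [v Hv]; exists (Cmod v); apply (filterlim_Cmod_R (at_right t)); auto.
  - intros t Ht; destruct (H3 t Ht) as [v Hv]; exists (Cmod v); apply (filterlim_Cmod_R (at_left t)); auto.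
Qed.

(** Absolute convergence expressed by a bound over all compact pieces. In this form it passes to
    dominated integrands at once, and the bound also bounds the integral. *)
Definition absint (A B : Rbar) (c : R -> C) (F : C -> C) (M : R) : Prop :=
  forall a b y, param A B a -> param A B b -> a <= b -> is_RInt (abs_integrand c F) a b y -> y <= M.

Lemma abs_integrand_ge0 (c : R -> C) (F : C -> C) (t : R) : 0 <= abs_integrand c F t.
Proof. apply Rmult_le_pos; apply Cmod_ge_0. Qed.

Lemma abs_integral_ge0 (c : R -> C) (F : C -> C) (a b y : R) : a <= b ->
  is_RInt (abs_integrand c F) a b y -> 0 <= y.
Proof.
  intros Hab Hy; eapply (is_RInt_ge_0 (abs_integrand c F) a b); eauto.
  intros; apply abs_integrand_ge0.
Qed.

Lemma arc_integral_le (c : R -> C) (F : C -> C) (a b y : R) (l : C) : a <= b ->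
  CRInt (arc_integrand c F) a b l -> is_RInt (abs_integrand c F) a b y -> Cmod l <= y.
Proof.
  intros Hab Hl Hy; apply (CRInt_norm_le _ _ a b l y Hab) with (2 := Hl) (3 := Hy).
  intros t _; unfold arc_integrand, abs_integrand; rewrite Cmod_mult; lra.
Qed.

Lemma param_exists (A B : Rbar) : Rbar_lt A B -> exists a, param A B a.
Proof.
  intro H; destruct (proj1 (endpoint_left_iff A B (fun _ => True) H)) as [a [Ha _]]; [|eauto].
  destruct A; [exact I|exists 0; auto|exists 0; auto].
Qed.

(** Let a compact piece have an absolute integral above S - eps, where S is the supremum over all
    pieces. Enlarging it adds an absolute integral below eps, so that the integral of F moves by
    less than eps: the integrals over growing pieces form a Cauchy family, compared through common
    enlargements. *)
Lemma absint_cint (A B : Rbar) (bs : list R) (c : R -> C) (F : C -> C) (M : R) : contour A B bs c ->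
  (forall z, trace A B c z -> cont_at F z) -> absint A B c F M ->
  exists l, is_cint A B c F l /\ Cmod l <= M.
Proof.
  intros H HF HM; assert (HAB := contour_dom _ _ _ _ H).
  set (E := fun y => exists a b, param A B a /\ param A B b /\ a <= b /\ is_RInt (abs_integrand c F) a b y).
  destruct (completeness E) as [S [S1 S2]].
  { exists M; intros y [a [b [Ha [Hb [Hab Hy]]]]]; apply (HM a b); auto. }
  { destruct (param_exists A B HAB) as [a Ha]; exists 0, a, a; psplit; auto; [lra|].
    apply (is_RInt_point (V := R_NormedModule)). }
  assert (K : forall eps, 0 < eps -> exists a1 b1 (l1 : C), param A B a1 /\ param A B b1 /\ a1 <= b1 /\
    CRInt (arc_integrand c F) a1 b1 l1 /\
    forall a b, param A B a -> param A B b -> a <= a1 -> b1 <= b ->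
      exists y : C, CRInt (arc_integrand c F) a b y /\ Cmod (y - l1) < eps /\ Cmod y <= M).
  { intros eps He.
    assert (X : exists y, E y /\ S - eps < y).
    { apply NNPP; intro N; assert (S <= S - eps); [|lra]; apply S2; intros y Hy.
      apply Rnot_lt_le; intro L; apply N; exists y; auto. }
    destruct X as [y1 [[a1 [b1 [Ha1 [Hb1 [Hab1 Hy1]]]]] L1]].
    destruct (arc_integrand_ex A B bs c F a1 b1 H HF Ha1 Hb1 Hab1) as [l1 Hl1].
    exists a1, b1, l1; psplit; auto.
    intros a b Ha Hb La Lb.
    destruct (arc_integrand_ex A B bs c F a a1 H HF Ha Ha1 La) as [u Hu].
    destruct (arc_integrand_ex A B bs c F b1 b H HF Hb1 Hb Lb) as [v Hv].
    destruct (abs_integrand_ex A B bs c F a a1 H HF Ha Ha1 La) as [u' Hu'].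
    destruct (abs_integrand_ex A B bs c F b1 b H HF Hb1 Hb Lb) as [v' Hv'].
    exists (u + l1 + v)%C.
    assert (T : CRInt (arc_integrand c F) a b (u + l1 + v)%C).
    { apply (is_RInt_Chasles (V := CR)) with b1; [|exact Hv].
      apply (is_RInt_Chasles (V := CR)) with a1; [exact Hu|exact Hl1]. }
    assert (T' : is_RInt (abs_integrand c F) a b (u' + y1 + v')).
    { apply (is_RInt_Chasles (V := R_NormedModule)) with b1; [|exact Hv'].
      apply (is_RInt_Chasles (V := R_NormedModule)) with a1; [exact Hu'|exact Hy1]. }
    assert (T2 : u' + y1 + v' <= S) by (apply S1; exists a, b; psplit; auto; lra).
    assert (B1 := arc_integral_le c F _ _ _ _ La Hu Hu').
    assert (B2 := arc_integral_le c F _ _ _ _ Lb Hv Hv').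
    split; [exact T|split].
    - replace (u + l1 + v - l1)%C with (u + v)%C by ring.
      eapply Rle_lt_trans; [apply Cmod_triangle|]; lra.
    - assert (Lab : a <= b) by lra.
      eapply Rle_trans; [apply (arc_integral_le c F _ _ _ _ Lab T T')|].
      apply (HM a b); auto. }
  destruct (ClassicalChoice.choice (fun (n : nat) (p : R * R * C) =>
    param A B (fst (fst p)) /\ param A B (snd (fst p)) /\
    forall a b, param A B a -> param A B b -> a <= fst (fst p) -> snd (fst p) <= b ->
      exists y : C, CRInt (arc_integrand c F) a b y /\ Cmod (y - snd p) < / (INR n + 1) /\ Cmod y <= M)) as [p Hp].
  { intro n; destruct (K (/ (INR n + 1))) as [a1 [b1 [l1 [Ha1 [Hb1 [_ [_ K1]]]]]]].
    - apply Rinv_0_lt_compat; generalize (pos_INR n); lra.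
    - exists (a1, b1, l1); auto. }
  assert (small : forall eps, 0 < eps -> exists N, forall n, (N <= n)%nat -> / (INR n + 1) < eps).
  { intros eps He; destruct (INR_large (/ eps)) as [N [_ HN]]; exists N; intros n Hn; specialize (HN n Hn).
    rewrite <- (Rinv_inv eps); apply Rinv_lt_contravar; [|lra].
    apply Rmult_lt_0_compat; [apply Rinv_0_lt_compat; auto|generalize (pos_INR n); lra]. }
  destruct (Cseq_complete (fun n => snd (p n))) as [l Hl].
  { intros eps He; destruct (small (eps / 2)) as [N HN]; [lra|]; exists N; intros n m Hn Hm.
    destruct (Hp n) as [P1 [P2 P3]]; destruct (Hp m) as [Q1 [Q2 Q3]].
    set (a := Rmin (fst (fst (p n))) (fst (fst (p m)))); set (b := Rmax (snd (fst (p n))) (snd (fst (p m)))).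
    destruct (P3 a b) as [y [Y1 [Y2 _]]]; [apply param_min; auto|apply param_max; auto|apply Rmin_l|apply Rmax_l|].
    destruct (Q3 a b) as [y' [Y1' [Y2' _]]]; [apply param_min; auto|apply param_max; auto|apply Rmin_r|apply Rmax_r|].
    assert (E' : y = y') by (eapply is_RInt_uniq; [apply Y1|apply Y1']); subst y'.
    replace (snd (p n) - snd (p m))%C with ((y - snd (p m)) - (y - snd (p n)))%C by ring.
    eapply Rle_lt_trans; [apply Cmod_minus_le|]; generalize (HN n Hn) (HN m Hm); lra. }
  exists l.
  assert (I : is_cint A B c F l).
  { apply is_cint_iff; auto; intros eps He.
    destruct (Hl (eps / 2)) as [N HN]; [lra|]; destruct (small (eps / 2)) as [N' HN']; [lra|].
    set (n := max N N'); specialize (HN n ltac:(lia)); specialize (HN' n ltac:(lia)).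
    destruct (Hp n) as [P1 [P2 P3]].
    exists (Rmin (fst (fst (p n))) (snd (fst (p n)))), (Rmax (fst (fst (p n))) (snd (fst (p n)))).
    psplit; try apply param_min; try apply param_max; auto.
    { eapply Rle_trans; [apply Rmin_l|apply Rmax_l]. }
    intros a b Ha Hb La Lb; destruct (P3 a b Ha Hb) as [y [Y1 [Y2 Y3]]].
    { eapply Rle_trans; [exact La|apply Rmin_l]. }
    { eapply Rle_trans; [apply Rmax_r|exact Lb]. }
    exists y; split; auto.
    replace (y - l)%C with ((y - snd (p n)) + (snd (p n) - l))%C by ring.
    eapply Rle_lt_trans; [apply Cmod_triangle|]; lra. }
  split; [exact I|].
  apply le_epsilon; intros eps He; assert (I' := proj1 (is_cint_iff A B c F l HAB) I).
  destruct (I' eps He) as [a1 [b1 [Ha1 [Hb1 [L1 I1]]]]].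
  destruct (I1 a1 b1 Ha1 Hb1 (Rle_refl _) (Rle_refl _)) as [y [Y1 Y2]].
  destruct (abs_integrand_ex A B bs c F a1 b1 H HF Ha1 Hb1 L1) as [y' Hy'].
  assert (Y3 := arc_integral_le c F _ _ _ _ L1 Y1 Hy').
  assert (Y4 := HM a1 b1 y' Ha1 Hb1 L1 Hy').
  generalize (Cmod_triangle_minus l y); rewrite Cmod_minus_sym; lra.
Qed.

Lemma is_cint_unique (A B : Rbar) (c : R -> C) (F : C -> C) (l m : C) : Rbar_lt A B ->
  is_cint A B c F l -> is_cint A B c F m -> l = m.
Proof.
  intros H Hl Hm; rewrite is_cint_iff in Hl, Hm by auto.
  apply Cminus_eq_0; rewrite (Cmod_small_0 (l - m)); [apply Cmod_0|]; intros eps He.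
  destruct (Hl (eps / 2)) as [a1 [b1 [Ha1 [Hb1 [L1 K1]]]]]; [lra|].
  destruct (Hm (eps / 2)) as [a2 [b2 [Ha2 [Hb2 [L2 K2]]]]]; [lra|].
  set (a := Rmin a1 a2); set (b := Rmax b1 b2).
  destruct (K1 a b) as [y [Y1 Y2]]; [apply param_min; auto|apply param_max; auto|apply Rmin_l|apply Rmax_l|].
  destruct (K2 a b) as [y' [Y1' Y2']]; [apply param_min; auto|apply param_max; auto|apply Rmin_r|apply Rmax_r|].
  assert (E' : y = y') by (eapply is_RInt_uniq; [apply Y1|apply Y1']); subst y'.
  replace (l - m)%C with ((y - m) - (y - l))%C by ring.
  eapply Rle_trans; [apply Cmod_minus_le|]; lra.
Qed.

Lemma is_cint_lin (A B : Rbar) (c : R -> C) (F G : C -> C) (k l m : C) : Rbar_lt A B ->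
  is_cint A B c F l -> is_cint A B c G m -> is_cint A B c (fun z => F z + k * G z)%C (l + k * m).
Proof.
  intros H Hl Hm; rewrite is_cint_iff in * by auto; intros eps He.
  assert (Kp : 0 < Cmod k + 1) by (generalize (Cmod_ge_0 k); lra).
  destruct (Hl (eps / 2)) as [a1 [b1 [Ha1 [Hb1 [L1 K1]]]]]; [lra|].
  destruct (Hm (eps / (2 * (Cmod k + 1)))) as [a2 [b2 [Ha2 [Hb2 [L2 K2]]]]]; [apply Rdiv_lt_0_compat; lra|].
  exists (Rmin a1 a2), (Rmax b1 b2); psplit; try apply param_min; try apply param_max; auto.
  { eapply Rle_trans; [apply Rmin_l|]; eapply Rle_trans; [apply L1|apply Rmax_l]. }
  intros a b Ha Hb La Lb.
  destruct (K1 a b Ha Hb) as [y [Y1 Y2]]; [eapply Rle_trans; [exact La|apply Rmin_l]|eapply Rle_trans; [apply Rmax_l|exact Lb]|].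
  destruct (K2 a b Ha Hb) as [y' [Y1' Y2']]; [eapply Rle_trans; [exact La|apply Rmin_r]|eapply Rle_trans; [apply Rmax_r|exact Lb]|].
  exists (y + k * y')%C; split.
  - eapply CRInt_ext; [|apply (CRInt_plus _ _ _ _ _ _ Y1 (CRInt_mult_l k _ _ _ _ Y1'))].
    intro t; unfold arc_integrand; simpl; ring.
  - replace (y + k * y' - (l + k * m))%C with ((y - l) + k * (y' - m))%C by ring.
    eapply Rle_lt_trans; [apply Cmod_triangle|]; rewrite Cmod_mult.
    assert (Bk : Cmod k * Cmod (y' - m) <= (Cmod k + 1) * Cmod (y' - m))
      by (apply Rmult_le_compat_r; [apply Cmod_ge_0|lra]).
    apply Rmult_lt_compat_l with (r := Cmod k + 1) in Y2'; auto.
    replace ((Cmod k + 1) * (eps / (2 * (Cmod k + 1)))) with (eps / 2) in Y2' by (field; lra); lra.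
Qed.

Lemma is_cint_ext (A B : Rbar) (c : R -> C) (F G : C -> C) (l : C) : Rbar_lt A B ->
  (forall z, trace A B c z -> F z = G z) -> is_cint A B c F l -> is_cint A B c G l.
Proof.
  intros H E Hl; rewrite is_cint_iff in * by auto; intros eps He.
  destruct (Hl eps He) as [a1 [b1 [Ha1 [Hb1 [L1 K1]]]]]; exists a1, b1; psplit; auto.
  intros a b Ha Hb La Lb; destruct (K1 a b Ha Hb La Lb) as [y [Y1 Y2]]; exists y; split; auto.
  apply (is_RInt_ext (V := CR) (arc_integrand c F)); [|exact Y1].
  rewrite Rmin_left, Rmax_right by lra.
  intros t Ht; unfold arc_integrand; rewrite E; auto; exists t; split; auto.
  apply (param_between A B a b); auto; lra.
Qed.

Lemma is_cint_zero (A B : Rbar) (c : R -> C) (F : C -> C) : Rbar_lt A B ->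
  (forall z, trace A B c z -> F z = 0%C) -> is_cint A B c F 0%C.
Proof.
  intros H E; apply (is_cint_ext A B c (fun _ => RtoC 0)); auto.
  { intros; rewrite E; auto. }
  rewrite is_cint_iff by auto; intros eps He; destruct (param_exists A B H) as [a0 Ha0].
  exists a0, a0; psplit; auto; [lra|]; intros a b _ _ _ _.
  exists (RtoC 0); split; [|rewrite Cmod_minus_diag; auto].
  eapply CRInt_ext; [|eapply CRInt_val; [apply (CRInt_const 0 a b)|ring]]; intro t; unfold arc_integrand; ring.
Qed.

Lemma absint_dom (A B : Rbar) (bs : list R) (c : R -> C) (F G : C -> C) (k M : R) : contour A B bs c ->
  0 <= k -> (forall z, trace A B c z -> cont_at G z) ->
  (forall z, trace A B c z -> Cmod (F z) <= k * Cmod (G z)) -> absint A B c G M -> absint A B c F (k * M).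
Proof.
  intros H Hk HG D HM a b y Ha Hb Hab Hy.
  destruct (abs_integrand_ex A B bs c G a b H HG Ha Hb Hab) as [m Hm].
  apply Rle_trans with (k * m); [|apply Rmult_le_compat_l; auto; apply (HM a b); auto].
  apply (is_RInt_le (abs_integrand c F) (fun t => k * abs_integrand c G t) a b); auto.
  - apply (is_RInt_scal (V := R_NormedModule)); exact Hm.
  - intros t Ht; unfold abs_integrand; rewrite <- Rmult_assoc; apply Rmult_le_compat_r; [apply Cmod_ge_0|].
    apply D; exists t; split; auto; apply (param_between A B a b); auto; lra.
Qed.

(** Domination by several functions at once is required because e^(s|y|) is not bounded by the
    modulus of a single exponential of a linear function of y, but by a sum of four. *)
Lemma absint_dom_sum (A B : Rbar) (bs : list R) (c : R -> C) (F : C -> C) (Gs : list (C -> C)) : contour A B bs c ->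
  (forall G, In G Gs -> (forall z, trace A B c z -> cont_at G z) /\ exists M, absint A B c G M) ->
  (forall z, trace A B c z -> Cmod (F z) <= Rsum Gs (fun G => Cmod (G z))) -> exists M, absint A B c F M.
Proof.
  intros H HG D.
  assert (K : exists M, forall a b, param A B a -> param A B b -> a <= b ->
    exists m, is_RInt (fun t => Rsum Gs (fun G => Cmod (G (c t))) * Cmod (velocity c t)) a b m /\ m <= M).
  { clear D; induction Gs as [|G Gs IH].
    - exists 0; intros a b _ _ _; exists 0; split; [|lra].
      apply (is_RInt_ext (V := R_NormedModule) (fun _ => 0)); [intros; simpl; ring|].
      eapply is_RInt_val; [apply (is_RInt_const (V := R_NormedModule))|].
      unfold scal; simpl; unfold mult; simpl; ring.
    - destruct IH as [M HM]; [intros; apply HG; right; auto|].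
      destruct (HG G (or_introl eq_refl)) as [CG [N HN]].
      exists (N + M); intros a b Ha Hb Hab; destruct (HM a b Ha Hb Hab) as [m [Hm Lm]].
      destruct (abs_integrand_ex A B bs c G a b H CG Ha Hb Hab) as [n Hn].
      exists (n + m); split; [|apply Rplus_le_compat; auto; apply (HN a b); auto].
      eapply (is_RInt_ext (V := R_NormedModule)); [|apply (is_RInt_plus (V := R_NormedModule) _ _ _ _ _ _ Hn Hm)].
      intros t _; unfold abs_integrand, plus; simpl; ring. }
  destruct K as [M HM]; exists M; intros a b y Ha Hb Hab Hy.
  destruct (HM a b Ha Hb Hab) as [m [Hm Lm]]; eapply Rle_trans; [|exact Lm].
  apply (is_RInt_le (abs_integrand c F) (fun t => Rsum Gs (fun G => Cmod (G (c t))) * Cmod (velocity c t)) a b); auto.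
  intros t Ht; unfold abs_integrand; apply Rmult_le_compat_r; [apply Cmod_ge_0|].
  apply D; exists t; split; auto; apply (param_between A B a b); auto; lra.
Qed.

(** Every compact piece can be enlarged to one whose absolute integral is within 1 of the limit L,
    and enlarging does not decrease it. *)
Lemma abs_converges_absint (A B : Rbar) (bs : list R) (c : R -> C) (F : C -> C) : contour A B bs c ->
  (forall z, trace A B c z -> cont_at F z) -> cint_abs_converges A B c F -> exists M, absint A B c F M.
Proof.
  intros H HF [L HL]; assert (HAB := contour_dom _ _ _ _ H).
  rewrite (is_RInt_gen_iff (V := R_NormedModule)) in HL by auto.
  exists (L + 1); intros a b y Ha Hb Hab Hy.
  destruct (HL (fun x => x < L + 1)) as [a1 [b1 [Ha1 [Hb1 [L1 K1]]]]].
  { exists (mkposreal 1 Rlt_0_1); intros x Hx; change (Rabs (x - L) < 1) in Hx; apply Rabs_def2 in Hx; lra. }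
  set (a' := Rmin a a1); set (b' := Rmax b b1).
  assert (Pa' : param A B a') by (apply param_min; auto); assert (Pb' : param A B b') by (apply param_max; auto).
  assert (La' : a' <= a) by apply Rmin_l; assert (Lb' : b <= b') by apply Rmax_l.
  destruct (K1 a' b' Pa' Pb' (Rmin_r _ _) (Rmax_r _ _)) as [x [X1 X2]].
  destruct (abs_integrand_ex A B bs c F a' a H HF Pa' Ha La') as [u Hu].
  destruct (abs_integrand_ex A B bs c F b b' H HF Hb Pb' Lb') as [v Hv].
  assert (E : x = u + y + v).
  { eapply is_RInt_uniq; [exact X1|].
    apply (is_RInt_Chasles (V := R_NormedModule)) with b; [|exact Hv].
    apply (is_RInt_Chasles (V := R_NormedModule)) with a; [exact Hu|exact Hy]. }
  assert (U := abs_integral_ge0 c F _ _ _ La' Hu); assert (V' := abs_integral_ge0 c F _ _ _ Lb' Hv); lra.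
Qed.

Lemma exp_le (x y : R) : x <= y -> exp x <= exp y.
Proof. intros [H | ->]; [left; apply exp_increasing; exact H|lra]. Qed.

Lemma is_derive_sqrt_sum (p q : R -> R) (t dp dq : R) : is_derive p t dp -> is_derive q t dq ->
  0 < p t ^ 2 + q t ^ 2 ->
  is_derive (fun s => sqrt (p s ^ 2 + q s ^ 2)) t ((p t * dp + q t * dq) / sqrt (p t ^ 2 + q t ^ 2)).
Proof.
  intros H1 H2 P.
  assert (E1 : Derive (fun s => p s) t = dp) by apply is_derive_unique, H1.
  assert (E2 : Derive (fun s => q s) t = dq) by apply is_derive_unique, H2.
  auto_derive.
  - repeat split; [eexists; exact H1|eexists; exact H2|]; simpl in P; lra.
  - rewrite E1, E2; simpl in *; field; apply Rgt_not_eq, sqrt_lt_R0; lra.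
Qed.

(** This is how the angle condition acts: it bounds the derivative of |c| from below, in absolute
    value, by a multiple of the speed. *)
Lemma pderiv_Cmod (c : R -> C) (t : R) (v : C) : pderiv c t v -> c t <> 0%C -> v <> 0%C ->
  is_derive (fun s => Cmod (c s)) t (cos_angle (c t) v * Cmod v).
Proof.
  intros H Hc Nv; assert (H1 := pderiv_fst _ _ _ H); assert (H2 := pderiv_snd _ _ _ H).
  assert (P : 0 < Cmod (c t)) by (apply Cmod_gt_0; auto).
  assert (Q : 0 < Cmod v) by (apply Cmod_gt_0; auto).
  assert (P2 : 0 < fst (c t) ^ 2 + snd (c t) ^ 2).
  { apply Rnot_le_lt; intro N; unfold Cmod in P; rewrite sqrt_neg_0 in P; lra. }
  assert (K := is_derive_sqrt_sum _ _ t _ _ H1 H2 P2).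
  replace (cos_angle (c t) v * Cmod v) with
    ((fst (c t) * fst v + snd (c t) * snd v) / sqrt (fst (c t) ^ 2 + snd (c t) ^ 2)); [exact K|].
  unfold cos_angle; fold (Cmod (c t)); unfold Re, Im; field; lra.
Qed.

Lemma ccont_Lipschitz (g : C -> R) (c : R -> C) (t : R) :
  (forall u v, Rabs (g u - g v) <= Cmod (u - v)) -> ccont c t -> continuity_pt (fun s => g (c s)) t.
Proof.
  intros Hg Hc eps He; destruct (Hc eps He) as [d [Hd D]]; exists d; split; auto.
  intros s [_ Hs]; simpl in *; unfold R_dist in *.
  eapply Rle_lt_trans; [apply Hg|apply D; exact Hs].
Qed.

Lemma Re_Lipschitz (u v : C) : Rabs (Re u - Re v) <= Cmod (u - v).
Proof. apply (re_le_Cmod (u - v)%C). Qed.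

Lemma Im_Lipschitz (u v : C) : Rabs (Im u - Im v) <= Cmod (u - v).
Proof. eapply Rle_trans; [|apply Rmax_Cmod]; apply Rmax_r. Qed.

Lemma Cmod_Lipschitz (u v : C) : Rabs (Cmod u - Cmod v) <= Cmod (u - v).
Proof.
  generalize (Cmod_triangle_minus u v) (Cmod_triangle_minus v u); rewrite (Cmod_minus_sym v); intros.
  apply Rabs_le; lra.
Qed.

Lemma constant_sign (D : R -> R) (x y : R) :
  (forall t, x <= t <= y -> continuity_pt D t) -> (forall t, x <= t <= y -> D t <> 0) ->
  exists s, (s = 1 \/ s = -1) /\ forall t, x <= t <= y -> Rabs (D t) = s * D t.
Proof.
  intros HC HN; destruct (Rle_dec x y) as [L|L]; [|exists 1; split; [auto|intros; lra]].
  assert (N := HN x ltac:(lra)).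
  destruct (Rlt_dec 0 (D x)) as [P|P].
  - exists 1; split; auto; intros t Ht; rewrite Rmult_1_l; apply Rabs_pos_eq.
    apply Rnot_lt_le; intro Q.
    destruct (Req_dec x t) as [->|E]; [lra|].
    destruct (Ranalysis5.IVT_interv (fun s => - D s) x t) as [z [Hz Z]]; try lra.
    + intros a Ha; apply continuity_pt_opp, HC; lra.
    + apply (HN z); lra.
  - exists (-1); split; auto; intros t Ht; rewrite Rabs_left1; [ring|].
    apply Rnot_lt_le; intro Q.
    destruct (Req_dec x t) as [->|E]; [lra|].
    destruct (Ranalysis5.IVT_interv D x t) as [z [Hz Z]]; try lra.
    + intros a Ha; apply HC; lra.
    + apply (HN z); lra.
Qed.

Lemma is_derive_val (f : R -> R) (t l m : R) : is_derive f t l -> l = m -> is_derive f t m.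
Proof. intros H <-; exact H. Qed.

Lemma is_derive_exp_comp (k : R) (m : R -> R) (t nu d : R) : is_derive m t d ->
  is_derive (fun s => k * exp (- nu * m s)) t (k * (- nu * d) * exp (- nu * m t)).
Proof.
  intro H; assert (E : Derive (fun s => m s) t = d) by apply is_derive_unique, H.
  auto_derive; [eexists; exact H|]; rewrite E; ring.
Qed.

(* Along an arc satisfying the angle condition, |c| is monotone and its speed
   controls the speed of c, so that an exponentially decaying integrand
   is dominated by the derivative of a bounded function. *)
Lemma arc_bound (A B : Rbar) (bs : list R) (c : R -> C) (F : C -> C) (x y b nu C0 Y : R) :
  contour A B bs c -> 0 < b -> 0 < nu -> 0 <= C0 -> x <= y ->
  (forall t, x <= t <= y -> inner A B t /\ ~ In t bs /\ c t <> 0%C /\ velocity c t <> 0%C /\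
     b <= Rabs (cos_angle (c t) (velocity c t)) /\ Cmod (F (c t)) <= C0 * exp (- nu * Cmod (c t))) ->
  is_RInt (abs_integrand c F) x y Y -> Y <= C0 / (b * nu).
Proof.
  intros H Hb Hnu HC0 Hxy HE HY.
  set (v := velocity c) in *.
  set (D := fun t => cos_angle (c t) (v t) * Cmod (v t)).
  assert (HD : forall t, x <= t <= y -> is_derive (fun s => Cmod (c s)) t (D t)).
  { intros t Ht; destruct (HE t Ht) as [E1 [E2 [E3 [E4 _]]]].
    apply pderiv_Cmod; auto; apply (contour_pderiv A B bs c t H E1 E2). }
  assert (DC : forall t, x <= t <= y -> continuity_pt D t).
  { intros t Ht; destruct (HE t Ht) as [E1 [E2 [E3 [E4 _]]]].
    destruct (contour_pderiv A B bs c t H E1 E2) as [K1 K2]; apply pderiv_ccont in K1.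
    assert (P : 0 < Cmod (c t)) by (apply Cmod_gt_0; auto).
    assert (Q : 0 < Cmod (v t)) by (apply Cmod_gt_0; auto).
    unfold D, cos_angle.
    apply (continuity_pt_mult (fun t => (Re (c t) * Re (v t) + Im (c t) * Im (v t)) / (Cmod (c t) * Cmod (v t))));
      [|apply (ccont_Lipschitz Cmod); [apply Cmod_Lipschitz|exact K2]].
    apply (continuity_pt_div (fun t => Re (c t) * Re (v t) + Im (c t) * Im (v t)) (fun t => Cmod (c t) * Cmod (v t))).
    - apply (continuity_pt_plus (fun t => Re (c t) * Re (v t)) (fun t => Im (c t) * Im (v t))).
      + apply (continuity_pt_mult (fun t => Re (c t)) (fun t => Re (v t)));
          apply (ccont_Lipschitz Re); auto; apply Re_Lipschitz.
      + apply (continuity_pt_mult (fun t => Im (c t)) (fun t => Im (v t)));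
          apply (ccont_Lipschitz Im); auto; apply Im_Lipschitz.
    - apply (continuity_pt_mult (fun t => Cmod (c t)) (fun t => Cmod (v t)));
        apply (ccont_Lipschitz Cmod); auto; apply Cmod_Lipschitz.
    - apply Rmult_integral_contrapositive; split; lra. }
  assert (DB : forall t, x <= t <= y -> b * Cmod (v t) <= Rabs (D t)).
  { intros t Ht; destruct (HE t Ht) as [_ [_ [_ [_ [E5 _]]]]].
    unfold D; rewrite Rabs_mult, (Rabs_pos_eq (Cmod _)) by apply Cmod_ge_0.
    apply Rmult_le_compat_r; [apply Cmod_ge_0|exact E5]. }
  destruct (constant_sign D x y DC) as [s [Hs S]].
  { intros t Ht Z; specialize (DB t Ht); rewrite Z, Rabs_R0 in DB.
    destruct (HE t Ht) as [_ [_ [_ [E4 _]]]]; apply Cmod_gt_0 in E4; nra. }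
  (* The integrand is at most C0 e^(-nu|c|) |v|, and |v| <= |D| / b = s D / b with the constant sign
     s. The majorant [G'] is thus an exact derivative, and its primitive [G] varies by at most C0 /
     (b nu), however long the arc is. *)
  set (G := fun t => s * (- C0 / (b * nu)) * exp (- nu * Cmod (c t))).
  set (G' := fun t => s * (C0 / b) * D t * exp (- nu * Cmod (c t))).
  assert (CC : forall t, x <= t <= y -> continuity_pt (fun t => exp (- nu * Cmod (c t))) t).
  { intros t Ht; destruct (HE t Ht) as [E1 [E2 _]].
    destruct (contour_pderiv A B bs c t H E1 E2) as [K1 K2]; apply pderiv_ccont in K1.
    apply (continuity_pt_comp (fun t => - nu * Cmod (c t)) exp).
    - apply (continuity_pt_mult (fun _ => - nu)); [apply continuity_pt_const; intros ? ?; reflexivity|].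
      apply (ccont_Lipschitz Cmod); auto; apply Cmod_Lipschitz.
    - apply derivable_continuous_pt, derivable_pt_exp. }
  assert (I : is_RInt G' x y (G y - G x)).
  { apply (is_RInt_derive (V := R_CompleteNormedModule) G G'); rewrite Rmin_left, Rmax_right by lra; intros t Ht.
    - eapply is_derive_val; [apply (is_derive_exp_comp _ (fun s => Cmod (c s)) t _ _ (HD t Ht))|].
      unfold G'; field; lra.
    - apply continuity_pt_filterlim; unfold G'.
      apply (continuity_pt_mult (fun t => s * (C0 / b) * D t)); auto.
      apply (continuity_pt_mult (fun _ => s * (C0 / b))); auto.
      apply continuity_pt_const; intros ? ?; reflexivity. }
  apply Rle_trans with (G y - G x).
  - apply (is_RInt_le (abs_integrand c F) G' x y); auto.
    intros t Ht; unfold abs_integrand, G'.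
    assert (Ht' : x <= t <= y) by lra.
    specialize (DB t Ht'); rewrite (S t Ht') in DB; destruct (HE t Ht') as [_ [_ [_ [_ [_ E6]]]]].
    apply Rle_trans with (C0 * exp (- nu * Cmod (c t)) * Cmod (v t)).
    + apply Rmult_le_compat_r; [apply Cmod_ge_0|exact E6].
    + replace (s * (C0 / b) * D t * exp (- nu * Cmod (c t))) with
        (C0 * exp (- nu * Cmod (c t)) * ((s * D t) / b)) by (field; lra).
      apply Rmult_le_compat_l; [apply Rmult_le_pos; [lra|left; apply exp_pos]|].
      apply Rle_div_r; lra.
  - assert (E : forall t, 0 < exp (- nu * Cmod (c t)) <= 1).
    { intro t; split; [apply exp_pos|]; rewrite <- exp_0; apply exp_le; generalize (Cmod_ge_0 (c t)); nra. }
    assert (Q : 0 <= C0 / (b * nu)) by (apply Rdiv_le_0_compat; nra).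
    unfold G; generalize (E x) (E y); intros Ex Ey.
    replace (s * (- C0 / (b * nu)) * exp (- nu * Cmod (c y)) - s * (- C0 / (b * nu)) * exp (- nu * Cmod (c x)))
      with (C0 / (b * nu) * (s * (exp (- nu * Cmod (c x)) - exp (- nu * Cmod (c y))))) by (field; lra).
    rewrite <- (Rmult_1_r (C0 / (b * nu))) at 2; apply Rmult_le_compat_l; auto.
    destruct Hs as [-> | ->]; lra.
Qed.

Lemma list_bound (bs : list R) : exists M, forall t, In t bs -> Rabs t <= M.
Proof.
  induction bs as [|x bs [M IH]]; [exists 0; intros t []|].
  exists (Rmax (Rabs x) M); intros t [->|Ht]; [apply Rmax_l|eapply Rle_trans; [apply IH, Ht|apply Rmax_r]].
Qed.

(** Near an infinite end the curve has passed its break points and satisfies |c| >= r, so that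
    [arc_bound] bounds every piece of the tail by C0 / (b nu). At a finite end there is no tail.
    Between the tails the interval is compact. *)
Lemma absint_tails (A B : Rbar) (bs : list R) (c : R -> C) (F : C -> C) (b nu C0 r : R) :
  contour A B bs c -> (forall z, trace A B c z -> cont_at F z) -> 0 < b -> 0 < nu -> 0 <= C0 -> 0 < r ->
  (forall t, inner A B t -> ~ In t bs -> r <= Cmod (c t) -> c t <> RtoC 0 ->
     velocity c t <> RtoC 0 /\ b <= Rabs (cos_angle (c t) (velocity c t))) ->
  (forall z, trace A B c z -> r <= Cmod z -> Cmod (F z) <= C0 * exp (- nu * Cmod z)) ->
  exists M, absint A B c F M.
Proof.
  intros H HF Hb Hnu HC0 Hr HE HFz; assert (HAB := contour_dom _ _ _ _ H).
  assert (Q : 0 <= C0 / (b * nu)) by (apply Rdiv_le_0_compat; nra).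
  destruct (list_bound bs) as [M0 HM0].
  assert (arc : forall x y Y, x <= y -> (forall t, x <= t <= y -> inner A B t /\ ~ In t bs /\ r <= Cmod (c t)) ->
    is_RInt (abs_integrand c F) x y Y -> Y <= C0 / (b * nu)).
  { intros x y Y Hxy K; apply (arc_bound A B bs c F x y b nu C0 Y); auto.
    intros t Ht; destruct (K t Ht) as [K1 [K2 K3]].
    assert (K4 : c t <> 0%C) by (apply Cmod_gt_0; lra).
    destruct (HE t K1 K2 K3 K4) as [K5 K6]; repeat (split; auto).
    apply HFz; auto; exists t; split; auto; destruct K1; split; apply Rbar_lt_le; auto. }
  assert (RT : exists T2, param A B T2 /\ forall y Y, param A B y -> T2 <= y ->
    is_RInt (abs_integrand c F) T2 y Y -> Y <= C0 / (b * nu)).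
  { destruct (classic (B = p_infty)) as [EB|NB].
    - assert (L := contour_end _ _ _ _ H EB); apply is_lim_spec in L; simpl in L.
      destruct (L r) as [T0 HT0].
      destruct (param_exists A B HAB) as [p Hp].
      (* Beyond [T] the parameter is interior, |c| exceeds r, and no break point is left. *)
      set (T := Rmax (p + 1) (Rmax (T0 + 1) (M0 + 1))).
      assert (X1 : p + 1 <= T) by apply Rmax_l.
      assert (X2 : T0 + 1 <= T) by (eapply Rle_trans; [apply Rmax_l|apply Rmax_r]).
      assert (X3 : M0 + 1 <= T) by (eapply Rle_trans; [apply Rmax_r|apply Rmax_r]).
      assert (IT : forall t, T <= t -> inner A B t).
      { intros t Ht; split; [|rewrite EB; exact I].
        destruct Hp as [Hp _]; eapply Rbar_le_lt_trans; [exact Hp|]; simpl; lra. }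
      exists T; split; [destruct (IT T (Rle_refl _)); split; apply Rbar_lt_le; auto|].
      intros y Y _ Hy HY; apply (arc T y Y Hy); auto; intros t Ht; split; [apply IT; lra|split].
      + intro N; apply HM0 in N; generalize (Rle_abs t); lra.
      + left; apply HT0; lra.
    - destruct B as [b0| |]; [|contradiction NB; reflexivity|destruct A; contradiction].
      exists b0; split; [split; [apply Rbar_lt_le; exact HAB|apply Rbar_le_refl]|].
      intros y Y [_ Hy] Ly HY; simpl in Hy; assert (E : y = b0) by lra; subst y.
      assert (EY : Y = 0) by (eapply is_RInt_uniq; [exact HY|apply (is_RInt_point (V := R_NormedModule))]); lra. }
  destruct RT as [T2 [PT2 RT]].
  assert (LT : exists T1, param A B T1 /\ T1 <= T2 /\ forall y Y, param A B y -> y <= T1 ->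
    is_RInt (abs_integrand c F) y T1 Y -> Y <= C0 / (b * nu)).
  { destruct (classic (A = m_infty)) as [EA|NA].
    - assert (L := contour_start _ _ _ _ H EA); apply is_lim_spec in L; simpl in L.
      destruct (L r) as [T0 HT0].
      set (T := Rmin (T2 - 1) (Rmin (T0 - 1) (- M0 - 1))).
      assert (X1 : T <= T2 - 1) by apply Rmin_l.
      assert (X2 : T <= T0 - 1) by (eapply Rle_trans; [apply Rmin_r|apply Rmin_l]).
      assert (X3 : T <= - M0 - 1) by (eapply Rle_trans; [apply Rmin_r|apply Rmin_r]).
      assert (IT : forall t, t <= T -> inner A B t).
      { intros t Ht; split; [rewrite EA; exact I|].
        destruct PT2 as [_ Hp]; eapply Rbar_lt_le_trans; [|exact Hp]; simpl; lra. }
      exists T; split; [destruct (IT T (Rle_refl _)); split; apply Rbar_lt_le; auto|split; [lra|]].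
      intros y Y _ Hy HY; apply (arc y T Y Hy); auto; intros t Ht; split; [apply IT; lra|split].
      + intro N; apply HM0 in N; generalize (Rle_abs (- t)); rewrite Rabs_Ropp; lra.
      + left; apply HT0; lra.
    - destruct A as [a0| |]; [|destruct B; contradiction|contradiction NA; reflexivity].
      exists a0; split; [split; [apply Rbar_le_refl|apply Rbar_lt_le; exact HAB]|].
      split; [destruct PT2 as [P _]; exact P|].
      intros y Y [Hy _] Ly HY; simpl in Hy; assert (E : y = a0) by lra; subst y.
      assert (EY : Y = 0) by (eapply is_RInt_uniq; [exact HY|apply (is_RInt_point (V := R_NormedModule))]); lra. }
  destruct LT as [T1 [PT1 [L12 LT]]].
  destruct (abs_integrand_ex A B bs c F T1 T2 H HF PT1 PT2 L12) as [m Hm].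
  exists (C0 / (b * nu) + m + C0 / (b * nu)); intros x y Y Hx Hy Hxy HY.
  set (x' := Rmin x T1); set (y' := Rmax y T2).
  assert (Px : param A B x') by (apply param_min; auto); assert (Py : param A B y') by (apply param_max; auto).
  assert (L1 : x' <= x) by apply Rmin_l; assert (L2 : y <= y') by apply Rmax_l.
  assert (L3 : x' <= T1) by apply Rmin_r; assert (L4 : T2 <= y') by apply Rmax_r.
  destruct (abs_integrand_ex A B bs c F x' x H HF Px Hx L1) as [u Hu].
  destruct (abs_integrand_ex A B bs c F y y' H HF Hy Py L2) as [w Hw].
  destruct (abs_integrand_ex A B bs c F x' T1 H HF Px PT1 L3) as [u' Hu'].
  destruct (abs_integrand_ex A B bs c F T2 y' H HF PT2 Py L4) as [w' Hw'].
  assert (E : u + Y + w = u' + m + w').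
  { eapply is_RInt_uniq.
    - apply (is_RInt_Chasles (V := R_NormedModule)) with y; [|exact Hw].
      apply (is_RInt_Chasles (V := R_NormedModule)) with x; [exact Hu|exact HY].
    - apply (is_RInt_Chasles (V := R_NormedModule)) with T2; [|exact Hw'].
      apply (is_RInt_Chasles (V := R_NormedModule)) with T1; [exact Hu'|exact Hm]. }
  generalize (abs_integral_ge0 c F _ _ _ L1 Hu) (abs_integral_ge0 c F _ _ _ L2 Hw)
    (LT x' u' Px L3 Hu') (RT y' w' Py L4 Hw'); lra.
Qed.

(** * Deformation of the contour *)

Lemma disc_holo (r : R) (z0 : C) (g : C -> C) : holomorphic_on (Defs.disc z0 r) g <->
  forall y, Cmod (y - z0) < r -> holo_at g y.
Proof. apply holomorphic_on_cderiv. Qed.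

Lemma not_pole_holo (f : C -> C) (z : C) : meromorphic f -> ~ is_pole f z ->
  exists r, 0 < r /\ forall y, Cmod (y - z) < r -> holo_at f y.
Proof.
  intros Hf N; destruct (Hf z) as [P|[r [Hr H]]]; [contradiction|].
  exists r; split; auto; apply disc_holo; exact H.
Qed.

Lemma holo_cont_at (f : C -> C) (z : C) : holo_at f z -> cont_at f z.
Proof. intro H; exact (holo_at_continuous f z H). Qed.

Lemma cont_at_mult (F G : C -> C) (z : C) : cont_at F z -> cont_at G z -> cont_at (fun y => F y * G y)%C z.
Proof.
  intros HF HG.
  assert (K := filterlim_Cmult (locally (T := C_UniformSpace) z) F G _ _
    (cont_at_filterlim _ _ HF) (cont_at_filterlim _ _ HG)).
  intros eps He; assert (K' := proj1 (filterlim_Cmod (locally (T := C_UniformSpace) z) _ _) K eps He).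
  apply locally_Cmod in K'; exact K'.
Qed.

Lemma cont_at_eq (F G : C -> C) (z : C) (d0 : R) : 0 < d0 -> cont_at F z -> cont_at G z ->
  (forall y, 0 < Cmod (y - z) < d0 -> F y = G y) -> F z = G z.
Proof.
  intros Hd0 HF HG E; apply Cminus_eq_0; rewrite (Cmod_small_0 (F z - G z)); [apply Cmod_0|]; intros eps He.
  destruct (HF (eps / 2)) as [d1 [Hd1 D1]]; [lra|]; destruct (HG (eps / 2)) as [d2 [Hd2 D2]]; [lra|].
  set (s := Rmin d0 (Rmin d1 d2) / 2).
  assert (P : 0 < Rmin d0 (Rmin d1 d2)) by (repeat apply Rmin_glb_lt; auto).
  generalize (Rmin_l d0 (Rmin d1 d2)) (Rmin_r d0 (Rmin d1 d2)) (Rmin_l d1 d2) (Rmin_r d1 d2); intros.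
  assert (Ms : Cmod (z + s - z) = s).
  { replace (z + s - z)%C with (RtoC s) by ring; rewrite Cmod_R, Rabs_pos_eq; unfold s; lra. }
  specialize (D1 (z + s)%C); specialize (D2 (z + s)%C); specialize (E (z + s)%C).
  rewrite Ms in D1, D2, E; specialize (D1 ltac:(unfold s; lra)); specialize (D2 ltac:(unfold s; lra)).
  rewrite E in D1 by (unfold s; lra).
  replace (F z - G z)%C with ((G (z + s)%C - G z) - (G (z + s)%C - F z))%C by ring.
  eapply Rle_trans; [apply Cmod_minus_le|]; lra.
Qed.

(** For m >= k0 the pole at 0 is cancelled, but the total function [kap] may take any value there,
    so that the product has to be redefined at 0. The last clause says that nothing changes when 0
    is not a pole of [kap]: both sides are then continuous at 0. *)
Lemma power_extension (kap : C -> C) (k0 m : nat) : meromorphic kap -> pole_order kap 0%C k0 -> (k0 <= m)%nat ->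
  exists Fs : C -> C,
    (forall z : C, z <> 0%C -> Fs z = (kap z * Cpow z m)%C) /\
    (forall z : C, ~ is_pole kap z \/ z = 0%C -> exists r, 0 < r /\ forall y, Cmod (y - z) < r -> holo_at Fs y) /\
    (~ is_pole kap 0%C -> Fs 0%C = (kap 0%C * Cpow 0 m)%C).
Proof.
  intros HM [r [g [Hr [Hg [_ E]]]]] Hm; rewrite disc_holo in Hg.
  set (Fs := fun z : C => if excluded_middle_informative (z = 0%C) then (g 0%C * Cpow 0 (m - k0))%C else (kap z * Cpow z m)%C).
  assert (F1 : forall z : C, z <> 0%C -> Fs z = (kap z * Cpow z m)%C).
  { intros z Hz; unfold Fs; destruct (excluded_middle_informative _); [contradiction|reflexivity]. }
  assert (F0 : forall z : C, Cmod (z - 0) < r -> Fs z = (g z * Cpow z (m - k0))%C).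
  { intros z Hz; unfold Fs; destruct (excluded_middle_informative _) as [->|N]; [reflexivity|].
    rewrite (E z Hz N), Cminus_0_r; replace m with (k0 + (m - k0))%nat at 1 by lia.
    rewrite Cpow_add_r; field; apply Cpow_nz; auto. }
  assert (H0 : forall y : C, Cmod (y - 0) < r -> holo_at Fs y).
  { intros y Hy; apply (holo_at_local (fun z => g z * Cpow z (m - k0))%C Fs y (r - Cmod (y - 0))); [lra| |].
    - intros x Hx; symmetry; apply F0; replace (x - 0)%C with ((x - y) + (y - 0))%C by ring.
      eapply Rle_lt_trans; [apply Cmod_triangle|]; lra.
    - apply holo_at_mult; [auto|apply holo_at_pow]. }
  exists Fs; split; [exact F1|split].
  - intros z Hz; destruct (classic (z = 0%C)) as [->|N]; [exists r; auto|].
    destruct Hz as [Hz|Hz]; [|contradiction].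
    destruct (not_pole_holo kap z HM Hz) as [r' [Hr' K]]; apply Cmod_gt_0 in N.
    exists (Rmin r' (Cmod z)); split; [apply Rmin_glb_lt; auto|]; intros y Hy.
    assert (Y1 : Cmod (y - z) < r') by (eapply Rlt_le_trans; [apply Hy|apply Rmin_l]).
    assert (Y2 : Cmod (y - z) < Cmod z) by (eapply Rlt_le_trans; [apply Hy|apply Rmin_r]).
    apply (holo_at_local (fun z => kap z * Cpow z m)%C Fs y (Cmod z - Cmod (y - z))); [lra| |].
    + intros x Hx; symmetry; apply F1; intros ->.
      replace z with ((y - 0) - (y - z))%C in Y2 at 2 by ring.
      rewrite Cmod_minus_sym in Hx.
      generalize (Cmod_minus_le (y - 0) (y - z)); replace (y - 0 - (y - z))%C with z by ring; lra.
    + apply holo_at_mult; [auto|apply holo_at_pow].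
  - intro N; destruct (not_pole_holo kap 0%C HM N) as [r' [Hr' K]].
    apply (cont_at_eq Fs (fun z => kap z * Cpow z m)%C 0%C 1 Rlt_0_1).
    + apply holo_cont_at, H0; rewrite Cmod_minus_diag; auto.
    + apply holo_cont_at, holo_at_mult; [apply K; rewrite Cmod_minus_diag; auto|apply holo_at_pow].
    + intros y [Hy _]; apply F1; apply Cmod_gt_0; rewrite Cminus_0_r in Hy; exact Hy.
Qed.

Lemma Riemann_sum_zero (D : R -> C) (tag : R -> R -> R) (s : list R) :
  (forall x y, x < y -> D (tag x y) = 0%C) -> sorted Rle s ->
  Riemann_sum (V := CR) D (SF_seq_f2 tag s) = RtoC 0.
Proof.
  intro HD; induction s as [|x s IH]; intro Hs; [reflexivity|].
  destruct s as [|y s]; [reflexivity|].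
  rewrite SF_cons_f2 by (simpl; lia); rewrite Riemann_sum_cons, IH by apply Hs; simpl.
  destruct Hs as [[L|E] _].
  - rewrite HD by exact L; rewrite CR_scal; unfold plus; simpl; unfold prod_plus, plus; simpl.
    apply injective_projections; simpl; ring.
  - subst y; rewrite CR_scal; unfold plus; simpl; unfold prod_plus, plus; simpl.
    apply injective_projections; simpl; ring.
Qed.

Lemma RInt_dense_zero (D : R -> C) (a b : R) (l : C) : a < b -> CRInt D a b l ->
  (forall x y, a <= x -> x < y -> y <= b -> exists t, x < t < y /\ D t = 0%C) -> l = 0%C.
Proof.
  intros Hab Hl HD.
  (* Extended by 0, the function has a zero as a tag for every pair x < y, and a tag function can be
     chosen without regard to [a, b]. *)
  set (D' := fun t => if Rlt_dec t a then RtoC 0 else if Rlt_dec b t then RtoC 0 else D t).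
  assert (Hl' : CRInt D' a b l).
  { apply (is_RInt_ext (V := CR) D); [|exact Hl]; rewrite Rmin_left, Rmax_right by lra; intros t Ht.
    unfold D'; destruct (Rlt_dec t a); [lra|]; destruct (Rlt_dec b t); [lra|reflexivity]. }
  destruct (ClassicalChoice.choice (fun (p : R * R) (t : R) =>
    (fst p <= snd p -> fst p <= t <= snd p) /\ (fst p < snd p -> D' t = 0%C))) as [tag Htag].
  { intros [x y]; simpl; destruct (Rlt_dec x y) as [L|L]; [|exists x; split; intros; lra].
    destruct (Rlt_dec x a) as [L1|L1].
    { exists x; split; [lra|]; intros _; unfold D'; destruct (Rlt_dec x a); [reflexivity|lra]. }
    destruct (Rlt_dec b y) as [L2|L2].
    { exists y; split; [lra|]; intros _; unfold D'; destruct (Rlt_dec y a); [reflexivity|].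
      destruct (Rlt_dec b y); [reflexivity|lra]. }
    destruct (HD x y) as [t [Ht Et]]; try lra; exists t; split; [lra|]; intros _.
    unfold D'; destruct (Rlt_dec t a); [lra|]; destruct (Rlt_dec b t); [lra|exact Et]. }
  apply Cmod_small_0; intros eps He.
  assert (K := proj1 (filterlim_Cmod (Riemann_fine a b) _ _) Hl' eps He).
  destruct K as [d Kd].
  destruct (INR_large ((b - a) / d)) as [n [_ Hn]]; specialize (Hn n (le_n n)).
  destruct (Riemann_fine_unif_part (fun x y => tag (x, y)) a b n) as [R1 [R2 [R3 R4]]].
  { intros x y Hxy; apply (Htag (x, y)); exact Hxy. }
  { lra. }
  specialize (Kd (SF_seq_f2 (fun x y => tag (x, y)) (unif_part a b n))).
  rewrite Riemann_sum_zero in Kd.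
  - rewrite CR_scal, Cmult_0_r in Kd; replace (0 - l)%C with (- l)%C in Kd by ring.
    rewrite Cmod_opp in Kd; left; apply Kd.
    + apply Rle_lt_trans with ((b - a) / (INR n + 1)).
      { exact R1. }
      apply Rlt_div_l; [generalize (pos_INR n); lra|].
      apply Rlt_div_l in Hn; [generalize (cond_pos d); nra|apply cond_pos].
    + rewrite Rmin_left, Rmax_right by lra; split; [exact R2|split; [exact R3|exact R4]].
  - intros x y L; apply (Htag (x, y)); exact L.
  - apply unif_part_sort; lra.
Qed.

(** The flux is measured with F, the homotopy argument requires [Fs], and the path may visit 0
    often. Where p t = 0 away from the break points, either the velocity vanishes and both
    integrands are 0, or p leaves 0 right after t. The integrands thus agree on a dense set of
    parameters. *)
Lemma flux_polysum (Fs F : C -> C) (bs : list R) (p : R -> C) (l : C) :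
  contour 0 1 bs p -> (forall z : C, z <> 0%C -> Fs z = F z) ->
  (forall t, 0 <= t <= 1 -> exists r, 0 < r /\ forall z, Cmod (z - p t) < r -> holo_at Fs z) ->
  is_cint 0 1 p F l -> exists N, forall n, (N <= n)%nat -> polysum Fs p 0 1 n = l.
Proof.
  intros H EF HFs Hl.
  assert (P01 : forall t, param 0 1 t <-> 0 <= t <= 1) by (intro t; unfold param; simpl; tauto).
  assert (Hl' : CRInt (arc_integrand p F) 0 1 l).
  { apply (is_RInt_gen_at_point (V := CR)); exact Hl. }
  destruct (arc_integrand_ex 0 1 bs p Fs 0 1 H) as [l' Hl1]; [|apply P01; lra|apply P01; lra|lra|].
  { intros z [t [Ht <-]]; destruct (HFs t (proj1 (P01 t) Ht)) as [r [Hr K]].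
    apply holo_cont_at, K; rewrite Cmod_minus_diag; auto. }
  assert (I01 : forall t, 0 < t < 1 -> inner 0 1 t) by (intros t Ht; split; simpl; lra).
  assert (E : l' = l).
  { assert (Z := CRInt_minus _ _ _ _ _ _ Hl1 Hl').
    apply RInt_dense_zero in Z; [apply Cminus_eq_0; rewrite Z; apply Cmod_0|lra|].
    intros x y Hx Hxy Hy.
    assert (T : exists t, x < t < y /\ ~ In t bs).
    { assert (K : forall l x y, x < y -> exists x' y', x <= x' /\ x' < y' /\ y' <= y /\ forall t, In t l -> ~ (x' < t < y')).
      { clear; induction l as [|q l IH]; intros x y Hxy.
        - exists x, y; repeat split; try lra; intros t [].
        - destruct (IH x y Hxy) as [x' [y' [H1 [H2 [H3 H4]]]]].
          destruct (Rlt_dec q y') as [L|L]; [destruct (Rlt_dec x' q) as [L'|L']|].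
          + exists q, y'; repeat split; try lra; intros t [->|Ht]; [lra|]; intro; apply (H4 t Ht); lra.
          + exists x', y'; repeat split; try lra; intros t [->|Ht]; [lra|]; apply H4; auto.
          + exists x', y'; repeat split; try lra; intros t [->|Ht]; [lra|]; apply H4; auto. }
      destruct (K bs x y Hxy) as [x' [y' [H1 [H2 [H3 H4]]]]].
      exists ((x' + y') / 2); split; [lra|]; intro N; apply (H4 _ N); lra. }
    destruct T as [t [Ht Nt]].
    assert (D0 : forall s, p s <> 0%C -> (arc_integrand p Fs s - arc_integrand p F s)%C = 0%C).
    { intros s Hs; unfold arc_integrand; rewrite EF by auto; ring. }
    destruct (classic (p t = 0%C)) as [Zt|Zt]; [|exists t; auto].
    destruct (contour_pderiv 0 1 bs p t H (I01 t ltac:(lra)) Nt) as [Kp _].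
    destruct (classic (velocity p t = 0%C)) as [Zv|Zv].
    { exists t; split; auto; unfold arc_integrand; rewrite Zv; ring. }
    apply Cmod_gt_0 in Zv.
    destruct (Kp (Cmod (velocity p t) / 2)) as [d [Hd Kd]]; [lra|].
    set (s := t + Rmin d (y - t) / 2).
    assert (Pm : 0 < Rmin d (y - t)) by (apply Rmin_glb_lt; lra).
    generalize (Rmin_l d (y - t)) (Rmin_r d (y - t)); intros M1 M2.
    exists s; split; [unfold s; lra|]; apply D0; intro Zs.
    assert (Est : s - t = Rmin d (y - t) / 2) by (unfold s; ring).
    specialize (Kd s); rewrite Est, Rabs_pos_eq in Kd by lra; specialize (Kd ltac:(lra)).
    rewrite Zs, Zt in Kd.
    replace (0 - 0 - (Rmin d (y - t) / 2)%R * velocity p t)%C with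
      (- ((Rmin d (y - t) / 2)%R * velocity p t))%C in Kd by ring.
    rewrite Cmod_opp, Cmod_mult, Cmod_R, Rabs_pos_eq in Kd by lra; nra. }
  subst l'.
  apply (polysum_contour Fs p (velocity p) bs 0 1 l); auto; [lra| |].
  - apply (contour_ccont_on 0 1 bs p 0 1 H); apply P01; lra.
  - intros t Ht Nt; apply (contour_pderiv 0 1 bs p t H (I01 t Ht) Nt).
Qed.

(** Up to the transverse polygons at a and b the two sums agree. For closed curves these polygons
    coincide; at a finite end the homotopy is constant and they vanish; at an infinite end
    [no_flux_at_infinity] makes them small. *)
Lemma deformation_polysum (Om : C -> Prop) (A B : Rbar) (c0 c1 : R -> C) (Fs F : C -> C)
    (integrands : (C -> C) -> Prop) : Rbar_lt A B ->
  deformable Om A B c0 c1 integrands -> integrands F -> (forall z : C, z <> 0%C -> Fs z = F z) ->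
  (forall z, Om z -> exists r, 0 < r /\ forall y, Cmod (y - z) < r -> holo_at Fs y) ->
  forall eps, 0 < eps -> exists a1 b1, param A B a1 /\ param A B b1 /\ a1 <= b1 /\
    forall a b, param A B a -> param A B b -> a <= a1 -> b1 <= b ->
      exists N, forall n, (N <= n)%nat -> Cmod (polysum Fs c0 a b n - polysum Fs c1 a b n) <= eps.
Proof.
  intros HAB [H [[Hc [H01 [HS [Hcl Hbd]]]] Hfl]] HF EF HFs eps Heps; specialize (Hfl F HF).
  assert (RC : forall a b, param A B a -> param A B b -> rect_cont a b H).
  { intros a b Ha Hb s t Hs Ht e He.
    assert (Pt : param A B t) by (apply (param_between A B a b); auto).
    assert (K := proj1 (filterlim_Cmod (within (fun x : R * R => 0 <= fst x <= 1 /\ param A B (snd x))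
       (locally (T := prod_UniformSpace R_UniformSpace R_UniformSpace) (s, t))) _ _) (Hc s t Hs Pt) e He).
    destruct K as [d Kd]; exists d; split; [apply cond_pos|]; intros s' t' Hs' Ht' D1 D2.
    apply (Kd (s', t')); [split; [exact D1|exact D2]|]; split; [exact Hs'|].
    apply (param_between A B a b); auto. }
  assert (HO : forall a b, param A B a -> param A B b -> forall s t, 0 <= s <= 1 -> a <= t <= b ->
    exists r, 0 < r /\ forall z, Cmod (z - H s t) < r -> holo_at Fs z).
  { intros a b Ha Hb s t Hs Ht; apply HFs, HS; auto; apply (param_between A B a b); auto. }
  assert (Main : forall a b, param A B a -> param A B b -> a <= b -> exists N, forall n, (N <= n)%nat ->
    (polysum Fs c0 a b n - polysum Fs c1 a b n)%C =
    (polysum Fs (fun s => H s a) 0 1 n - polysum Fs (fun s => H s b) 0 1 n)%C).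
  { intros a b Ha Hb Hab; destruct (polysum_homotopy Fs a b H Hab (RC a b Ha Hb) (HO a b Ha Hb)) as [N HN].
    exists (S N); intros n Hn; specialize (HN n ltac:(lia)).
    rewrite (polysum_ext Fs c0 (H 0) a b n), (polysum_ext Fs c1 (H 1) a b n); auto; try lia.
    - replace (polysum Fs (H 0) a b n) with
        (polysum Fs (H 0) a b n + polysum Fs (fun s => H s b) 0 1 n - polysum Fs (fun s => H s b) 0 1 n)%C by ring.
      rewrite HN; ring.
    - intros t Ht; symmetry; apply H01, (param_between A B a b); auto.
    - intros t Ht; symmetry; apply H01, (param_between A B a b); auto. }
  destruct (classic (closed_curve A B c0)) as [Cl|NCl].
  - specialize (Hcl Cl); destruct A as [a0| |]; [|contradiction|contradiction].
    destruct B as [b0| |]; [|contradiction|contradiction].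
    exists a0, b0; simpl in HAB; psplit; [split; simpl; lra|split; simpl; lra|lra|].
    intros a b Ha Hb La Lb; unfold param in Ha, Hb; simpl in Ha, Hb.
    assert (a = a0) by lra; assert (b = b0) by lra; subst a b.
    destruct (Main a0 b0) as [N HN]; [split; simpl; lra|split; simpl; lra|lra|].
    exists (S N); intros n Hn; rewrite HN by lia.
    rewrite (polysum_ext Fs (fun s => H s a0) (fun s => H s b0)); [rewrite Cmod_minus_diag; lra|lia|lra|].
    intros s Hs; apply Hcl; exact Hs.
  - specialize (Hbd NCl).
    assert (Fin : forall E, (E = A \/ E = B) -> forall t, E = Finite t ->
      exists N, forall n, (N <= n)%nat -> Cmod (polysum Fs (fun s => H s t) 0 1 n) <= eps / 2).
    { intros E HE t Et; exists 1%nat; intros n Hn; rewrite (polysum_const Fs _ (c0 t)); [rewrite Cmod_0; lra|lia|lra|].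
      intros s Hs; apply Hbd; auto; destruct HE as [-> | ->]; [left|right]; auto. }
    assert (Inf : forall E, (E = A \/ E = B) -> ~ is_finite E -> Rbar_locally E (fun t => param A B t ->
      exists N, forall n, (N <= n)%nat -> Cmod (polysum Fs (fun s => H s t) 0 1 n) <= eps / 2)).
    { intros E HE NE; generalize (Hfl E HE NE (eps / 2) ltac:(lra)); apply filter_imp.
      intros t [[bs Hbs] [l [Hl Ll]]] Pt.
      destruct (flux_polysum Fs F bs (fun s => H s t) l Hbs EF) as [N HN]; auto.
      exists N; intros n Hn; rewrite HN by exact Hn; lra. }
    assert (LE : endpoint A (fun t => param A B t ->
      exists N, forall n, (N <= n)%nat -> Cmod (polysum Fs (fun s => H s t) 0 1 n) <= eps / 2)).
    { destruct A as [a0| |].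
      - intros _; apply (Fin a0); auto.
      - destruct B; contradiction.
      - apply (Inf m_infty); auto; intro K; discriminate K. }
    assert (RE : endpoint B (fun t => param A B t ->
      exists N, forall n, (N <= n)%nat -> Cmod (polysum Fs (fun s => H s t) 0 1 n) <= eps / 2)).
    { destruct B as [b0| |].
      - intros _; apply (Fin b0); auto.
      - apply (Inf p_infty); auto; intro K; discriminate K.
      - destruct A; contradiction. }
    apply (endpoint_left_iff A B _ HAB) in LE; apply (endpoint_right_iff A B _ HAB) in RE.
    destruct LE as [a1 [Pa1 LE]], RE as [b1 [Pb1 RE]].
    exists (Rmin a1 b1), (Rmax a1 b1); psplit; try apply param_min; try apply param_max; auto.
    { eapply Rle_trans; [apply Rmin_l|apply Rmax_l]. }
    intros a b Ha Hb La Lb.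
    assert (La1 : a <= a1) by (eapply Rle_trans; [exact La|apply Rmin_l]).
    assert (Lb1 : b1 <= b) by (eapply Rle_trans; [apply Rmax_r|exact Lb]).
    assert (Lab : a <= b).
    { eapply Rle_trans; [exact La1|]; eapply Rle_trans; [apply Rmax_l|exact Lb]. }
    destruct (LE a Ha La1 Ha) as [N1 HN1]; destruct (RE b Hb Lb1 Hb) as [N2 HN2].
    destruct (Main a b Ha Hb Lab) as [N HN].
    exists (max N (max N1 N2)); intros n Hn; rewrite HN by lia.
    eapply Rle_trans; [apply Cmod_minus_le|]; generalize (HN1 n ltac:(lia)) (HN2 n ltac:(lia)); lra.
Qed.

Lemma contour_polysum (A B : Rbar) (bs : list R) (c : R -> C) (Fs : C -> C) (a b : R) (y : C) : contour A B bs c ->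
  (forall z, trace A B c z -> exists r, 0 < r /\ forall y, Cmod (y - z) < r -> holo_at Fs y) ->
  param A B a -> param A B b -> a <= b -> CRInt (arc_integrand c Fs) a b y ->
  exists N, forall n, (N <= n)%nat -> polysum Fs c a b n = y.
Proof.
  intros H HF Ha Hb Hab Hy; apply (polysum_contour Fs c (velocity c) bs a b y Hab); auto.
  - apply (contour_ccont_on A B bs c a b H); auto.
  - intros t Ht; apply HF; exists t; split; auto; apply (param_between A B a b); auto.
  - intros t Ht Nt; apply (contour_pderiv A B bs c t H); auto; apply (inner_between A B a b); auto.
Qed.

(** The middle curve c1 enters only through the polygonal sums of [Fs] along it, which occur in both
    deformations and cancel. No integral along c1 has to exist, although it may pass through 0. *)
Lemma deformation_integral (S1 S2 : C -> Prop) (A B : Rbar) (bs0 bs2 : list R) (c0 c1 c2 : R -> C) (Fs F : C -> C)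
    (integrands : (C -> C) -> Prop) (l0 l2 : C) :
  contour A B bs0 c0 -> contour A B bs2 c2 ->
  deformable S1 A B c0 c1 integrands -> deformable S2 A B c1 c2 integrands -> integrands F ->
  (forall z : C, z <> 0%C -> Fs z = F z) ->
  (forall z, S1 z \/ S2 z \/ trace A B c0 z \/ trace A B c2 z ->
     exists r, 0 < r /\ forall y, Cmod (y - z) < r -> holo_at Fs y) ->
  is_cint A B c0 Fs l0 -> is_cint A B c2 Fs l2 -> l0 = l2.
Proof.
  intros H0 H2 D1 D2 HF EF HH I0 I2; assert (HAB := contour_dom _ _ _ _ H0).
  rewrite is_cint_iff in I0, I2 by auto.
  apply Cminus_eq_0; rewrite (Cmod_small_0 (l0 - l2)); [apply Cmod_0|]; intros eps He.
  assert (He4 : 0 < eps / 4) by lra.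
  destruct (I0 _ He4) as [a1 [b1 [Pa1 [Pb1 [L1 K1]]]]]; destruct (I2 _ He4) as [a2 [b2 [Pa2 [Pb2 [L2 K2]]]]].
  destruct (deformation_polysum S1 A B c0 c1 Fs F integrands HAB D1 HF EF ltac:(intros; apply HH; auto) _ He4)
    as [a3 [b3 [Pa3 [Pb3 [L3 K3]]]]].
  destruct (deformation_polysum S2 A B c1 c2 Fs F integrands HAB D2 HF EF ltac:(intros; apply HH; auto) _ He4)
    as [a4 [b4 [Pa4 [Pb4 [L4 K4]]]]].
  set (a := Rmin (Rmin a1 a2) (Rmin a3 a4)); set (b := Rmax (Rmax b1 b2) (Rmax b3 b4)).
  assert (Pa : param A B a) by (repeat apply param_min; auto); assert (Pb : param A B b) by (repeat apply param_max; auto).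
  generalize (Rmin_l (Rmin a1 a2) (Rmin a3 a4)) (Rmin_r (Rmin a1 a2) (Rmin a3 a4)) (Rmin_l a1 a2) (Rmin_r a1 a2)
    (Rmin_l a3 a4) (Rmin_r a3 a4) (Rmax_l (Rmax b1 b2) (Rmax b3 b4)) (Rmax_r (Rmax b1 b2) (Rmax b3 b4))
    (Rmax_l b1 b2) (Rmax_r b1 b2) (Rmax_l b3 b4) (Rmax_r b3 b4); fold a b; intros.
  destruct (K1 a b Pa Pb) as [y1 [Y1 E1]]; try lra; destruct (K2 a b Pa Pb) as [y2 [Y2 E2]]; try lra.
  destruct (K3 a b Pa Pb) as [N3 E3]; try lra; destruct (K4 a b Pa Pb) as [N4 E4]; try lra.
  assert (Lab : a <= b) by lra.
  destruct (contour_polysum A B bs0 c0 Fs a b y1 H0 ltac:(intros; apply HH; auto) Pa Pb Lab Y1) as [N1 Q1].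
  destruct (contour_polysum A B bs2 c2 Fs a b y2 H2 ltac:(intros; apply HH; auto) Pa Pb Lab Y2) as [N2 Q2].
  set (n := max (max N1 N2) (max N3 N4)).
  specialize (Q1 n ltac:(lia)); specialize (Q2 n ltac:(lia)); specialize (E3 n ltac:(lia)); specialize (E4 n ltac:(lia)).
  rewrite Q1 in E3; rewrite Q2 in E4; set (q := polysum Fs c1 a b n) in *.
  replace (l0 - l2)%C with (((y1 - q) + (q - y2)) + ((y2 - l2) - (y1 - l0)))%C by ring.
  eapply Rle_trans; [apply Cmod_triangle|].
  eapply Rle_trans; [apply Rplus_le_compat; [apply Cmod_triangle|apply Cmod_minus_le]|]; lra.
Qed.

(** * Sums over the poles *)

Lemma Csum_Permutation {T : Type} (l l' : list T) (F : T -> C) : Permutation l l' -> Csum l F = Csum l' F.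
Proof.
  induction 1 as [|x l l' _ IH|x y l|l l' l'' _ IH1 _ IH2]; unfold Csum in *; simpl in *;
    [reflexivity|rewrite IH; reflexivity|ring|congruence].
Qed.

Lemma Rsum_Permutation {T : Type} (l l' : list T) (F : T -> R) : Permutation l l' -> Rsum l F = Rsum l' F.
Proof.
  induction 1 as [|x l l' _ IH|x y l|l l' l'' _ IH1 _ IH2]; unfold Rsum in *; simpl in *;
    [reflexivity|rewrite IH; reflexivity|ring|congruence].
Qed.

Lemma Csum_app {T : Type} (l l' : list T) (F : T -> C) : Csum (l ++ l') F = (Csum l F + Csum l' F)%C.
Proof. induction l as [|x l IH]; unfold Csum in *; simpl; [ring|rewrite IH; ring]. Qed.

Lemma Rsum_app {T : Type} (l l' : list T) (F : T -> R) : Rsum (l ++ l') F = Rsum l F + Rsum l' F.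
Proof. induction l as [|x l IH]; unfold Rsum in *; simpl; [ring|rewrite IH; ring]. Qed.

Lemma Csum_lin {T : Type} (l : list T) (F G : T -> C) (k : C) :
  Csum l (fun x => F x + k * G x)%C = (Csum l F + k * Csum l G)%C.
Proof. induction l as [|x l IH]; unfold Csum in *; simpl; [ring|rewrite IH; ring]. Qed.

Lemma Csum_ext {T : Type} (l : list T) (F G : T -> C) : (forall x, In x l -> F x = G x) -> Csum l F = Csum l G.
Proof.
  induction l as [|x l IH]; intro H; [reflexivity|]; unfold Csum in *; simpl.
  rewrite H by (left; reflexivity); rewrite IH by (intros; apply H; right; auto); reflexivity.
Qed.

Lemma Rsum_le {T : Type} (l : list T) (F G : T -> R) : (forall x, In x l -> F x <= G x) -> Rsum l F <= Rsum l G.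
Proof.
  induction l as [|x l IH]; intro H; [unfold Rsum; simpl; lra|]; unfold Rsum in *; simpl.
  generalize (H x (or_introl eq_refl)) (IH (fun y Hy => H y (or_intror Hy))); lra.
Qed.

Lemma Rsum_mult_l {T : Type} (l : list T) (F : T -> R) (k : R) : Rsum l (fun x => k * F x) = k * Rsum l F.
Proof. induction l as [|x l IH]; unfold Rsum in *; simpl; [ring|rewrite IH; ring]. Qed.

Lemma Rsum_ge0 {T : Type} (l : list T) (F : T -> R) : (forall x, In x l -> 0 <= F x) -> 0 <= Rsum l F.
Proof.
  induction l as [|x l IH]; intro H; [unfold Rsum; simpl; lra|]; unfold Rsum in *; simpl.
  generalize (H x (or_introl eq_refl)) (IH (fun y Hy => H y (or_intror Hy))); lra.
Qed.

Lemma Rsum_In {T : Type} (l : list T) (F : T -> R) (x : T) : (forall x, In x l -> 0 <= F x) -> In x l -> F x <= Rsum l F.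
Proof.
  induction l as [|y l IH]; [intros _ []|]; intros H [->|Hx]; unfold Rsum in *; simpl.
  - generalize (Rsum_ge0 l F (fun y Hy => H y (or_intror Hy))); unfold Rsum; lra.
  - generalize (H y (or_introl eq_refl)) (IH (fun y Hy => H y (or_intror Hy)) Hx); lra.
Qed.

Lemma Cmod_Csum {T : Type} (l : list T) (F : T -> C) : Cmod (Csum l F) <= Rsum l (fun x => Cmod (F x)).
Proof.
  induction l as [|x l IH]; unfold Csum, Rsum in *; simpl; [rewrite Cmod_0; lra|].
  eapply Rle_trans; [apply Cmod_triangle|]; lra.
Qed.

Lemma Rsum_swap {T U : Type} (l : list T) (l' : list U) (F : T -> U -> R) :
  Rsum l (fun x => Rsum l' (F x)) = Rsum l' (fun y => Rsum l (fun x => F x y)).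
Proof.
  induction l as [|x l IH]; unfold Rsum in *; simpl.
  - induction l' as [|y l' IH]; simpl; [reflexivity|rewrite <- IH; ring].
  - rewrite IH; clear IH; induction l' as [|y l' IH]; simpl; [ring|rewrite <- IH; ring].
Qed.

Definition keep {T : Type} (Q : T -> Prop) (l : list T) : list T :=
  filter (fun x => if excluded_middle_informative (Q x) then true else false) l.

Lemma in_keep {T : Type} (Q : T -> Prop) (l : list T) (x : T) : In x (keep Q l) <-> In x l /\ Q x.
Proof.
  unfold keep; rewrite filter_In; destruct (excluded_middle_informative (Q x)); split; intros [? ?]; split; auto; discriminate.
Qed.

Lemma NoDup_keep {T : Type} (Q : T -> Prop) (l : list T) : NoDup l -> NoDup (keep Q l).
Proof. apply NoDup_filter. Qed.

Lemma keep_split {T : Type} (Q : T -> Prop) (l : list T) :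
  Permutation l (keep Q l ++ keep (fun x => ~ Q x) l).
Proof.
  induction l as [|x l IH]; [constructor|]; unfold keep in *; simpl.
  destruct (excluded_middle_informative (Q x)); destruct (excluded_middle_informative (~ Q x)); try contradiction.
  - simpl; constructor; exact IH.
  - apply Permutation_cons_app; exact IH.
Qed.

Lemma enumerates_perm {T : Type} (P : T -> Prop) (l l' : list T) : enumerates P l -> enumerates P l' -> Permutation l l'.
Proof.
  intros [N E] [N' E']; apply NoDup_Permutation; auto; intro x; rewrite E, E'; reflexivity.
Qed.

Lemma Rsum_incl {T : Type} (l l' : list T) (F : T -> R) : NoDup l -> incl l l' -> (forall x, In x l' -> 0 <= F x) ->
  NoDup l' -> Rsum l F <= Rsum l' F.
Proof.
  intros N I H N'.
  rewrite (Rsum_Permutation l' _ F (keep_split (fun x => In x l) l')), Rsum_app.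
  rewrite (Rsum_Permutation (keep (fun x => In x l) l') l F).
  - assert (0 <= Rsum (keep (fun x => ~ In x l) l') F); [|lra].
    apply Rsum_ge0; intros x Hx; apply in_keep in Hx; apply H, Hx.
  - apply NoDup_Permutation; [apply NoDup_keep; auto|auto|].
    intro x; rewrite in_keep; split; [intros [_ ?]; auto|intro; split; auto].
Qed.

(** The mean value theorem for x^(-e). It turns the sum of n^(-e-1) over n > N into a telescoping
    sum, bounded by N^(-e) / e. *)
Lemma Rpower_telescope (e : R) (n : nat) : 0 < e -> (2 <= n)%nat ->
  e * Rpower (INR n) (- e - 1) <= Rpower (INR (n - 1)) (- e) - Rpower (INR n) (- e).
Proof.
  intros He Hn.
  assert (Hn1 : 1 <= INR (n - 1)) by (apply (le_INR 1); lia).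
  assert (En : INR n = INR (n - 1) + 1) by (rewrite <- S_INR; f_equal; lia).
  destruct (MVT_gen (fun x => Rpower x (- e)) (INR (n - 1)) (INR n) (fun x => - e * Rpower x (- e - 1))) as [x [Hx E]].
  - intros x Hx; rewrite Rmin_left, Rmax_right in Hx by lra; apply is_derive_Reals, derivable_pt_lim_power; lra.
  - intros x Hx; rewrite Rmin_left, Rmax_right in Hx by lra.
    apply derivable_continuous_pt; eexists; apply derivable_pt_lim_power; lra.
  - rewrite Rmin_left, Rmax_right in Hx by lra.
    assert (K : Rpower (INR n) (- e - 1) <= Rpower x (- e - 1)).
    { replace (- e - 1) with (- (e + 1)) by ring; rewrite !Rpower_Ropp.
      apply Rinv_le_contravar; [apply exp_pos|]; apply Rle_Rpower_l; lra. }
    replace (INR n - INR (n - 1)) with 1 in E by lra.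
    apply Rmult_le_compat_l with (r := e) in K; lra.
Qed.

Lemma Rpower_neg_small (e : R) : 0 < e -> forall eps, 0 < eps ->
  exists N, (1 <= N)%nat /\ forall n, (N <= n)%nat -> Rpower (INR n) (- e) < eps.
Proof.
  intros He eps Heps; destruct (INR_large (Rpower (/ eps) (/ e))) as [N [HN0 HN]]; exists N; split; [lia|].
  intros n Hn; specialize (HN n Hn).
  assert (P : 0 < Rpower (/ eps) (/ e)) by apply exp_pos.
  assert (Ie : 0 < / eps) by (apply Rinv_0_lt_compat; auto).
  rewrite Rpower_Ropp; rewrite <- (Rinv_inv eps); apply Rinv_lt_contravar.
  - apply Rmult_lt_0_compat; [auto|apply exp_pos].
  - replace (/ eps) with (Rpower (Rpower (/ eps) (/ e)) e).
    + apply Rlt_Rpower_l; lra.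
    + rewrite Rpower_mult; replace (/ e * e) with 1 by (field; lra); apply Rpower_1; auto.
Qed.

Definition list_in (P : C -> Prop) (N : nat) (l : list C) : Prop :=
  NoDup l /\ forall p, In p l -> P p /\ INR N <= Cmod p.

(* The weights u are summable over P; T bounds the tails and T 0 the whole sum. *)
Definition summable (P : C -> Prop) (u : C -> R) (T : nat -> R) : Prop :=
  (forall n : nat, exists l, enumerates (fun p => P p /\ Cmod p < INR n) l) /\
  (forall eps, 0 < eps -> exists N, T N < eps) /\
  (forall N l, list_in P N l -> Rsum l u <= T N) /\ (forall p, P p -> 0 <= u p).

(** A finite set of points beyond N is cut into unit annuli. The annulus of outer radius n
    contributes at most C1 n^(-e-1), and these bounds telescope to [tail N]. *)
Lemma summable_weights (P : C -> Prop) (u : C -> R) (C1 e : R) : 0 < e -> 0 <= C1 ->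
  (forall p, P p -> 0 <= u p) ->
  (forall n, (1 <= n)%nat -> exists l, enumerates (fun p => P p /\ INR n - 1 <= Cmod p < INR n) l /\
     Rsum l u <= C1 * Rpower (INR n) (- e - 1)) ->
  exists T, summable P u T.
Proof.
  intros He HC1 Hu H.
  set (tail := fun N => C1 / e * Rpower (INR N) (- e)).
  assert (ann : forall n l, (1 <= n)%nat -> NoDup l -> (forall p, In p l -> P p /\ INR n - 1 <= Cmod p < INR n) ->
    Rsum l u <= C1 * Rpower (INR n) (- e - 1)).
  { intros n l Hn Nl Hl; destruct (H n Hn) as [l' [[N' E'] B]]; eapply Rle_trans; [|exact B].
    apply Rsum_incl; auto.
    - intros p Hp; apply E'; auto.
    - intros p Hp; apply E' in Hp; apply Hu, Hp. }
  assert (K : forall k N l, (1 <= N)%nat -> NoDup l -> (forall p, In p l -> P p /\ INR N <= Cmod p < INR (N + k)) ->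
    Rsum l u <= tail N - tail (N + k)%nat).
  { induction k as [|k IH]; intros N l HN Nl Hl.
    - rewrite Nat.add_0_r in *; destruct l as [|p l]; [unfold Rsum; simpl; lra|].
      destruct (Hl p (or_introl eq_refl)) as [_ ?]; lra.
    - rewrite (Rsum_Permutation _ _ u (keep_split (fun p => Cmod p < INR (N + k)) l)), Rsum_app.
      assert (B1 : Rsum (keep (fun p => Cmod p < INR (N + k)) l) u <= tail N - tail (N + k)%nat).
      { apply IH; auto; [apply NoDup_keep; auto|]; intros p Hp; apply in_keep in Hp; destruct Hp as [Hp L].
        destruct (Hl p Hp) as [? ?]; split; auto; lra. }
      assert (B2 : Rsum (keep (fun p => ~ Cmod p < INR (N + k)) l) u <= C1 * Rpower (INR (N + S k)) (- e - 1)).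
      { apply ann; [lia|apply NoDup_keep; auto|]; intros p Hp; apply in_keep in Hp; destruct Hp as [Hp L].
        destruct (Hl p Hp) as [? ?]; split; auto; split; [|lra].
        replace (N + S k)%nat with (S (N + k)) by lia; rewrite S_INR; lra. }
      assert (B3 := Rpower_telescope e (N + S k) He ltac:(lia)).
      replace (N + S k - 1)%nat with (N + k)%nat in B3 by lia.
      assert (B4 : C1 * Rpower (INR (N + S k)) (- e - 1) <= tail (N + k)%nat - tail (N + S k)%nat); [|lra].
      unfold tail; apply Rmult_le_compat_l with (r := C1 / e) in B3; [|apply Rdiv_le_0_compat; lra].
      replace (C1 / e * (e * Rpower (INR (N + S k)) (- e - 1))) with (C1 * Rpower (INR (N + S k)) (- e - 1)) in B3
        by (field; lra); lra. }
  assert (K1 : forall N l, (1 <= N)%nat -> list_in P N l -> Rsum l u <= tail N).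
  { intros N l HN [Nl Hl].
    assert (M : exists M, forall p, In p l -> Cmod p < INR M).
    { clear - l; induction l as [|p l [M IH]]; [exists O; intros p []|].
      destruct (INR_large (Cmod p)) as [M' [_ HM']]; exists (max M M'); intros q [->|Hq].
      - apply HM'; lia.
      - eapply Rlt_le_trans; [apply IH; auto|apply le_INR; lia]. }
    destruct M as [M HM].
    assert (B := K M N l HN Nl); assert (B' : Rsum l u <= tail N - tail (N + M)%nat).
    { apply B; intros p Hp; destruct (Hl p Hp); split; auto; split; auto.
      eapply Rlt_le_trans; [apply HM; auto|apply le_INR; lia]. }
    assert (0 <= tail (N + M)%nat); [|lra].
    unfold tail; apply Rmult_le_pos; [apply Rdiv_le_0_compat; lra|left; apply exp_pos]. }
  (* The power n^(-e) telescopes from n = 1 on only; for N = 0 the contribution of the unit disc is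
     added. *)
  exists (fun N => match N with O => C1 * Rpower (INR 1) (- e - 1) + tail 1%nat | S _ => tail N end).
  split; [|split; [|split; [|exact Hu]]].
  - induction n as [|n [l [Nl El]]].
    + exists nil; split; [constructor|]; intro p; split; [intros []|]; intros [_ L]; simpl in L.
      generalize (Cmod_ge_0 p); lra.
    + destruct (H (S n) ltac:(lia)) as [l' [[N' E'] _]]; exists (l ++ l'); split.
      * apply NoDup_app; auto; intros p Hp Hp'; apply El in Hp; apply E' in Hp'.
        rewrite S_INR in Hp'; lra.
      * intro p; rewrite in_app_iff, El, E', S_INR; split.
        -- intros [[? ?]|[? ?]]; split; auto; lra.
        -- intros [? ?]; destruct (Rlt_dec (Cmod p) (INR n)); [left; auto|right; split; auto; lra].
  - intros eps Heps; destruct (Rpower_neg_small e He (eps / (C1 / e + 1))) as [N [HN0 HN]].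
    { apply Rdiv_lt_0_compat; [lra|]; assert (0 <= C1 / e) by (apply Rdiv_le_0_compat; lra); lra. }
    exists N; destruct N as [|N]; [lia|]; specialize (HN (S N) (le_n _)).
    assert (Q : 0 <= C1 / e) by (apply Rdiv_le_0_compat; lra).
    unfold tail; apply Rlt_div_r in HN; [|lra].
    assert (0 < Rpower (INR (S N)) (- e)) by apply exp_pos; lra.
  - intros N l Hl; destruct N as [|N]; [|apply K1; auto; lia].
    destruct Hl as [Nl Hl].
    rewrite (Rsum_Permutation _ _ u (keep_split (fun p => Cmod p < INR 1) l)), Rsum_app.
    apply Rplus_le_compat.
    + apply ann; [lia|apply NoDup_keep; auto|]; intros p Hp; apply in_keep in Hp; destruct Hp as [Hp L].
      destruct (Hl p Hp) as [? ?]; split; auto; simpl in *; split; lra.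
    + apply K1; [lia|]; split; [apply NoDup_keep; auto|]; intros p Hp; apply in_keep in Hp; destruct Hp as [Hp L].
      destruct (Hl p Hp) as [? ?]; split; auto; lra.
Qed.

Lemma summable_enum (P : C -> Prop) (u : C -> R) (T : nat -> R) (r : R) : summable P u T ->
  exists l, enumerates (fun p => P p /\ Cmod p < r) l.
Proof.
  intros [H _]; destruct (INR_large r) as [n [_ Hn]]; specialize (Hn n (le_n n)).
  destruct (H n) as [l [N E]]; exists (keep (fun p => Cmod p < r) l); split; [apply NoDup_keep; auto|].
  intro p; rewrite in_keep, E; split; [intros [[? ?] ?]; auto|intros [? ?]; repeat split; auto; lra].
Qed.

(** The weights are fixed and eps scales: the sum is a bounded functional of F, so that small
    remainders have small sums. Two cut-offs beyond radius N differ by points of modulus at least N,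
    hence by at most eps T N each from the sum up to N. *)
Lemma sum_by_modulus_exists (P : C -> Prop) (u : C -> R) (T : nat -> R) (F : C -> C) (eps : R) :
  summable P u T -> 0 <= eps -> (forall p, P p -> Cmod (F p) <= eps * u p) ->
  exists S, is_sum_by_modulus P F S /\ Cmod S <= eps * T O.
Proof.
  intros HS Heps HF; assert (HS' := HS); destruct HS' as [HE [HT [HB Hu]]].
  assert (B : forall N l, list_in P N l -> Cmod (Csum l F) <= eps * T N).
  { intros N l Hl; eapply Rle_trans; [apply Cmod_Csum|].
    eapply Rle_trans; [|apply Rmult_le_compat_l; [exact Heps|apply (HB N l Hl)]].
    rewrite <- Rsum_mult_l; apply Rsum_le; intros p Hp; apply HF, (proj2 Hl p Hp). }
  assert (D : forall N l0 R1 l, enumerates (fun p => P p /\ Cmod p < INR N) l0 -> INR N <= R1 ->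
    enumerates (fun p => P p /\ Cmod p < R1) l -> Cmod (Csum l F - Csum l0 F) <= eps * T N).
  { intros N l0 R1 l E0 LN [Nl El].
    rewrite (Csum_Permutation _ _ F (keep_split (fun p => Cmod p < INR N) l)), Csum_app.
    rewrite (Csum_Permutation (keep (fun p => Cmod p < INR N) l) l0).
    - replace (Csum l0 F + Csum (keep (fun p => ~ Cmod p < INR N) l) F - Csum l0 F)%C with
        (Csum (keep (fun p => ~ Cmod p < INR N) l) F) by ring.
      apply B; split; [apply NoDup_keep; auto|]; intros p Hp; apply in_keep in Hp; destruct Hp as [Hp L].
      apply El in Hp; split; [apply Hp|lra].
    - eapply enumerates_perm; [|exact E0]; split; [apply NoDup_keep; auto|].
      intro p; rewrite in_keep, El; split; [intros [[? ?] ?]; auto|intros [? ?]; repeat split; auto; lra]. }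
  destruct (ClassicalChoice.choice _ HE) as [L HL].
  destruct (Cseq_complete (fun n => Csum (L n) F)) as [v Hv].
  { intros e He; destruct (HT (e / (2 * (eps + 1)))) as [N HN]; [apply Rdiv_lt_0_compat; lra|].
    assert (X : eps * T N < e / 2).
    { apply Rlt_div_r in HN; [|lra].
      assert (0 <= T N) by (apply (HB N nil); split; [constructor|intros p []]); nra. }
    exists N; intros n m Hn Hm.
    replace (Csum (L n) F - Csum (L m) F)%C with
      ((Csum (L n) F - Csum (L N) F) - (Csum (L m) F - Csum (L N) F))%C by ring.
    eapply Rle_lt_trans; [apply Cmod_minus_le|].
    assert (Y : forall k, (N <= k)%nat -> Cmod (Csum (L k) F - Csum (L N) F) <= eps * T N).
    { intros k Hk; apply (D N (L N) (INR k)); auto; apply le_INR; auto. }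
    generalize (Y n Hn) (Y m Hm); lra. }
  exists v; split.
  - intros e He; destruct (HT (e / (4 * (eps + 1)))) as [N HN]; [apply Rdiv_lt_0_compat; lra|].
    assert (X : eps * T N < e / 4).
    { apply Rlt_div_r in HN; [|lra].
      assert (0 <= T N) by (apply (HB N nil); split; [constructor|intros p []]); nra. }
    exists (INR N); intros R1 HR1; destruct (summable_enum P u T R1 HS) as [l Hl]; exists l; split; auto.
    destruct (Hv (e / 4)) as [M HM]; [lra|]; specialize (HM (max M N) ltac:(lia)).
    assert (D1 := D N (L N) R1 l (HL N) ltac:(lra) Hl).
    assert (D2 := D N (L N) (INR (max M N)) (L (max M N)) (HL N) ltac:(apply le_INR; lia) (HL _)).
    replace (Csum l F - v)%C with ((Csum l F - Csum (L N) F) -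
      (Csum (L (max M N)) F - Csum (L N) F) + (Csum (L (max M N)) F - v))%C by ring.
    eapply Rle_lt_trans; [apply Cmod_triangle|].
    eapply Rle_lt_trans; [apply Rplus_le_compat_r, Cmod_minus_le|]; lra.
  - rewrite <- (Cminus_0_r v); apply (clim_bound _ _ _ _ O Hv); intros n _; rewrite Cminus_0_r.
    apply B; destruct (HL n) as [Nn En]; split; auto; intros p Hp; apply En in Hp; split; [apply Hp|].
    simpl; apply Cmod_ge_0.
Qed.

Lemma sum_by_modulus_lin (P : C -> Prop) (F G : C -> C) (k S T : C) :
  is_sum_by_modulus P F S -> is_sum_by_modulus P G T ->
  is_sum_by_modulus P (fun p => F p + k * G p)%C (S + k * T).
Proof.
  intros HF HG eps He; assert (Kp : 0 < Cmod k + 1) by (generalize (Cmod_ge_0 k); lra).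
  destruct (HF (eps / 2)) as [R1 H1]; [lra|].
  destruct (HG (eps / (2 * (Cmod k + 1)))) as [R2 H2]; [apply Rdiv_lt_0_compat; lra|].
  exists (Rmax R1 R2); intros R0 HR.
  destruct (H1 R0) as [l1 [E1 B1]]; [eapply Rle_lt_trans; [apply Rmax_l|exact HR]|].
  destruct (H2 R0) as [l2 [E2 B2]]; [eapply Rle_lt_trans; [apply Rmax_r|exact HR]|].
  exists l1; split; auto; rewrite Csum_lin.
  rewrite (Csum_Permutation l1 l2 G) by (eapply enumerates_perm; eauto).
  replace (Csum l1 F + k * Csum l2 G - (S + k * T))%C with ((Csum l1 F - S) + k * (Csum l2 G - T))%C by ring.
  eapply Rle_lt_trans; [apply Cmod_triangle|]; rewrite Cmod_mult.
  assert (Bk : Cmod k * Cmod (Csum l2 G - T) <= (Cmod k + 1) * Cmod (Csum l2 G - T))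
    by (apply Rmult_le_compat_r; [apply Cmod_ge_0|lra]).
  apply Rmult_lt_compat_l with (r := Cmod k + 1) in B2; auto.
  replace ((Cmod k + 1) * (eps / (2 * (Cmod k + 1)))) with (eps / 2) in B2 by (field; lra); lra.
Qed.

Lemma sum_by_modulus_unique (P : C -> Prop) (F : C -> C) (S T : C) :
  is_sum_by_modulus P F S -> is_sum_by_modulus P F T -> S = T.
Proof.
  intros HS HT; apply Cminus_eq_0; rewrite (Cmod_small_0 (S - T)); [apply Cmod_0|]; intros eps He.
  destruct (HS (eps / 2)) as [R1 H1]; [lra|]; destruct (HT (eps / 2)) as [R2 H2]; [lra|].
  assert (L1 := Rmax_l R1 R2); assert (L2 := Rmax_r R1 R2).
  destruct (H1 (Rmax R1 R2 + 1)) as [l1 [E1 B1]]; [lra|]; destruct (H2 (Rmax R1 R2 + 1)) as [l2 [E2 B2]]; [lra|].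
  rewrite (Csum_Permutation l1 l2 F) in B1 by (eapply enumerates_perm; eauto).
  replace (S - T)%C with ((Csum l2 F - T) - (Csum l2 F - S))%C by ring.
  eapply Rle_trans; [apply Cmod_minus_le|]; lra.
Qed.

Lemma sum_by_modulus_ext (P : C -> Prop) (F G : C -> C) (S : C) : (forall p, P p -> F p = G p) ->
  is_sum_by_modulus P F S -> is_sum_by_modulus P G S.
Proof.
  intros E H eps He; destruct (H eps He) as [R0 HR]; exists R0; intros R1 L; destruct (HR R1 L) as [l [El Bl]].
  exists l; split; auto; rewrite (Csum_ext l G F); auto; intros p Hp; symmetry; apply E; apply El in Hp; apply Hp.
Qed.

Lemma principal_sum_lin (n : nat) (bp : nat -> C) (p k : C) (X Y : nat -> C) :
  principal_sum n bp p (fun j => X j + k * Y j)%C = (principal_sum n bp p X + k * principal_sum n bp p Y)%C.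
Proof.
  unfold principal_sum; rewrite <- Csum_lin; apply Csum_ext; intros m _.
  replace (k * (bp m / Cpow p m * Csum (seq 0 m) (fun l => RtoC (Binomial.C m l) * Cpow (RtoC (-1)) l *
      Csum (seq 0 (S l)) (fun l' => RtoC (Binomial.C l l') * Y (m - l + l')%nat))))%C with
    (bp m / Cpow p m * (k * Csum (seq 0 m) (fun l => RtoC (Binomial.C m l) * Cpow (RtoC (-1)) l *
      Csum (seq 0 (S l)) (fun l' => RtoC (Binomial.C l l') * Y (m - l + l')%nat))))%C by ring.
  rewrite <- Cmult_plus_distr_l, <- Csum_lin; f_equal; apply Csum_ext; intros l _.
  rewrite (Csum_ext _ _ (fun l' => RtoC (Binomial.C l l') * X (m - l + l')%nat +
    k * (RtoC (Binomial.C l l') * Y (m - l + l')%nat))%C) by (intros; ring).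
  rewrite Csum_lin; ring.
Qed.

Lemma principal_sum_ext (n : nat) (bp : nat -> C) (p : C) (X Y : nat -> C) :
  (forall k, (1 <= k <= n)%nat -> X k = Y k) -> principal_sum n bp p X = principal_sum n bp p Y.
Proof.
  intro H; unfold principal_sum; apply Csum_ext; intros m Hm; apply in_seq in Hm; f_equal.
  apply Csum_ext; intros l Hl; apply in_seq in Hl; f_equal.
  apply Csum_ext; intros l' Hl'; apply in_seq in Hl'; f_equal; apply H; lia.
Qed.

Lemma principal_sum_bound (n : nat) : exists D, 0 <= D /\ forall (bp : nat -> C) (p : C) (X : nat -> C) (x : R),
  p <> 0%C -> 0 <= x -> (forall k, (1 <= k <= n)%nat -> Cmod (X k) <= x) ->
  Cmod (principal_sum n bp p X) <= D * x * Rsum (seq 1 n) (fun m => Cmod (bp m) / Cmod p ^ m).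
Proof.
  set (Dm := fun m => Rsum (seq 0 m) (fun l => Rabs (Binomial.C m l) * Rsum (seq 0 (S l)) (fun l' => Rabs (Binomial.C l l')))).
  assert (D0 : forall m, 0 <= Dm m).
  { intro m; apply Rsum_ge0; intros; apply Rmult_le_pos; [apply Rabs_pos|apply Rsum_ge0; intros; apply Rabs_pos]. }
  exists (Rsum (seq 1 n) Dm); split; [apply Rsum_ge0; auto|]; intros bp p X x Hp Hx HX.
  unfold principal_sum; eapply Rle_trans; [apply Cmod_Csum|].
  rewrite <- Rsum_mult_l; apply Rsum_le; intros m Hm.
  assert (Pm : 0 < Cmod p ^ m) by (apply pow_lt, Cmod_gt_0; auto).
  rewrite Cmod_mult, Cmod_div, Cmod_pow by (apply Cpow_nz; auto); rewrite Rmult_comm.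
  apply Rmult_le_compat_r; [apply Rdiv_le_0_compat; auto using Cmod_ge_0|].
  apply Rle_trans with (Dm m * x).
  - eapply Rle_trans; [apply Cmod_Csum|]; unfold Dm; rewrite Rmult_comm, <- Rsum_mult_l.
    apply Rsum_le; intros l Hl; rewrite !Cmod_mult, Cmod_R, Cmod_pow.
    replace (Cmod (-1)) with 1 by (rewrite Cmod_R, Rabs_left1; lra); rewrite pow1, Rmult_1_r.
    replace (x * (Rabs (Binomial.C m l) * Rsum (seq 0 (S l)) (fun l' => Rabs (Binomial.C l l')))) with
      (Rabs (Binomial.C m l) * (x * Rsum (seq 0 (S l)) (fun l' => Rabs (Binomial.C l l')))) by ring.
    apply Rmult_le_compat_l; [apply Rabs_pos|].
    eapply Rle_trans; [apply Cmod_Csum|]; rewrite <- Rsum_mult_l; apply Rsum_le; intros l' Hl'.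
    rewrite Cmod_mult, Cmod_R, Rmult_comm; apply Rmult_le_compat_r; [apply Rabs_pos|].
    apply HX; apply in_seq in Hm; apply in_seq in Hl; apply in_seq in Hl'; lia.
  - apply Rmult_le_compat_r; auto; apply (Rsum_In (seq 1 n) Dm m); auto.
Qed.

Lemma pow_le_1 (q : R) (n : nat) : 0 <= q <= 1 -> q ^ n <= 1.
Proof. intro H; rewrite <- (pow1 n); apply pow_incr; exact H. Qed.

(** The kernels will supply a factor 1/|p| and the definition of the principal sum another 1/|p|^m
    with m >= 1. On the n-th annulus this is O(n^-2), so that [H2] leaves n^(c-2) = n^(-(1-c)-1),
    which is summable because c < 1. *)
Lemma pole_weights_summable (P : C -> Prop) (nphi : nat) (b : C -> nat -> C) (c Ct rm : R) : c < 1 -> 0 < rm ->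
  (forall p, P p -> rm <= Cmod p) -> (forall p, P p -> (1 <= nphi)%nat) ->
  (forall n m : nat, (1 <= n)%nat -> (1 <= m <= nphi)%nat ->
     exists l, enumerates (fun p => P p /\ INR n - 1 <= Cmod p < INR n) l /\
       Rsum l (fun p => Cmod (b p m)) <= Ct * Rpower (INR n) c) ->
  exists T, summable P (fun p => / Cmod p * Rsum (seq 1 nphi) (fun m => Cmod (b p m) / Cmod p ^ m)) T.
Proof.
  intros Hc Hrm HP Hn H.
  (* On the n-th annulus |p| >= kap n: by rm for n = 1, and by n - 1 >= n/2 for n >= 2. As r1 <= 1,
     all powers of |p| up to the exponent nphi are at least r1^nphi. *)
  set (kap := Rmin rm (1 / 2)); set (r1 := Rmin rm 1).
  assert (Hkap : 0 < kap) by (apply Rmin_glb_lt; lra).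
  assert (Hr1 : 0 < r1 <= 1) by (split; [apply Rmin_glb_lt; lra|apply Rmin_r]).
  assert (Pr1 : 0 < r1 ^ nphi) by (apply pow_lt; lra).
  set (Q := / (kap ^ 2 * r1 ^ nphi)).
  assert (HQ : 0 < Q) by (apply Rinv_0_lt_compat, Rmult_lt_0_compat; auto; apply pow_lt; auto).
  assert (Hp : forall p, P p -> 0 < Cmod p) by (intros p Pp; specialize (HP p Pp); lra).
  apply (summable_weights P _ (Q * (INR nphi * Rabs Ct)) (1 - c)); [lra| | |].
  - apply Rmult_le_pos; [lra|]; apply Rmult_le_pos; [apply pos_INR|apply Rabs_pos].
  - intros p Pp; apply Rmult_le_pos; [left; apply Rinv_0_lt_compat; auto|].
    apply Rsum_ge0; intros m _; apply Rdiv_le_0_compat; [apply Cmod_ge_0|apply pow_lt; auto].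
  - intros n Hn1; assert (In1 : 1 <= INR n) by (apply (le_INR 1); auto).
    (* For nphi = 0 the hypothesis yields no enumeration, but then P is empty. *)
    destruct (Nat.eq_dec nphi 0) as [E0|N0].
    { exists nil; split.
      - split; [constructor|]; intro p; split; [intros []|]; intros [Pp _]; specialize (Hn p Pp); lia.
      - unfold Rsum at 1; simpl; apply Rmult_le_pos; [|left; apply exp_pos].
        apply Rmult_le_pos; [lra|]; apply Rmult_le_pos; [apply pos_INR|apply Rabs_pos]. }
    destruct (H n 1%nat Hn1 ltac:(lia)) as [l [El _]]; exists l; split; auto.
    assert (In2 : 0 < INR n ^ 2) by (apply pow_lt; lra).
    apply Rle_trans with (Q / INR n ^ 2 * Rsum l (fun p => Rsum (seq 1 nphi) (fun m => Cmod (b p m)))).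
    + rewrite <- Rsum_mult_l; apply Rsum_le; intros p Ip; apply El in Ip; destruct Ip as [Pp [L1 L2]].
      rewrite <- !Rsum_mult_l; apply Rsum_le; intros m Im; apply in_seq in Im.
      specialize (Hp p Pp); specialize (HP p Pp).
      assert (K : kap * INR n <= Cmod p).
      { generalize (Rmin_l rm (1 / 2)) (Rmin_r rm (1 / 2)); fold kap; intros.
        destruct (Nat.eq_dec n 1) as [->|N1]; [simpl; lra|].
        assert (2 <= INR n) by (apply (le_INR 2); lia); nra. }
      assert (K2 : kap ^ 2 * INR n ^ 2 <= Cmod p ^ 2) by (rewrite <- Rpow_mult_distr; apply pow_incr; nra).
      assert (K3 : r1 ^ nphi <= Cmod p ^ (m - 1)).
      { apply Rle_trans with (r1 ^ (m - 1)).
        - replace nphi with ((m - 1) + (nphi - (m - 1)))%nat by lia; rewrite pow_add.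
          rewrite <- (Rmult_1_r (r1 ^ (m - 1))) at 2; apply Rmult_le_compat_l; [apply pow_le; lra|].
          rewrite <- (pow1 (nphi - (m - 1))); apply pow_incr; lra.
        - apply pow_incr; split; [lra|]; generalize (Rmin_l rm 1); fold r1; lra. }
      assert (K4 : kap ^ 2 * INR n ^ 2 * r1 ^ nphi <= Cmod p * Cmod p ^ m).
      { replace (Cmod p * Cmod p ^ m) with (Cmod p ^ 2 * Cmod p ^ (m - 1)).
        - apply Rmult_le_compat; auto; [|lra]; apply Rmult_le_pos; [apply pow_le|]; lra.
        - replace m with (S (m - 1)) at 2 by lia; simpl; ring. }
      assert (Pm : 0 < Cmod p ^ m) by (apply pow_lt; auto).
      replace (/ Cmod p * (Cmod (b p m) / Cmod p ^ m)) with (/ (Cmod p * Cmod p ^ m) * Cmod (b p m)) by (field; lra).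
      apply Rmult_le_compat_r; [apply Cmod_ge_0|].
      replace (Q / INR n ^ 2) with (/ (kap ^ 2 * INR n ^ 2 * r1 ^ nphi))
        by (unfold Q; field; repeat split; try apply pow_nonzero; lra).
      apply Rinv_le_contravar; [|exact K4].
      apply Rmult_lt_0_compat; auto; apply Rmult_lt_0_compat; auto; apply pow_lt; auto.
    + rewrite Rsum_swap.
      assert (B : forall s, (forall m, In m s -> (1 <= m <= nphi)%nat) ->
        Rsum s (fun m => Rsum l (fun p => Cmod (b p m))) <= INR (length s) * (Rabs Ct * Rpower (INR n) c)).
      { induction s as [|m s IH]; intro Hs; [unfold Rsum; simpl; lra|].
        change (length (m :: s)) with (S (length s)); rewrite S_INR; unfold Rsum at 1; simpl.
        change (fold_right (fun x s0 => Rsum l (fun p => Cmod (b p x)) + s0) 0 s) with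
          (Rsum s (fun m => Rsum l (fun p => Cmod (b p m)))).
        specialize (IH (fun m' Hm' => Hs m' (or_intror Hm'))).
        destruct (H n m Hn1 (Hs m (or_introl eq_refl))) as [l' [El' Bl']].
        rewrite (Rsum_Permutation l l') by (eapply enumerates_perm; eauto).
        assert (Rp : 0 < Rpower (INR n) c) by apply exp_pos.
        assert (Ct * Rpower (INR n) c <= Rabs Ct * Rpower (INR n) c) by (apply Rmult_le_compat_r; [lra|apply Rle_abs]).
        lra. }
      specialize (B (seq 1 nphi) ltac:(intros m Hm; apply in_seq in Hm; lia)); rewrite length_seq in B.
      assert (E : Rpower (INR n) (- (1 - c) - 1) = / INR n ^ 2 * Rpower (INR n) c).
      { replace (- (1 - c) - 1) with (- INR 2 + c) by (simpl; ring).
        rewrite Rpower_plus, Rpower_Ropp, Rpower_pow by lra; reflexivity. }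
      rewrite E; replace (Q * (INR nphi * Rabs Ct) * (/ INR n ^ 2 * Rpower (INR n) c)) with
        (Q / INR n ^ 2 * (INR nphi * (Rabs Ct * Rpower (INR n) c))) by (field; lra).
      apply Rmult_le_compat_l; [apply Rdiv_le_0_compat; lra|exact B].
Qed.

(** The entry X p k stands for the factor of index k = m - l + l' in the formula. The sum of the
    principal parts, its Taylor coefficients and the sum in the conclusion differ only in X, and
    dependence on X is linear. *)
Definition is_pole_sum (P : C -> Prop) (nphi : nat) (b : C -> nat -> C) (X : C -> nat -> C) (S : C) : Prop :=
  is_sum_by_modulus P (fun p => principal_sum nphi (b p) p (X p)) S.

(** The sum over the poles is a bounded linear functional on arrays X, for the norm given by the
    supremum of |p| |X p k|. Every later estimate of such a sum reduces to an estimate of single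
    entries, with constants O(1/|p|). *)
Lemma pole_sum_exists (P : C -> Prop) (nphi : nat) (b : C -> nat -> C) (c Ct rm : R) : c < 1 -> 0 < rm ->
  (forall p, P p -> rm <= Cmod p) -> (forall p, P p -> (1 <= nphi)%nat) ->
  (forall n m : nat, (1 <= n)%nat -> (1 <= m <= nphi)%nat ->
     exists l, enumerates (fun p => P p /\ INR n - 1 <= Cmod p < INR n) l /\
       Rsum l (fun p => Cmod (b p m)) <= Ct * Rpower (INR n) c) ->
  exists L, 0 <= L /\ forall X eps, 0 <= eps ->
    (forall p k, P p -> (1 <= k <= nphi)%nat -> Cmod (X p k) <= eps / Cmod p) ->
    exists S, is_pole_sum P nphi b X S /\ Cmod S <= L * eps.
Proof.
  intros Hc Hrm HP Hn H; destruct (pole_weights_summable P nphi b c Ct rm Hc Hrm HP Hn H) as [T HT].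
  destruct (principal_sum_bound nphi) as [D [HD PB]].
  assert (T0 : 0 <= T O).
  { destruct HT as [_ [_ [HB _]]]; apply (HB O nil); split; [constructor|intros p []]. }
  exists (D * T O); split; [apply Rmult_le_pos; auto|]; intros X eps He HX.
  destruct (sum_by_modulus_exists P _ T (fun p => principal_sum nphi (b p) p (X p)) (D * eps) HT) as [S [HS BS]].
  - apply Rmult_le_pos; auto.
  - intros p Pp; specialize (HP p Pp); assert (Mp : 0 < Cmod p) by lra.
    eapply Rle_trans; [apply (PB (b p) p (X p) (eps / Cmod p))|].
    + apply Cmod_gt_0; auto.
    + apply Rdiv_le_0_compat; auto.
    + intros k Hk; apply HX; auto.
    + right; unfold Rdiv; ring.
  - exists S; split; [exact HS|]; eapply Rle_trans; [exact BS|]; right; ring.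
Qed.

Lemma pole_sum_lin (P : C -> Prop) (nphi : nat) (b : C -> nat -> C) (X Y : C -> nat -> C) (k S T : C) :
  is_pole_sum P nphi b X S -> is_pole_sum P nphi b Y T ->
  is_pole_sum P nphi b (fun p j => X p j + k * Y p j)%C (S + k * T).
Proof.
  intros HX HY; eapply sum_by_modulus_ext; [|apply (sum_by_modulus_lin P _ _ k S T HX HY)].
  intros p _; simpl; symmetry; apply principal_sum_lin.
Qed.

Lemma pole_sum_ext (P : C -> Prop) (nphi : nat) (b : C -> nat -> C) (X Y : C -> nat -> C) (S : C) :
  (forall p k, P p -> (1 <= k <= nphi)%nat -> X p k = Y p k) -> is_pole_sum P nphi b X S -> is_pole_sum P nphi b Y S.
Proof. intro E; apply sum_by_modulus_ext; intros p Pp; apply principal_sum_ext; auto. Qed.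

Lemma pole_sum_csum (P : C -> Prop) (nphi : nat) (b : C -> nat -> C) (X : nat -> C -> nat -> C) (S : nat -> C) (v : nat -> C) (N : nat) :
  is_pole_sum P nphi b (fun _ _ => 0%C) 0%C ->
  (forall n, is_pole_sum P nphi b (X n) (S n)) ->
  is_pole_sum P nphi b (fun p k => csum N (fun n => v n * X n p k))%C (csum N (fun n => v n * S n)%C).
Proof.
  intros H0 H; induction N as [|N IH]; [exact H0|]; simpl; apply pole_sum_lin; auto.
Qed.

(** * The exponential series and its binomial kernels *)

Lemma cderiv_pow (n : nat) (z : C) : cderiv (fun y => Cpow y (S n)) z (INR (S n) * Cpow z n).
Proof.
  induction n as [|n IH].
  - simpl; apply (cderiv_ext (fun y => y)); [intro; ring|].
    replace (1 * 1)%C with (RtoC 1) by ring; apply cderiv_id.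
  - assert (K := cderiv_mult (fun y => y) (fun y => Cpow y (S n)) z _ _ (cderiv_id z) IH).
    replace (INR (S (S n)) * Cpow z (S n))%C with (1 * Cpow z (S n) + z * (INR (S n) * Cpow z n))%C; [exact K|].
    rewrite (S_INR (S n)), RtoC_plus; simpl Cpow; ring.
Qed.

Definition exp_poly (N : nat) (z : C) : C := csum N (fun j => / INR (fact j) * Cpow z j)%C.

Lemma INR_fact_neq (n : nat) : RtoC (INR (fact n)) <> 0%C.
Proof. intro E; apply RtoC_inj in E; generalize (INR_fact_lt_0 n); lra. Qed.

Lemma exp_poly_cderiv (N : nat) (z : C) : cderiv (exp_poly (S N)) z (exp_poly N z).
Proof.
  induction N as [|N IH].
  - apply (cderiv_ext (fun _ => / INR (fact 0) * 1)%C); [intro y; unfold exp_poly; simpl; ring|].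
    apply cderiv_const.
  - apply (cderiv_plus (exp_poly (S N)) (fun y => / INR (fact (S N)) * Cpow y (S N))%C); [exact IH|].
    assert (K := cderiv_scal (/ INR (fact (S N))) _ _ _ (cderiv_pow N z)).
    replace (/ INR (fact N) * Cpow z N)%C with (/ INR (fact (S N)) * (INR (S N) * Cpow z N))%C; [exact K|].
    change (fact (S N)) with (S N * fact N)%nat; rewrite mult_INR, RtoC_mult.
    field; split; [apply INR_fact_neq|]; intro E; apply RtoC_inj in E; apply (not_0_INR (S N)); auto.
Qed.

Lemma Cexp_add (x y : C) : Cexp (x + y) = (Cexp x * Cexp y)%C.
Proof.
  unfold Cexp, Cmult, Re, Im; simpl; rewrite exp_plus, cos_plus, sin_plus; f_equal; ring.
Qed.

Lemma Cexp_0 : Cexp 0 = 1%C.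
Proof. unfold Cexp, Re, Im; simpl; rewrite exp_0, cos_0, sin_0; unfold RtoC; f_equal; ring. Qed.

Lemma Cexp_cis (z : C) : Cexp z = (exp (Re z) * cis (Im z))%C.
Proof. unfold Cexp, cis, RtoC, Cmult; simpl; f_equal; ring. Qed.

Lemma Cmod_Cexp (z : C) : Cmod (Cexp z) = exp (Re z).
Proof.
  rewrite Cexp_cis, Cmod_mult, Cmod_cis, Cmod_R, Rabs_pos_eq; [ring|left; apply exp_pos].
Qed.

Lemma Cmod_Cexp_le (z : C) : Cmod (Cexp z) <= exp (Cmod z).
Proof.
  rewrite Cmod_Cexp; apply exp_le; eapply Rle_trans; [apply Rle_abs|apply re_le_Cmod].
Qed.

Lemma Cexp_pderiv (y : C) (t : R) : pderiv (fun s => Cexp (s * y)%C) t (Cexp (t * y) * y)%C.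
Proof.
  destruct y as [u v].
  assert (K := pderiv_pair (fun s => exp (s * u) * cos (s * v)) (fun s => exp (s * u) * sin (s * v)) t
    (exp (t * u) * cos (t * v) * u - exp (t * u) * sin (t * v) * v)
    (exp (t * u) * cos (t * v) * v + exp (t * u) * sin (t * v) * u)).
  assert (E : forall s : R, Cexp (s * (u, v))%C = (exp (s * u) * cos (s * v), exp (s * u) * sin (s * v))).
  { intro s; unfold Cexp, Cmult, Re, Im; simpl; do 2 f_equal; (f_equal; ring). }
  intros eps He; destruct (K ltac:(auto_derive; auto; ring) ltac:(auto_derive; auto; ring) eps He) as [d [Hd D]].
  assert (E2 : (Cexp (t * (u, v)) * (u, v))%C = (exp (t * u) * cos (t * v) * u - exp (t * u) * sin (t * v) * v,
     exp (t * u) * cos (t * v) * v + exp (t * u) * sin (t * v) * u)).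
  { rewrite E; unfold Cmult; simpl; f_equal; ring. }
  rewrite E2; exists d; split; auto; intros s Hs; specialize (D s Hs); rewrite !E; exact D.
Qed.

(** Induction on N along the segment from 0 to y: the remainder of order N + 1 vanishes at 0 and its
    derivative in t is y times the remainder of order N, so that integrating t^N produces the next
    factorial. *)
Lemma Cexp_remainder (N : nat) (y : C) :
  Cmod (Cexp y - exp_poly N y) <= Cmod y ^ N / INR (fact N) * exp (Cmod y).
Proof.
  assert (y0 := Cmod_ge_0 y).
  assert (K : forall N t, 0 <= t <= 1 -> Cmod (Cexp (t * y) - exp_poly N (t * y)) <=
    Cmod y ^ N * t ^ N / INR (fact N) * exp (Cmod y)).
  { clear N; induction N as [|N IH]; intros t Ht.
    - unfold exp_poly; simpl; replace (Cexp (t * y) - 0)%C with (Cexp (t * y)) by ring.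
      eapply Rle_trans; [apply Cmod_Cexp_le|]; rewrite Cmod_mult, Cmod_R, Rabs_pos_eq by lra.
      replace (1 * 1 / 1 * exp (Cmod y)) with (exp (Cmod y)) by field; apply exp_le; nra.
    - set (f := fun s : R => (Cexp (s * y) - exp_poly (S N) (s * y))%C).
      set (f' := fun s : R => ((Cexp (s * y) - exp_poly N (s * y)) * y)%C).
      assert (py : forall s : R, pderiv (fun s => s * y)%C s y).
      { intros s eps He; exists 1; split; [lra|]; intros s' _.
        replace (s' * y - s * y - (s' - s)%R * y)%C with (RtoC 0) by (rewrite RtoC_minus; ring).
        rewrite Cmod_0; apply Rmult_le_pos; [lra|apply Rabs_pos]. }
      assert (Pd : forall s, pderiv f s (f' s)).
      { intros s eps He.
        destruct (Cexp_pderiv y s (eps / 2)) as [d1 [Hd1 D1]]; [lra|].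
        destruct (cderiv_pderiv (exp_poly (S N)) (fun s => s * y)%C s _ _ (exp_poly_cderiv N _) (py s) (eps / 2))
          as [d2 [Hd2 D2]]; [lra|].
        exists (Rmin d1 d2); split; [apply Rmin_glb_lt; auto|]; intros s' Hs'.
        specialize (D1 s' (Rlt_le_trans _ _ _ Hs' (Rmin_l _ _))).
        specialize (D2 s' (Rlt_le_trans _ _ _ Hs' (Rmin_r _ _))).
        unfold f, f'.
        replace (Cexp (s' * y) - exp_poly (S N) (s' * y) - (Cexp (s * y) - exp_poly (S N) (s * y)) -
          (s' - s)%R * ((Cexp (s * y) - exp_poly N (s * y)) * y))%C with
          ((Cexp (s' * y) - Cexp (s * y) - (s' - s)%R * (Cexp (s * y) * y)) -
           (exp_poly (S N) (s' * y) - exp_poly (S N) (s * y) - (s' - s)%R * (exp_poly N (s * y) * y)))%C by ring.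
        eapply Rle_trans; [apply Cmod_minus_le|]; lra. }
      assert (Cd : forall s, ccont f' s).
      { intro s; apply ccont_mult; [|apply ccont_const].
        apply continuous_ccont, (continuous_minus (V := CR)); apply continuous_ccont.
        - apply pderiv_ccont with (Cexp (s * y) * y)%C, Cexp_pderiv.
        - apply (ccont_comp (exp_poly N) (fun s => s * y)%C); [|apply pderiv_ccont with y, py].
          apply holo_at_continuous; destruct N as [|N]; [|eexists; apply exp_poly_cderiv].
          apply (holo_at_const 0). }
      assert (I : CRInt f' 0 t (f t - f 0)%C).
      { apply (is_RInt_derive (V := C_R_CompleteNormedModule) f f'); intros s _.
        - apply is_derive_pderiv, Pd.
        - apply continuous_ccont, Cd. }
      assert (f0 : f 0 = 0%C).
      { unfold f; replace (0 * y)%C with (RtoC 0) by ring; rewrite Cexp_0.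
        replace (exp_poly (S N) 0) with (RtoC 1); [ring|].
        clear; induction N as [|N IH]; [unfold exp_poly; simpl; field|].
        change (exp_poly (S (S N)) 0) with (exp_poly (S N) 0 + / INR (fact (S N)) * Cpow 0 (S N))%C.
        rewrite <- IH; simpl; ring. }
      rewrite f0 in I; replace (f t - 0)%C with (f t) in I by ring.
      assert (J : is_RInt (fun s => Cmod y ^ S N * exp (Cmod y) / INR (fact N) * s ^ N) 0 t
        (Cmod y ^ S N * exp (Cmod y) / INR (fact N) * (t ^ S N / INR (S N)))).
      { apply (is_RInt_scal (V := R_NormedModule)).
        apply (is_RInt_val _ _ _ (minus (t ^ S N / INR (S N)) (0 ^ S N / INR (S N)))).
        - apply (is_RInt_derive (V := R_CompleteNormedModule) (fun s => s ^ S N / INR (S N)) (fun s => s ^ N)).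
          + intros s _; auto_derive; auto; rewrite <- S_INR; change (pred (S N)) with N.
            field; destruct N; [lra|apply not_0_INR; discriminate].
          + intros s _; apply (ex_derive_continuous (V := R_NormedModule)); auto_derive; auto.
        - unfold minus, plus, opp; simpl; rewrite Rmult_0_l; unfold Rdiv; ring. }
      eapply Rle_trans; [apply (CRInt_norm_le _ _ 0 t _ _ ltac:(lra)) with (2 := I) (3 := J)|].
      + intros s Hs; unfold f'; rewrite Cmod_mult.
        eapply Rle_trans; [apply Rmult_le_compat_r; [auto|apply IH; lra]|]; right; simpl; unfold Rdiv; ring.
      + right; change (fact (S N)) with (S N * fact N)%nat; rewrite mult_INR.
        field; split; [apply INR_fact_neq_0|apply not_0_INR; auto]. }
  specialize (K N 1 ltac:(lra)); replace (1 * y)%C with y in K by ring; rewrite pow1, Rmult_1_r in K; exact K.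
Qed.

Lemma pow_fact_exp (x : R) (n : nat) : 0 <= x -> x ^ n / INR (fact n) <= exp x.
Proof.
  intro Hx; eapply Rle_trans; [|apply (exp_ge_taylor x n Hx)].
  assert (P : forall k, 0 <= x ^ k / INR (fact k)).
  { intro k; apply Rdiv_le_0_compat; [apply pow_le; exact Hx|apply INR_fact_lt_0]. }
  destruct n as [|n]; [simpl; lra|]; rewrite tech5.
  generalize (cond_pos_sum (fun k => x ^ k / INR (fact k)) n P); lra.
Qed.

(** Pascal's recursion gives 0 for k > n, which the quotient of factorials [Binomial.C] does not;
    sums over n can then start at 0 for every k. *)
Fixpoint bincoef (n k : nat) : nat :=
  match k, n with
  | O, _ => 1%nat
  | S _, O => 0%nat
  | S k', S n' => (bincoef n' k' + bincoef n' k)%nat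
  end.

Lemma bincoef_zero (n k : nat) : (n < k)%nat -> bincoef n k = 0%nat.
Proof.
  revert k; induction n as [|n IH]; intros [|k] H; try lia; simpl; [reflexivity|].
  rewrite !IH by lia; reflexivity.
Qed.

Lemma bincoef_le (n k : nat) : INR (bincoef n k) <= 2 ^ n.
Proof.
  assert (P : forall n, 1 <= 2 ^ n) by (intro m; apply pow_R1_Rle; lra).
  revert k; induction n as [|n IH]; intros [|k]; simpl bincoef.
  - simpl; lra.
  - simpl; lra.
  - apply P.
  - rewrite plus_INR; generalize (IH k) (IH (S k)); simpl; lra.
Qed.

Lemma bincoef_diag (n : nat) : bincoef n n = 1%nat.
Proof. induction n as [|n IH]; simpl; [reflexivity|]; rewrite IH, bincoef_zero by lia; reflexivity. Qed.

Lemma bincoef_fact (n k : nat) : (bincoef (n + k) k * (fact k * fact n) = fact (n + k))%nat.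
Proof.
  revert n; induction k as [|k IHk]; intro n.
  - rewrite Nat.add_0_r; destruct n; simpl; lia.
  - induction n as [|n IHn]; [rewrite Nat.add_0_l, bincoef_diag; change (fact 0) with 1%nat; lia|].
    change (S n + S k)%nat with (S (n + S k)); simpl bincoef.
    assert (E1 := IHk (S n)); replace (S n + k)%nat with (n + S k)%nat in E1 by lia.
    change (fact (S (n + S k))) with (S (n + S k) * fact (n + S k))%nat.
    rewrite Nat.mul_add_distr_r.
    change (fact (S k)) with (S k * fact k)%nat in *; change (fact (S n)) with (S n * fact n)%nat in *.
    replace (bincoef (n + S k) k * (S k * fact k * (S n * fact n)))%nat with
      (S k * (bincoef (n + S k) k * (fact k * (S n * fact n))))%nat by ring.
    rewrite E1.
    replace (bincoef (n + S k) (S k) * (S k * fact k * (S n * fact n)))%nat with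
      (S n * (bincoef (n + S k) (S k) * (S k * fact k * fact n)))%nat by ring.
    rewrite IHn; ring.
Qed.

(** Dividing the coefficient of x^(n+1) in (x/(1-x))^(j+1) by n!, as the Borel transform does, turns
    the binomial series into y^j/j! e^y. The identity is exact for truncated sums, which leaves only
    the remainder of the exponential to estimate. *)
Lemma borel_kernel_poly (N j : nat) (y : C) :
  csum N (fun n => INR (bincoef n j) / INR (fact n) * Cpow y n)%C =
  (Cpow y j / INR (fact j) * exp_poly (N - j) y)%C.
Proof.
  induction N as [|N IH]; [unfold exp_poly; simpl; ring|]; simpl csum; rewrite IH.
  destruct (le_lt_dec j N) as [L|L].
  - replace (S N - j)%nat with (S (N - j)) by lia; unfold exp_poly; simpl csum.
    assert (E := bincoef_fact (N - j) j); replace (N - j + j)%nat with N in E by lia.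
    assert (E' : (INR (bincoef N j) / INR (fact N) = / (INR (fact j) * INR (fact (N - j))))%C).
    { rewrite <- E, !mult_INR, !RtoC_mult; field; repeat split; try apply INR_fact_neq.
      intro Z; apply RtoC_inj in Z; apply (INR_fact_neq_0 N); rewrite <- E, mult_INR, Z; ring. }
    rewrite E'; replace (Cpow y N) with (Cpow y (j + (N - j))) by (f_equal; lia); rewrite Cpow_add_r.
    field; split; apply INR_fact_neq.
  - rewrite bincoef_zero by exact L; replace (S N - j)%nat with 0%nat by lia; replace (N - j)%nat with 0%nat by lia.
    unfold Cdiv; simpl (INR 0); ring.
Qed.

Lemma half_pow (n : nat) : (1 / 2) ^ n = / 2 ^ n.
Proof. rewrite <- pow_inv; f_equal; lra. Qed.

Lemma borel_kernel_remainder (N j : nat) (y : C) :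
  Cmod (Cpow y j / INR (fact j) * Cexp y - csum N (fun n => INR (bincoef n j) / INR (fact n) * Cpow y n))%C <=
    (1 / 2) ^ N * exp (5 * Cmod y).
Proof.
  rewrite borel_kernel_poly.
  replace (Cpow y j / INR (fact j) * Cexp y - Cpow y j / INR (fact j) * exp_poly (N - j) y)%C with
    (Cpow y j / INR (fact j) * (Cexp y - exp_poly (N - j) y))%C by ring.
  assert (y0 := Cmod_ge_0 y).
  assert (Q : forall n, 0 <= Cmod y ^ n / INR (fact n) <= (1 / 2) ^ n * exp (2 * Cmod y)).
  { intro n; split; [apply Rdiv_le_0_compat; [apply pow_le; auto|apply INR_fact_lt_0]|].
    assert (K := pow_fact_exp (2 * Cmod y) n ltac:(lra)); rewrite Rpow_mult_distr in K.
    assert (0 < 2 ^ n) by (apply pow_lt; lra).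
    rewrite half_pow; apply Rmult_le_reg_l with (2 ^ n); auto.
    replace (2 ^ n * (/ 2 ^ n * exp (2 * Cmod y))) with (exp (2 * Cmod y)) by (field; lra).
    eapply Rle_trans; [|exact K]; right; unfold Rdiv; ring. }
  rewrite Cmod_mult, Cmod_div, Cmod_pow, Cmod_R, (Rabs_pos_eq (INR _)) by (try apply INR_fact_neq; apply pos_INR).
  set (M := (N - j)%nat).
  (* Each |y|^n/n! is at most 2^-n e^(2|y|). This is used for n = j and for n = N - j, and the
     exponential remainder adds e^|y|: hence the constant 5. For j > N the truncated difference is
     0, and (1/2)^j is already small enough. *)
  apply Rle_trans with (((1 / 2) ^ j * exp (2 * Cmod y)) * ((1 / 2) ^ M * exp (2 * Cmod y) * exp (Cmod y))).
  - apply Rmult_le_compat; [apply Q|apply Cmod_ge_0|apply Q|].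
    eapply Rle_trans; [apply Cexp_remainder|]; apply Rmult_le_compat_r; [left; apply exp_pos|apply Q].
  - replace (((1 / 2) ^ j * exp (2 * Cmod y)) * ((1 / 2) ^ M * exp (2 * Cmod y) * exp (Cmod y))) with
      ((1 / 2) ^ (j + M) * exp (5 * Cmod y)).
    + apply Rmult_le_compat_r; [left; apply exp_pos|].
      replace (j + M)%nat with (N + (j + M - N))%nat by (unfold M; lia); rewrite pow_add.
      rewrite <- (Rmult_1_r ((1 / 2) ^ N)) at 2; apply Rmult_le_compat_l; [apply pow_le; lra|].
      apply pow_le_1; lra.
    + rewrite pow_add; replace (5 * Cmod y) with (2 * Cmod y + 2 * Cmod y + Cmod y) by ring; rewrite !exp_plus; ring.
Qed.

Lemma clim_shift (u : nat -> C) (v : C) : clim u v -> clim (fun n => u (S n)) v.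
Proof. intros H eps He; destruct (H eps He) as [N HN]; exists N; intros; apply HN; lia. Qed.

Lemma csum_head (N : nat) (u : nat -> C) : csum (S N) u = (u O + csum N (fun j => u (S j)))%C.
Proof. induction N as [|N IH]; [simpl; ring|]; change (csum (S (S N)) u) with (csum (S N) u + u (S N))%C.
  rewrite IH; simpl; ring. Qed.

(** For |x| <= 1/4 the terms are at most 2^n 4^-n, so that the tail is at most 2 (1/2)^N. The limit
    v is found by induction on j: Pascal's rule gives v (1 - x) = x w, where w is the limit for j -
    1. *)
Lemma pascal_kernel_remainder (N j : nat) (x : C) : Cmod x <= 1 / 4 ->
  Cmod (Cpow (x / (1 - x)) (S j) - x * csum N (fun n => INR (bincoef n j) * Cpow x n))%C <= 2 * Cmod x * (1 / 2) ^ N.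
Proof.
  intro Hx; assert (x0 := Cmod_ge_0 x).
  assert (N1 : (1 - x)%C <> 0%C).
  { apply Cmod_gt_0; generalize (Cmod_triangle_minus 1 x); rewrite Cmod_1; lra. }
  assert (L : forall i, exists v, clim (fun n => csum n (fun n => INR (bincoef n i) * Cpow x n)%C) v /\
    forall n, Cmod (v - csum n (fun n => INR (bincoef n i) * Cpow x n)%C) <= 1 * (1 / 2) ^ n / (1 - 1 / 2)).
  { intro i; apply (csum_geom_limit (fun n => INR (bincoef n i) * Cpow x n)%C 1 (1 / 2)); [lra|lra|]; intro n; rewrite Cmod_mult, Cmod_pow, Cmod_R, Rabs_pos_eq by apply pos_INR.
    rewrite Rmult_1_l.
    apply Rle_trans with (2 ^ n * Cmod x ^ n); [apply Rmult_le_compat_r; [apply pow_le; auto|apply bincoef_le]|].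
    rewrite <- Rpow_mult_distr; apply pow_incr; lra. }
  assert (V : forall i v, clim (fun n => csum n (fun n => INR (bincoef n i) * Cpow x n)%C) v -> (x * v)%C = Cpow (x / (1 - x)) (S i)).
  { induction i as [|i IH]; intros v Hv.
    - assert (E : v = (1 + x * v)%C).
      { apply (clim_unique _ _ _ (clim_shift _ _ Hv)).
        apply (clim_ext (fun n => 1 + x * csum n (fun n => INR (bincoef n 0) * Cpow x n))%C).
        - intro n; rewrite csum_head, <- csum_mult_l; f_equal; [simpl; ring|].
          apply csum_ext; intros m _; destruct m; simpl; ring.
        - apply clim_plus; [intros e He; exists O; intros; rewrite Cmod_minus_diag; exact He|].
          apply clim_mult_l; exact Hv. }
      assert (E' : (v * (1 - x))%C = 1%C).
      { replace (v * (1 - x))%C with (v - x * v)%C by ring; rewrite E at 1; ring. }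
      simpl; transitivity (x * (v * (1 - x)) / (1 - x))%C; [field; auto|]; rewrite E'; field; auto.
    - destruct (L i) as [w [Hw _]]; specialize (IH w Hw).
      assert (E : v = (x * (v + w))%C).
      { apply (clim_unique _ _ _ (clim_shift _ _ Hv)).
        apply (clim_ext (fun n => x * (csum n (fun n => INR (bincoef n (S i)) * Cpow x n) + csum n (fun n => INR (bincoef n i) * Cpow x n)))%C).
        - intro n; rewrite csum_head; simpl bincoef at 3; rewrite <- csum_plus, <- csum_mult_l; simpl (INR 0).
          replace (0 * Cpow x 0)%C with (RtoC 0) by ring; rewrite Cplus_0_l.
          apply csum_ext; intros m _; simpl bincoef; rewrite plus_INR, RtoC_plus; simpl Cpow; ring.
        - apply clim_mult_l, clim_plus; auto. }
      assert (E' : (v * (1 - x))%C = (x * w)%C).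
      { replace (v * (1 - x))%C with (v - x * v)%C by ring; rewrite E at 1; ring. }
      rewrite Cpow_S, <- IH; transitivity (x * (v * (1 - x)) / (1 - x))%C; [field; auto|]; rewrite E'; field; auto. }
  destruct (L j) as [v [Hv B]]; rewrite <- (V j v Hv).
  replace (x * v - x * csum N (fun n => INR (bincoef n j) * Cpow x n))%C with
    (x * (v - csum N (fun n => INR (bincoef n j) * Cpow x n)))%C by ring.
  rewrite Cmod_mult; specialize (B N).
  apply Rmult_le_compat_l with (r := Cmod x) in B; auto.
  eapply Rle_trans; [exact B|]; right; field.
Qed.

(** * Watson's lemma *)

Lemma Carg_cos_sin (z : C) : z <> 0%C -> cos (Carg z) = Re z / Cmod z /\ sin (Carg z) = Im z / Cmod z.
Proof.
  intro Hz; assert (P : 0 < Cmod z) by (apply Cmod_gt_0; auto).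
  assert (E : Cmod z ^ 2 = Re z ^ 2 + Im z ^ 2) by apply Cmod2_alt.
  assert (B : -1 <= Re z / Cmod z <= 1).
  { assert (K := re_le_Cmod z); apply Rabs_le_between in K.
    split; [apply Rle_div_r|apply Rle_div_l]; lra. }
  assert (S : sqrt (1 - Rsqr (Re z / Cmod z)) = Rabs (Im z) / Cmod z).
  { replace (1 - Rsqr (Re z / Cmod z)) with (Rsqr (Rabs (Im z) / Cmod z)).
    - apply sqrt_Rsqr, Rdiv_le_0_compat; [apply Rabs_pos|exact P].
    - rewrite Rsqr_div', Rsqr_div', <- Rsqr_abs; unfold Rsqr.
      replace (Im z * Im z) with (Cmod z * Cmod z - Re z * Re z) by (simpl in E; lra); field; lra. }
  unfold Carg; destruct (Rle_dec 0 (Im z)) as [L|L].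
  - rewrite cos_acos, sin_acos, S, Rabs_pos_eq by auto; auto.
  - rewrite cos_neg, sin_neg, cos_acos, sin_acos, S, Rabs_left by lra; split; [reflexivity|field; lra].
Qed.

Lemma Cexp_Ci (t : R) : Cexp (Ci * t) = cis t.
Proof.
  unfold Cexp, cis, Ci, Cmult, Re, Im, RtoC; simpl.
  replace (0 * t - 1 * 0) with 0 by ring; replace (0 * 0 + 1 * t) with t by ring; rewrite exp_0.
  f_equal; ring.
Qed.

Lemma Cexp_RtoC (x : R) : Cexp x = RtoC (exp x).
Proof. unfold Cexp, Re, Im, RtoC; simpl; rewrite cos_0, sin_0; f_equal; ring. Qed.

Lemma cis_Carg (z : C) : z <> 0%C -> z = (Cmod z * cis (Carg z))%C.
Proof.
  intro Hz; assert (P : 0 < Cmod z) by (apply Cmod_gt_0; auto).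
  destruct (Carg_cos_sin z Hz) as [E1 E2]; unfold cis; rewrite E1, E2.
  destruct z as [x y]; unfold RtoC, Cmult, Re, Im; simpl; f_equal; field; lra.
Qed.

Lemma Carg_ray (s theta : R) : 0 < s -> cos (theta - Carg (s * cis theta)) = 1.
Proof.
  intro Hs.
  assert (M : Cmod (s * cis theta) = s) by (rewrite Cmod_mult, Cmod_cis, Cmod_R, Rabs_pos_eq; lra).
  assert (N : (s * cis theta)%C <> 0%C) by (apply Cmod_gt_0; rewrite M; auto).
  destruct (Carg_cos_sin _ N) as [E1 E2]; rewrite cos_minus, E1, E2, M.
  unfold cis, Re, Im; simpl; generalize (sin2_cos2 theta); unfold Rsqr; intro K.
  replace (cos theta * ((s * cos theta - 0 * sin theta) / s) + sin theta * ((s * sin theta + 0 * cos theta) / s))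
    with (sin theta * sin theta + cos theta * cos theta) by (field; lra); exact K.
Qed.

Definition ray (theta t : R) : C := (t * Cexp (Ci * theta))%C.

Lemma ray_pderiv (theta t : R) : pderiv (ray theta) t (cis theta).
Proof.
  intros eps He; exists 1; split; [lra|]; intros s _; unfold ray; rewrite Cexp_Ci.
  replace (s * cis theta - t * cis theta - (s - t)%R * cis theta)%C with (RtoC 0) by (rewrite RtoC_minus; ring).
  rewrite Cmod_0; apply Rmult_le_pos; [lra|apply Rabs_pos].
Qed.

Lemma ray_velocity (theta t : R) : velocity (ray theta) t = cis theta.
Proof.
  unfold velocity.
  assert (E1 : Derive (fun s => fst (ray theta s)) t = fst (cis theta)) by apply is_derive_unique, pderiv_fst, ray_pderiv.
  assert (E2 : Derive (fun s => snd (ray theta s)) t = snd (cis theta)) by apply is_derive_unique, pderiv_snd, ray_pderiv.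
  rewrite E1, E2; reflexivity.
Qed.

Lemma Cmod_ray (theta t : R) : 0 <= t -> Cmod (ray theta t) = t.
Proof. intro; unfold ray; rewrite Cexp_Ci, Cmod_mult, Cmod_cis, Cmod_R, Rabs_pos_eq; lra. Qed.

(** As a contour, the ray inherits absolute convergence, linearity and uniqueness of integrals, so
    that Laplace transforms need no theory of their own. *)
Lemma ray_contour (theta : R) : contour 0 p_infty nil (ray theta).
Proof.
  assert (V : forall F : (R -> Prop) -> Prop, Filter F -> filterlim (velocity (ray theta)) F (locally (T := C_UniformSpace) (cis theta))).
  { intros F FF; apply (filterlim_Cmod F); intros eps He; apply filter_forall; intro x.
    rewrite ray_velocity, Cmod_minus_diag; exact He. }
  constructor.
  - exact I.
  - intros t _; apply (filterlim_Cmod (within _ (locally t))); intros eps He.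
    destruct (pderiv_ccont _ _ _ (ray_pderiv theta t) eps He) as [d [Hd D]].
    exists (mkposreal d Hd); intros s Hs _; apply D; exact Hs.
  - intros t _ _; split; [exists (cis theta); apply is_derive_pderiv, ray_pderiv|].
    rewrite ray_velocity; apply V, locally_filter.
  - intros t _ _; exists (cis theta); apply V, at_left_proper_filter.
  - intros t _ _; exists (cis theta); apply V, at_right_proper_filter.
  - discriminate.
  - intros _; apply (is_lim_ext_loc (fun t => t)); [|apply is_lim_id].
    exists 0; intros t Ht; rewrite Cmod_ray; lra.
Qed.

Lemma param_ray (t : R) : param 0 p_infty t <-> 0 <= t.
Proof. unfold param; simpl; tauto. Qed.

Lemma is_laplace_cint (theta : R) (chi : C -> C) (gam v : C) :
  is_laplace theta chi gam v <-> is_cint 0 p_infty (ray theta) (fun xi => Cexp (- (xi / gam)) * chi xi)%C v.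
Proof.
  assert (E : forall t : R, (let xi := (t * Cexp (Ci * theta))%C in (Cexp (- (xi / gam)) * chi xi * Cexp (Ci * theta))%C) =
    ((fun xi => Cexp (- (xi / gam)) * chi xi)%C (ray theta t) * velocity (ray theta) t)%C).
  { intro t; rewrite ray_velocity; unfold ray; rewrite Cexp_Ci; reflexivity. }
  unfold is_laplace, is_cint; split; intro H;
    (eapply (is_RInt_gen_ext (V := CR)); [|exact H]); apply filter_forall; intros [x y] t _; rewrite E; reflexivity.
Qed.

Lemma pow_exp_bound (beta t : R) (k : nat) : 0 < beta -> 0 <= t ->
  t ^ k * exp (- beta * t) <= INR (fact k) * (2 / beta) ^ k * exp (- (beta / 2) * t).
Proof.
  intros Hb Ht; assert (F := INR_fact_lt_0 k).
  assert (K := pow_fact_exp (beta / 2 * t) k ltac:(apply Rmult_le_pos; lra)).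
  assert (Q : 0 < (beta / 2) ^ k) by (apply pow_lt; lra).
  assert (K2 : t ^ k <= INR (fact k) * (2 / beta) ^ k * exp (beta / 2 * t)).
  { rewrite Rpow_mult_distr in K; apply Rle_div_l in K; [|lra].
    replace ((2 / beta) ^ k) with (/ (beta / 2) ^ k) by (rewrite <- pow_inv; f_equal; field; lra).
    apply Rmult_le_reg_l with ((beta / 2) ^ k); auto.
    replace ((beta / 2) ^ k * (INR (fact k) * / (beta / 2) ^ k * exp (beta / 2 * t))) with
      (exp (beta / 2 * t) * INR (fact k)) by (field; lra); exact K. }
  replace (- (beta / 2) * t) with (beta / 2 * t + - beta * t) by field; rewrite exp_plus.
  rewrite <- Rmult_assoc; apply Rmult_le_compat_r; [left; apply exp_pos|exact K2].
Qed.

(** Half of the decay absorbs the power, t^k e^(-beta t/2) <= k! (2/beta)^k, and integrating the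
    other half gives one more factor 2/beta. The exponent S k is what makes the transform of a
    remainder O(t^k) small of order k + 1. *)
Lemma ray_absint (theta : R) (F : C -> C) (M beta : R) (k : nat) : 0 <= M -> 0 < beta ->
  (forall t, 0 <= t -> Cmod (F (ray theta t)) <= M * (t ^ k * exp (- beta * t))) ->
  absint 0 p_infty (ray theta) F (M * (INR (fact k) * (2 / beta) ^ S k)).
Proof.
  intros HM Hb HF a b y Ha Hb' Hab Hy; apply param_ray in Ha; apply param_ray in Hb'.
  set (C1 := M * (INR (fact k) * (2 / beta) ^ k)).
  assert (HC1 : 0 <= C1).
  { apply Rmult_le_pos; auto; apply Rmult_le_pos; [apply pos_INR|apply pow_le, Rdiv_le_0_compat; lra]. }
  set (G := fun t => - C1 * (2 / beta) * exp (- (beta / 2) * t)).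
  assert (I : is_RInt (fun t => C1 * exp (- (beta / 2) * t)) a b (G b - G a)).
  { apply (is_RInt_derive (V := R_CompleteNormedModule) G); intros t _.
    - eapply is_derive_val; [apply (is_derive_exp_comp _ (fun t => t) t _ 1 (is_derive_id t))|field; lra].
    - apply (ex_derive_continuous (V := R_NormedModule)); auto_derive; auto. }
  apply Rle_trans with (G b - G a).
  - apply (is_RInt_le (abs_integrand (ray theta) F) (fun t => C1 * exp (- (beta / 2) * t)) a b); auto.
    intros t Ht; unfold abs_integrand; rewrite ray_velocity, Cmod_cis, Rmult_1_r.
    eapply Rle_trans; [apply HF; lra|]; unfold C1; rewrite Rmult_assoc; apply Rmult_le_compat_l; auto.
    apply pow_exp_bound; lra.
  - assert (E : forall t, 0 <= t -> 0 < exp (- (beta / 2) * t) <= 1).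
    { intros t Ht; split; [apply exp_pos|]; rewrite <- exp_0; apply exp_le; nra. }
    generalize (E a Ha) (E b Hb'); intros Ea Eb; unfold G.
    replace (- C1 * (2 / beta) * exp (- (beta / 2) * b) - - C1 * (2 / beta) * exp (- (beta / 2) * a)) with
      (C1 * (2 / beta) * (exp (- (beta / 2) * a) - exp (- (beta / 2) * b))) by ring.
    replace (M * (INR (fact k) * (2 / beta) ^ S k)) with (C1 * (2 / beta) * 1) by (unfold C1; simpl; ring).
    apply Rmult_le_compat_l; [apply Rmult_le_pos; [auto|apply Rdiv_le_0_compat; lra]|lra].
Qed.

Lemma holo_at_Cexp_ray_cont (gam : C) (z : C) : cont_at (fun xi => Cexp (- (xi / gam))) z.
Proof.
  assert (K : forall w : C, cont_at Cexp w).
  { intros w eps He; assert (P := exp_pos (Re w)).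
    exists (Rmin 1 (eps / (exp (Re w) * exp 1 * 2))); split.
    { apply Rmin_glb_lt; [lra|]; apply Rdiv_lt_0_compat; auto.
      assert (Q := exp_pos 1); apply Rmult_lt_0_compat; [apply Rmult_lt_0_compat; auto|lra]. }
    intros y Hy.
    assert (Y1 : Cmod (y - w) < 1) by (eapply Rlt_le_trans; [apply Hy|apply Rmin_l]).
    assert (Y2 : Cmod (y - w) < eps / (exp (Re w) * exp 1 * 2)) by (eapply Rlt_le_trans; [apply Hy|apply Rmin_r]).
    replace y with (w + (y - w))%C by ring; rewrite Cexp_add.
    replace (Cexp w * Cexp (y - w) - Cexp w)%C with (Cexp w * (Cexp (y - w) - exp_poly 1 (y - w)))%C
      by (unfold exp_poly; simpl; field).
    rewrite Cmod_mult, Cmod_Cexp; assert (R := Cexp_remainder 1 (y - w)%C).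
    set (h := Cmod (y - w)) in *; assert (h0 : 0 <= h) by apply Cmod_ge_0.
    assert (Q := exp_pos 1).
    assert (X : exp h <= exp 1) by (apply exp_le; lra).
    replace (h ^ 1 / INR (fact 1) * exp h) with (h * exp h) in R by (simpl; field).
    apply Rle_lt_trans with (exp (Re w) * (h * exp 1)).
    - apply Rmult_le_compat_l; [lra|]; eapply Rle_trans; [exact R|]; apply Rmult_le_compat_l; auto.
    - apply Rlt_div_r in Y2; [|apply Rmult_lt_0_compat; [apply Rmult_lt_0_compat; auto|lra]].
      assert (0 <= h * (exp (Re w) * exp 1)) by (apply Rmult_le_pos; [auto|left; apply Rmult_lt_0_compat; auto]); lra. }
  intros eps He; destruct (K (- (z / gam))%C eps He) as [d [Hd D]].
  assert (G : 0 < Cmod (/ gam) + 1) by (generalize (Cmod_ge_0 (/ gam)); lra).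
  exists (d / (Cmod (/ gam) + 1)); split; [apply Rdiv_lt_0_compat; auto|]; intros y Hy; apply D.
  replace (- (y / gam) - - (z / gam))%C with (- ((y - z) * / gam))%C by (unfold Cdiv; ring).
  rewrite Cmod_opp, Cmod_mult; apply Rlt_div_r in Hy; [|auto]; generalize (Cmod_ge_0 (y - z)); nra.
Qed.

(** On the ray gam = s cis theta the exponent xi/gam = t/s is real, and the integrand has an
    elementary primitive that decays at infinity. *)
Lemma laplace_monomial (theta s : R) (n : nat) : 0 < s ->
  is_laplace theta (fun xi => Cpow xi n) (s * cis theta) (INR (fact n) * Cpow (s * cis theta) (S n)).
Proof.
  intro Hs; apply is_laplace_cint; apply is_cint_iff; [exact I|]; intros eps He.
  set (gam := (s * cis theta)%C).
  assert (Mg : Cmod gam = s) by (unfold gam; rewrite Cmod_mult, Cmod_cis, Cmod_R, Rabs_pos_eq; lra).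
  assert (Ng : gam <> 0%C) by (apply Cmod_gt_0; rewrite Mg; auto).
  set (k := (INR (fact n) * Cpow gam (S n))%C).
  (* With x = t/s the derivative of -e^(-x) (1 + x + ... + x^n/n!) with respect to x is e^(-x)
     x^n/n!, because all other terms cancel. As q(0) = -1, the integral of the primitive k q is
     k. *)
  set (q := fun t : R => (- (Cexp (t * (- / s)) * exp_poly (S n) (t * / s)))%C).
  assert (Ns : RtoC s <> 0%C) by (intro E; apply RtoC_inj in E; lra).
  assert (arg : forall t : R, (ray theta t / gam)%C = (t * / s)%C).
  { intro t; unfold ray, gam; rewrite Cexp_Ci; field; auto using cis_neq_0. }
  assert (D : forall t, pderiv (fun t => k * q t)%C t (arc_integrand (ray theta) (fun xi => Cexp (- (xi / gam)) * Cpow xi n)%C t)).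
  { intro t.
    assert (P1 := Cexp_pderiv (- / s)%C t).
    assert (py : pderiv (fun t : R => t * / s)%C t (/ s)%C).
    { intros e Hee; exists 1; split; [lra|]; intros s' _.
      replace (s' * / s - t * / s - (s' - t)%R * / s)%C with (RtoC 0) by (rewrite RtoC_minus; ring).
      rewrite Cmod_0; apply Rmult_le_pos; [lra|apply Rabs_pos]. }
    assert (P2 := cderiv_pderiv (exp_poly (S n)) (fun t => t * / s)%C t _ _ (exp_poly_cderiv n _) py).
    cbv beta in P2.
    set (e := fun t : R => Cexp (t * (- / s))) in *; set (p := fun t : R => exp_poly (S n) (t * / s)) in *.
    assert (PR : pderiv (fun t => e t * p t)%C t (e t * - / s * p t + e t * (exp_poly n (t * / s) * / s))%C).
    { intros e0 He0.
      assert (Cp := pderiv_ccont _ _ _ P2).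
      set (A := Cmod (e t * - / s)%C + 1); set (Bp := Cmod (p t) + 1); set (Ce := Cmod (e t) + 1).
      assert (HA : 0 < A) by (unfold A; generalize (Cmod_ge_0 (e t * - / s)%C); lra).
      assert (HB : 0 < Bp) by (unfold Bp; generalize (Cmod_ge_0 (p t)); lra).
      assert (HC : 0 < Ce) by (unfold Ce; generalize (Cmod_ge_0 (e t)); lra).
      destruct (P1 (e0 / (3 * Bp))) as [d1 [Hd1 D1]]; [apply Rdiv_lt_0_compat; lra|].
      destruct (P2 (e0 / (3 * Ce))) as [d2 [Hd2 D2]]; [apply Rdiv_lt_0_compat; lra|].
      destruct (Cp (Rmin 1 (e0 / (3 * A)))) as [d3 [Hd3 D3]].
      { apply Rmin_glb_lt; [lra|apply Rdiv_lt_0_compat; lra]. }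
      exists (Rmin d1 (Rmin d2 d3)); split; [repeat apply Rmin_glb_lt; auto|]; intros s' Hs'.
      assert (S1 : Rabs (s' - t) < d1) by (eapply Rlt_le_trans; [apply Hs'|apply Rmin_l]).
      assert (S' : Rabs (s' - t) < Rmin d2 d3) by (eapply Rlt_le_trans; [apply Hs'|apply Rmin_r]).
      specialize (D1 s' S1); specialize (D2 s' (Rlt_le_trans _ _ _ S' (Rmin_l _ _))).
      specialize (D3 s' (Rlt_le_trans _ _ _ S' (Rmin_r _ _))).
      fold (e s') (e t) in D1; fold (p s') (p t) in D2, D3.
      generalize (Rmin_l 1 (e0 / (3 * A))) (Rmin_r 1 (e0 / (3 * A))); intros M1 M2.
      set (h := Rabs (s' - t)) in *; assert (Hh : 0 <= h) by apply Rabs_pos.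
      assert (G : Cmod (p s') <= Bp) by (unfold Bp; generalize (Cmod_triangle_minus (p s') (p t)); lra).
      replace (e s' * p s' - e t * p t - (s' - t)%R * (e t * - / s * p t + e t * (exp_poly n (t * / s) * / s)))%C with
        (((e s' - e t - (s' - t)%R * (e t * - / s)) * p s' + (s' - t)%R * ((e t * - / s) * (p s' - p t)))
         + e t * (p s' - p t - (s' - t)%R * (exp_poly n (t * / s) * / s)))%C by ring.
      assert (B1 : Cmod ((e s' - e t - (s' - t)%R * (e t * - / s)) * p s') <= e0 / 3 * h).
      { rewrite Cmod_mult; replace (e0 / 3 * h) with ((e0 / (3 * Bp) * h) * Bp) by (field; lra).
        apply Rmult_le_compat; auto using Cmod_ge_0. }
      assert (B2 : Cmod ((s' - t)%R * ((e t * - / s) * (p s' - p t))) <= e0 / 3 * h).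
      { rewrite Cmod_mult, (Cmod_mult (e t * - / s)), Cmod_R; fold h.
        replace (e0 / 3 * h) with (h * (A * (e0 / (3 * A)))) by (field; lra).
        apply Rmult_le_compat_l; auto; apply Rmult_le_compat; auto using Cmod_ge_0; [unfold A|]; lra. }
      assert (B3 : Cmod (e t * (p s' - p t - (s' - t)%R * (exp_poly n (t * / s) * / s))) <= e0 / 3 * h).
      { rewrite Cmod_mult; replace (e0 / 3 * h) with (Ce * (e0 / (3 * Ce) * h)) by (field; lra).
        apply Rmult_le_compat; auto using Cmod_ge_0; unfold Ce; lra. }
      eapply Rle_trans; [apply Cmod_triangle|].
      eapply Rle_trans; [apply Rplus_le_compat_r, Cmod_triangle|]; lra. }
    assert (K := cderiv_pderiv (fun y => (- k) * y)%C (fun t => e t * p t)%C t _ _ (cderiv_scal (- k) (fun y => y) _ _ (cderiv_id _)) PR).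
    intros e0 He0; destruct (K e0 He0) as [d [Hd Dd]]; exists d; split; auto; intros s' Hs'; specialize (Dd s' Hs').
    replace (k * q s' - k * q t - (s' - t)%R * arc_integrand (ray theta) (fun xi => Cexp (- (xi / gam)) * Cpow xi n)%C t)%C
      with (- k * (e s' * p s') - - k * (e t * p t) -
        (s' - t)%R * (- k * 1 * (e t * - / s * p t + e t * (exp_poly n (t * / s) * / s))))%C; [exact Dd|].
    unfold q; fold (e s') (e t) (p s') (p t).
    assert (Ep : p t = (exp_poly n (t * / s) + / INR (fact n) * Cpow (t * / s) n)%C) by reflexivity.
    assert (Ea : arc_integrand (ray theta) (fun xi => Cexp (- (xi / gam)) * Cpow xi n)%C t =
      (e t * (Cpow (t * / s) n * Cpow gam n * cis theta))%C).
    { unfold arc_integrand; rewrite ray_velocity, arg.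
      replace (- (t * / s))%C with (t * - / s)%C by ring; fold (e t).
      rewrite <- Cpow_mult_l; replace (t * / s * gam)%C with (ray theta t); [ring|].
      rewrite <- arg; field; exact Ng. }
    rewrite Ea.
    assert (Ek : (k * (e t * / INR (fact n) * Cpow (t * / s) n * / s))%C = (e t * (Cpow (t * / s) n * Cpow gam n * cis theta))%C).
    { unfold k; rewrite Cpow_S; unfold gam at 1; field; auto using INR_fact_neq. }
    rewrite <- Ek, Ep; ring. }
  assert (small : exists M, forall t, 0 <= t -> Cmod (q t) <= M * exp (- (/ s / 2) * t)).
  { unfold q; assert (Z : forall m, exists M, 0 <= M /\ forall x, 0 <= x -> Cmod (exp_poly m x) <= M * exp (x / 2)).
    { induction m as [|m [M [HM IH]]]; [exists 0; split; [lra|]; intros; unfold exp_poly; simpl; rewrite Cmod_0; lra|].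
      exists (M + 2 ^ m); split; [assert (0 < 2 ^ m) by (apply pow_lt; lra); lra|]; intros x Hx; unfold exp_poly; simpl csum.
      eapply Rle_trans; [apply Cmod_triangle|]; rewrite Rmult_plus_distr_r; apply Rplus_le_compat; [apply IH; auto|].
      rewrite Cmod_mult, Cmod_inv by apply INR_fact_neq; rewrite Cmod_pow, !Cmod_R, (Rabs_pos_eq x), Rabs_pos_eq by (auto; apply pos_INR).
      assert (K := pow_fact_exp (x / 2) m ltac:(lra)); unfold Rdiv in K at 1 2; rewrite Rpow_mult_distr, pow_inv in K.
      assert (P2 : 0 < 2 ^ m) by (apply pow_lt; lra); apply Rmult_le_compat_l with (r := 2 ^ m) in K; [|lra].
      eapply Rle_trans; [|exact K]; right; field; split; [apply INR_fact_neq_0|apply pow_nonzero; lra]. }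
    destruct (Z (S n)) as [M [HM HZ]]; exists M; intros t Ht.
    rewrite Cmod_opp, Cmod_mult.
    assert (Is : 0 < / s) by (apply Rinv_0_lt_compat; auto).
    replace (t * - / s)%C with (RtoC (- (/ s * t))) by (rewrite RtoC_opp, RtoC_mult, RtoC_inv by lra; ring).
    replace (t * / s)%C with (RtoC (/ s * t)) by (rewrite RtoC_mult, RtoC_inv by lra; ring).
    rewrite Cexp_RtoC, Cmod_R, Rabs_pos_eq by (left; apply exp_pos).
    eapply Rle_trans; [apply Rmult_le_compat_l; [left; apply exp_pos|apply HZ; nra]|].
    right; replace (- (/ s / 2) * t) with (- (/ s * t) + / s * t / 2) by (field; lra); rewrite exp_plus; ring. }
  destruct small as [M HM].
  assert (q0 : q 0 = (- (1))%C).
  { unfold q; replace (0 * - / s)%C with (RtoC 0) by ring; rewrite Cexp_0.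
    replace (0 * / s)%C with (RtoC 0) by ring.
    replace (exp_poly (S n) 0) with (RtoC 1); [ring|].
    clear; induction n as [|n IH]; [unfold exp_poly; simpl; field|].
    change (exp_poly (S (S n)) 0) with (exp_poly (S n) 0 + / INR (fact (S n)) * Cpow 0 (S n))%C.
    rewrite <- IH; simpl; ring. }
  set (Kk := Cmod k * (Rabs M + 1) + 1).
  assert (HK : 0 < Kk) by (unfold Kk; generalize (Cmod_ge_0 k) (Rabs_pos M); intros; nra).
  assert (T : exists T, 0 <= T /\ forall t, T <= t -> Kk * exp (- (/ s / 2) * t) < eps).
  { assert (Is : 0 < / s / 2) by (apply Rdiv_lt_0_compat; [apply Rinv_0_lt_compat; auto|lra]).
    exists (Rmax 0 ((Kk / eps) / (/ s / 2))); split; [apply Rmax_l|]; intros t Ht.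
    assert (L : Kk / eps / (/ s / 2) <= t) by (eapply Rle_trans; [apply Rmax_r|exact Ht]).
    apply Rle_div_l in L; [|auto].
    assert (X : Kk / eps < exp (/ s / 2 * t)).
    { generalize (exp_ineq1_le (/ s / 2 * t)); lra. }
    replace (- (/ s / 2) * t) with (- (/ s / 2 * t)) by ring; rewrite exp_Ropp.
    assert (P := exp_pos (/ s / 2 * t)); apply Rlt_div_l in X; [|auto].
    apply Rmult_lt_reg_r with (exp (/ s / 2 * t)); auto.
    replace (Kk * / exp (/ s / 2 * t) * exp (/ s / 2 * t)) with Kk by (field; lra); lra. }
  destruct T as [T [HT0 HT]].
  exists 0, T; psplit; [apply param_ray; lra|apply param_ray; lra|exact HT0|].
  intros a b' Ha Hb' La Lb; apply param_ray in Ha; assert (a = 0) by lra; subst a.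
  exists (k * q b' - k * q 0)%C; split.
  - apply (is_RInt_derive (V := C_R_CompleteNormedModule) (fun t => k * q t)%C); intros t _.
    + apply is_derive_pderiv, D.
    + apply continuous_ccont; unfold arc_integrand.
      apply ccont_mult.
      * apply (ccont_comp (fun xi => Cexp (- (xi / gam)) * Cpow xi n)%C (ray theta)); [|eapply pderiv_ccont, ray_pderiv].
        apply cont_at_mult; [apply holo_at_Cexp_ray_cont|apply holo_cont_at, holo_at_pow].
      * intros e0 He0; exists 1; split; [lra|]; intros; rewrite !ray_velocity, Cmod_minus_diag; exact He0.
  - rewrite q0; fold gam k; replace (k * q b' - k * - (1) - k)%C with (k * q b')%C by ring.
    rewrite Cmod_mult; eapply Rle_lt_trans; [|apply (HT b' Lb)].
    assert (Hb0 : 0 <= b') by lra; specialize (HM b' Hb0).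
    assert (P := exp_pos (- (/ s / 2) * b')).
    apply Rle_trans with (Cmod k * ((Rabs M + 1) * exp (- (/ s / 2) * b'))).
    + apply Rmult_le_compat_l; [apply Cmod_ge_0|]; generalize (Rle_abs M); nra.
    + unfold Kk; lra.
Qed.

Lemma csum_S (n : nat) (u : nat -> C) : csum (S n) u = (csum n u + u n)%C.
Proof. reflexivity. Qed.

Lemma cont_at_minus (F G : C -> C) (z : C) : cont_at F z -> cont_at G z -> cont_at (fun y => F y - G y)%C z.
Proof.
  intros HF HG eps He; destruct (HF (eps / 2)) as [d1 [Hd1 D1]]; [lra|]; destruct (HG (eps / 2)) as [d2 [Hd2 D2]]; [lra|].
  exists (Rmin d1 d2); split; [apply Rmin_glb_lt; auto|]; intros y Hy.
  specialize (D1 y (Rlt_le_trans _ _ _ Hy (Rmin_l _ _))); specialize (D2 y (Rlt_le_trans _ _ _ Hy (Rmin_r _ _))).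
  replace (F y - G y - (F z - G z))%C with ((F y - F z) - (G y - G z))%C by ring.
  eapply Rle_lt_trans; [apply Cmod_minus_le|]; lra.
Qed.

(** For t < r/2 the remainder of the power series applies. For t >= r/2 the factor (2t/r)^N is at
    least 1 and absorbs both the exponential bound on chi and the polynomial that is subtracted. *)
Lemma ray_taylor_bound (theta : R) (chi : C -> C) (d : nat -> C) (M r K a : R) (N : nat) :
  0 < r -> pbound d M r -> (forall xi, Cmod xi < r -> pser d xi (chi xi)) -> 0 <= a ->
  (forall t, 0 <= t -> Cmod (chi (ray theta t)) <= K * exp (a * t)) ->
  exists MN, 0 <= MN /\ forall t, 0 <= t ->
    Cmod (chi (ray theta t) - csum N (fun n => d n * Cpow (ray theta t) n)%C) <= MN * (t ^ N * exp (a * t)).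
Proof.
  intros Hr PB PS Ha HK; assert (M0 := pbound_nonneg _ _ _ PB).
  assert (K0 : 0 <= K).
  { specialize (HK 0 (Rle_refl 0)); rewrite Rmult_0_r, exp_0, Rmult_1_r in HK.
    eapply Rle_trans; [apply Cmod_ge_0|exact HK]. }
  assert (P2 : 0 < (2 / r) ^ N) by (apply pow_lt, Rdiv_lt_0_compat; lra).
  assert (M1 : 0 <= 2 * M / r ^ N) by (apply Rdiv_le_0_compat; [lra|apply pow_lt; auto]).
  assert (M2 : 0 <= (K + INR N * M) * (2 / r) ^ N).
  { apply Rmult_le_pos; [|lra]; assert (0 <= INR N * M) by (apply Rmult_le_pos; [apply pos_INR|auto]); lra. }
  exists (2 * M / r ^ N + (K + INR N * M) * (2 / r) ^ N); split; [lra|]; intros t Ht.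
  assert (Mt := Cmod_ray theta t Ht).
  assert (Ee : 1 <= exp (a * t)) by (rewrite <- exp_0; apply exp_le; nra).
  assert (tN : 0 <= t ^ N) by (apply pow_le; auto).
  destruct (Rlt_dec t (r / 2)) as [L|L].
  - assert (B := pser_remainder d M r (ray theta t) _ N Hr PB ltac:(rewrite Mt; lra) (PS _ ltac:(rewrite Mt; lra))).
    rewrite Mt in B; eapply Rle_trans; [exact B|].
    apply Rle_trans with (2 * M / r ^ N * t ^ N).
    + unfold Rdiv at 1 2; rewrite Rpow_mult_distr, pow_inv.
      assert (Q : / (1 - t * / r) <= 2).
      { replace 2 with (/ (1 / 2)) by field; apply Rinv_le_contravar; [lra|].
        assert (t / r <= 1 / 2) by (apply Rle_div_l; lra); unfold Rdiv in *; lra. }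
      replace (2 * M / r ^ N * t ^ N) with (M * (t ^ N * / r ^ N) * 2) by (field; apply pow_nonzero; lra).
      apply Rmult_le_compat_l; [|exact Q].
      apply Rmult_le_pos; auto; apply Rmult_le_pos; auto; left; apply Rinv_0_lt_compat, pow_lt; auto.
    + assert (X1 : 0 <= 2 * M / r ^ N * t ^ N) by (apply Rmult_le_pos; auto).
      assert (X2 : 0 <= (K + INR N * M) * (2 / r) ^ N * t ^ N) by (apply Rmult_le_pos; auto).
      rewrite <- Rmult_assoc, Rmult_plus_distr_r; nra.
  - assert (T1 : 1 <= 2 / r * t).
    { replace 1 with (2 / r * (r / 2)) by (field; lra); apply Rmult_le_compat_l; [|lra].
      left; apply Rdiv_lt_0_compat; lra. }
    assert (T2 : 1 <= (2 / r * t) ^ N) by (apply pow_R1_Rle; exact T1).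
    assert (S : Cmod (csum N (fun n => d n * Cpow (ray theta t) n)%C) <= INR N * M * (2 / r * t) ^ N).
    { assert (G : forall k, (k <= N)%nat -> Cmod (csum k (fun n => d n * Cpow (ray theta t) n)%C) <= INR k * M * (2 / r * t) ^ N).
      { induction k as [|k IH]; intro Hk; [simpl; rewrite Cmod_0; lra|]; simpl csum.
        eapply Rle_trans; [apply Cmod_triangle|]; rewrite S_INR.
        replace ((INR k + 1) * M * (2 / r * t) ^ N) with (INR k * M * (2 / r * t) ^ N + M * (2 / r * t) ^ N) by ring.
        apply Rplus_le_compat; [apply IH; lia|].
        eapply Rle_trans; [apply (pbound_term d M r _ k Hr PB)|]; rewrite Mt; apply Rmult_le_compat_l; auto.
        apply Rle_trans with ((2 / r * t) ^ k).
        - apply pow_incr; split; [apply Rdiv_le_0_compat; lra|].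
          unfold Rdiv; assert (0 <= t * / r) by (apply Rmult_le_pos; [auto|left; apply Rinv_0_lt_compat; auto]); lra.
        - apply Rle_pow; [exact T1|lia]. }
      apply G; lia. }
    eapply Rle_trans; [apply Cmod_minus_le|].
    apply Rle_trans with (K * exp (a * t) + INR N * M * (2 / r * t) ^ N); [apply Rplus_le_compat; auto|].
    rewrite Rpow_mult_distr in *.
    set (Z := (2 / r) ^ N * t ^ N) in *.
    assert (NM : 0 <= INR N * M) by (apply Rmult_le_pos; [apply pos_INR|auto]).
    apply Rle_trans with ((K + INR N * M) * (Z * exp (a * t))).
    + rewrite Rmult_plus_distr_r; apply Rplus_le_compat; apply Rmult_le_compat_l; auto; nra.
    + assert (X1 : 0 <= 2 * M / r ^ N * (t ^ N * exp (a * t))) by (apply Rmult_le_pos; auto; nra).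
      unfold Z; rewrite Rmult_plus_distr_r; nra.
Qed.

(** Subtracting N Taylor terms of chi, whose transforms are known, leaves a remainder O(t^N e^(at)),
    with transform O(s^(N+1)) at gam = s cis theta. So psi has an asymptotic expansion along the
    ray, and it must agree with its convergent Taylor series there. *)
Lemma watson (theta : R) (chi psi : C -> C) (c d : nat -> C) (M1 r1 M2 r2 al K a : R) :
  0 < r1 -> pbound c M1 r1 -> (forall g, Cmod g < r1 -> pser c g (psi g)) ->
  0 < r2 -> pbound d M2 r2 -> (forall xi, Cmod xi < r2 -> pser d xi (chi xi)) ->
  0 <= a -> (forall t, 0 <= t -> Cmod (chi (ray theta t)) <= K * exp (a * t)) ->
  (forall z, trace 0 p_infty (ray theta) z -> cont_at chi z) ->
  is_inverse_laplace theta al psi chi ->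
  c O = 0%C /\ forall n, c (S n) = (INR (fact n) * d n)%C.
Proof.
  intros Hr1 PB1 PS1 Hr2 PB2 PS2 Ha HK HC HL.
  (* The transform of xi^n is n! gam^(n+1): coefficients are shifted by one and the constant term is
     0. *)
  set (w := fun j => match j with O => RtoC 0 | S n => (INR (fact n) * d n)%C end).
  assert (E : forall j, ((c j - w j) * Cpow (cis theta) j)%C = 0%C).
  { apply coeff_zero; intros [|N]; [exists 0, 1; split; [lra|]; intros; simpl; rewrite Cmod_0; lra|].
    destruct (ray_taylor_bound theta chi d M2 r2 K a N Hr2 PB2 PS2 Ha HK) as [MN [HMN0 HMN]].
    (* For s < del the Taylor remainder of psi is controlled, s al < 1/2 puts gam where the
       transform of chi is psi, and s a < 1/2 gives 1/s - a >= 1/(2s), hence 2/beta <= 4s. *)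
    set (del := Rmin (r1 / 2) (Rmin (1 / (2 * (Rabs al + 1))) (1 / (2 * (a + 1))))).
    assert (P1 := Rabs_pos al).
    exists (2 * M1 / r1 ^ S N + MN * (INR (fact N) * 4 ^ S N)), del; split.
    { repeat apply Rmin_glb_lt; [lra|apply Rdiv_lt_0_compat; lra|apply Rdiv_lt_0_compat; lra]. }
    intros s [Hs0 Hs].
    assert (S1 : s < r1 / 2) by (eapply Rlt_le_trans; [exact Hs|apply Rmin_l]).
    assert (S' : s < Rmin (1 / (2 * (Rabs al + 1))) (1 / (2 * (a + 1)))) by (eapply Rlt_le_trans; [exact Hs|apply Rmin_r]).
    assert (S2 : s < 1 / (2 * (Rabs al + 1))) by (eapply Rlt_le_trans; [exact S'|apply Rmin_l]).
    assert (S3 : s < 1 / (2 * (a + 1))) by (eapply Rlt_le_trans; [exact S'|apply Rmin_r]).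
    apply Rlt_div_r in S2; [|lra]; apply Rlt_div_r in S3; [|lra].
    set (gam := (s * cis theta)%C).
    assert (Mg : Cmod gam = s) by (unfold gam; rewrite Cmod_mult, Cmod_cis, Cmod_R, Rabs_pos_eq; lra).
    assert (Ng : gam <> 0%C) by (apply Cmod_gt_0; rewrite Mg; auto).
    assert (Lap : is_laplace theta chi gam (psi gam)).
    { apply HL; auto; rewrite Mg; unfold gam; rewrite Carg_ray by auto; generalize (Rle_abs al); nra. }
    assert (Lap' := proj1 (is_laplace_cint theta chi gam (psi gam)) Lap).
    assert (LapN : forall m, is_cint 0 p_infty (ray theta)
      (fun xi => Cexp (- (xi / gam)) * (chi xi - csum m (fun n => d n * Cpow xi n)))%C
      (psi gam - csum m (fun n => w (S n) * Cpow gam (S n)))%C).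
    { induction m as [|m IH].
      - simpl; rewrite Cminus_0_r; eapply is_cint_ext; [exact I| |exact Lap']; intros; simpl; ring.
      - assert (LM := proj1 (is_laplace_cint _ _ _ _) (laplace_monomial theta s m Hs0)).
        assert (L := is_cint_lin 0 p_infty (ray theta) _ _ (- d m)%C _ _ I IH LM).
        replace (psi gam - csum (S m) (fun n => w (S n) * Cpow gam (S n)))%C with
          (psi gam - csum m (fun n => w (S n) * Cpow gam (S n)) + - d m * (INR (fact m) * Cpow gam (S m)))%C
          by (rewrite csum_S; change (w (S m)) with (INR (fact m) * d m)%C; ring).
        eapply is_cint_ext; [exact I| |exact L]; intros z _; rewrite csum_S; fold gam; ring. }
    specialize (LapN N).
    set (beta := / s - a).
    assert (Is : 0 < / s) by (apply Rinv_0_lt_compat; auto).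
    assert (as1 : a <= / s / 2).
    { apply Rmult_le_reg_l with s; auto; replace (s * (/ s / 2)) with (1 / 2) by (field; lra); nra. }
    assert (Hbeta : 0 < beta) by (unfold beta; lra).
    destruct (absint_cint 0 p_infty nil (ray theta)
      (fun xi => Cexp (- (xi / gam)) * (chi xi - csum N (fun n => d n * Cpow xi n)))%C
      (MN * (INR (fact N) * (2 / beta) ^ S N)) (ray_contour theta)) as [l [Hl Bl]].
    { intros z Hz; apply cont_at_mult; [apply holo_at_Cexp_ray_cont|].
      apply cont_at_minus; [apply HC; exact Hz|].
      apply holo_cont_at; clear; induction N as [|N IH]; [apply (holo_at_const 0)|].
      apply (holo_at_plus (fun y => csum N (fun n => d n * Cpow y n))%C (fun y => d N * Cpow y N)%C); [exact IH|].
      apply holo_at_mult; [apply holo_at_const|apply holo_at_pow]. }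
    { apply ray_absint; auto; intros t Ht; rewrite Cmod_mult, Cmod_Cexp.
      replace (- (ray theta t / gam))%C with (RtoC (- / s * t)).
      2: { unfold ray, gam; rewrite Cexp_Ci, RtoC_mult, RtoC_opp, RtoC_inv by lra; field; split;
           [apply cis_neq_0|intro Z; apply RtoC_inj in Z; lra]. }
      simpl Re; replace (- beta * t) with (- / s * t + a * t) by (unfold beta; ring); rewrite exp_plus.
      specialize (HMN t Ht).
      apply Rmult_le_compat_l with (r := exp (- / s * t)) in HMN; [|left; apply exp_pos].
      eapply Rle_trans; [exact HMN|]; right; ring. }
    assert (El : l = (psi gam - csum N (fun n => w (S n) * Cpow gam (S n)))%C).
    { eapply is_cint_unique; [|exact Hl|exact LapN]; exact I. }
    rewrite El in Bl.
    assert (B1 := pser_remainder c M1 r1 gam _ (S N) Hr1 PB1 ltac:(rewrite Mg; lra) (PS1 gam ltac:(rewrite Mg; lra))).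
    rewrite Mg in B1.
    replace (csum (S N) (fun j => (c j - w j) * Cpow (cis theta) j * Cpow s j)%C) with
      ((psi gam - csum N (fun n => w (S n) * Cpow gam (S n))) - (psi gam - csum (S N) (fun j => c j * Cpow gam j)))%C.
    2: { rewrite (csum_ext (S N) (fun j => (c j - w j) * Cpow (cis theta) j * Cpow s j)%C (fun j => c j * Cpow gam j - w j * Cpow gam j)%C)
           by (intros; unfold gam; rewrite Cpow_mult_l; ring).
         rewrite csum_minus, (csum_head N (fun j => w j * Cpow gam j)%C); simpl (w O); ring. }
    eapply Rle_trans; [apply Cmod_minus_le|].
    assert (M0 := pbound_nonneg _ _ _ PB1).
    assert (sN : 0 <= s ^ S N) by (apply pow_le; lra).
    rewrite Rmult_plus_distr_r, Rplus_comm; apply Rplus_le_compat.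
    - eapply Rle_trans; [exact B1|]; unfold Rdiv at 1 2; rewrite Rpow_mult_distr, pow_inv.
      assert (Q : / (1 - s * / r1) <= 2).
      { replace 2 with (/ (1 / 2)) by field; apply Rinv_le_contravar; [lra|].
        assert (s / r1 <= 1 / 2) by (apply Rle_div_l; lra); unfold Rdiv in *; lra. }
      replace (2 * M1 / r1 ^ S N * s ^ S N) with (M1 * (s ^ S N * / r1 ^ S N) * 2) by (field; apply pow_nonzero; lra).
      apply Rmult_le_compat_l; [|exact Q].
      apply Rmult_le_pos; auto; apply Rmult_le_pos; auto; left; apply Rinv_0_lt_compat, pow_lt; auto.
    - eapply Rle_trans; [exact Bl|]; rewrite !Rmult_assoc; apply Rmult_le_compat_l; auto.
      apply Rmult_le_compat_l; [apply pos_INR|]; rewrite <- Rpow_mult_distr; apply pow_incr; split.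
      + left; apply Rdiv_lt_0_compat; lra.
      + apply Rle_div_l; [lra|]; unfold beta.
        replace (4 * s * (/ s - a)) with (4 - 4 * (s * a)) by (field; lra).
        assert (s * a <= s * (/ s / 2)) by (apply Rmult_le_compat_l; lra).
        replace (s * (/ s / 2)) with (1 / 2) in * by (field; lra); lra. }
  assert (E' : forall j, c j = w j).
  { intro j; specialize (E j); apply Cminus_eq_0.
    assert (Nc : Cpow (cis theta) j <> 0%C) by (apply Cpow_nz, cis_neq_0).
    replace (c j - w j)%C with ((c j - w j) * Cpow (cis theta) j * / Cpow (cis theta) j)%C by (field; exact Nc).
    rewrite E, Cmult_0_l; apply Cmod_0. }
  split; [apply (E' O)|intro n; apply (E' (S n))].
Qed.

Lemma cont_at_const (k z : C) : cont_at (fun _ => k) z.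
Proof. intros eps He; exists 1; split; [lra|]; intros; rewrite Cmod_minus_diag; exact He. Qed.

Lemma cont_at_R (g : C -> R) (z : C) : (forall u v, Rabs (g u - g v) <= Cmod (u - v)) ->
  forall e : R -> R, continuity_pt e (g z) -> cont_at (fun y => RtoC (e (g y))) z.
Proof.
  intros Hg e He eps Heps; destruct (He eps Heps) as [d [Hd D]]; exists d; split; [exact Hd|]; intros y Hy.
  rewrite <- RtoC_minus, Cmod_R; destruct (Req_dec (g y) (g z)) as [E|N].
  - rewrite E, Rminus_diag, Rabs_R0; exact Heps.
  - apply (D (g y)); split; [split; [exact I|auto]|]; simpl; unfold R_dist.
    eapply Rle_lt_trans; [apply Hg|exact Hy].
Qed.

Lemma cont_at_exp_Cmod (mu : R) (z : C) : cont_at (fun y => RtoC (exp (mu * Cmod y))) z.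
Proof.
  apply (cont_at_R Cmod z Cmod_Lipschitz (fun x => exp (mu * x))).
  apply (continuity_pt_comp (fun x => mu * x) exp); [|apply derivable_continuous_pt, derivable_pt_exp].
  apply continuity_pt_mult; [apply continuity_pt_const; intros ? ?; reflexivity|apply continuity_pt_id].
Qed.

Lemma cont_at_Cexp_lin (k z : C) : cont_at (fun y => Cexp (y * k)) z.
Proof.
  assert (K := holo_at_Cexp_ray_cont (- / k) z).
  destruct (classic (k = 0%C)) as [->|N].
  - intros eps He; exists 1; split; [lra|]; intros y _; rewrite !Cmult_0_r, Cmod_minus_diag; exact He.
  - intros eps He; destruct (K eps He) as [d [Hd D]]; exists d; split; auto; intros y Hy.
    replace (y * k)%C with (- (y / - / k))%C by (field; auto).
    replace (z * k)%C with (- (z / - / k))%C by (field; auto); auto.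
Qed.

Lemma cont_at_pow (n : nat) (k z : C) : cont_at (fun y => Cpow (y * k) n) z.
Proof.
  apply holo_cont_at; induction n as [|n IH]; [apply (holo_at_const 1)|].
  apply (holo_at_mult (fun y => y * k)%C (fun y => Cpow (y * k) n)); [|exact IH].
  apply (holo_at_mult (fun y => y) (fun _ => k)); [apply holo_at_id|apply holo_at_const].
Qed.

(** * The kernels of the pole sum *)

Definition weighted (kap : C -> C) (mu : R) (z : C) : C := (kap z * RtoC (exp (mu * Cmod z)))%C.

Lemma Cmod_weighted (kap : C -> C) (mu : R) (z : C) : Cmod (weighted kap mu z) = Cmod (kap z) * exp (mu * Cmod z).
Proof. unfold weighted; rewrite Cmod_mult, Cmod_R, Rabs_pos_eq by (left; apply exp_pos); reflexivity. Qed.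

Lemma weighted_cont (kap : C -> C) (mu : R) (z : C) : cont_at kap z -> cont_at (weighted kap mu) z.
Proof. intro H; apply cont_at_mult; [exact H|apply cont_at_exp_Cmod]. Qed.

(** The weight uses up the rate mu of the decay d1, and |z| >= r on the tails turns |z|^-k0 into a
    constant. The part of the contour with |z| < r needs no estimate beyond continuity of the
    kernel. *)
Lemma weighted_absint (A B : Rbar) (bs : list R) (c : R -> C) (kap : C -> C) (b d1 cw r mu : R) (k0 : nat) :
  contour A B bs c -> (forall z, trace A B c z -> cont_at kap z) -> 0 < b -> 0 <= cw -> 0 < r -> mu < d1 ->
  (forall t, inner A B t -> ~ In t bs -> r <= Cmod (c t) -> c t <> RtoC 0 ->
     velocity c t <> RtoC 0 /\ b <= Rabs (cos_angle (c t) (velocity c t))) ->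
  (forall z, trace A B c z -> r <= Cmod z -> z <> RtoC 0 -> Cmod (kap z) <= cw * exp (- d1 * Cmod z) * / Cmod z ^ k0) ->
  exists M, 0 <= M /\ absint A B c (weighted kap mu) M.
Proof.
  intros H HK Hb Hcw Hr Hmu HE HB.
  assert (Pr : 0 < r ^ k0) by (apply pow_lt; auto).
  destruct (absint_tails A B bs c (weighted kap mu) b (d1 - mu) (cw * / r ^ k0) r) as [M HM]; auto.
  - intros z Hz; apply weighted_cont; auto.
  - lra.
  - apply Rmult_le_pos; auto; left; apply Rinv_0_lt_compat; auto.
  - intros z Hz Lz; rewrite Cmod_weighted.
    assert (Nz : z <> 0%C) by (apply Cmod_gt_0; lra).
    specialize (HB z Hz Lz Nz); apply Rmult_le_compat_r with (r := exp (mu * Cmod z)) in HB; [|left; apply exp_pos].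
    eapply Rle_trans; [exact HB|].
    replace (- (d1 - mu) * Cmod z) with (- d1 * Cmod z + mu * Cmod z) by ring; rewrite exp_plus.
    replace (cw * / r ^ k0 * (exp (- d1 * Cmod z) * exp (mu * Cmod z))) with
      (cw * exp (- d1 * Cmod z) * / r ^ k0 * exp (mu * Cmod z)) by ring.
    apply Rmult_le_compat_r; [left; apply exp_pos|]; apply Rmult_le_compat_l.
    + apply Rmult_le_pos; [auto|left; apply exp_pos].
    + apply Rinv_le_contravar; auto; apply pow_incr; lra.
  - destruct (param_exists A B (contour_dom _ _ _ _ H)) as [p Hp].
    exists M; split; auto; apply (HM p p); auto; [lra|apply (is_RInt_point (V := R_NormedModule))].
Qed.

Lemma cint_estimate (A B : Rbar) (bs : list R) (c : R -> C) (F G : C -> C) (k M : R) : contour A B bs c -> 0 <= k ->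
  (forall z, trace A B c z -> cont_at F z) -> (forall z, trace A B c z -> cont_at G z) ->
  (forall z, trace A B c z -> Cmod (F z) <= k * Cmod (G z)) -> absint A B c G M ->
  exists l, is_cint A B c F l /\ Cmod l <= k * M.
Proof.
  intros H Hk HF HG D HM; apply (absint_cint A B bs); auto; apply (absint_dom A B bs c F G); auto.
Qed.

Lemma pow_exp_le (x s : R) (n : nat) : 0 < s -> 0 <= x -> x ^ n <= INR (fact n) * (/ s) ^ n * exp (s * x).
Proof.
  intros Hs Hx; assert (K := pow_fact_exp (s * x) n ltac:(nra)).
  apply Rle_div_l in K; [|apply INR_fact_lt_0]; rewrite Rpow_mult_distr in K.
  assert (P : 0 < s ^ n) by (apply pow_lt; auto).
  rewrite pow_inv; apply Rmult_le_reg_l with (s ^ n); auto.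
  replace (s ^ n * (INR (fact n) * / s ^ n * exp (s * x))) with (exp (s * x) * INR (fact n)) by (field; lra); exact K.
Qed.

Definition jker (kap : C -> C) (p : C) (k : nat) (xi z : C) : C :=
  (kap z * Cexp (z * xi / p) * Cpow (z / p) k)%C.

Lemma jker_cont (kap : C -> C) (p : C) (k : nat) (xi z : C) : cont_at kap z -> cont_at (jker kap p k xi) z.
Proof.
  intro H; unfold jker; apply cont_at_mult; [apply cont_at_mult; [exact H|]|].
  - intros eps He; destruct (cont_at_Cexp_lin (xi * / p) z eps He) as [d [Hd D]]; exists d; split; auto; intros y Hy.
    unfold Cdiv; rewrite <- !Cmult_assoc; auto.
  - apply (cont_at_pow k (/ p)).
Qed.

(** One of Re y, -Re y, Im y, -Im y is at least |y| / sqrt 2, hence at least |y| / 2. *)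
Lemma exp_four_directions (s : R) (y : C) : 0 <= s ->
  exp (s * Cmod y) <= exp (2 * s * Re y) + exp (2 * s * - Re y) + exp (2 * s * Im y) + exp (2 * s * - Im y).
Proof.
  intro Hs.
  assert (K : Cmod y <= 2 * Rmax (Rabs (Re y)) (Rabs (Im y))).
  { eapply Rle_trans; [apply Cmod_2Rmax|]; apply Rmult_le_compat_r.
    - eapply Rle_trans; [apply Rabs_pos|apply Rmax_l].
    - generalize (sqrt_sqrt 2 ltac:(lra)) (sqrt_pos 2); nra. }
  generalize (exp_pos (2 * s * Re y)) (exp_pos (2 * s * - Re y)) (exp_pos (2 * s * Im y)) (exp_pos (2 * s * - Im y)); intros.
  assert (C4 : exists x, (x = Re y \/ x = - Re y \/ x = Im y \/ x = - Im y) /\ Cmod y <= 2 * x).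
  { revert K; unfold Rmax, Rabs; destruct (Rle_dec _ _); destruct (Rcase_abs (Re y)); destruct (Rcase_abs (Im y)); intro K;
      first [exists (Re y); split; [tauto|lra] | exists (- Re y); split; [tauto|lra]
            |exists (Im y); split; [tauto|lra] | exists (- Im y); split; [tauto|lra]]. }
  destruct C4 as [x [Hx Lx]].
  assert (E : exp (s * Cmod y) <= exp (2 * s * x)) by (apply exp_le; nra).
  destruct Hx as [-> | [-> | [-> | ->]]]; lra.
Qed.

(* The weight e^(s|z/p|) absorbs the second order remainder of e^(zh/p). *)
Lemma jker_second_order (A B : Rbar) (bs : list R) (c : R -> C) (kap : C -> C) (p xi : C) (k : nat) (s M : R) :
  contour A B bs c -> (forall z, trace A B c z -> cont_at kap z) -> 0 < s <= 1 -> 0 <= M ->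
  absint A B c (fun z => jker kap p k xi z * RtoC (exp (s * Cmod (z * / p))))%C M ->
  exists j0 j1, is_cint A B c (jker kap p k xi) j0 /\ Cmod j0 <= 8 / s ^ 2 * M /\ Cmod j1 <= 8 / s ^ 2 * M /\
    forall h, Cmod h <= s / 2 -> exists jh, is_cint A B c (jker kap p k (xi + h)) jh /\
      Cmod (jh - j0 - h * j1) <= 8 / s ^ 2 * M * Cmod h ^ 2.
Proof.
  intros H HK Hs HM0 HM; assert (HAB := contour_dom _ _ _ _ H).
  set (G := fun z => (jker kap p k xi z * RtoC (exp (s * Cmod (z * / p))))%C) in *.
  assert (CG : forall z, trace A B c z -> cont_at G z).
  { intros z Hz; apply cont_at_mult; [apply jker_cont; auto|].
    intros eps He; destruct (cont_at_exp_Cmod (s * Cmod (/ p)) z eps He) as [d [Hd D]]; exists d; split; auto; intros y Hy.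
    rewrite !Cmod_mult, !(Rmult_comm (Cmod _) (Cmod (/ p))), <- !Rmult_assoc; auto. }
  assert (MG : forall z, Cmod (G z) = Cmod (jker kap p k xi z) * exp (s * Cmod (z * / p))).
  { intro z; unfold G; rewrite Cmod_mult, (Cmod_R (exp _)), Rabs_pos_eq by (left; apply exp_pos); reflexivity. }
  assert (S2 : 0 < s ^ 2) by (apply pow_lt; lra).
  (* The constant is 2! (2/s)^2, the cost of y^2 against e^(s y/2); as s <= 1 it also covers the
     constants 1 and 1/s of the value and the derivative. *)
  assert (Q1 : 1 <= 8 / s ^ 2).
  { apply Rle_div_r; auto; simpl; nra. }
  assert (Q2 : / s <= 8 / s ^ 2).
  { apply Rle_div_r; auto; replace (/ s * s ^ 2) with s by (simpl; field; lra); lra. }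
  assert (C1 : forall z, trace A B c z -> cont_at (fun z => jker kap p k xi z * (z * / p))%C z).
  { intros z Hz; apply cont_at_mult; [apply jker_cont; auto|].
    apply holo_cont_at, (holo_at_mult (fun y => y)); [apply holo_at_id|apply holo_at_const]. }
  destruct (cint_estimate A B bs c (jker kap p k xi) G 1 M H) as [j0 [I0 B0]]; auto; [lra| | |].
  { intros; apply jker_cont; auto. }
  { intros z Hz; rewrite MG, Rmult_1_l; rewrite <- (Rmult_1_r (Cmod (jker _ _ _ _ _))) at 1.
    apply Rmult_le_compat_l; [apply Cmod_ge_0|]; rewrite <- exp_0; apply exp_le.
    apply Rmult_le_pos; [lra|apply Cmod_ge_0]. }
  destruct (cint_estimate A B bs c (fun z => jker kap p k xi z * (z * / p))%C G (/ s) M H) as [j1 [I1 B1]]; auto.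
  { left; apply Rinv_0_lt_compat; lra. }
  { intros z Hz; rewrite MG, Cmod_mult; set (y := Cmod (z * / p)).
    assert (y0 : 0 <= y) by apply Cmod_ge_0.
    assert (E := pow_exp_le y s 1 ltac:(lra) y0); simpl in E.
    replace (/ s * (Cmod (jker kap p k xi z) * exp (s * y))) with (Cmod (jker kap p k xi z) * (/ s * exp (s * y))) by ring.
    apply Rmult_le_compat_l; [apply Cmod_ge_0|]; lra. }
  exists j0, j1; split; [exact I0|]; split; [|split].
  - eapply Rle_trans; [exact B0|]; apply Rmult_le_compat_r; auto.
  - eapply Rle_trans; [exact B1|]; apply Rmult_le_compat_r; auto.
  - intros h Hh; assert (h0 := Cmod_ge_0 h).
    assert (Rem : forall z, (jker kap p k (xi + h) z - jker kap p k xi z - h * (jker kap p k xi z * (z * / p)))%C =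
      (jker kap p k xi z * (Cexp (h * (z * / p)) - exp_poly 2 (h * (z * / p))))%C).
    { intro z; unfold jker.
      replace (z * (xi + h) / p)%C with (z * xi / p + h * (z * / p))%C by (unfold Cdiv; ring); rewrite Cexp_add.
      replace (exp_poly 2 (h * (z * / p))) with (1 + h * (z * / p))%C by (generalize (h * (z * / p))%C; intro y; unfold exp_poly; simpl; field); ring. }
    set (F := fun z => (jker kap p k (xi + h) z - jker kap p k xi z - h * (jker kap p k xi z * (z * / p)))%C).
    destruct (cint_estimate A B bs c F G (8 / s ^ 2 * Cmod h ^ 2) M H) as [l [Il Bl]]; auto.
    { apply Rmult_le_pos; [lra|apply pow_le; auto]. }
    { intros z Hz; apply cont_at_minus; [apply cont_at_minus; apply jker_cont; auto|].
      apply cont_at_mult; [apply cont_at_const|apply C1; exact Hz]. }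
    { intros z Hz; unfold F; rewrite Rem, MG, Cmod_mult; set (y := Cmod (z * / p)).
      assert (y0 : 0 <= y) by apply Cmod_ge_0.
      replace (8 / s ^ 2 * Cmod h ^ 2 * (Cmod (jker kap p k xi z) * exp (s * y))) with
        (Cmod (jker kap p k xi z) * (8 / s ^ 2 * Cmod h ^ 2 * exp (s * y))) by ring.
      apply Rmult_le_compat_l; [apply Cmod_ge_0|].
      eapply Rle_trans; [apply Cexp_remainder|]; rewrite Cmod_mult; fold y; rewrite Rpow_mult_distr.
      (* Half of the weight pays for the square y^2, the other half for the factor e^(|h| y), as |h|
         <= s/2. *)
      assert (E := pow_exp_le y (s / 2) 2 ltac:(lra) y0).
      replace (INR (fact 2) * (/ (s / 2)) ^ 2) with (8 / s ^ 2) in E by (simpl; field; lra).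
      assert (E2 : exp (Cmod h * y) <= exp (s / 2 * y)) by (apply exp_le; apply Rmult_le_compat_r; auto).
      apply Rle_trans with (Cmod h ^ 2 * (8 / s ^ 2 * exp (s / 2 * y)) * exp (s / 2 * y)).
      - apply Rmult_le_compat; auto; [|left; apply exp_pos|].
        + apply Rdiv_le_0_compat; [|simpl; lra]; apply Rmult_le_pos; apply pow_le; auto.
        + assert (0 <= Cmod h ^ 2 * y ^ 2) by (apply Rmult_le_pos; apply pow_le; auto).
          apply Rle_trans with (Cmod h ^ 2 * y ^ 2); [simpl INR; apply Rle_div_l; lra|].
          apply Rmult_le_compat_l; [apply pow_le; auto|exact E].
      - right; replace (s * y) with (s / 2 * y + s / 2 * y) by field; rewrite exp_plus; ring. }
    exists (l + j0 + h * j1)%C; split.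
    + assert (L1 := is_cint_lin A B c F (jker kap p k xi) 1 l j0 HAB Il I0).
      assert (L2 := is_cint_lin A B c _ _ h _ j1 HAB L1 I1).
      replace (l + j0 + h * j1)%C with (l + 1 * j0 + h * j1)%C by ring.
      eapply is_cint_ext; [exact HAB| |exact L2]; intros z _; unfold F; ring.
    + replace (l + j0 + h * j1 - j0 - h * j1)%C with l by ring.
      eapply Rle_trans; [exact Bl|]; right; ring.
Qed.

(** Multiplying the kernel by e^(e z/p) amounts to moving xi by e. Absolute convergence at four
    points around xi therefore gives an integrable weight e^(s|z/p|) at xi, although convergence is
    known at each point of V separately, without any uniformity. *)
Lemma jker_corner (kap : C -> C) (p : C) (k : nat) (xi : C) (s : R) (z : C) : 0 <= s ->
  Cmod (jker kap p k xi z * RtoC (exp (s * Cmod (z * / p))))%C <=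
  Rsum (jker kap p k (xi + 2 * s) :: jker kap p k (xi - 2 * s) :: jker kap p k (xi - 2 * s * Ci) ::
        jker kap p k (xi + 2 * s * Ci) :: nil)%C (fun G => Cmod (G z)).
Proof.
  intro Hs; unfold Rsum; simpl; rewrite Cmod_mult, Cmod_R, Rabs_pos_eq by (left; apply exp_pos).
  assert (E : forall e : C, Cmod (jker kap p k (xi + e) z) = Cmod (jker kap p k xi z) * exp (Re (e * (z * / p)))).
  { intro e; unfold jker; replace (z * (xi + e) / p)%C with (z * xi / p + e * (z * / p))%C by (unfold Cdiv; ring).
    rewrite Cexp_add, !Cmod_mult, (Cmod_Cexp (e * _)); ring. }
  unfold Cminus; rewrite !E; set (y := (z * / p)%C); set (J := Cmod (jker kap p k xi z)).
  assert (J0 : 0 <= J) by apply Cmod_ge_0.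
  replace (Re (2 * s * y)) with (2 * s * Re y) by (destruct y; unfold Re, Cmult, RtoC; simpl; ring).
  replace (Re (- (2 * s) * y)) with (2 * s * - Re y) by (destruct y; unfold Re, Cmult, RtoC; simpl; ring).
  replace (Re (- (2 * s * Ci) * y)) with (2 * s * Im y) by (destruct y; unfold Re, Im, Ci, Cmult, RtoC; simpl; ring).
  replace (Re (2 * s * Ci * y)) with (2 * s * - Im y) by (destruct y; unfold Re, Im, Ci, Cmult, RtoC; simpl; ring).
  assert (K := exp_four_directions s y Hs); apply Rmult_le_compat_l with (r := J) in K; auto; lra.
Qed.

(** * Germs at the origin *)

Lemma list_min (l : list C) : (forall x : C, In x l -> x <> 0%C) ->
  exists r, 0 < r <= 1 /\ forall x, In x l -> r <= Cmod x.
Proof.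
  induction l as [| y l IH]; intros Hl.
  - exists 1. split; [lra |]. intros x [].
  - destruct IH as [r [Hr1 Hr2]]; [intros x Hx; apply Hl; now right |].
    assert (Hy : 0 < Cmod y) by (apply Cmod_gt_0, Hl; now left).
    exists (Rmin r (Cmod y)). split.
    + split; [apply Rmin_glb_lt; lra | pose proof (Rmin_l r (Cmod y)); lra].
    + intros x [-> | Hx].
      * apply Rmin_r.
      * apply Rle_trans with r; [apply Rmin_l | now apply Hr2].
Qed.

(** What is kept of [H1] and [H2]: the poles keep away from 0, and the sum over them is defined and
    bounded on arrays X with |p| |X p k| bounded. Here [rm] is some lower bound of |p|, at most 1,
    rather than the minimum. *)
Definition pole_functional (P : C -> Prop) (nphi : nat) (b : C -> nat -> C) (rm L : R) : Prop :=
  0 < rm <= 1 /\ (forall p, P p -> rm <= Cmod p) /\ 0 <= L /\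
  forall X eps, 0 <= eps -> (forall p k, P p -> (1 <= k <= nphi)%nat -> Cmod (X p k) <= eps / Cmod p) ->
    exists S, is_pole_sum P nphi b X S /\ Cmod S <= L * eps.

Lemma pole_functional_exists (P : C -> Prop) (nphi : nat) (b : C -> nat -> C) (c Ct : R) : c < 1 -> ~ P 0%C ->
  (forall p, P p -> (1 <= nphi)%nat) ->
  (forall n m : nat, (1 <= n)%nat -> (1 <= m <= nphi)%nat ->
     exists l, enumerates (fun p => P p /\ INR n - 1 <= Cmod p < INR n) l /\
       Rsum l (fun p => Cmod (b p m)) <= Ct * Rpower (INR n) c) ->
  exists rm L, pole_functional P nphi b rm L.
Proof.
  intros Hc H0 Hn H2.
  assert (Hrm : exists rm, 0 < rm <= 1 /\ forall p, P p -> rm <= Cmod p).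
  { destruct (le_lt_dec 1 nphi) as [Hle | Hlt].
    (* The case n = 1 says that the unit disc contains finitely many poles, and none of them is
       0. *)
    - destruct (H2 1%nat 1%nat) as [l [[_ Hl] _]]; [lia | lia |].
      destruct (list_min l) as [r [Hr1 Hr2]].
      + intros x Hx Hx0. apply Hl in Hx. subst x. tauto.
      + exists r. split; [exact Hr1 |]. intros p Hp.
        destruct (Rlt_le_dec (Cmod p) 1) as [Hp1 | Hp1]; [| lra].
        apply Hr2, Hl. split; [exact Hp |]. simpl. pose proof (Cmod_ge_0 p). lra.
    - exists 1. split; [lra |]. intros p Hp. specialize (Hn p Hp). lia. }
  destruct Hrm as [rm [Hrm1 Hrm2]].
  destruct (pole_sum_exists P nphi b c Ct rm Hc (proj1 Hrm1) Hrm2 Hn H2) as [L [HL1 HL2]].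
  exists rm, L. split; [exact Hrm1 |]. split; [exact Hrm2 |]. split; [exact HL1 | exact HL2].
Qed.

Lemma pole_sum_unique (P : C -> Prop) (nphi : nat) (b : C -> nat -> C) (X : C -> nat -> C) (S T : C) :
  is_pole_sum P nphi b X S -> is_pole_sum P nphi b X T -> S = T.
Proof. apply sum_by_modulus_unique. Qed.

Lemma pole_sum_zero (P : C -> Prop) (nphi : nat) (b : C -> nat -> C) (rm L : R) : pole_functional P nphi b rm L ->
  is_pole_sum P nphi b (fun _ _ => 0%C) 0%C.
Proof.
  intros [_ [_ [_ H]]]. destruct (H (fun _ _ => 0%C) 0) as [S [HS1 HS2]]; [lra | |].
  - intros p k _ _. rewrite Cmod_0. unfold Rdiv. lra.
  - replace S with (RtoC 0) in HS1; [exact HS1 |]. symmetry. apply Cmod_small_0. intros; lra.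
Qed.

(** Termwise summation: the expansions of the entries have remainders at most M (1/2)^N / |p|,
    uniformly in p and k, and the bounded functional maps these to O((1/2)^N). *)
Lemma pole_sum_pser (P : C -> Prop) (nphi : nat) (b : C -> nat -> C) (rm L : R) (Y : C -> nat -> C)
    (X : nat -> C -> nat -> C) (T : nat -> C) (v : nat -> C) (S : C) (M : R) :
  pole_functional P nphi b rm L -> 0 <= M -> is_pole_sum P nphi b Y S -> (forall n, is_pole_sum P nphi b (X n) (T n)) ->
  (forall p k N, P p -> (1 <= k <= nphi)%nat ->
     Cmod (Y p k - csum N (fun n => v n * X n p k))%C <= M * (1 / 2) ^ N / Cmod p) ->
  clim (fun N => csum N (fun n => v n * T n)%C) S.
Proof.
  intros HF HM HY HX Hb eps He.
  pose proof (pole_sum_zero P nphi b rm L HF) as H0.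
  destruct HF as [_ [_ [HL HF]]].
  destruct (pow_small (1 / 2) ltac:(lra) (L * M) eps He) as [N0 HN0].
  exists N0. intros n Hn. rewrite Cmod_minus_sym.
  assert (Em : RtoC (-1) = (- (1))%C) by (apply injective_projections; simpl; ring).
  destruct (HF (fun p k => Y p k - csum n (fun n => v n * X n p k))%C (M * (1 / 2) ^ n)) as [D [HD1 HD2]].
  - apply Rmult_le_pos; [exact HM | apply pow_le; lra].
  - intros p k Hp Hk. now apply Hb.
  - assert (HD3 : is_pole_sum P nphi b (fun p k => Y p k - csum n (fun n => v n * X n p k))%C
                    (S - csum n (fun n => v n * T n))%C).
    { assert (E : (S - csum n (fun n => v n * T n) = S + (-1)%R * csum n (fun n => v n * T n))%C).
      { rewrite Em. ring. }
      rewrite E.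
      eapply pole_sum_ext; [| apply pole_sum_lin; [exact HY | apply pole_sum_csum; [exact H0 | exact HX]]].
      intros p k _ _. cbv beta. rewrite Em. ring. }
    rewrite (pole_sum_unique _ _ _ _ _ _ HD3 HD1).
    apply Rle_lt_trans with (1 := HD2). specialize (HN0 n Hn). rewrite <- Rmult_assoc. exact HN0.
Qed.

(* From (x/(1-x))^k = sum_n bincoef n (k-1) x^(n+1) at x = u/p. *)
Definition is_pole_coeffs (P : C -> Prop) (nphi : nat) (b : C -> nat -> C) (lam : nat -> C) : Prop :=
  forall n, is_pole_sum P nphi b (fun p k => INR (bincoef n (k - 1)) * Cpow (/ p) (S n))%C (lam n).

Lemma pole_coeffs_exist (P : C -> Prop) (nphi : nat) (b : C -> nat -> C) (rm L : R) :
  pole_functional P nphi b rm L -> exists lam, is_pole_coeffs P nphi b lam.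
Proof.
  intros [Hrm1 [Hrm2 [HL HF]]]. unfold is_pole_coeffs.
  apply (choice (fun n l => is_pole_sum P nphi b (fun p k => INR (bincoef n (k - 1)) * Cpow (/ p) (S n))%C l)).
  intros n. destruct (HF (fun p k => INR (bincoef n (k - 1)) * Cpow (/ p) (S n))%C (2 ^ n * (/ rm) ^ n)) as [S [HS _]].
  - apply Rmult_le_pos; apply pow_le; [lra |]. apply Rlt_le, Rinv_0_lt_compat; lra.
  - intros p k Hp Hk. specialize (Hrm2 p Hp).
    assert (Hp0 : p <> 0%C) by (apply Cmod_gt_0; lra).
    rewrite Cmod_mult, Cmod_R, Cmod_pow, Cmod_inv by exact Hp0.
    rewrite Rabs_right by (apply Rle_ge, pos_INR).
    simpl. assert (Hi : / Cmod p <= / rm) by (apply Rinv_le_contravar; lra).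
    assert (Hi0 : 0 < / Cmod p) by (apply Rinv_0_lt_compat; lra).
    assert (Hq : (/ Cmod p) ^ n <= (/ rm) ^ n) by (apply pow_incr; lra).
    assert (Hq0 : 0 <= (/ Cmod p) ^ n) by (apply pow_le; lra).
    unfold Rdiv. rewrite (Rmult_comm (/ Cmod p)), <- Rmult_assoc.
    apply Rmult_le_compat_r; [lra |].
    apply Rmult_le_compat; [apply pos_INR | exact Hq0 | apply bincoef_le | exact Hq].
  - now exists S.
Qed.

(** After multiplication by u^n0 the Laurent polynomial that is removed becomes the sum of the first
    n0 + k0 terms of the Taylor series of u^n0 f(u). Dividing back requires u <> 0, where alone the
    tail is meaningful. *)
Lemma laurent_tail_pser (f : C -> C) (n0 k0 : nat) (a : Z -> C) : is_laurent_at0 f n0 a ->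
  exists r, 0 < r /\ forall u, 0 < Cmod u < r ->
    pser (fun m => if Nat.leb k0 m then a (Z.of_nat m) else 0%C) u (laurent_tail f a n0 k0 u).
Proof.
  intros [r [Hr Ha]]. exists r. split; [exact Hr |]. intros u Hu.
  specialize (Ha u Hu). apply pser_is_pseries in Ha.
  assert (Hu0 : u <> 0%C) by (apply Cmod_gt_0; lra).
  set (A := fun j => a (Z.of_nat j - Z.of_nat n0)%Z) in *.
  assert (Hpow : Cpow u n0 <> 0%C) by now apply Cpow_nz.
  assert (HZ : forall j, (Cpow u n0 * CpowZ u (Z.of_nat j - Z.of_nat n0) = Cpow u j)%C).
  { intros j. destruct (lt_eq_lt_dec j n0) as [[Hj | ->] | Hj].
    - replace (Z.of_nat j - Z.of_nat n0)%Z with (- Z.of_nat (n0 - j))%Z by lia.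
      destruct (n0 - j)%nat as [| q] eqn:Eq; [lia |].
      replace (- Z.of_nat (S q))%Z with (Zneg (Pos.of_succ_nat q)) by reflexivity.
      unfold CpowZ. rewrite SuccNat2Pos.id_succ. rewrite <- Eq.
      replace n0 with (j + (n0 - j))%nat at 1 by lia. rewrite Cpow_add_r.
      field. now apply Cpow_nz.
    - replace (Z.of_nat n0 - Z.of_nat n0)%Z with 0%Z by lia. simpl. ring.
    - replace (Z.of_nat j - Z.of_nat n0)%Z with (Z.of_nat (j - n0)) by lia.
      destruct (j - n0)%nat as [| q] eqn:Eq; [lia |].
      replace (Z.of_nat (S q))%Z with (Zpos (Pos.of_succ_nat q)) by reflexivity.
      unfold CpowZ. rewrite SuccNat2Pos.id_succ. rewrite <- Eq, <- Cpow_add_r. f_equal. lia. }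
  assert (Hsum : forall n s, Csum (seq s n) (fun j => A j * CpowZ u (Z.of_nat j - Z.of_nat n0))%C =
     (/ Cpow u n0 * Csum (seq s n) (fun j => A j * Cpow u j))%C).
  { induction n as [| n IH]; intros s; simpl; [ring |].
    rewrite IH, <- (HZ s). field. exact Hpow. }
  assert (Hseq : forall n (v : nat -> C), Csum (seq 0 n) v = csum n v).
  { induction n as [| n IH]; intros v; [reflexivity |].
    rewrite seq_S, Csum_app, IH, csum_S. simpl. ring. }
  assert (HN : forall N, (k0 <= N)%nat ->
    csum N (fun m => (if Nat.leb k0 m then a (Z.of_nat m) else 0%C) * Cpow u m)%C =
    (/ Cpow u n0 * (csum (N + n0) (fun j => A j * Cpow u j) - csum (n0 + k0) (fun j => A j * Cpow u j)))%C).
  { induction 1 as [| N HN IH].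
    - rewrite (Nat.add_comm k0 n0).
      assert (E : forall n, (n <= k0)%nat ->
        csum n (fun m => (if Nat.leb k0 m then a (Z.of_nat m) else 0%C) * Cpow u m)%C = 0%C).
      { induction n as [| n IHn]; intros Hn; [reflexivity |]. rewrite csum_S, IHn by lia.
        assert (E2 : Nat.leb k0 n = false) by (apply Nat.leb_gt; lia). rewrite E2. ring. }
      rewrite E by lia. ring.
    - rewrite csum_S, IH. simpl (S N + n0)%nat. rewrite csum_S.
      assert (E2 : Nat.leb k0 N = true) by (apply Nat.leb_le; lia). rewrite E2.
      replace (A (N + n0)%nat) with (a (Z.of_nat N)) by (unfold A; f_equal; lia).
      rewrite Cpow_add_r. field. exact Hpow. }
  unfold laurent_tail. cbv zeta.
  change (Csum (seq 0 (n0 + k0)) (fun j => a (Z.of_nat j - Z.of_nat n0)%Z * CpowZ u (Z.of_nat j - Z.of_nat n0))%C)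
    with (Csum (seq 0 (n0 + k0)) (fun j => A j * CpowZ u (Z.of_nat j - Z.of_nat n0))%C).
  rewrite Hsum, Hseq.
  intros eps He.
  assert (Hq : 0 < Cmod (Cpow u n0)) by now apply Cmod_gt_0.
  destruct (Ha (eps * Cmod (Cpow u n0))) as [N0 HN0]; [now apply Rmult_lt_0_compat |].
  exists (N0 + k0)%nat. intros n Hn. rewrite HN by lia.
  specialize (HN0 (n + n0)%nat ltac:(lia)).
  match goal with |- Cmod ?e < eps => assert (E : e = (/ Cpow u n0 * (csum (n + n0) (fun j => A j * Cpow u j) - Cpow u n0 * f u))%C) by (field; exact Hpow); rewrite E end.
  rewrite Cmod_mult, Cmod_inv by exact Hpow.
  apply Rmult_lt_reg_l with (Cmod (Cpow u n0)); [exact Hq |].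
  rewrite <- Rmult_assoc, Rinv_r, Rmult_1_l by lra. lra.
Qed.

Lemma clim_unshift (u : nat -> C) (v : C) : clim (fun n => u (S n)) v -> clim u v.
Proof.
  intros H eps He. destruct (H eps He) as [N HN]. exists (S N). intros [| n] Hn; [lia |]. apply HN. lia.
Qed.

Lemma principal_sum_0 (n : nat) (bp : nat -> C) (p : C) : principal_sum n bp p (fun _ => 0%C) = 0%C.
Proof.
  assert (H := principal_sum_lin n bp p (- (1))%C (fun _ => 0%C) (fun _ => 0%C)).
  rewrite (principal_sum_ext n bp p _ (fun _ => 0%C)) in H by (intros; ring).
  rewrite H. ring.
Qed.

Definition total_coeffs (alf lam : nat -> C) (n : nat) : C :=
  (alf n + match n with O => 0 | S m => lam m end)%C.

(** With x = gam z / p the quotient (z/p) / (1/gam - z/p) equals x / (1 - x), which depends on the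
    product u = gam z only. As gam tends to 0, 1/gam gets far from all z/p, these being bounded by
    |z|/rm, so that a punctured disc lies in [O_region] for eps = 1. *)
Lemma psi_germ (P : C -> Prop) (nphi : nat) (b : C -> nat -> C) (rm L r : R) (lam alf : nat -> C) (phi psi : C -> C)
    (z : C) : pole_functional P nphi b rm L -> is_pole_coeffs P nphi b lam -> 0 < r ->
  (forall u, 0 < Cmod u < r -> pser alf u (phi u)) -> z <> 0%C ->
  (forall gam, O_region P 1 z gam ->
     is_sum_by_modulus P (fun p => tilde_phi' nphi b p z gam) (phi (gam * z) - psi gam)%C) ->
  exists d, 0 < d /\ forall gam, 0 < Cmod gam < d ->
    pser (fun n => total_coeffs alf lam n * Cpow z n)%C gam (psi gam).
Proof.
  intros HF Hlam Hr Half Hz H3.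
  pose proof (pole_sum_zero P nphi b rm L HF) as Hzero.
  assert (Hrm := HF). destruct Hrm as [Hrm1 [Hrm2 _]].
  assert (Hz0 : 0 < Cmod z) by now apply Cmod_gt_0.
  assert (Hzr : 0 < 1 + Cmod z / rm).
  { pose proof (Rdiv_lt_0_compat _ _ Hz0 (proj1 Hrm1)). lra. }
  (* The three bounds put u into the disc of the Laurent expansion, make |u/p| <= 1/4 for
     [pascal_kernel_remainder], and ensure |1/gam| > 1 + |z|/rm. *)
  set (d := Rmin (Rmin (r / Cmod z) (rm / 4 / Cmod z)) (/ (1 + Cmod z / rm))).
  exists d. split.
  { unfold d. repeat apply Rmin_glb_lt.
    - now apply Rdiv_lt_0_compat.
    - apply Rdiv_lt_0_compat; lra.
    - now apply Rinv_0_lt_compat. }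
  intros gam [Hg0 Hgd].
  assert (Hgr : Cmod gam < r / Cmod z).
  { eapply Rlt_le_trans; [exact Hgd | unfold d; eapply Rle_trans; [apply Rmin_l | apply Rmin_l]]. }
  assert (Hgrm : Cmod gam < rm / 4 / Cmod z).
  { eapply Rlt_le_trans; [exact Hgd | unfold d; eapply Rle_trans; [apply Rmin_l | apply Rmin_r]]. }
  assert (Hg1 : Cmod gam < / (1 + Cmod z / rm)).
  { eapply Rlt_le_trans; [exact Hgd | unfold d; apply Rmin_r]. }
  assert (Hg : gam <> 0%C) by now apply Cmod_gt_0.
  set (u := (gam * z)%C).
  assert (Hu : Cmod u = Cmod gam * Cmod z) by (unfold u; apply Cmod_mult).
  assert (Hu0 : 0 < Cmod u) by (rewrite Hu; now apply Rmult_lt_0_compat).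
  assert (Hur : Cmod u < r).
  { rewrite Hu. apply (Rmult_lt_compat_r (Cmod z)) in Hgr; [| exact Hz0].
    replace (r / Cmod z * Cmod z) with r in Hgr by (field; lra). exact Hgr. }
  assert (Hurm : Cmod u < rm / 4).
  { rewrite Hu. apply (Rmult_lt_compat_r (Cmod z)) in Hgrm; [| exact Hz0].
    replace (rm / 4 / Cmod z * Cmod z) with (rm / 4) in Hgrm by (field; lra). exact Hgrm. }
  assert (HO : O_region P 1 z gam).
  { split; [exact Hg |]. intros p Hp. specialize (Hrm2 p Hp).
    assert (Hp0 : p <> 0%C) by (apply Cmod_gt_0; lra).
    pose proof (Cmod_triangle_minus (/ gam) (z / p)) as Ht.
    rewrite Cmod_inv, Cmod_div in Ht by assumption.
    assert (H1 : 1 + Cmod z / rm < / Cmod gam).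
    { rewrite <- (Rinv_inv (1 + Cmod z / rm)). apply Rinv_lt_contravar; [| exact Hg1].
      apply Rmult_lt_0_compat; [exact Hg0 | now apply Rinv_0_lt_compat]. }
    assert (H2 : Cmod z / Cmod p <= Cmod z / rm).
    { apply Rmult_le_compat_l; [lra |]. apply Rinv_le_contravar; lra. }
    lra. }
  specialize (H3 gam HO). fold u in H3.
  assert (HS : is_pole_sum P nphi b (fun p k => Cpow (u / p / (1 - u / p)) k) (psi gam - phi u)%C).
  { assert (E : (psi gam - phi u = 0 + (- (1)) * (phi u - psi gam))%C) by ring.
    rewrite E. unfold is_pole_sum in Hzero |- *.
    eapply sum_by_modulus_ext; [| exact (sum_by_modulus_lin _ _ _ (- (1))%C _ _ Hzero H3)].
    intros p Hp. cbv beta. rewrite principal_sum_0. unfold tilde_phi'.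
    assert (Hp0 : p <> 0%C) by (apply Cmod_gt_0; specialize (Hrm2 p Hp); lra).
    assert (Hd : (/ gam - z / p)%C <> 0%C).
    { apply Cmod_gt_0. destruct HO as [_ HO]. specialize (HO p Hp). lra. }
    rewrite (principal_sum_ext nphi (b p) p (fun k => Cpow (u / p / (1 - u / p)) k)
      (fun k => Cpow (z / p) k * / Cpow (/ gam - z / p) k)%C).
    - ring.
    - intros k _. rewrite <- Cpow_inv by exact Hd. rewrite <- Cpow_mult_l. f_equal. unfold u.
      assert (Hd2 : (p - gam * z)%C <> 0%C).
      { intros Hd2. apply Hd. replace (/ gam - z / p)%C with ((p - gam * z) / (gam * p))%C by (field; auto).
        rewrite Hd2. unfold Cdiv. ring. }
      field. psplit; auto. now rewrite Cmult_comm. }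
  assert (Hcl : clim (fun N => csum N (fun n => Cpow u (S n) * lam n)%C) (psi gam - phi u)%C).
  { eapply (pole_sum_pser P nphi b rm L _ _ lam (fun n => Cpow u (S n)) _ (2 * Cmod u) HF); [lra | exact HS | exact Hlam |].
    intros p k N Hp Hk. cbv beta. specialize (Hrm2 p Hp).
    assert (Hp0 : p <> 0%C) by (apply Cmod_gt_0; lra).
    assert (Hx : Cmod (u / p) = Cmod u / Cmod p) by now apply Cmod_div.
    assert (Hx4 : Cmod (u / p) <= 1 / 4).
    { rewrite Hx. apply Rle_trans with (Cmod u / rm).
      - apply Rmult_le_compat_l; [lra |]. apply Rinv_le_contravar; lra.
      - apply Rmult_le_reg_r with rm; [lra |]. unfold Rdiv. rewrite Rmult_assoc, Rinv_l by lra. lra. }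
    pose proof (pascal_kernel_remainder N (k - 1) (u / p)%C Hx4) as Hpas.
    replace (S (k - 1)) with k in Hpas by lia.
    rewrite <- csum_mult_l in Hpas.
    eapply Rle_trans; [| apply Rle_trans with (1 := Hpas); rewrite Hx; right; field; lra].
    right. f_equal. f_equal. apply csum_ext. intros n _.
    unfold Cdiv. rewrite Cpow_mult_l. rewrite (Cpow_S u n), (Cpow_S (/ p) n). ring. }
  assert (Hps : pser (fun n => match n with O => 0%C | S m => lam m end) u (psi gam - phi u)%C).
  { apply clim_unshift. eapply clim_ext; [| exact Hcl]. intros N. cbv beta. rewrite csum_head.
    simpl (Cpow u 0). rewrite Cmult_0_l, Cplus_0_l. apply csum_ext. intros n _. ring. }
  assert (Hpa : pser alf u (phi u)) by (apply Half; lra).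
  pose proof (clim_plus _ _ _ _ Hpa Hps) as Hsum.
  replace (phi u + (psi gam - phi u))%C with (psi gam) in Hsum by ring.
  eapply clim_ext; [| exact Hsum]. intros N. cbv beta. rewrite <- csum_plus. apply csum_ext. intros n _.
  unfold total_coeffs, u. rewrite Cpow_mult_l. ring.
Qed.

(** An entire function is bounded on circles of every radius, which gives Cauchy estimates for every
    rho; its coefficients are identified near 0 by [psi_germ]. *)
Lemma psi_taylor (P : C -> Prop) (nphi : nat) (b : C -> nat -> C) (rm L r : R) (lam alf : nat -> C) (phi psi : C -> C)
    (z : C) : pole_functional P nphi b rm L -> is_pole_coeffs P nphi b lam -> 0 < r ->
  (forall u, 0 < Cmod u < r -> pser alf u (phi u)) -> z <> 0%C ->
  (forall gam, O_region P 1 z gam ->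
     is_sum_by_modulus P (fun p => tilde_phi' nphi b p z gam) (phi (gam * z) - psi gam)%C) ->
  entire psi ->
  forall rho, 0 < rho -> exists M, pbound (fun n => total_coeffs alf lam n * Cpow z n)%C M rho /\
    forall gam, Cmod gam < rho -> pser (fun n => total_coeffs alf lam n * Cpow z n)%C gam (psi gam).
Proof.
  intros HF Hlam Hr Half Hz H3 Hent rho Hrho.
  destruct (psi_germ _ _ _ _ _ _ _ _ _ _ _ HF Hlam Hr Half Hz H3) as [d [Hd Hg]].
  assert (Hhol : forall y, holo_at psi y).
  { intros y. apply (proj1 (holomorphic_on_cderiv (fun _ => True) psi) Hent). exact I. }
  destruct (taylor psi 0%C rho (rho + 1)) as [A [[M HM] HA]]; [lra | intros; apply Hhol |].
  destruct (HA M HM) as [HA1 HA2].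
  assert (HAp : forall gam, Cmod gam < rho -> pser A gam (psi gam)).
  { intros gam Hgam eps He.
    assert (Hq : 0 <= Cmod gam / rho < 1) by (apply div_lt_1; split; [apply Cmod_ge_0 | exact Hgam]).
    destruct (pow_small _ Hq (M * (rho / (rho - Cmod gam))) eps He) as [N HN].
    exists N. intros n Hn. rewrite Cmod_minus_sym. specialize (HA2 gam n Hgam).
    rewrite Cplus_0_l in HA2. eapply Rle_lt_trans; [exact HA2 |].
    specialize (HN n Hn). lra. }
  assert (HE : forall n, A n = (total_coeffs alf lam n * Cpow z n)%C).
  { apply (pser_unique A (fun n => total_coeffs alf lam n * Cpow z n)%C (Rmin d rho)); [now apply Rmin_glb_lt |].
    intros s Hs. pose proof (Rmin_l d rho). pose proof (Rmin_r d rho).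
    assert (Hs1 : Cmod s = s) by (rewrite Cmod_R; apply Rabs_right; lra).
    exists (psi s). split; [apply HAp; lra | apply Hg; lra]. }
  exists M. split.
  - intros n. rewrite <- HE. apply HA1.
  - intros gam Hgam. eapply pser_eq; [exact HE |]. now apply HAp.
Qed.

(** * The entire part *)

(** All rates below d1 are recorded because parts of the decay are spent, in varying proportions, on
    powers of z and on e^(z xi/p), and some must be left for integrability. *)
Definition decaying (A B : Rbar) (bs : list R) (c : R -> C) (kap : C -> C) (d1 : R) : Prop :=
  contour A B bs c /\ (forall z, trace A B c z -> cont_at kap z) /\ 0 < d1 /\
  forall mu, mu < d1 -> exists M, 0 <= M /\ absint A B c (weighted kap mu) M.

Lemma is_cint_csum (A B : Rbar) (c : R -> C) (N : nat) (v : nat -> C) (G : nat -> C -> C) (l : nat -> C) :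
  Rbar_lt A B -> (forall n, is_cint A B c (G n) (l n)) ->
  is_cint A B c (fun z => csum N (fun n => v n * G n z)%C) (csum N (fun n => v n * l n)%C).
Proof.
  intros HAB HG. induction N as [| N IH].
  - apply is_cint_zero; [exact HAB |]. intros; reflexivity.
  - rewrite csum_S. eapply is_cint_ext; [exact HAB | | exact (is_cint_lin A B c _ _ (v N) _ _ HAB IH (HG N))].
    intros z _. cbv beta. now rewrite csum_S.
Qed.

Lemma kernel_moments (A B : Rbar) (bs : list R) (c : R -> C) (kap : C -> C) (d1 : R) : decaying A B bs c kap d1 ->
  exists H : nat -> C, forall m, is_cint A B c (fun z => kap z * Cpow z m)%C (H m).
Proof.
  intros [Hc [Hk [Hd Hw]]].
  apply (choice (fun m l => is_cint A B c (fun z => kap z * Cpow z m)%C l)). intros m.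
  destruct (Hw (d1 / 2)) as [M [HM1 HM2]]; [lra |].
  assert (Hf : 0 <= INR (fact m) * (/ (d1 / 2)) ^ m).
  { apply Rmult_le_pos; [apply pos_INR |]. apply pow_le, Rlt_le, Rinv_0_lt_compat. lra. }
  destruct (cint_estimate A B bs c (fun z => kap z * Cpow z m)%C (weighted kap (d1 / 2))
    (INR (fact m) * (/ (d1 / 2)) ^ m) M Hc Hf) as [l [Hl _]].
  - intros z Hz. apply cont_at_mult; [now apply Hk |]. apply holo_cont_at, holo_at_pow.
  - intros z Hz. apply weighted_cont. now apply Hk.
  - intros z Hz. rewrite Cmod_weighted, Cmod_mult, Cmod_pow.
    pose proof (pow_exp_le (Cmod z) (d1 / 2) m ltac:(lra) (Cmod_ge_0 z)) as Hp.
    pose proof (Cmod_ge_0 (kap z)) as H0.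
    apply (Rmult_le_compat_l (Cmod (kap z))) in Hp; [| exact H0]. lra.
  - exact HM2.
  - now exists l.
Qed.

Definition entire_series (x : nat -> C) (X : C -> C) : Prop :=
  (forall y, pser x y (X y)) /\ (forall R0, 0 < R0 -> exists M, pbound x M R0) /\ forall y, holo_at X y.

Lemma entire_series_exists (x : nat -> C) : (forall R0, 0 < R0 -> exists M, pbound x M R0) ->
  exists X, entire_series x X.
Proof.
  intros Hx. destruct (choice (fun y v => pser x y v)) as [X HX].
  - intros y. destruct (Hx (Cmod y + 1)) as [M HM]; [pose proof (Cmod_ge_0 y); lra |].
    apply (pser_exists x M (Cmod y + 1)); [pose proof (Cmod_ge_0 y); lra | exact HM | lra].
  - exists X. split; [exact HX | split; [exact Hx |]]. intros y.
    destruct (Hx (Cmod y + 1)) as [M HM]; [pose proof (Cmod_ge_0 y); lra |].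
    apply (pser_holo x M (Cmod y + 1)); [pose proof (Cmod_ge_0 y); lra | exact HM | | lra].
    intros z _. apply HX.
Qed.

Definition borel_coeffs (ct : nat -> C) (n : nat) : C := (ct (S n) / INR (fact n))%C.

Lemma INR_fact_ge_1 (n : nat) : 1 <= INR (fact n).
Proof. change 1 with (INR 1). apply le_INR. pose proof (lt_O_fact n). lia. Qed.

(** The numbers ct n do not depend on z. A single z <> 0 for which the ct n z^n are the coefficients
    of an entire function therefore bounds them by every geometric sequence. *)
Lemma borel_coeffs_pbound (ct : nat -> C) (z : C) : z <> 0%C ->
  (forall rho, 0 < rho -> exists M, pbound (fun n => ct n * Cpow z n)%C M rho) ->
  forall R0, 0 < R0 -> exists M, pbound (borel_coeffs ct) M R0.
Proof.
  intros Hz Hc R0 HR0. assert (Hz0 : 0 < Cmod z) by now apply Cmod_gt_0.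
  destruct (Hc (R0 / Cmod z)) as [M HM]; [now apply Rdiv_lt_0_compat |].
  exists (M / R0). intros n. unfold borel_coeffs.
  specialize (HM (S n)). cbv beta in HM. rewrite Cmod_mult, Cmod_pow in HM.
  rewrite Cmod_div, Cmod_R, Rabs_right by (try apply INR_fact_neq; apply Rle_ge, pos_INR).
  pose proof (INR_fact_ge_1 n) as Hf.
  assert (HR : 0 < R0 ^ S n) by now apply pow_lt.
  assert (HZ : 0 < Cmod z ^ S n) by now apply pow_lt.
  assert (H1 : Cmod (ct (S n)) <= M / R0 ^ S n).
  { apply Rmult_le_reg_r with (Cmod z ^ S n); [exact HZ |]. apply Rle_trans with (1 := HM). right.
    unfold Rdiv at 2. rewrite Rpow_mult_distr, pow_inv. field. split; lra. }
  apply Rle_trans with (Cmod (ct (S n))).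
  - apply Rmult_le_reg_r with (INR (fact n)); [lra |]. unfold Rdiv. rewrite Rmult_assoc, Rinv_l by lra.
    apply Rmult_le_compat_l; [apply Cmod_ge_0 | exact Hf].
  - apply Rle_trans with (1 := H1). right. simpl. field. psplit; try apply pow_nonzero; lra.
Qed.

Definition growth (al : R) (Cm : list (R * nat)) (x : R) : R :=
  exp (al * x) * Rsum Cm (fun e => fst e * x ^ snd e).

(** The polynomial factor is absorbed by e^x, which brings the growth bound into the purely
    exponential form used in Watson's lemma. The absolute value makes the rate nonnegative. *)
Lemma growth_exp (al : R) (Cm : list (R * nat)) : exists K, forall x, 0 <= x ->
  growth al Cm x <= K * exp ((Rabs al + 1) * x).
Proof.
  exists (Rsum Cm (fun e => Rabs (fst e) * INR (fact (snd e)))). intros x Hx. unfold growth.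
  assert (H1 : exp (al * x) <= exp (Rabs al * x)).
  { apply exp_le. apply Rmult_le_compat_r; [exact Hx | apply Rle_abs]. }
  assert (H2 : Rsum Cm (fun e => fst e * x ^ snd e) <= Rsum Cm (fun e => exp x * (Rabs (fst e) * INR (fact (snd e))))).
  { apply Rsum_le. intros e _. pose proof (pow_fact_exp x (snd e) Hx) as Hp.
    pose proof (INR_fact_ge_1 (snd e)) as Hf.
    assert (Hp2 : x ^ snd e <= exp x * INR (fact (snd e))).
    { apply (Rmult_le_compat_r (INR (fact (snd e)))) in Hp; [| lra].
      unfold Rdiv in Hp. rewrite Rmult_assoc, Rinv_l in Hp by lra. lra. }
    apply Rle_trans with (Rabs (fst e) * x ^ snd e).
    - apply Rmult_le_compat_r; [now apply pow_le | apply Rle_abs].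
    - pose proof (Rabs_pos (fst e)). nra. }
  rewrite Rsum_mult_l in H2.
  set (Q := Rsum Cm (fun e => Rabs (fst e) * INR (fact (snd e)))) in *.
  assert (HQ : 0 <= Q).
  { apply Rsum_ge0. intros e _. apply Rmult_le_pos; [apply Rabs_pos | apply pos_INR]. }
  rewrite Rmult_plus_distr_r, exp_plus, Rmult_1_l.
  pose proof (exp_pos (al * x)). pose proof (exp_pos (Rabs al * x)). pose proof (exp_pos x).
  apply Rle_trans with (exp (al * x) * (exp x * Q)); [nra |].
  assert (0 <= exp x * Q) by nra. nra.
Qed.

Lemma holo_at_comp_lin (X : C -> C) (z xi : C) : holo_at X (z * xi) -> holo_at (fun y => X (z * y)%C) xi.
Proof.
  intros [l Hl]. exists (l * z)%C. intros eps He.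
  destruct (Hl (eps / (Cmod z + 1))) as [d [Hd H]].
  { apply Rdiv_lt_0_compat; [exact He |]. pose proof (Cmod_ge_0 z). lra. }
  exists (d / (Cmod z + 1)). pose proof (Cmod_ge_0 z) as Hz.
  split; [apply Rdiv_lt_0_compat; lra |]. intros y Hy.
  assert (E : (z * y - z * xi = z * (y - xi))%C) by ring.
  specialize (H (z * y)%C). rewrite E, Cmod_mult in H.
  replace (l * (z * (y - xi)))%C with (l * z * (y - xi))%C in H by ring.
  pose proof (Cmod_ge_0 (y - xi)) as H0.
  apply (Rmult_lt_compat_r (Cmod z + 1)) in Hy; [| lra].
  unfold Rdiv in Hy. rewrite Rmult_assoc, Rinv_l, Rmult_1_r in Hy by lra.
  eapply Rle_trans; [apply H; nra |].
  apply Rle_trans with (eps / (Cmod z + 1) * ((Cmod z + 1) * Cmod (y - xi))).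
  - apply Rmult_le_compat_l; [apply Rlt_le, Rdiv_lt_0_compat; lra | nra].
  - right. field. lra.
Qed.

Lemma chi_formula (theta al : R) (Cm : list (R * nat)) (V : C -> Prop) (psi chi X : C -> C) (ct : nat -> C) (z : C)
    (M rho : R) : Copen V -> Cconnected V -> (forall xi, closed_ray theta xi -> V xi) ->
  (forall xi, V xi -> holo_at chi xi) -> (forall xi, V xi -> Cmod (chi xi) <= growth al Cm (Cmod xi)) ->
  is_inverse_laplace theta al psi chi -> 0 < rho -> pbound (fun n => ct n * Cpow z n)%C M rho ->
  (forall gam, Cmod gam < rho -> pser (fun n => ct n * Cpow z n)%C gam (psi gam)) ->
  entire_series (borel_coeffs ct) X ->
  forall xi, V xi -> chi xi = (z * X (z * xi))%C.
Proof.
  intros HVo HVc HVr Hhol Hbd Hinv Hrho HMb Hpsi [HX1 [_ HX3]].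
  assert (Hr : forall t, 0 <= t -> closed_ray theta (ray theta t)) by (intros t Ht; now exists t).
  assert (H0V : V 0%C).
  { replace (RtoC 0) with (ray theta 0); [apply HVr, Hr; lra | unfold ray; ring]. }
  destruct (proj1 (Copen_disc V) HVo 0%C H0V) as [d [Hd HdV]].
  destruct (taylor_pser chi 0%C d Hd) as [D [M2 [r2 [Hr2 [HD1 HD2]]]]].
  { intros y Hy. now apply Hhol, HdV. }
  assert (HD3 : forall xi, Cmod xi < r2 -> pser D xi (chi xi)).
  { intros xi Hxi. specialize (HD2 xi Hxi). now rewrite Cplus_0_l in HD2. }
  destruct (growth_exp al Cm) as [K HK].
  destruct (watson theta chi psi (fun n => ct n * Cpow z n)%C D M rho M2 r2 al K (Rabs al + 1)
    Hrho HMb Hpsi Hr2 HD1 HD3) as [_ Hw].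
  - pose proof (Rabs_pos al). lra.
  - intros t Ht. rewrite <- (Cmod_ray theta t Ht) at 2.
    apply Rle_trans with (growth al Cm (Cmod (ray theta t))); [apply Hbd, HVr, Hr, Ht |].
    apply HK, Cmod_ge_0.
  - intros y [t [Ht <-]]. apply holo_cont_at, Hhol, HVr, Hr. exact (proj1 (param_ray t) Ht).
  - exact Hinv.
  - assert (HDn : forall n, D n = (z * (borel_coeffs ct n * Cpow z n))%C).
    { intros n. specialize (Hw n). cbv beta in Hw. unfold borel_coeffs.
      assert (Hf := INR_fact_neq n).
      apply (f_equal (fun q => (q / INR (fact n))%C)) in Hw. rewrite Cpow_S in Hw.
      replace (INR (fact n) * D n / INR (fact n))%C with (D n) in Hw by (field; exact Hf).
      rewrite <- Hw. field. exact Hf. }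
    assert (HHol : forall xi, V xi -> holo_at (fun y => z * X (z * y))%C xi).
    { intros xi _. apply holo_at_mult; [apply holo_at_const |]. apply holo_at_comp_lin, HX3. }
    refine (identity_theorem V chi (fun y => z * X (z * y))%C 0%C r2 HVo HVc Hhol HHol H0V Hr2 _).
    intros y Hy. rewrite Cminus_0_r in Hy.
    apply (clim_unique _ _ _ (HD3 y Hy)).
    pose proof (clim_mult_l z _ _ (HX1 (z * y)%C)) as Hm.
    eapply clim_ext; [| exact Hm]. intros N. cbv beta. rewrite <- csum_mult_l. apply csum_ext. intros n _.
    rewrite HDn, Cpow_mult_l. ring.
Qed.

(* Cauchy estimates for z X(z xi), uniformly in z. *)
Lemma coeffs_vanish_or_bounded (T : C -> Prop) (x : nat -> C) (X : C -> C) (d G : R) : entire_series x X -> 0 < d ->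
  (forall z xi, T z -> Cmod xi < d -> Cmod (z * X (z * xi))%C <= G) ->
  (forall n, x n = 0%C) \/ exists R0, 0 < R0 /\ forall z, T z -> Cmod z <= R0.
Proof.
  intros [HX1 [_ HX3]] Hd HG.
  destruct (classic (forall n, x n = 0%C)) as [H | H]; [now left | right].
  destruct (classic (exists z, T z)) as [[z0 Hz0] | Hno];
    [| exists 1; split; [lra |]; intros z Hz; exfalso; apply Hno; now exists z].
  apply not_all_ex_not in H. destruct H as [n Hn].
  assert (Hxn : 0 < Cmod (x n)) by now apply Cmod_gt_0.
  set (r := d / 2). assert (Hr : 0 < r < d) by (unfold r; lra).
  assert (Hest : forall z, T z -> Cmod (x n) * Cmod z ^ S n <= G / r ^ n).
  { intros z Hz.
    (* The coefficient of degree n of this function of y is x n z^(n+1). The bound G is independent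
       of z, so that |x n| |z|^(n+1) <= G / r^n on all of T. *)
    destruct (taylor (fun y => z * X (z * y))%C 0%C r d Hr) as [A [_ HA]].
    { intros y _. apply holo_at_mult; [apply holo_at_const |]. apply holo_at_comp_lin, HX3. }
    destruct (HA G) as [HA1 HA2].
    { intros t _. apply HG; [exact Hz |]. rewrite Cplus_0_l, Cmod_mult, Cmod_R, Cmod_cis, Rabs_right; lra. }
    specialize (HA1 n).
    assert (E : forall m, A m = (z * (x m * Cpow z m))%C).
    { apply (pser_unique A (fun m => z * (x m * Cpow z m))%C r (proj1 Hr)).
      intros s Hs. exists (z * X (z * s))%C.
      assert (Hs1 : Cmod s = s) by (rewrite Cmod_R; apply Rabs_right; lra).
      split.
      - intros eps He.
        assert (Hq : 0 <= Cmod s / r < 1) by (apply div_lt_1; split; [apply Cmod_ge_0 | lra]).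
        destruct (pow_small _ Hq (G * (r / (r - Cmod s))) eps He) as [N HN].
        exists N. intros m Hm. rewrite Cmod_minus_sym.
        specialize (HA2 s m ltac:(lra)). rewrite Cplus_0_l in HA2.
        eapply Rle_lt_trans; [exact HA2 |]. specialize (HN m Hm). lra.
      - pose proof (clim_mult_l z _ _ (HX1 (z * s)%C)) as Hm.
        eapply clim_ext; [| exact Hm]. intros N. cbv beta. rewrite <- csum_mult_l. apply csum_ext. intros m _.
        rewrite Cpow_mult_l. ring. }
    rewrite E in HA1. rewrite !Cmod_mult, Cmod_pow in HA1. simpl. lra. }
  exists (1 + G / r ^ n / Cmod (x n)).
  assert (HG0 : 0 <= G / r ^ n / Cmod (x n)).
  { apply Rle_mult_inv_pos; [| exact Hxn]. apply Rle_trans with (2 := Hest z0 Hz0).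
    apply Rmult_le_pos; [lra | apply pow_le, Cmod_ge_0]. }
  split; [lra |]. intros z Hz. destruct (Rle_lt_dec (Cmod z) 1) as [H1 | H1]; [lra |].
  apply Rle_trans with (Cmod z ^ S n).
  - rewrite <- (pow_1 (Cmod z)) at 1. apply Rle_pow; [lra | lia].
  - specialize (Hest z Hz). apply Rle_trans with (G / r ^ n / Cmod (x n)); [| lra].
    apply Rmult_le_reg_l with (Cmod (x n)); [exact Hxn |].
    replace (Cmod (x n) * (G / r ^ n / Cmod (x n))) with (G / r ^ n); [exact Hest |].
    field. split; try apply pow_nonzero; lra.
Qed.

(** On a bounded contour the series of X at z xi converges uniformly in z and the kernel is
    absolutely integrable, so that integration is termwise and produces the moments H. When all
    coefficients vanish, so do all terms. *)
Lemma entire_part (A B : Rbar) (bs : list R) (c : R -> C) (kap : C -> C) (d1 : R) (x H : nat -> C) (X : C -> C) :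
  decaying A B bs c kap d1 -> entire_series x X -> (forall m, is_cint A B c (fun z => kap z * Cpow z m)%C (H m)) ->
  ((forall n, x n = 0%C) \/ exists R0, 0 < R0 /\ forall z, trace A B c z -> Cmod z <= R0) ->
  exists I : C -> C, (forall xi, is_cint A B c (fun z => kap z * (z * X (z * xi)))%C (I xi)) /\
    (forall xi, pser (fun n => x n * H (S n))%C xi (I xi)) /\ forall xi, holo_at I xi.
Proof.
  intros [Hc [Hk [Hd Hw]]] [HX1 [HX2 HX3]] HH Halt. pose proof (contour_dom _ _ _ _ Hc) as HAB.
  assert (Hex : forall xi, exists l, is_cint A B c (fun z => kap z * (z * X (z * xi)))%C l /\
     pser (fun n => x n * H (S n))%C xi l).
  { intros xi. destruct Halt as [Hx0 | [R0 [HR0 HT]]].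
    - assert (Hcs : forall N (v : nat -> C), csum N (fun n => x n * v n)%C = 0%C).
      { induction N as [| N IH]; intros v; [reflexivity |]. rewrite csum_S, IH, Hx0. ring. }
      exists 0%C. split.
      + apply is_cint_zero; [exact HAB |]. intros z _.
        assert (E : X (z * xi)%C = 0%C).
        { apply (clim_unique _ _ _ (HX1 (z * xi)%C)). intros eps He. exists O. intros n _.
          rewrite Hcs, Cmod_minus_diag. exact He. }
        rewrite E. ring.
      + intros eps He. exists O. intros n _.
        assert (E : csum n (fun j => x j * H (S j) * Cpow xi j)%C = csum n (fun j => x j * (H (S j) * Cpow xi j))%C).
        { apply csum_ext. intros; ring. }
        rewrite E, Hcs, Cmod_minus_diag. exact He.
    - destruct (Hw 0 Hd) as [M0 [HM0 Habs]].
      (* The choice gives |z xi| <= Rx / 2 along the contour: the remainder of X after N terms is at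
         most 2 M (1/2)^N, and the summand 1 keeps Rx positive. *)
      set (Rx := 2 * R0 * (Cmod xi + 1)). pose proof (Cmod_ge_0 xi) as Hxi.
      assert (HRx : 0 < Rx) by (unfold Rx; nra).
      destruct (HX2 Rx HRx) as [M HM]. pose proof (pbound_nonneg _ _ _ HM) as HMn.
      assert (Hcont : forall N z, trace A B c z ->
        cont_at (fun z => kap z * (z * (X (z * xi) - csum N (fun n => x n * Cpow (z * xi) n))))%C z).
      { intros N z Hz. apply cont_at_mult; [now apply Hk |]. apply holo_cont_at.
        apply holo_at_mult; [apply holo_at_id |].
        assert (Hlin : forall (Y : C -> C), (forall y, holo_at Y y) -> holo_at (fun y => Y (y * xi)%C) z).
        { intros Y HY. pose proof (holo_at_comp_lin Y xi z (HY _)) as Hl.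
          eapply holo_at_local; [exact Rlt_0_1 | | exact Hl]. intros y _. cbv beta. now rewrite Cmult_comm. }
        apply (Hlin (fun y => X y - csum N (fun n => x n * Cpow y n))%C). intros y.
        apply holo_at_minus; [apply HX3 |]. induction N as [| N IH]; [apply (holo_at_const 0%C) |].
        apply (holo_at_local (fun y => csum N (fun n => x n * Cpow y n) + x N * Cpow y N)%C _ y 1 Rlt_0_1).
        - intros q _. cbv beta. now rewrite csum_S.
        - apply holo_at_plus; [exact IH |]. apply holo_at_mult; [apply holo_at_const | apply holo_at_pow]. }
      assert (Hest : forall N, exists l, is_cint A B c
         (fun z => kap z * (z * (X (z * xi) - csum N (fun n => x n * Cpow (z * xi) n))))%C l /\
         Cmod l <= R0 * (2 * M * (1 / 2) ^ N) * M0).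
      { intros N. assert (Hh : 0 < (1 / 2) ^ N) by (apply pow_lt; lra).
        apply (cint_estimate A B bs c _ (weighted kap 0) _ M0 Hc); [| apply Hcont | | | exact Habs].
        - apply Rmult_le_pos; [lra |]. apply Rmult_le_pos; lra.
        - intros z Hz. apply weighted_cont. now apply Hk.
        - intros z Hz. rewrite Cmod_weighted, Rmult_0_l, exp_0, Rmult_1_r.
          specialize (HT z Hz). pose proof (Cmod_ge_0 z) as Hz0.
          assert (Hzx : Cmod (z * xi) <= Rx / 2) by (rewrite Cmod_mult; unfold Rx; nra).
          assert (Hlt : Cmod (z * xi) < Rx) by lra.
          pose proof (pser_remainder x M Rx (z * xi)%C _ N HRx HM Hlt (HX1 _)) as Hrem.
          assert (Hq1 : Cmod (z * xi) / Rx <= 1 / 2).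
          { apply Rmult_le_reg_r with Rx; [exact HRx |]. unfold Rdiv at 1. rewrite Rmult_assoc, Rinv_l by lra. lra. }
          assert (Hq0 : 0 <= Cmod (z * xi) / Rx) by (apply Rdiv_le_0_compat; [apply Cmod_ge_0 | exact HRx]).
          assert (Hrem2 : M * (Cmod (z * xi) / Rx) ^ N / (1 - Cmod (z * xi) / Rx) <= 2 * M * (1 / 2) ^ N).
          { assert (Hp : (Cmod (z * xi) / Rx) ^ N <= (1 / 2) ^ N) by now apply pow_incr.
            assert (Hp0 : 0 <= (Cmod (z * xi) / Rx) ^ N) by now apply pow_le.
            assert (Hi : / (1 - Cmod (z * xi) / Rx) <= 2).
            { rewrite <- (Rinv_inv 2). apply Rinv_le_contravar; lra. }
            assert (Hi0 : 0 < / (1 - Cmod (z * xi) / Rx)) by (apply Rinv_0_lt_compat; lra).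
            replace (2 * M * (1 / 2) ^ N) with (M * (1 / 2) ^ N * 2) by ring.
            apply Rmult_le_compat; [now apply Rmult_le_pos | lra | now apply Rmult_le_compat_l | exact Hi]. }
          rewrite !Cmod_mult. pose proof (Cmod_ge_0 (kap z)) as Hk0.
          rewrite Rmult_comm. apply Rmult_le_compat_r; [exact Hk0 |].
          apply Rmult_le_compat; [exact Hz0 | apply Cmod_ge_0 | exact HT | lra]. }
      destruct (Hest O) as [l [Hl _]].
      assert (Hl2 : is_cint A B c (fun z => kap z * (z * X (z * xi)))%C l).
      { eapply is_cint_ext; [exact HAB | | exact Hl]. intros z _. cbv beta. simpl csum. ring. }
      exists l. split; [exact Hl2 |]. intros eps He.
      destruct (pow_small (1 / 2) ltac:(lra) (R0 * (2 * M) * M0) eps He) as [N0 HN0].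
      exists N0. intros N HN. rewrite Cmod_minus_sym.
      destruct (Hest N) as [lN [HlN1 HlN2]].
      pose proof (is_cint_csum A B c N (fun n => x n * Cpow xi n)%C (fun n z => kap z * Cpow z (S n))%C (fun n => H (S n))
        HAB (fun n => HH (S n))) as Hcs.
      pose proof (is_cint_lin A B c _ _ (- (1))%C _ _ HAB Hl2 Hcs) as Hdiff.
      assert (Hdiff2 : is_cint A B c
         (fun z => kap z * (z * (X (z * xi) - csum N (fun n => x n * Cpow (z * xi) n))))%C
         (l + - (1) * csum N (fun n => x n * Cpow xi n * H (S n)))%C).
      { eapply is_cint_ext; [exact HAB | | exact Hdiff]. intros z _. cbv beta.
        assert (E : csum N (fun n => x n * Cpow xi n * (kap z * Cpow z (S n)))%C =
          (kap z * z * csum N (fun n => x n * Cpow (z * xi) n))%C).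
        { rewrite <- csum_mult_l. apply csum_ext. intros n _. rewrite Cpow_mult_l, Cpow_S. ring. }
        rewrite E. ring. }
      pose proof (is_cint_unique A B c _ _ _ HAB Hdiff2 HlN1) as EE.
      assert (E : csum N (fun j => x j * H (S j) * Cpow xi j)%C = csum N (fun n => x n * Cpow xi n * H (S n))%C).
      { apply csum_ext. intros; ring. }
      rewrite E.
      replace (l - csum N (fun n => x n * Cpow xi n * H (S n)))%C
        with (l + - (1) * csum N (fun n => x n * Cpow xi n * H (S n)))%C by ring.
      rewrite EE. apply Rle_lt_trans with (1 := HlN2). specialize (HN0 N HN). lra. }
  destruct (choice _ Hex) as [I HI]. exists I.
  split; [intros xi; apply HI |]. split; [intros xi; apply HI |].
  (* Convergence of the series at the single point |xi| + 1 bounds its coefficients, which gives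
     holomorphy on the disc of that radius. *)
  intros xi. pose proof (Cmod_ge_0 xi) as Hxi.
  assert (Hm : Cmod (RtoC (Cmod xi + 1)) = Cmod xi + 1) by (rewrite Cmod_R; apply Rabs_right; lra).
  destruct (pser_pbound (fun n => x n * H (S n))%C (RtoC (Cmod xi + 1)) (I (RtoC (Cmod xi + 1)))) as [M HM].
  - apply Cmod_gt_0. lra.
  - apply HI.
  - rewrite Hm in HM. apply (pser_holo (fun n => x n * H (S n))%C M (Cmod xi + 1) I xi); [lra | exact HM | intros y _; apply HI | lra].
Qed.

(** * The pole part *)

(** If there is a pole, [r_min] is finite and positive. An infinite supremum would make alpha |gam|
    infinite for gam <> 0, and then not less than a cosine. If there is no pole, the bound is
    vacuous. *)
Lemma sector_bound (U T P : C -> Prop) (theta rm : R) (gam : C) : 0 < rm -> (forall p, P p -> rm <= Cmod p) ->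
  gam <> 0%C -> U_sector U theta (alpha theta T P) gam ->
  exists l, 0 <= l /\ forall z p, T z -> P p -> Cmod z * cos (theta + Carg z - Carg p) <= l.
Proof.
  intros Hrm HP Hg [_ HU].
  destruct (classic (exists p, P p)) as [[p0 Hp0] | Hno];
    [| exists 0; split; [lra |]; intros z p _ Hp; exfalso; apply Hno; now exists p].
  unfold alpha in HU.
  set (E := fun x => exists z p, T z /\ P p /\ x = Cmod z * cos (theta + Carg z - Carg p)) in *.
  assert (Hr : exists r, 0 < r /\ r_min P = Finite r).
  { unfold r_min. destruct (Glb_Rbar_correct (fun x => exists p, P p /\ x = Cmod p)) as [H1 H2].
    assert (Ha : Rbar_le rm (Glb_Rbar (fun x => exists p, P p /\ x = Cmod p))).
    { apply H2. intros x [p [Hp ->]]. simpl. now apply HP. }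
    assert (Hb : Rbar_le (Glb_Rbar (fun x => exists p, P p /\ x = Cmod p)) (Cmod p0)).
    { apply H1. now exists p0. }
    destruct (Glb_Rbar (fun x => exists p, P p /\ x = Cmod p)) as [r | |]; simpl in *; try tauto.
    exists r. split; [lra | reflexivity]. }
  destruct Hr as [r [Hr Er]]. rewrite Er in HU.
  assert (Hg0 : 0 < Cmod gam) by now apply Cmod_gt_0.
  destruct (Lub_Rbar_correct E) as [H1 _].
  destruct (Lub_Rbar E) as [l | |] eqn:El.
  - exists (Rmax 0 l). split; [apply Rmax_l |]. intros z p Hz Hp.
    apply Rle_trans with (2 := Rmax_r 0 l). apply (H1 (Cmod z * cos (theta + Carg z - Carg p))).
    now exists z, p.
  - exfalso.
    assert (Ei : Rbar_inv (Finite r) = Finite (/ r)).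
    { simpl. reflexivity. }
    rewrite Ei in HU.
    assert (E1 : Rbar_mult (/ r) p_infty = p_infty).
    { apply is_Rbar_mult_unique. apply is_Rbar_mult_sym, is_Rbar_mult_p_infty_pos.
      simpl. now apply Rinv_0_lt_compat. }
    assert (E2 : Rbar_mult p_infty (Cmod gam) = p_infty).
    { apply is_Rbar_mult_unique. now apply is_Rbar_mult_p_infty_pos. }
    rewrite E1, E2 in HU. exact HU.
  - exists 0. split; [lra |]. intros z p Hz Hp. exfalso.
    apply (H1 (Cmod z * cos (theta + Carg z - Carg p))). now exists z, p.
Qed.

Lemma cis_plus (x y : R) : cis (x + y) = (cis x * cis y)%C.
Proof. unfold cis. rewrite cos_plus, sin_plus. apply injective_projections; simpl; ring. Qed.

Lemma Re_ray_quotient (theta t : R) (z p : C) : z <> 0%C -> p <> 0%C ->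
  Re (z * ray theta t / p) = t * (Cmod z * cos (theta + Carg z - Carg p)) / Cmod p.
Proof.
  intros Hz Hp. assert (Hp0 : 0 < Cmod p) by now apply Cmod_gt_0.
  assert (Hpc : RtoC (Cmod p) <> 0%C) by (intros E; apply RtoC_inj in E; lra).
  assert (E : (z * ray theta t / p = RtoC (t * Cmod z / Cmod p) * cis (theta + Carg z - Carg p))%C).
  { assert (E1 : (z * ray theta t = RtoC (t * Cmod z / Cmod p) * cis (theta + Carg z - Carg p) * p)%C).
    { rewrite (cis_Carg p Hp) at 3. rewrite (cis_Carg z Hz) at 1. unfold ray. rewrite Cexp_Ci.
      transitivity (RtoC (t * Cmod z / Cmod p) * Cmod p * (cis (theta + Carg z - Carg p) * cis (Carg p)))%C; [| ring].
      rewrite <- cis_plus. replace (theta + Carg z - Carg p + Carg p) with (theta + Carg z) by ring.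
      rewrite cis_plus. rewrite <- RtoC_mult. replace (t * Cmod z / Cmod p * Cmod p) with (t * Cmod z) by (field; lra).
      rewrite RtoC_mult. ring. }
    rewrite E1. field. exact Hp. }
  rewrite E. unfold cis. simpl. field. lra.
Qed.

Lemma jker_bound (kap : C -> C) (p xi z : C) (k : nat) (s : R) : 0 < s -> p <> 0%C ->
  Cmod (jker kap p k xi z) <=
    exp (Re (z * xi / p)) * (INR (fact k) * (/ s) ^ k) / Cmod p ^ k * (Cmod (kap z) * exp (s * Cmod z)).
Proof.
  intros Hs Hp. unfold jker. rewrite !Cmod_mult, Cmod_Cexp, Cmod_pow, Cmod_div by exact Hp.
  assert (Hp0 : 0 < Cmod p ^ k) by (apply pow_lt; now apply Cmod_gt_0).
  pose proof (pow_exp_le (Cmod z) s k Hs (Cmod_ge_0 z)) as Hz.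
  unfold Rdiv. rewrite Rpow_mult_distr, pow_inv.
  assert (H0 : 0 <= Cmod (kap z) * exp (Re (z * xi / p)) * / Cmod p ^ k).
  { apply Rmult_le_pos; [apply Rmult_le_pos; [apply Cmod_ge_0 | apply Rlt_le, exp_pos] |].
    now apply Rlt_le, Rinv_0_lt_compat. }
  apply (Rmult_le_compat_l _ _ _ H0) in Hz. unfold Cdiv in *. lra.
Qed.

(** For xi on the ray the real part of z xi / p is t |z| cos(theta + Arg z - Arg p) / |p|, hence at
    most t l / |p| along the whole contour. The exponential costs only a constant, and half of the
    decay of the kernel pays for (z/p)^k. *)
Lemma jker_ray_absint (A B : Rbar) (bs : list R) (c : R -> C) (kap : C -> C) (d1 l theta t : R) (p : C) (k : nat) :
  decaying A B bs c kap d1 -> (forall z, trace A B c z -> z <> 0%C) -> p <> 0%C -> 0 <= t ->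
  (forall z, trace A B c z -> Cmod z * cos (theta + Carg z - Carg p) <= l) ->
  exists M, absint A B c (jker kap p k (ray theta t)) M.
Proof.
  intros [Hc [Hk [Hd Hw]]] Hz Hp Ht Hl. destruct (Hw (d1 / 2)) as [M [HM Habs]]; [lra |].
  assert (Hp0 : 0 < Cmod p) by now apply Cmod_gt_0.
  set (q := exp (t * l / Cmod p) * (INR (fact k) * (/ (d1 / 2)) ^ k) / Cmod p ^ k).
  assert (Hf : 0 <= (INR (fact k) * (/ (d1 / 2)) ^ k) / Cmod p ^ k).
  { apply Rdiv_le_0_compat; [| now apply pow_lt]. apply Rmult_le_pos; [apply pos_INR |].
    apply pow_le, Rlt_le, Rinv_0_lt_compat. lra. }
  exists (q * M). apply (absint_dom A B bs c _ (weighted kap (d1 / 2)) q M Hc); [| | | exact Habs].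
  - unfold q, Rdiv. rewrite Rmult_assoc. apply Rmult_le_pos; [apply Rlt_le, exp_pos | exact Hf].
  - intros z Hz0. apply weighted_cont. now apply Hk.
  - intros z Hz0. rewrite Cmod_weighted.
    eapply Rle_trans; [apply (jker_bound kap p (ray theta t) z k (d1 / 2)); [lra | exact Hp] |].
    apply Rmult_le_compat_r; [apply Rmult_le_pos; [apply Cmod_ge_0 | apply Rlt_le, exp_pos] |].
    unfold q, Rdiv. rewrite !(Rmult_assoc (exp _)). apply Rmult_le_compat_r; [exact Hf |].
    apply exp_le. fold (Rdiv (t * l) (Cmod p)). fold (z * ray theta t / p)%C.
    rewrite Re_ray_quotient by auto.
    unfold Rdiv. apply Rmult_le_compat_r; [now apply Rlt_le, Rinv_0_lt_compat |].
    apply Rmult_le_compat_l; [exact Ht | now apply Hl].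
Qed.

Lemma list_uniform {T : Type} (l : list T) (Q : T -> R -> Prop) : (forall x m m', Q x m -> m <= m' -> Q x m') ->
  (forall x, In x l -> exists m, Q x m) -> exists m, 0 <= m /\ forall x, In x l -> Q x m.
Proof.
  intros Hmono. induction l as [| y l IH]; intros Hl.
  - exists 0. split; [lra |]. intros x [].
  - destruct IH as [m [Hm1 Hm2]]; [intros x Hx; apply Hl; now right |].
    destruct (Hl y) as [m' Hm']; [now left |].
    exists (Rmax m m'). pose proof (Rmax_l m m'). pose proof (Rmax_r m m'). split; [lra |].
    intros x [<- | Hx]; [now apply Hmono with m' | apply Hmono with m; [now apply Hm2 | lra]].
Qed.

Lemma absint_mono (A B : Rbar) (c : R -> C) (F : C -> C) (M M' : R) : absint A B c F M -> M <= M' -> absint A B c F M'.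
Proof. intros H HM a b y Ha Hb Hab Hy. apply Rle_trans with M; [now apply (H a b y) | exact HM]. Qed.

Definition all_jker_absint (A B : Rbar) (c : R -> C) (kap : C -> C) (P V : C -> Prop) (nphi : nat) : Prop :=
  forall xi p k, V xi -> P p -> (1 <= k <= nphi)%nat -> exists M, absint A B c (jker kap p k xi) M.

Lemma poles_enumerable (P : C -> Prop) (nphi : nat) (b : C -> nat -> C) (rm L R0 : R) :
  pole_functional P nphi b rm L -> exists R1 l, R0 <= R1 /\ enumerates (fun p => P p /\ Cmod p < R1) l.
Proof.
  intros HF. pose proof (pole_sum_zero _ _ _ _ _ HF) as H0.
  destruct (H0 1 Rlt_0_1) as [R1 H1].
  destruct (H1 (Rmax R0 R1 + 1)) as [l [Hl _]]; [pose proof (Rmax_r R0 R1); lra |].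
  exists (Rmax R0 R1 + 1), l. split; [pose proof (Rmax_l R0 R1); lra | exact Hl].
Qed.

(* For large |p| the kernel is dominated by kap with half of its decay; the finitely many
   remaining poles are handled one at a time. *)
Lemma jker_absint_uniform (A B : Rbar) (bs : list R) (c : R -> C) (kap : C -> C) (d1 : R) (P V : C -> Prop)
    (nphi : nat) (b : C -> nat -> C) (rm L : R) (xi : C) : decaying A B bs c kap d1 -> pole_functional P nphi b rm L ->
  all_jker_absint A B c kap P V nphi -> Copen V -> V xi ->
  exists s M, 0 < s <= 1 /\ 0 <= M /\ (forall h, Cmod h <= s -> V (xi + h)%C) /\
    forall p k, P p -> (1 <= k <= nphi)%nat ->
      absint A B c (fun z => jker kap p k xi z * RtoC (exp (s * Cmod (z * / p))))%C (M / Cmod p).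
Proof.
  intros Hdec HF HA HVo HV. assert (Hdec2 := Hdec). destruct Hdec2 as [Hc [Hk [Hd Hw]]].
  assert (Hrm := HF). destruct Hrm as [Hrm1 [Hrm2 _]].
  destruct (proj1 (Copen_disc V) HVo xi HV) as [d [Hd0 HdV]].
  (* The corners of [jker_corner] lie at distance 2s from xi, which is less than d and so stays in
     V. *)
  set (s := Rmin 1 (d / 3)).
  assert (Hs : 0 < s <= 1) by (unfold s; split; [apply Rmin_glb_lt; lra | apply Rmin_l]).
  assert (Hsd : s <= d / 3) by apply Rmin_r.
  assert (HVh : forall h, Cmod h <= 2 * s -> V (xi + h)%C).
  { intros h Hh. apply HdV. replace (xi + h - xi)%C with h by ring. lra. }
  pose proof (Cmod_ge_0 xi) as Hxi.
  (* Beyond this radius (|xi| + 1) / |p| <= d1/2, so that both exponentials together cost half of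
     the decay, and |p| >= 1 gives |p|^-k <= 1/|p|. *)
  destruct (poles_enumerable P nphi b rm L (Rmax 1 (2 * (Cmod xi + 1) / d1)) HF) as [R1 [l [HR1 [_ Hl]]]].
  pose proof (Rmax_l 1 (2 * (Cmod xi + 1) / d1)) as HR1a. pose proof (Rmax_r 1 (2 * (Cmod xi + 1) / d1)) as HR1b.
  (* Half of d1 goes to the exponentials and a quarter to the power of z; a quarter remains for
     integrability. *)
  destruct (Hw (3 * d1 / 4)) as [M0 [HM0 Habs]]; [lra |].
  set (D := Rsum (seq 0 (S nphi)) (fun k => INR (fact k) * (/ (d1 / 4)) ^ k)).
  assert (HDk : forall k, 0 <= INR (fact k) * (/ (d1 / 4)) ^ k).
  { intros k. apply Rmult_le_pos; [apply pos_INR |]. apply pow_le, Rlt_le, Rinv_0_lt_compat. lra. }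
  assert (HD : forall k, (k <= nphi)%nat -> INR (fact k) * (/ (d1 / 4)) ^ k <= D).
  { intros k Hkn. apply (Rsum_In (seq 0 (S nphi)) (fun k => INR (fact k) * (/ (d1 / 4)) ^ k)).
    - intros; apply HDk.
    - apply in_seq. lia. }
  assert (HD0 : 0 <= D) by (apply Rsum_ge0; intros; apply HDk).
  (* Each of the finitely many pairs (p, k) with |p| < R1 has its own bound from the four corners;
     multiplying it by |p| puts it into the form M / |p|, and the maximum serves all of them. *)
  destruct (list_uniform (list_prod l (seq 1 nphi)) (fun e M => P (fst e) ->
      absint A B c (fun z => jker kap (fst e) (snd e) xi z * RtoC (exp (s * Cmod (z * / fst e))))%C (M / Cmod (fst e))))
    as [M1 [HM1 HM1b]].
  { intros [p k] m m' H Hm Hp. simpl in *. apply absint_mono with (1 := H Hp).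
    apply Rmult_le_compat_r; [| exact Hm]. apply Rlt_le, Rinv_0_lt_compat. specialize (Hrm2 p Hp). lra. }
  { intros [p k] Hpk. apply in_prod_iff in Hpk. destruct Hpk as [Hp Hk2]. apply in_seq in Hk2. apply Hl in Hp.
    destruct Hp as [Hp _]. simpl. assert (Hp0 : 0 < Cmod p) by (specialize (Hrm2 p Hp); lra).
    assert (Hco : forall h, Cmod h <= 2 * s -> (forall z, trace A B c z -> cont_at (jker kap p k (xi + h)) z) /\
       exists M, absint A B c (jker kap p k (xi + h)) M).
    { intros h Hh. split; [intros z Hz; apply jker_cont; now apply Hk |].
      apply HA; [now apply HVh | exact Hp | lia]. }
    assert (Hm2 : Cmod (2 * s) = 2 * s).
    { rewrite <- RtoC_mult, Cmod_R. apply Rabs_right. lra. }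
    destruct (absint_dom_sum A B bs c (fun z => jker kap p k xi z * RtoC (exp (s * Cmod (z * / p))))%C
      (jker kap p k (xi + 2 * s) :: jker kap p k (xi - 2 * s) :: jker kap p k (xi - 2 * s * Ci) ::
        jker kap p k (xi + 2 * s * Ci) :: nil)%C Hc) as [M HM].
    - intros G [<- | [<- | [<- | [<- | []]]]]; apply Hco; rewrite ?Cmod_opp, ?Cmod_mult, ?Cmod_Ci, ?Rmult_1_r;
        rewrite <- ?Cmod_mult, ?Hm2; lra.
    - intros z _. apply jker_corner. lra.
    - exists (M * Cmod p). intros _. replace (M * Cmod p / Cmod p) with M by (field; lra). exact HM. }
  exists s, (M1 + D * M0). split; [exact Hs |].
  assert (HDM : 0 <= D * M0) by now apply Rmult_le_pos.
  split; [lra |]. split; [intros h Hh; apply HVh; lra |].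
  intros p k Hp Hkn. assert (Hp1 := Hrm2 p Hp). assert (Hp0 : 0 < Cmod p) by lra.
  assert (Hpn : p <> 0%C) by now apply Cmod_gt_0.
  assert (Hi0 : 0 < / Cmod p) by now apply Rinv_0_lt_compat.
  destruct (Rlt_le_dec (Cmod p) R1) as [Hlt | Hge].
  - apply absint_mono with (M1 / Cmod p).
    + apply (HM1b (p, k)); [| exact Hp]. apply in_prod; [now apply Hl | apply in_seq; lia].
    + apply Rmult_le_compat_r; lra.
  - apply absint_mono with (D / Cmod p * M0).
    + apply (absint_dom A B bs c _ (weighted kap (3 * d1 / 4)) (D / Cmod p) M0 Hc); [| | | exact Habs].
      * apply Rdiv_le_0_compat; lra.
      * intros z Hz. apply weighted_cont. now apply Hk.
      * intros z Hz. rewrite Cmod_weighted, Cmod_mult, Cmod_R, Rabs_right by (apply Rle_ge, Rlt_le, exp_pos).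
        pose proof (jker_bound kap p xi z k (d1 / 4) ltac:(lra) Hpn) as Hj.
        pose proof (Cmod_ge_0 z) as Hz0. pose proof (Cmod_ge_0 (kap z)) as Hk0.
        assert (He : exp (Re (z * xi / p)) * exp (s * Cmod (z * / p)) <= exp (d1 / 2 * Cmod z)).
        { rewrite <- exp_plus. apply exp_le.
          assert (Ha : Re (z * xi / p) <= Cmod xi * (Cmod z * / Cmod p)).
          { apply Rle_trans with (Cmod (z * xi / p)); [apply Rle_trans with (1 := Rle_abs _), re_le_Cmod |].
            rewrite Cmod_div, Cmod_mult by exact Hpn. right. unfold Rdiv. ring. }
          rewrite Cmod_mult, Cmod_inv by exact Hpn.
          assert (Hb0 : 0 <= Cmod z * / Cmod p) by (apply Rmult_le_pos; lra).
          apply Rle_trans with ((Cmod xi + 1) * (Cmod z * / Cmod p)); [nra |].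
          assert (Hb : (Cmod xi + 1) * / Cmod p <= d1 / 2).
          { apply Rmult_le_reg_r with (Cmod p); [exact Hp0 |]. rewrite Rmult_assoc, Rinv_l, Rmult_1_r by lra.
            assert (Hc1 : 2 * (Cmod xi + 1) / d1 <= Cmod p) by lra.
            apply (Rmult_le_compat_r d1) in Hc1; [| lra].
            unfold Rdiv in Hc1. rewrite Rmult_assoc, Rinv_l in Hc1 by lra. lra. }
          apply (Rmult_le_compat_r (Cmod z)) in Hb; [lra | exact Hz0]. }
        assert (Hpk : / Cmod p ^ k <= / Cmod p).
        { apply Rinv_le_contravar; [exact Hp0 |]. rewrite <- (pow_1 (Cmod p)) at 1. apply Rle_pow; [lra | lia]. }
        assert (Hpk0 : 0 < / Cmod p ^ k) by (apply Rinv_0_lt_compat; now apply pow_lt).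
        specialize (HD k ltac:(lia)). specialize (HDk k).
        set (Fk := INR (fact k) * (/ (d1 / 4)) ^ k) in *.
        set (E1 := exp (Re (z * xi / p))) in *. set (E2 := exp (s * Cmod (z * / p))) in *.
        assert (HE1 : 0 < E1) by apply exp_pos. assert (HE2 : 0 < E2) by apply exp_pos.
        pose proof (exp_pos (d1 / 4 * Cmod z)) as HE3.
        apply Rle_trans with (E1 * E2 * (Fk * / Cmod p ^ k) * (Cmod (kap z) * exp (d1 / 4 * Cmod z))).
        { apply (Rmult_le_compat_r E2) in Hj; [| lra]. unfold Rdiv in Hj. lra. }
        replace (3 * d1 / 4 * Cmod z) with (d1 / 2 * Cmod z + d1 / 4 * Cmod z) by field.
        rewrite exp_plus.
        assert (Hg1 : Fk * / Cmod p ^ k <= D / Cmod p) by (apply Rmult_le_compat; lra).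
        assert (Hg0 : 0 <= Fk * / Cmod p ^ k) by (apply Rmult_le_pos; lra).
        replace (D / Cmod p * (Cmod (kap z) * (exp (d1 / 2 * Cmod z) * exp (d1 / 4 * Cmod z))))
          with (exp (d1 / 2 * Cmod z) * (D / Cmod p) * (Cmod (kap z) * exp (d1 / 4 * Cmod z))) by ring.
        apply Rmult_le_compat_r; [apply Rmult_le_pos; lra |].
        apply Rmult_le_compat; [nra | exact Hg0 | exact He | exact Hg1].
    + unfold Rdiv. assert (0 <= M1 * / Cmod p) by (apply Rmult_le_pos; lra). lra.
Qed.

Definition monom (n : nat) (xi : C) : C := (Cpow xi n / INR (fact n))%C.

Lemma monom_second_order (xi : C) (N : nat) : exists Q, 0 <= Q /\ forall n, (n <= N)%nat ->
  exists q1, Cmod q1 <= Q /\ Cmod (monom n xi) <= Q /\ forall h, Cmod h <= 1 ->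
    Cmod (monom n (xi + h)) <= Q /\ Cmod (monom n (xi + h) - monom n xi) <= Q * Cmod h /\
    Cmod (monom n (xi + h) - monom n xi - h * q1) <= Q * Cmod h ^ 2.
Proof.
  set (r := Cmod xi + 1). pose proof (Cmod_ge_0 xi) as Hxi.
  assert (Hr : 1 <= r) by (unfold r; lra).
  assert (HN : 0 <= INR N) by apply pos_INR.
  assert (HrN : 1 <= r ^ N) by now apply pow_R1_Rle.
  exists ((INR N + 1) * r ^ N). split; [apply Rmult_le_pos; lra |].
  intros n Hn.
  assert (Hrn : r ^ n <= r ^ N) by now apply Rle_pow.
  assert (HQ : r ^ N <= (INR N + 1) * r ^ N) by nra.
  assert (Hf := INR_fact_ge_1 n). assert (Hfc := INR_fact_neq n).
  assert (Hdiv : forall (y : C) (m : R), Cmod y <= m -> Cmod (y / INR (fact n)) <= m).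
  { intros y m Hm. rewrite Cmod_div, Cmod_R, Rabs_right by (try exact Hfc; lra).
    apply Rmult_le_reg_r with (INR (fact n)); [lra |]. unfold Rdiv. rewrite Rmult_assoc, Rinv_l by lra.
    pose proof (Cmod_ge_0 y). nra. }
  exists (INR n * Cpow xi (n - 1) / INR (fact n))%C. unfold monom.
  assert (Hpw : forall y m, Cmod y <= r -> (m <= N)%nat -> Cmod (Cpow y m) <= r ^ N).
  { intros y m Hy Hm. rewrite Cmod_pow. apply Rle_trans with (r ^ m).
    - apply pow_incr. split; [apply Cmod_ge_0 | exact Hy].
    - now apply Rle_pow. }
  split; [| split].
  - apply Hdiv. rewrite Cmod_mult, Cmod_R, Rabs_right by (apply Rle_ge, pos_INR).
    apply Rmult_le_compat; [apply pos_INR | apply Cmod_ge_0 | |].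
    + apply le_INR in Hn. lra.
    + apply Hpw; [unfold r; lra | lia].
  - apply Hdiv. apply Rle_trans with (2 := HQ). apply Hpw; [unfold r; lra | exact Hn].
  - intros h Hh. pose proof (Cmod_ge_0 h) as Hh0. psplit.
    + apply Hdiv. apply Rle_trans with (2 := HQ). apply Hpw; [| exact Hn].
      pose proof (Cmod_triangle xi h). unfold r. lra.
    + replace (Cpow (xi + h) n / INR (fact n) - Cpow xi n / INR (fact n))%C
        with ((Cpow (xi + h) n - Cpow xi n) / INR (fact n))%C by (field; exact Hfc).
      apply Hdiv. pose proof (pow_diff_bound xi h 1 n Rlt_0_1 Hh) as Hd.
      unfold Rdiv in Hd. rewrite Rinv_1, Rmult_1_r in Hd. fold r in Hd. nra.
    + replace (Cpow (xi + h) n / INR (fact n) - Cpow xi n / INR (fact n) - h * (INR n * Cpow xi (n - 1) / INR (fact n)))%C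
        with ((Cpow (xi + h) n - Cpow xi n - h * (INR n * Cpow xi (n - 1))) / INR (fact n))%C by (field; exact Hfc).
      apply Hdiv. pose proof (pow_diff2_bound xi h 1 n Rlt_0_1 Hh) as Hd.
      unfold Rdiv in Hd. rewrite Rinv_1, Rmult_1_r in Hd. fold r in Hd.
      assert (0 <= Cmod h ^ 2) by (apply pow_le; lra). nra.
Qed.

(** Value, derivative and quadratic remainder of each integral are O(1/|p|) with one constant. The
    product rule with xi^(k-1)/(k-1)! preserves this form, so that the functional can be applied to
    values, derivatives and remainders separately. *)
Lemma jker_sum_local (A B : Rbar) (bs : list R) (c : R -> C) (kap : C -> C) (d1 : R) (P V : C -> Prop)
    (nphi : nat) (b : C -> nat -> C) (rm L : R) (J : C -> C -> nat -> C) (xi : C) :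
  decaying A B bs c kap d1 -> pole_functional P nphi b rm L -> all_jker_absint A B c kap P V nphi -> Copen V ->
  (forall xi p k, V xi -> P p -> (1 <= k <= nphi)%nat -> is_cint A B c (jker kap p k xi) (J xi p k)) -> V xi ->
  exists S0 S1 s M, 0 < s /\ (forall h, Cmod h <= s -> V (xi + h)%C) /\
    is_pole_sum P nphi b (fun p k => J xi p k * monom (k - 1) xi)%C S0 /\
    forall h S, Cmod h <= s -> is_pole_sum P nphi b (fun p k => J (xi + h)%C p k * monom (k - 1) (xi + h))%C S ->
      Cmod (S - S0 - h * S1) <= M * Cmod h ^ 2.
Proof.
  intros Hdec HF HA HVo HJ HV. assert (Hc := proj1 Hdec). assert (Hk := proj1 (proj2 Hdec)).
  pose proof (contour_dom _ _ _ _ Hc) as HAB.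
  destruct (jker_absint_uniform A B bs c kap d1 P V nphi b rm L xi Hdec HF HA HVo HV) as [s [M [Hs [HM [HVs Habs]]]]].
  assert (Hrm := HF). destruct Hrm as [Hrm1 [Hrm2 [HL HFn]]].
  destruct (monom_second_order xi nphi) as [Q [HQ0 HQ]].
  assert (Hs2 : 0 < s ^ 2) by (apply pow_lt; lra).
  set (M2 := 8 / s ^ 2 * M).
  assert (HM2 : 0 <= M2) by (unfold M2; apply Rmult_le_pos; [apply Rlt_le, Rdiv_lt_0_compat; lra | exact HM]).
  assert (Hj1 : exists J1 : C * nat -> C, forall e, P (fst e) -> (1 <= snd e <= nphi)%nat ->
    Cmod (J xi (fst e) (snd e)) <= M2 / Cmod (fst e) /\ Cmod (J1 e) <= M2 / Cmod (fst e) /\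
    forall h, Cmod h <= s / 2 ->
      Cmod (J (xi + h)%C (fst e) (snd e) - J xi (fst e) (snd e) - h * J1 e) <= M2 / Cmod (fst e) * Cmod h ^ 2).
  { apply (choice (fun e j1 => P (fst e) -> (1 <= snd e <= nphi)%nat ->
    Cmod (J xi (fst e) (snd e)) <= M2 / Cmod (fst e) /\ Cmod j1 <= M2 / Cmod (fst e) /\
    forall h, Cmod h <= s / 2 ->
      Cmod (J (xi + h)%C (fst e) (snd e) - J xi (fst e) (snd e) - h * j1) <= M2 / Cmod (fst e) * Cmod h ^ 2)).
    intros [p k]. simpl fst. simpl snd.
    destruct (classic (P p /\ (1 <= k <= nphi)%nat)) as [[Hp Hkn] | Hno];
      [| exists 0%C; intros Hp Hkn; exfalso; now apply Hno].
    assert (Hp0 : 0 < Cmod p) by (specialize (Hrm2 p Hp); lra).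
    assert (HMp : 0 <= M / Cmod p) by (apply Rdiv_le_0_compat; lra).
    destruct (jker_second_order A B bs c kap p xi k s (M / Cmod p) Hc Hk Hs HMp (Habs p k Hp Hkn))
      as [j0 [j1 [H0 [H1 [H2 H3]]]]].
    assert (E : M2 / Cmod p = 8 / s ^ 2 * (M / Cmod p)) by (unfold M2; field; split; lra).
    rewrite <- (is_cint_unique A B c _ _ _ HAB (HJ xi p k HV Hp Hkn) H0) in H1, H3.
    exists j1. intros _ _. rewrite E. split; [exact H1 |]. split; [exact H2 |].
    intros h Hh. destruct (H3 h Hh) as [jh [Hjh1 Hjh2]].
    assert (HVh : V (xi + h)%C) by (apply HVs; lra).
    rewrite <- (is_cint_unique A B c _ _ _ HAB (HJ (xi + h)%C p k HVh Hp Hkn) Hjh1) in Hjh2. exact Hjh2. }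
  destruct Hj1 as [J1 HJ1].
  assert (Hq1 : exists q1 : nat -> C, forall n, (n <= nphi)%nat -> Cmod (q1 n) <= Q /\ Cmod (monom n xi) <= Q /\ forall h, Cmod h <= 1 ->
    Cmod (monom n (xi + h)) <= Q /\ Cmod (monom n (xi + h) - monom n xi) <= Q * Cmod h /\
    Cmod (monom n (xi + h) - monom n xi - h * q1 n) <= Q * Cmod h ^ 2).
  { apply (choice (fun n q1 => (n <= nphi)%nat -> Cmod q1 <= Q /\ Cmod (monom n xi) <= Q /\ forall h, Cmod h <= 1 ->
      Cmod (monom n (xi + h)) <= Q /\ Cmod (monom n (xi + h) - monom n xi) <= Q * Cmod h /\
      Cmod (monom n (xi + h) - monom n xi - h * q1) <= Q * Cmod h ^ 2)).
    intros n. destruct (le_lt_dec n nphi) as [Hn | Hn]; [| exists 0%C; intros; lia].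
    destruct (HQ n Hn) as [q1 Hq1]. now exists q1. }
  destruct Hq1 as [q1 Hq1].
  assert (HMQ : 0 <= M2 * Q) by now apply Rmult_le_pos.
  destruct (HFn (fun p k => J xi p k * monom (k - 1) xi)%C (M2 * Q)) as [S0 [HS0 _]]; [lra | |].
  { intros p k Hp Hkn. destruct (HJ1 (p, k) Hp Hkn) as [H1 _]. destruct (Hq1 (k - 1)%nat ltac:(lia)) as [_ [H2 _]].
    simpl in H1. rewrite Cmod_mult. replace (M2 * Q / Cmod p) with (M2 / Cmod p * Q) by (unfold Rdiv; ring).
    apply Rmult_le_compat; [apply Cmod_ge_0 | apply Cmod_ge_0 | exact H1 | exact H2]. }
  destruct (HFn (fun p k => J1 (p, k) * monom (k - 1) xi + J xi p k * q1 (k - 1)%nat)%C (2 * (M2 * Q))) as [S1 [HS1 _]]; [lra | |].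
  { intros p k Hp Hkn. destruct (HJ1 (p, k) Hp Hkn) as [H1 [H1' _]]. destruct (Hq1 (k - 1)%nat ltac:(lia)) as [H2' [H2 _]].
    simpl in H1, H1'. eapply Rle_trans; [apply Cmod_triangle |]. rewrite !Cmod_mult.
    replace (2 * (M2 * Q) / Cmod p) with (M2 / Cmod p * Q + M2 / Cmod p * Q) by (unfold Rdiv; ring).
    apply Rplus_le_compat; apply Rmult_le_compat; try apply Cmod_ge_0; assumption. }
  exists S0, S1, (s / 2), (L * (3 * (M2 * Q))).
  split; [lra |]. split; [intros h Hh; apply HVs; lra |]. split; [exact HS0 |].
  intros h S Hh HS. pose proof (Cmod_ge_0 h) as Hh0.
  assert (Hh2 : 0 <= Cmod h ^ 2) by (apply pow_le; lra).
  destruct (HFn (fun p k => (J (xi + h)%C p k * monom (k - 1) (xi + h) - J xi p k * monom (k - 1) xi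
      - h * (J1 (p, k) * monom (k - 1) xi + J xi p k * q1 (k - 1)%nat)))%C (3 * (M2 * Q) * Cmod h ^ 2)) as [D [HD1 HD2]].
  { apply Rmult_le_pos; lra. }
  { intros p k Hp Hkn. assert (Hp0 : 0 < Cmod p) by (specialize (Hrm2 p Hp); lra).
    destruct (HJ1 (p, k) Hp Hkn) as [H1 [H2 H3]]. destruct (Hq1 (k - 1)%nat ltac:(lia)) as [H4 [H5 H6]].
    simpl in H1, H2, H3. specialize (H3 h Hh). destruct (H6 h ltac:(lra)) as [H7 [H8 H9]].
    set (jh := J (xi + h)%C p k) in *. set (j0 := J xi p k) in *. set (j1 := J1 (p, k)) in *.
    set (qh := monom (k - 1) (xi + h)) in *. set (q0 := monom (k - 1) xi) in *. set (qq := q1 (k - 1)%nat) in *.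
    (* Product rule with remainder: each of the three terms is at most M2 Q |h|^2 / |p|, which is
       where the factor 3 comes from. *)
    replace (jh * qh - j0 * q0 - h * (j1 * q0 + j0 * qq))%C
      with ((jh - j0 - h * j1) * qh + (j0 * (qh - q0 - h * qq) + h * j1 * (qh - q0)))%C by ring.
    assert (HMp : 0 <= M2 / Cmod p) by (apply Rdiv_le_0_compat; lra).
    eapply Rle_trans; [apply Cmod_triangle |].
    replace (3 * (M2 * Q) * Cmod h ^ 2 / Cmod p)
      with (M2 / Cmod p * Cmod h ^ 2 * Q + (M2 / Cmod p * (Q * Cmod h ^ 2) + Cmod h * (M2 / Cmod p) * (Q * Cmod h)))
      by (field; lra).
    apply Rplus_le_compat; [rewrite Cmod_mult; apply Rmult_le_compat; try apply Cmod_ge_0; assumption |].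
    eapply Rle_trans; [apply Cmod_triangle |]. rewrite !Cmod_mult.
    apply Rplus_le_compat; [apply Rmult_le_compat; try apply Cmod_ge_0; assumption |].
    apply Rmult_le_compat; [| apply Cmod_ge_0 | | exact H8].
    - apply Rmult_le_pos; apply Cmod_ge_0.
    - now apply Rmult_le_compat_l. }
  assert (HD3 : is_pole_sum P nphi b (fun p k => (J (xi + h)%C p k * monom (k - 1) (xi + h) - J xi p k * monom (k - 1) xi
      - h * (J1 (p, k) * monom (k - 1) xi + J xi p k * q1 (k - 1)%nat)))%C (S - S0 - h * S1)%C).
  { replace (S - S0 - h * S1)%C with (S + (- (1)) * S0 + (- h) * S1)%C by ring.
    eapply pole_sum_ext; [| apply pole_sum_lin; [apply pole_sum_lin; [exact HS | exact HS0] | exact HS1]].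
    intros p k _ _. cbv beta. ring. }
  rewrite (pole_sum_unique _ _ _ _ _ _ HD3 HD1). apply Rle_trans with (1 := HD2). right. ring.
Qed.

Lemma jker_sum_holo (A B : Rbar) (bs : list R) (c : R -> C) (kap : C -> C) (d1 : R) (P V : C -> Prop)
    (nphi : nat) (b : C -> nat -> C) (rm L : R) (J : C -> C -> nat -> C) :
  decaying A B bs c kap d1 -> pole_functional P nphi b rm L -> all_jker_absint A B c kap P V nphi -> Copen V ->
  (forall xi p k, V xi -> P p -> (1 <= k <= nphi)%nat -> is_cint A B c (jker kap p k xi) (J xi p k)) ->
  exists S, (forall xi, V xi -> is_pole_sum P nphi b (fun p k => J xi p k * monom (k - 1) xi)%C (S xi)) /\
    forall xi, V xi -> holo_at S xi.
Proof.
  intros Hdec HF HA HVo HJ.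
  assert (HS : exists S : C -> C, forall xi, V xi -> is_pole_sum P nphi b (fun p k => J xi p k * monom (k - 1) xi)%C (S xi)).
  { apply (choice (fun xi S => V xi -> is_pole_sum P nphi b (fun p k => J xi p k * monom (k - 1) xi)%C S)).
    intros xi. destruct (classic (V xi)) as [HV | HV]; [| exists 0%C; tauto].
    destruct (jker_sum_local A B bs c kap d1 P V nphi b rm L J xi Hdec HF HA HVo HJ HV) as [S0 [_ [_ [_ [_ [_ [H _]]]]]]].
    now exists S0. }
  destruct HS as [S HS]. exists S. split; [exact HS |]. intros xi HV.
  destruct (jker_sum_local A B bs c kap d1 P V nphi b rm L J xi Hdec HF HA HVo HJ HV)
    as [S0 [S1 [s [M [Hs [HVs [H0 H1]]]]]]].
  exists S1. apply (cderiv_second_order S xi S1 M s Hs). intros h Hh.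
  rewrite (pole_sum_unique _ _ _ _ _ _ (HS xi HV) H0).
  apply H1; [exact Hh |]. apply HS. now apply HVs.
Qed.

(** With y = z xi / p the remainder of the Borel kernel is (1/2)^N e^(5|y|), and |xi| <= rm d1 / 10
    makes 5|y| <= d1 |z| / 2 for all poles at once. The kernel still has enough decay to integrate
    this, so that the integrals may be expanded termwise inside the sum over the poles. *)
Lemma jker_sum_germ (A B : Rbar) (bs : list R) (c : R -> C) (kap : C -> C) (d1 : R) (P V : C -> Prop)
    (nphi : nat) (b : C -> nat -> C) (rm L : R) (J : C -> C -> nat -> C) (lam H : nat -> C) (xi S : C) :
  decaying A B bs c kap d1 -> pole_functional P nphi b rm L ->
  (forall xi p k, V xi -> P p -> (1 <= k <= nphi)%nat -> is_cint A B c (jker kap p k xi) (J xi p k)) ->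
  is_pole_coeffs P nphi b lam -> (forall m, is_cint A B c (fun z => kap z * Cpow z m)%C (H m)) ->
  V xi -> Cmod xi <= rm * d1 / 10 -> is_pole_sum P nphi b (fun p k => J xi p k * monom (k - 1) xi)%C S ->
  pser (fun n => lam n * (H (Datatypes.S n) / INR (fact n)))%C xi S.
Proof.
  intros Hdec HF HJ Hlam HH HV Hxi HS. destruct Hdec as [Hc [Hk [Hd Hw]]].
  pose proof (contour_dom _ _ _ _ Hc) as HAB.
  assert (Hrm := HF). destruct Hrm as [Hrm1 [Hrm2 _]].
  destruct (Hw (3 * d1 / 4)) as [M0 [HM0 Habs]]; [lra |].
  set (v := fun n => (Cpow xi n / INR (fact n) * H (Datatypes.S n))%C).
  assert (Hcl : clim (fun N => csum N (fun n => v n * lam n)%C) S).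
  { assert (Hd4 : 0 < / (d1 / 4)) by (apply Rinv_0_lt_compat; lra).
    eapply (pole_sum_pser P nphi b rm L _ _ lam v S (/ (d1 / 4) * M0) HF); [| exact HS | exact Hlam |].
    { apply Rmult_le_pos; lra. }
    intros p k N Hp Hkn. cbv beta. assert (Hp1 := Hrm2 p Hp). assert (Hp0 : 0 < Cmod p) by lra.
    assert (Hpn : p <> 0%C) by now apply Cmod_gt_0.
    pose proof (is_cint_csum A B c N (fun n => Cpow xi n / INR (fact n) * (INR (bincoef n (k - 1)) * Cpow (/ p) (Datatypes.S n)))%C
      (fun n z => kap z * Cpow z (Datatypes.S n))%C (fun n => H (Datatypes.S n)) HAB (fun n => HH (Datatypes.S n))) as Hcs.
    pose proof (is_cint_zero A B c (fun _ => 0%C) HAB (fun z _ => eq_refl)) as Hz.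
    pose proof (is_cint_lin A B c _ _ (monom (k - 1) xi) _ _ HAB Hz (HJ xi p k HV Hp Hkn)) as Hj.
    pose proof (is_cint_lin A B c _ _ (- (1))%C _ _ HAB Hj Hcs) as Hdiff.
    set (y := fun z => (z * xi / p)%C).
    (* One factor z/p is split off (z/p)^k: the other k - 1 combine with xi^(k-1) to y^(k-1), and
       the one left over supplies the 1/|p| required by the functional. *)
    set (F := fun z => (kap z * (z / p) * (Cpow (y z) (k - 1) / INR (fact (k - 1)) * Cexp (y z) -
       csum N (fun n => INR (bincoef n (k - 1)) / INR (fact n) * Cpow (y z) n)))%C).
    assert (HFE : forall z, (0 + monom (k - 1) xi * jker kap p k xi z + - (1) *
        csum N (fun n => Cpow xi n / INR (fact n) * (INR (bincoef n (k - 1)) * Cpow (/ p) (Datatypes.S n)) * (kap z * Cpow z (Datatypes.S n))))%C = F z).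
    { intros z. unfold F, jker, monom.
      assert (E1 : csum N (fun n => Cpow xi n / INR (fact n) * (INR (bincoef n (k - 1)) * Cpow (/ p) (Datatypes.S n)) * (kap z * Cpow z (Datatypes.S n)))%C =
        (kap z * (z / p) * csum N (fun n => INR (bincoef n (k - 1)) / INR (fact n) * Cpow (y z) n))%C).
      { rewrite <- csum_mult_l. apply csum_ext. intros n _. unfold y, Cdiv. rewrite !Cpow_mult_l, !Cpow_S. ring. }
      rewrite E1.
      assert (E2 : (Cpow (z / p) k * Cpow xi (k - 1) = z / p * Cpow (y z) (k - 1))%C).
      { replace k with (Datatypes.S (k - 1)) at 1 by lia. rewrite Cpow_S.
        replace (y z) with (z / p * xi)%C by (unfold y; field; exact Hpn). rewrite (Cpow_mult_l (z / p) xi). ring. }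
      fold (y z).
      transitivity (kap z * Cexp (y z) / INR (fact (k - 1)) * (Cpow (z / p) k * Cpow xi (k - 1)) -
        kap z * (z / p) * csum N (fun n => INR (bincoef n (k - 1)) / INR (fact n) * Cpow (y z) n))%C.
      - unfold Cdiv. ring.
      - rewrite E2. unfold Cdiv. ring. }
    assert (HFcont : forall z, trace A B c z -> cont_at F z).
    { intros z Hz0. unfold F.
      assert (Hlin : forall n z, cont_at (fun q => Cpow (y q) n) z).
      { intros n q. pose proof (cont_at_pow n (xi / p) q) as Hcp. intros eps He. destruct (Hcp eps He) as [d [Hd0 Hd1]].
        exists d. split; [exact Hd0 |]. intros u Hu. specialize (Hd1 u Hu). cbv beta in Hd1.
        unfold y. unfold Cdiv in *. rewrite <- !Cmult_assoc. exact Hd1. }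
      apply cont_at_mult.
      - apply cont_at_mult; [now apply Hk |]. apply (cont_at_mult (fun q => q) (fun _ => (/ p)%C)); [| apply cont_at_const].
        apply holo_cont_at, holo_at_id.
      - apply cont_at_minus.
        + apply cont_at_mult.
          * apply (cont_at_mult (fun q => Cpow (y q) (k - 1)) (fun _ => (/ INR (fact (k - 1)))%C)); [apply Hlin | apply cont_at_const].
          * pose proof (cont_at_Cexp_lin (xi / p) z) as Hce. intros eps He. destruct (Hce eps He) as [d [Hd0 Hd1]].
            exists d. split; [exact Hd0 |]. intros u Hu. specialize (Hd1 u Hu). cbv beta in Hd1.
            unfold y. unfold Cdiv in *. rewrite <- !Cmult_assoc. exact Hd1.
        + clear -Hlin. induction N as [| N IH]; [exact (cont_at_const 0%C z) |].
          intros eps He.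
          assert (Hsum : cont_at (fun q => csum N (fun n => INR (bincoef n (k - 1)) / INR (fact n) * Cpow (y q) n) -
             (- (INR (bincoef N (k - 1)) / INR (fact N))) * Cpow (y q) N)%C z).
          { apply cont_at_minus; [exact IH |]. apply cont_at_mult; [apply cont_at_const | apply Hlin]. }
          destruct (Hsum eps He) as [d [Hd0 Hd1]]. exists d. split; [exact Hd0 |]. intros u Hu. specialize (Hd1 u Hu).
          rewrite !csum_S. cbv beta in Hd1.
          match goal with |- Cmod ?e < eps => match type of Hd1 with Cmod ?e' < eps => replace e with e' by ring end end.
          exact Hd1. }
    destruct (cint_estimate A B bs c F (weighted kap (3 * d1 / 4)) (/ (d1 / 4) * (1 / 2) ^ N / Cmod p) M0 Hc)
      as [l [Hl1 Hl2]]; [| exact HFcont | | | exact Habs |].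
    - apply Rdiv_le_0_compat; [| exact Hp0]. apply Rmult_le_pos; [lra | apply pow_le; lra].
    - intros z Hz0. apply weighted_cont. now apply Hk.
    - intros z Hz0. rewrite Cmod_weighted. unfold F. rewrite !Cmod_mult, Cmod_div by exact Hpn.
      pose proof (borel_kernel_remainder N (k - 1) (y z)) as Hb.
      pose proof (Cmod_ge_0 z) as Hzz. pose proof (Cmod_ge_0 (kap z)) as Hkk.
      assert (Hy : 5 * Cmod (y z) <= d1 / 2 * Cmod z).
      { unfold y. rewrite Cmod_div, Cmod_mult by exact Hpn.
        assert (Hx2 : Cmod xi * / Cmod p <= d1 / 10).
        { apply Rmult_le_reg_r with (Cmod p); [exact Hp0 |]. rewrite Rmult_assoc, Rinv_l by lra. nra. }
        apply (Rmult_le_compat_r (Cmod z)) in Hx2; [| exact Hzz]. unfold Rdiv. lra. }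
      apply exp_le in Hy.
      pose proof (pow_exp_le (Cmod z) (d1 / 4) 1 ltac:(lra) Hzz) as Hz1. rewrite !pow_1 in Hz1.
      change (INR (fact 1)) with 1 in Hz1. rewrite Rmult_1_l in Hz1.
      assert (Hh : 0 < (1 / 2) ^ N) by (apply pow_lt; lra).
      replace (3 * d1 / 4 * Cmod z) with (d1 / 2 * Cmod z + d1 / 4 * Cmod z) by field. rewrite exp_plus.
      pose proof (exp_pos (d1 / 2 * Cmod z)) as He1. pose proof (exp_pos (d1 / 4 * Cmod z)) as He2.
      assert (Hip : 0 < / Cmod p) by now apply Rinv_0_lt_compat.
      assert (Hb2 : Cmod (Cpow (y z) (k - 1) / INR (fact (k - 1)) * Cexp (y z) -
         csum N (fun n => INR (bincoef n (k - 1)) / INR (fact n) * Cpow (y z) n))%C <= (1 / 2) ^ N * exp (d1 / 2 * Cmod z)).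
      { apply Rle_trans with (1 := Hb). apply Rmult_le_compat_l; lra. }
      apply Rle_trans with (Cmod (kap z) * (/ (d1 / 4) * exp (d1 / 4 * Cmod z) * / Cmod p) * ((1 / 2) ^ N * exp (d1 / 2 * Cmod z))).
      + apply Rmult_le_compat; [| apply Cmod_ge_0 | | exact Hb2].
        * apply Rmult_le_pos; [exact Hkk |]. apply Rmult_le_pos; lra.
        * apply Rmult_le_compat_l; [exact Hkk |]. apply Rmult_le_compat_r; lra.
      + right. unfold Rdiv. ring.
    - assert (HFint : is_cint A B c F (0 + monom (k - 1) xi * J xi p k + - (1) *
          csum N (fun n => Cpow xi n / INR (fact n) * (INR (bincoef n (k - 1)) * Cpow (/ p) (Datatypes.S n)) * H (Datatypes.S n)))%C).
      { eapply is_cint_ext; [exact HAB | | exact Hdiff]. intros z _. apply HFE. }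
      pose proof (is_cint_unique A B c _ _ _ HAB HFint Hl1) as EE.
      assert (E3 : csum N (fun n => v n * (INR (bincoef n (k - 1)) * Cpow (/ p) (Datatypes.S n)))%C =
        csum N (fun n => Cpow xi n / INR (fact n) * (INR (bincoef n (k - 1)) * Cpow (/ p) (Datatypes.S n)) * H (Datatypes.S n))%C).
      { apply csum_ext. intros n _. unfold v. ring. }
      rewrite E3.
      match goal with |- Cmod ?e <= _ => replace e with l by (rewrite <- EE; ring) end.
      apply Rle_trans with (1 := Hl2). right. unfold Rdiv. ring. }
  eapply clim_ext; [| exact Hcl]. intros N. apply csum_ext. intros n _. unfold v, Cdiv. ring.
Qed.

(** * Invariance of the moments, and the formula *)

Lemma CpowZ_nat (z : C) (m : nat) : CpowZ z (Z.of_nat m) = Cpow z m.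
Proof.
  destruct m as [| m]; [reflexivity |]. simpl Z.of_nat. unfold CpowZ. now rewrite SuccNat2Pos.id_succ.
Qed.

(** The first deformation may sweep across 0 even when it is a pole of [kap]; for m >= k0 the
    integrand extends holomorphically there. Both end contours avoid the poles, so that the
    extension has the same integrals along them as the given integrands. *)
Lemma moment_deformed (kap fg : C -> C) (k0 m : nat) (A B : Rbar) (bs bs2 : list R) (Gam Gamt Gamb : R -> C) (l l2 : C) :
  meromorphic kap -> pole_order kap 0%C k0 -> (k0 <= m)%nat ->
  contour A B bs Gam -> contour A B bs2 Gamb ->
  (forall z, trace A B Gam z -> ~ is_pole kap z) -> (forall z, trace A B Gamb z -> ~ is_pole kap z) ->
  deformable (fun z => ~ ((is_pole kap z \/ is_pole fg z) /\ z <> RtoC 0)) A B Gam Gamt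
       (fun F => exists m : nat, (k0 <= m)%nat /\ F = (fun z => kap z * Cpow z m)%C) ->
  deformable (fun z => ~ is_pole kap z) A B Gamt Gamb
       (fun F => exists m : nat, (k0 <= m)%nat /\ F = (fun z => kap z * Cpow z m)%C) ->
  is_cint A B Gam (fun z => kap z * CpowZ z (Z.of_nat m))%C l ->
  is_cint A B Gamb (fun z => kap z * Cpow z m)%C l2 -> l = l2.
Proof.
  intros Hmer Hpo Hm Hc Hc2 Htr Htr2 Hd1 Hd2 Hl Hl2.
  pose proof (contour_dom _ _ _ _ Hc) as HAB.
  destruct (power_extension kap k0 m Hmer Hpo Hm) as [Fs [HF1 [HF2 HF3]]].
  assert (Heq : forall z, ~ is_pole kap z -> Fs z = (kap z * Cpow z m)%C).
  { intros z Hz. destruct (classic (z = 0%C)) as [-> | Hn]; [now apply HF3 | now apply HF1]. }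
  apply (deformation_integral _ _ A B bs bs2 Gam Gamt Gamb Fs (fun z => kap z * Cpow z m)%C _ l l2 Hc Hc2 Hd1 Hd2).
  - now exists m.
  - exact HF1.
  - intros z Hz. apply HF2. destruct (classic (z = 0%C)) as [Hz0 | Hz0]; [now right | left].
    destruct Hz as [Hz | [Hz | [Hz | Hz]]]; [tauto | exact Hz | now apply Htr | now apply Htr2].
  - eapply is_cint_ext; [exact HAB | | exact Hl]. intros z Hz. cbv beta. rewrite CpowZ_nat. symmetry. now apply Heq, Htr.
  - eapply is_cint_ext; [exact HAB | | exact Hl2]. intros z Hz. symmetry. now apply Heq, Htr2.
Qed.

Theorem theorem4
  (* domains, kernel, function *)
  (W U : C -> Prop) (K : C -> C -> C) (f : C -> C)
  (HWopen : Copen W) (HWconn : Cconnected W)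
  (HUopen : Copen U) (HUconn : Cconnected U)
  (HUne : exists gam, U gam)
  (HU0 : ~ U (RtoC 0))
  (HU0cl : forall eps, 0 < eps -> exists gam, U gam /\ Cmod gam < eps)
  (HK : meromorphic2 W K) (Hf : meromorphic f)
  (k0 n0 : nat)
  (Hk0 : forall w, W w -> pole_order (K w) (RtoC 0) k0)
  (Hn0 : pole_order f (RtoC 0) n0)
  (a : Z -> C) (Ha : is_laurent_at0 f n0 a)
  (* the curves Gamma_w *)
  (A B : Rbar) (Gam : C -> R -> C)
  (HGam : forall w, W w -> exists bs, contour A B bs (Gam w))
  (HGamfam : continuous_family W A B Gam)
  (HGampole : forall w gam z, W w -> U gam -> trace A B (Gam w) z ->
     ~ is_pole (K w) z /\ ~ is_pole (fun y => f (gam * y)%C) z)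
  (g : C -> C -> C)
  (Hg : forall w gam, W w -> U gam ->
     is_cint A B (Gam w) (fun z => K w z * f (gam * z))%C (g gam w))
  (Hghol : forall gam, U gam -> holomorphic_on W (g gam))
  (h : Z -> C -> C)
  (Hh : forall m w, W w ->
     is_cint A B (Gam w) (fun z => K w z * CpowZ z m)%C (h m w))
  (Hhhol : forall m, holomorphic_on W (h m))
  (* the deformed contours and the conditions (E) *)
  (Gamt Gamb : C -> R -> C) (d : nat)
  (bcos c0 delta1 delta2 : R) (cw : C -> R) (ctilde : C -> R) (rad : C -> R)
  (Hbcos : 0 < bcos) (Hc0 : 0 < c0) (Hd1 : 0 < delta1) (Hd2 : 0 < delta2)
  (Hdelta : 0 < delta1 - delta2)
  (Hcw : forall w, W w -> 0 < cw w)
  (Hctilde : forall gam, U gam -> c0 <= ctilde gam)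
  (Hrad : forall w, W w -> 0 < rad w)
  (HGamt : forall w, W w -> exists bs,
     (length bs < d)%nat /\
     contour A B bs (Gamt w) /\
     (forall t, inner A B t -> Gamt w t = RtoC 0 -> In t bs) /\
     conditions_E bcos delta1 delta2 k0 n0 (cw w) ctilde (K w) f U
       (fun _ => True) A B bs (Gamt w))
  (Hdeft : forall w gam, W w -> U gam ->
     deformable
       (fun z => ~ ((is_pole (K w) z \/ is_pole (fun y => f (gam * y)%C) z) /\
                    z <> RtoC 0))
       A B (Gam w) (Gamt w)
       (fun F => exists m : nat, (k0 <= m)%nat /\
                   F = (fun z => K w z * Cpow z m)%C))
  (HGamb : forall w, W w -> exists bs,
     contour A B bs (Gamb w) /\
     conditions_E bcos delta1 delta2 k0 n0 (cw w) ctilde (K w) f U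
       (fun z => rad w <= Cmod z) A B bs (Gamb w))
  (HGambpole : forall w z, W w -> trace A B (Gamb w) z ->
     ~ is_pole (K w) z /\ z <> RtoC 0)
  (Hdefb : forall w, W w ->
     deformable (fun z => ~ is_pole (K w) z) A B (Gamt w) (Gamb w)
       (fun F => exists m : nat, (k0 <= m)%nat /\
                   F = (fun z => K w z * Cpow z m)%C))
  (* principal parts of phi *)
  (phi : C -> C) (Hphi : phi = laurent_tail f a n0 k0)
  (nphi : nat) (b : C -> nat -> C)
  (Hnphi : forall p n, pole_order phi p n -> (n <= nphi)%nat)
  (Hb : forall p, is_pole phi p -> is_principal_part phi p nphi (b p))
  (theta : R)
  (* (1) *)
  (H1 : ~ is_pole phi (RtoC 0))
  (* (2) *)
  (c Ctilde : R) (Hc : c < 1)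
  (H2 : forall n m : nat, (1 <= n)%nat -> (1 <= m <= nphi)%nat ->
     exists l, enumerates
       (fun p => is_pole phi p /\ INR n - 1 <= Cmod p < INR n) l /\
       Rsum l (fun p => Cmod (b p m)) <= Ctilde * Rpower (INR n) c)
  (* (3) *)
  (psi : C -> C -> C)
  (H3entire : forall w z, W w -> trace A B (Gamb w) z -> entire (psi z))
  (H3 : forall w z eps gam, W w -> trace A B (Gamb w) z -> 0 < eps ->
     O_region (is_pole phi) eps z gam ->
     is_sum_by_modulus (is_pole phi) (fun p => tilde_phi' nphi b p z gam)
       (phi (gam * z) - psi z gam)%C)
  (* (4) *)
  (H4 : forall gam, U gam ->
     0 < cos (theta - Carg gam) /\
     forall w, W w ->
       U_sector U theta (alpha theta (trace A B (Gamb w)) (is_pole phi)) gam)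
  (* (5) *)
  (alpha' : C -> R) (Cm : list (R * nat)) (V : C -> C -> Prop)
  (chi : C -> C -> C)
  (HVopen : forall w, W w -> Copen (V w))
  (HVconn : forall w, W w -> Cconnected (V w))
  (HVray : forall w xi, W w -> closed_ray theta xi -> V w xi)
  (H5inv : forall w z, W w -> trace A B (Gamb w) z ->
     is_inverse_laplace theta (alpha' w) (psi z) (chi z))
  (H5hol : forall w z, W w -> trace A B (Gamb w) z ->
     holomorphic_on (V w) (chi z))
  (H5bound : forall w z xi, W w -> trace A B (Gamb w) z -> V w xi ->
     Cmod (chi z xi) <= exp (alpha' w * Cmod xi) *
       Rsum Cm (fun Ci_mi => fst Ci_mi * Cmod xi ^ snd Ci_mi))
  (* off the half line, the integrals in the formula make sense *)
  (Hconv : forall w xi p k, W w -> V w xi -> ~ closed_ray theta xi ->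
     is_pole phi p -> (1 <= k <= nphi)%nat ->
     cint_abs_converges A B (Gamb w)
       (fun z => K w z * Cexp (z * xi / p) * Cpow (z / p) k)%C) :
  forall w, W w ->
  exists Bw : C -> C,
    is_analytic_extension (fun n => formal_borel (g_plus k0 a h) n w) (V w) Bw /\
    forall xi, V w xi ->
    exists (J : C -> nat -> C) (S I : C),
      (forall p k, is_pole phi p -> (1 <= k <= nphi)%nat ->
         is_cint A B (Gamb w)
           (fun z => K w z * Cexp (z * xi / p) * Cpow (z / p) k)%C (J p k)) /\
      is_sum_by_modulus (is_pole phi)
        (fun p => principal_sum nphi (b p) p (fun k =>
           J p k * (Cpow xi (k - 1) / RtoC (INR (fact (k - 1))))))%C S /\
      is_cint A B (Gamb w) (fun z => K w z * chi z xi)%C I /\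
      Bw xi = (- S + I)%C.
Proof.
  intros w Hw.
  (* One point of U is fixed: it supplies the first deformation and, through [H4], the finiteness of
     the supremum in [alpha]. *)
  destruct HUne as [gam0 Hgam0].
  assert (Hmer : meromorphic (K w)) by (apply (proj2 (proj2 HK)); exact Hw).
  destruct (HGam w Hw) as [bs0 Hcont0].
  destruct (HGamb w Hw) as [bs [Hcont [HE1 [HE2 _]]]].
  pose proof (contour_dom _ _ _ _ Hcont) as HAB.
  assert (Htr : forall z, trace A B (Gamb w) z -> z <> 0%C) by (intros z Hz; now apply (HGambpole w z Hw)).
  assert (Htp : forall z, trace A B (Gamb w) z -> ~ is_pole (K w) z) by (intros z Hz; now apply (HGambpole w z Hw)).
  assert (Hcat : forall z, trace A B (Gamb w) z -> cont_at (K w) z).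
  { intros z Hz. destruct (not_pole_holo (K w) z Hmer (Htp z Hz)) as [r [Hr Hr2]].
    apply holo_cont_at, Hr2. rewrite Cmod_minus_diag. exact Hr. }
  assert (Hdec : decaying A B bs (Gamb w) (K w) delta1).
  { split; [exact Hcont |]. split; [exact Hcat |]. split; [exact Hd1 |]. intros mu Hmu.
    apply (weighted_absint A B bs (Gamb w) (K w) bcos delta1 (cw w) (rad w) mu k0);
      [exact Hcont | exact Hcat | exact Hbcos | apply Rlt_le, Hcw, Hw | apply Hrad, Hw | exact Hmu | |].
    - intros t Ht Hb0 Hr Hz. now apply HE1.
    - intros z Hz Hr Hz0. now apply HE2. }
  set (P := is_pole phi).
  assert (HP1 : forall p, P p -> (1 <= nphi)%nat).
  { intros p [n [Hn Hpo]]. specialize (Hnphi p n Hpo). lia. }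
  destruct (pole_functional_exists P nphi b c Ctilde Hc H1 HP1 H2) as [rm [L HF]].
  assert (Hrm := HF). destruct Hrm as [Hrm1 [Hrm2 _]].
  destruct (pole_coeffs_exist P nphi b rm L HF) as [lam Hlam].
  destruct (laurent_tail_pser f n0 k0 a Ha) as [r [Hr Half]].
  set (alf := fun m => if Nat.leb k0 m then a (Z.of_nat m) else 0%C) in *.
  rewrite <- Hphi in Half.
  set (ct := total_coeffs alf lam).
  set (T := trace A B (Gamb w)).
  assert (Htay : forall z, T z -> forall rho, 0 < rho -> exists M, pbound (fun n => ct n * Cpow z n)%C M rho /\
    forall gam, Cmod gam < rho -> pser (fun n => ct n * Cpow z n)%C gam (psi z gam)).
  { intros z Hz. apply (psi_taylor P nphi b rm L r lam alf phi (psi z) z HF Hlam Hr Half (Htr z Hz)).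
    - intros gam HO. exact (H3 w z 1 gam Hw Hz Rlt_0_1 HO).
    - exact (H3entire w z Hw Hz). }
  (* The coefficients [ct] are common to all z, so that one point of the contour, nonzero by [Htr],
     shows that X is entire. *)
  destruct (param_exists A B HAB) as [t0 Ht0].
  assert (Hz0 : T (Gamb w t0)) by now exists t0.
  destruct (entire_series_exists (borel_coeffs ct)) as [X HX].
  { apply (borel_coeffs_pbound ct (Gamb w t0) (Htr _ Hz0)). intros rho Hrho.
    destruct (Htay _ Hz0 rho Hrho) as [M [HM _]]. now exists M. }
  assert (Hchi : forall z xi, T z -> V w xi -> chi z xi = (z * X (z * xi))%C).
  { intros z xi Hz Hxi. destruct (Htay z Hz 1 Rlt_0_1) as [M [HM1 HM2]].
    apply (chi_formula theta (alpha' w) Cm (V w) (psi z) (chi z) X ct z M 1).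
    - now apply HVopen.
    - now apply HVconn.
    - intros y Hy. now apply HVray.
    - intros y Hy. apply (proj1 (holomorphic_on_cderiv (V w) (chi z)) (H5hol w z Hw Hz) y Hy).
    - intros y Hy. now apply (H5bound w z y).
    - now apply (H5inv w z).
    - exact Rlt_0_1.
    - exact HM1.
    - exact HM2.
    - exact HX.
    - exact Hxi. }
  assert (HV0 : V w 0%C).
  { apply HVray; [exact Hw |]. exists 0. split; [lra | ring]. }
  destruct (proj1 (Copen_disc (V w)) (HVopen w Hw) 0%C HV0) as [d0 [Hd0 HdV]].
  assert (HdV2 : forall xi, Cmod xi < d0 -> V w xi) by (intros xi Hxi; apply HdV; now rewrite Cminus_0_r).
  (* On the disc of radius d0 the bound [H5bound] does not involve z, which yields the constant of
     the Cauchy estimates. Taking Rmax 0 Kg allows the exponent to be enlarged. *)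
  assert (Halt : (forall n, borel_coeffs ct n = 0%C) \/ exists R0, 0 < R0 /\ forall z, T z -> Cmod z <= R0).
  { destruct (growth_exp (alpha' w) Cm) as [Kg HKg].
    apply (coeffs_vanish_or_bounded T (borel_coeffs ct) X d0 (Rmax 0 Kg * exp ((Rabs (alpha' w) + 1) * d0)) HX Hd0).
    intros z xi Hz Hxi. rewrite <- Hchi by auto.
    apply Rle_trans with (growth (alpha' w) Cm (Cmod xi)); [now apply (H5bound w z xi Hw Hz), HdV2 |].
    pose proof (Cmod_ge_0 xi) as Hxi0. apply Rle_trans with (1 := HKg _ Hxi0).
    apply Rle_trans with (Rmax 0 Kg * exp ((Rabs (alpha' w) + 1) * Cmod xi)).
    - apply Rmult_le_compat_r; [apply Rlt_le, exp_pos | apply Rmax_r].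
    - apply Rmult_le_compat_l; [apply Rmax_l |]. apply exp_le. pose proof (Rabs_pos (alpha' w)). nra. }
  destruct (kernel_moments A B bs (Gamb w) (K w) delta1 Hdec) as [H HH].
  assert (Hmom : forall m, (k0 <= m)%nat -> h (Z.of_nat m) w = H m).
  { intros m Hm.
    apply (moment_deformed (K w) (fun y => f (gam0 * y)%C) k0 m A B bs0 bs (Gam w) (Gamt w) (Gamb w)); auto.
    intros z Hz. now apply (HGampole w gam0 z Hw Hgam0). }
  destruct (entire_part A B bs (Gamb w) (K w) delta1 (borel_coeffs ct) H X Hdec HX HH Halt) as [I0 [HI1 [HI2 HI3]]].
  assert (HA : all_jker_absint A B (Gamb w) (K w) P (V w) nphi).
  { intros xi p k Hxi Hp Hk.
    assert (Hp0 : p <> 0%C) by (apply Cmod_gt_0; specialize (Hrm2 p Hp); lra).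
    (* On the ray convergence follows from the sector condition, off the ray it is [Hconv]. *)
    destruct (classic (closed_ray theta xi)) as [[t [Ht ->]] | Hno].
    - assert (Hg0 : gam0 <> 0%C) by (intros ->; now apply HU0).
      destruct (H4 gam0 Hgam0) as [_ H4'].
      destruct (sector_bound U T P theta rm gam0 (proj1 Hrm1) Hrm2 Hg0 (H4' w Hw)) as [l [_ Hl]].
      apply (jker_ray_absint A B bs (Gamb w) (K w) delta1 l theta t p k Hdec Htr Hp0 Ht).
      intros z Hz. now apply Hl.
    - apply (abs_converges_absint A B bs (Gamb w) _ Hcont); [| now apply (Hconv w xi p k)].
      intros z Hz. apply (jker_cont (K w) p k xi z). now apply Hcat. }
  assert (HJ : exists J : C * C * nat -> C, forall e, V w (fst (fst e)) -> P (snd (fst e)) -> (1 <= snd e <= nphi)%nat ->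
    is_cint A B (Gamb w) (jker (K w) (snd (fst e)) (snd e) (fst (fst e))) (J e)).
  { apply (choice (fun e l => V w (fst (fst e)) -> P (snd (fst e)) -> (1 <= snd e <= nphi)%nat ->
      is_cint A B (Gamb w) (jker (K w) (snd (fst e)) (snd e) (fst (fst e))) l)).
    intros [[xi p] k]. simpl fst. simpl snd.
    destruct (classic (V w xi /\ P p /\ (1 <= k <= nphi)%nat)) as [[Hxi [Hp Hk]] | Hno]; [| exists 0%C; tauto].
    destruct (HA xi p k Hxi Hp Hk) as [M HM].
    destruct (absint_cint A B bs (Gamb w) (jker (K w) p k xi) M Hcont) as [l [Hl _]]; [| exact HM | now exists l].
    intros z Hz. apply jker_cont. now apply Hcat. }
  destruct HJ as [J0 HJ0]. set (J := fun xi p k => J0 (xi, p, k)).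
  assert (HJ : forall xi p k, V w xi -> P p -> (1 <= k <= nphi)%nat ->
    is_cint A B (Gamb w) (jker (K w) p k xi) (J xi p k)).
  { intros xi p k Hxi Hp Hk. exact (HJ0 (xi, p, k) Hxi Hp Hk). }
  destruct (jker_sum_holo A B bs (Gamb w) (K w) delta1 P (V w) nphi b rm L J Hdec HF HA (HVopen w Hw) HJ) as [S0 [HS1 HS2]].
  (* With this choice the formula itself is immediate; the content lies in
     [is_analytic_extension]. *)
  exists (fun xi => - S0 xi + I0 xi)%C. split; [split |].
  - apply holomorphic_on_cderiv. intros xi Hxi.
    destruct (HS2 xi Hxi) as [l1 Hl1]. destruct (HI3 xi) as [l2 Hl2].
    exists (- (1) * l1 + l2)%C.
    apply (cderiv_ext (fun y => - (1) * S0 y + I0 y)%C); [intros; ring |].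
    apply cderiv_plus; [now apply cderiv_scal | exact Hl2].
  - assert (Hrd : 0 < rm * delta1 / 10) by nra.
    exists (Rmin d0 (rm * delta1 / 10)). split; [now apply Rmin_glb_lt |]. intros xi Hxi.
    pose proof (Rmin_l d0 (rm * delta1 / 10)). pose proof (Rmin_r d0 (rm * delta1 / 10)).
    assert (HVxi : V w xi) by (apply HdV2; lra). split; [exact HVxi |].
    apply pser_is_pseries.
    assert (HSp := jker_sum_germ A B bs (Gamb w) (K w) delta1 P (V w) nphi b rm L J lam H xi (S0 xi)
      Hdec HF HJ Hlam HH HVxi ltac:(lra) (HS1 xi HVxi)).
    pose proof (clim_minus _ _ _ _ (HI2 xi) HSp) as Hd.
    replace (- S0 xi + I0 xi)%C with (I0 xi - S0 xi)%C by ring.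
    eapply clim_ext; [| exact Hd]. intros N. cbv beta. rewrite <- csum_minus. apply csum_ext. intros n _.
    (* The contributions of lam n cancel and alf (n+1) H (n+1) / n! remains. For n + 1 >= k0 the
       moment H is h; for n + 1 < k0 both coefficients are 0. *)
    unfold formal_borel, g_plus, borel_coeffs, ct, total_coeffs, alf.
    destruct (Nat.leb k0 (S n)) eqn:E.
    + rewrite Hmom by now apply Nat.leb_le. unfold Cdiv. ring.
    + unfold Cdiv. ring.
  - intros xi Hxi. exists (J xi), (S0 xi), (I0 xi).
    split; [| split; [| split]].
    + intros p k Hp Hk. now apply HJ.
    + exact (HS1 xi Hxi).
    + eapply is_cint_ext; [exact HAB | | exact (HI1 xi)]. intros z Hz. cbv beta. now rewrite Hchi.
    + reflexivity.
Qed.
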